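(* Let $\phi=(\phi_1,\phi_2)\in\mathcal O(\mathbb D^2,\mathbb D^2)$ extend to a $\mathcal C^3$-smooth map on $\overline{\mathbb D^2}$. (A) If $C_\phi f=f\circ\phi$ is compact on $H^2(\mathbb D^2)$, then (1) $\phi(\mathbb T^2)\cap\mathbb T^2=\varnothing$, and (2) for every $\xi\in\mathbb T^2$ and every $j\in\{1,2\}$ with $\phi_j(\xi)\in\mathbb T$, $\phi_j$ is truly two-dimensional at $\xi$. (B) Conversely, if (1) $\phi(\mathbb T^2)\cap\mathbb T^2=\varnothing$ and (2) for every $\xi\in\mathbb T^2$ and every $j\in\{1,2\}$ with $\phi_j(\xi)\in\mathbb T$, $\phi_j$ is truly two-dimensional at $\xi$ of order $2$, then $C_\phi$ is compact on $H^2(\mathbb D^2)$.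
   Context: $H^2(\mathbb D^2)$ is the Hardy space of holomorphic $f$ on $\mathbb D^2$ with $\sup_{0<r<1}\int_{\mathbb T^2}|f(r\zeta)|^2d\sigma_2(\zeta)<\infty$. For $\varphi\in\mathcal O(\mathbb D^2,\mathbb D)\cap\mathcal C^2(\overline{\mathbb D^2})$ and $\xi=(e^{i\alpha_1},e^{i\alpha_2})\in\mathbb T^2$ with $\varphi(\xi)\in\mathbb T$, let $\tilde\varphi(z)=\overline{\varphi(\xi)}\varphi(e^{i\alpha_1}z_1,e^{i\alpha_2}z_2)$ and $\psi(\theta)=\tilde\varphi(e^{i\theta_1},e^{i\theta_2})$, $\theta\in\mathbb R^2$. We say $\varphi$ is truly two-dimensional at $\xi$ if: (i) $\frac{\partial\tilde\varphi}{\partial z_1}(e)\ne0$ and $\frac{\partial\tilde\varphi}{\partial z_2}(e)\ne0$, where $e=(1,1)$; and (ii) writing $\mathrm{Im}\,\psi(\theta)=L(\theta)+G(\theta)$ with $L$ linear and $G(\theta)=O(|\theta|^2)$, the map $U(\theta)=(L(\theta)+G(\theta),\theta_2)$ is a diffeomorphism between neighbourhoods of $0$ in $\mathbb R^2$, and writing $\mathrm{Re}\,\psi\circ U^{-1}(u)=1+H(u)$, there is no function $h$ of one real variable with $H(u_1,u_2)=h(u_1)$ on a neighbourhood of $0$. We say $\varphi$ is truly two-dimensional at $\xi$ of order $2$ if, writing $\mathrm{Re}\,\psi(\theta)=1-Q(\theta)+o(|\theta|^2)$ with $Q$ a real quadratic form, $Q$ has signature $(2,0)$. *)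

(* Defs.v *)
From Stdlib Require Import Reals List.
From Coquelicot Require Import Coquelicot.
Open Scope R_scope.

Definition inD (z : C) : Prop := Cmod z < 1.
Definition inT (z : C) : Prop := Cmod z = 1.
Definition inD2 (z : C * C) : Prop := inD (fst z) /\ inD (snd z).
Definition inT2 (z : C * C) : Prop := inT (fst z) /\ inT (snd z).
Definition inclD2 (z : C * C) : Prop := Cmod (fst z) <= 1 /\ Cmod (snd z) <= 1.

Definition expi (t : R) : C := (cos t, sin t).

(* ---------- real differentiability classes ----------
   Ck k U basis g : g is C^k on the open set U, where partial derivatives
   are taken along the real directions listed in [basis] (a real basis of X). *)
Fixpoint Ck {X V : NormedModule R_AbsRing} (k : nat) (U : X -> Prop)
    (basis : list X) (g : X -> V) : Prop :=
  (forall x, U x -> continuous g x) /\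
  match k with
  | O => True
  | S k' => forall e, In e basis ->
      exists dg : X -> V,
        (forall x, U x -> is_derive (fun t : R => g (plus x (scal t e))) 0 (dg x))
        /\ Ck k' U basis dg
  end.

Definition open_set {X : UniformSpace} (U : X -> Prop) : Prop :=
  forall x, U x -> locally x U.

Definition basisC2 : list (C * C) :=
  ((RtoC 1, RtoC 0) :: (Ci, RtoC 0) :: (RtoC 0, RtoC 1) :: (RtoC 0, Ci) :: nil).
Definition basisR2 : list (R * R) := ((1, 0) :: (0, 1) :: nil).

Definition Ck_closed_bidisc {V : NormedModule R_AbsRing} (k : nat) (f : C * C -> V) : Prop :=
  exists (W : C * C -> Prop) (g : C * C -> V),
    open_set W /\ (forall z, inclD2 z -> W z) /\
    (forall z, inclD2 z -> g z = f z) /\ Ck k W basisC2 g.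

(* ---------- holomorphy on the bidisc ----------
   continuous and holomorphic in each variable separately (Osgood). *)
Definition holo_D2 (f : C * C -> C) : Prop :=
  forall z, inD2 z ->
    continuous f z /\
    ex_derive (fun w : C => f (w, snd z)) (fst z) /\
    ex_derive (fun w : C => f (fst z, w)) (snd z).

Definition circ_int (f : C * C -> C) (r : R) : R :=
  RInt (fun t1 => RInt (fun t2 =>
          (Cmod (f (RtoC r * expi t1, RtoC r * expi t2)%C)) ^ 2) 0 (2 * PI)) 0 (2 * PI)
  / (4 * PI ^ 2).

Definition H2 (f : C * C -> C) : Prop :=
  holo_D2 f /\ exists M : R, forall r, 0 < r < 1 -> circ_int f r <= M.

Definition compact_Cphi (phi : C * C -> C * C) : Prop :=
  (forall f, H2 f -> H2 (fun z => f (phi z))) /\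
  forall fn : nat -> C * C -> C,
    (forall n, H2 (fn n)) ->
    (exists M, forall n r, 0 < r < 1 -> circ_int (fn n) r <= M) ->
    exists (sigma : nat -> nat) (g : C * C -> C),
      (forall n, (sigma n < sigma (S n))%nat) /\ H2 g /\
      forall eps, 0 < eps -> exists N, forall k, (N <= k)%nat ->
        forall r, 0 < r < 1 ->
          circ_int (fun z => (fn (sigma k) (phi z) - g z)%C) r <= eps.

Definition phitilde (f : C * C -> C) (xi : C * C) (z : C * C) : C :=
  (Cconj (f xi) * f (fst xi * fst z, snd xi * snd z))%C.

Definition psi_of (f : C * C -> C) (xi : C * C) (th : R * R) : C :=
  phitilde f xi (expi (fst th), expi (snd th)).

Definition e2 : C * C := (RtoC 1, RtoC 1).

(* the value at e of (the continuous extension of) d g / d z1, resp. d z2,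
   is nonzero *)
Definition dz1_nonzero_at_e (g : C * C -> C) : Prop :=
  exists (d : C * C -> C) (l : C), l <> RtoC 0 /\
    (forall z, inD2 z -> is_derive (fun w : C => g (w, snd z)) (fst z) (d z)) /\
    filterlim d (within inD2 (locally e2)) (locally l).
Definition dz2_nonzero_at_e (g : C * C -> C) : Prop :=
  exists (d : C * C -> C) (l : C), l <> RtoC 0 /\
    (forall z, inD2 z -> is_derive (fun w : C => g (fst z, w)) (snd z) (d z)) /\
    filterlim d (within inD2 (locally e2)) (locally l).

Definition diffeo_nbhd0 (U Uinv : R * R -> R * R) (A B : R * R -> Prop) : Prop :=
  open_set A /\ open_set B /\ A (0, 0) /\ B (0, 0) /\
  (forall x, A x -> B (U x) /\ Uinv (U x) = x) /\
  (forall y, B y -> A (Uinv y) /\ U (Uinv y) = y) /\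
  Ck 1 A basisR2 U /\ Ck 1 B basisR2 Uinv.

Definition truly_2d (f : C * C -> C) (xi : C * C) : Prop :=
  dz1_nonzero_at_e (phitilde f xi) /\ dz2_nonzero_at_e (phitilde f xi) /\
  let U := fun th : R * R => (Im (psi_of f xi th), snd th) in
  exists (Uinv : R * R -> R * R) (A B : R * R -> Prop),
    diffeo_nbhd0 U Uinv A B /\
    let H := fun u : R * R => Re (psi_of f xi (Uinv u)) - 1 in
    ~ (exists (h : R -> R) (N : R * R -> Prop),
          locally (0, 0) N /\ forall u, N u -> H u = h (fst u)).

Definition quad (a b c : R) (th : R * R) : R :=
  a * fst th ^ 2 + b * fst th * snd th + c * snd th ^ 2.

Definition signature_2_0 (a b c : R) : Prop :=
  forall th : R * R, th <> (0, 0) -> 0 < quad a b c th.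

Definition truly_2d_order2 (f : C * C -> C) (xi : C * C) : Prop :=
  truly_2d f xi /\
  exists a b c : R,
    (forall eps, 0 < eps -> exists delta, 0 < delta /\
       forall th : R * R, fst th ^ 2 + snd th ^ 2 < delta ^ 2 ->
         Rabs (Re (psi_of f xi th) - (1 - quad a b c th))
           <= eps * (fst th ^ 2 + snd th ^ 2)) /\
    signature_2_0 a b c.

Definition phi_j (phi : C * C -> C * C) (j : bool) : C * C -> C :=
  fun z => if j then snd (phi z) else fst (phi z).

(* Main.v *)
Require Import Defs.
From Stdlib Require Import Reals List Lra Lia Psatz Classical ClassicalEpsilon FunctionalExtensionality Cantor.
From Coquelicot Require Import Coquelicot.
Set Bullet Behavior "Strict Subproofs".
Open Scope R_scope.

(* Sufficiency. On the boundary the Poisson kernel P_z is at most a constant times (1-|z|)^(1/8) |zeta-z|^(-9/8).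
   When phi_j has order 2 at its contact points, its tangential gradient does not vanish there and Re (conj eta phi_j)
   is strongly concave, so the integral of |eta - phi_j(r zeta)|^(-9/8) over the torus is bounded uniformly in eta and r.
   As phi_1 and phi_2 are never close to the circle simultaneously, subharmonicity of |f|^2 bounds the mean of
   |f o phi|^2 over a torus by the supremum of |f|^2 on the polydisc of radius 1-delta plus A delta^(1/8) ||f||^2,
   and compactness follows from Montel's theorem.

   Necessity. Normalized Szego kernels (or products of two of them) with poles tending to the boundary converge to 0
   locally uniformly, whereas the means of their compositions with phi stay bounded below if phi(T^2) meets T^2, or if
   phi_j is a unimodular constant on a curve of T^2 which projects onto an interval of one of the two angles. By Hopf's
   lemma such a curve exists (a circle) if a derivative of phi_j vanishes at a contact point; and if H(u) = h(u_1), then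
   h(0) = 0 and phi_j is constant on the curve Im psi = 0. *)

(** * Complex numbers, continuity and integrals of continuous functions *)

(** No boundary values of H^2 functions are used: all means are taken on tori of radius r < 1, and
    every bound must be uniform as r tends to 1. The point of such a torus where D = |eta - phi_j|
    is smallest depends on eta and r and is never located. It is replaced by inequalities between
    two points: the nonzero angular derivative of Im (conj eta phi_j) gives D(x,y) + D(x,y') >= c |y
    - y'|, and strong concavity, with |phi_j| < 1 at the midpoint, gives D(x,y) + D(x',y') >= c (x -
    x')^2. Comparison with approximate minimisers then bounds the kernel integral. For necessity the
    scale is h = 1 - rho. The kernel with pole rho eta has squared modulus of order 1/h where |phi_j
    - eta| = O(h). On the torus of radius rho this holds on a strip of width h along a level curve,
    so the mean does not decay; for two kernels the order is 1/h^2 on a square of side h. The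
    function theory is built from Goursat's theorem for a homotopy of circles, and compactness
    arguments on squares from bisection. *)

Lemma half_pos (e : R) : 0 < e -> 0 < e / 2.
Proof. lra. Qed.

Lemma Cmod_sub_sym (a b : C) : Cmod (a - b) = Cmod (b - a).
Proof. rewrite <- Cmod_opp. f_equal. ring. Qed.

Lemma Cmod_sub_triangle (a b c : C) : Cmod (a - c) <= Cmod (a - b) + Cmod (b - c).
Proof. replace (a - c)%C with ((a - b) + (b - c))%C by ring. apply Cmod_triangle. Qed.

Lemma Cmod_triangle_inv (a b : C) : Cmod a <= Cmod b + Cmod (a - b).
Proof. replace a with (b + (a - b))%C at 1 by ring. apply Cmod_triangle. Qed.

Lemma Cmod_sub_le (a b : C) : Cmod (a - b) <= Cmod a + Cmod b.
Proof. unfold Cminus. rewrite <- (Cmod_opp b). apply Cmod_triangle. Qed.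

Lemma im_le_Cmod (c : C) : Rabs (Im c) <= Cmod c.
Proof. eapply Rle_trans. apply Rmax_r. apply (Rmax_Cmod c). Qed.

Lemma Re_le_mod (c : C) : Re c <= Cmod c.
Proof. eapply Rle_trans. apply Rle_abs. apply re_le_Cmod. Qed.

Lemma Cmod_le_sum (c : C) : Cmod c <= Rabs (Re c) + Rabs (Im c).
Proof.
  replace c with (RtoC (Re c) + Ci * RtoC (Im c))%C at 1.
  - eapply Rle_trans. apply Cmod_triangle. rewrite Cmod_mult, Cmod_Ci, !Cmod_R. lra.
  - destruct c as [x y]. unfold Re, Im, Ci, RtoC, Cplus, Cmult; simpl. f_equal; ring.
Qed.

Lemma C_ext (a b : C) : Re a = Re b -> Im a = Im b -> a = b.
Proof. destruct a, b; simpl; intros; subst; reflexivity. Qed.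

Lemma Re_plus (a b : C) : Re (a + b) = Re a + Re b.
Proof. reflexivity. Qed.
Lemma Re_minus (a b : C) : Re (a - b) = Re a - Re b.
Proof. reflexivity. Qed.
Lemma Re_opp (a : C) : Re (- a) = - Re a.
Proof. reflexivity. Qed.
Lemma Re_mult (a b : C) : Re (a * b) = Re a * Re b - Im a * Im b.
Proof. reflexivity. Qed.
Lemma Im_mult (a b : C) : Im (a * b) = Re a * Im b + Im a * Re b.
Proof. reflexivity. Qed.
Lemma Re_RtoC (x : R) : Re (RtoC x) = x.
Proof. reflexivity. Qed.
Lemma Im_RtoC (x : R) : Im (RtoC x) = 0.
Proof. reflexivity. Qed.
Lemma Re_scal (x : R) (a : C) : Re (RtoC x * a) = x * Re a.
Proof. rewrite Re_mult, Re_RtoC, Im_RtoC. ring. Qed.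
Lemma Cmod_RtoC_pos (x : R) : 0 <= x -> Cmod (RtoC x) = x.
Proof. intros. rewrite Cmod_R. apply Rabs_pos_eq; auto. Qed.

Lemma Cmod_expi (t : R) : Cmod (expi t) = 1.
Proof.
  unfold Cmod, expi; simpl. replace (_ + _) with 1.
  apply sqrt_1. generalize (sin2_cos2 t); unfold Rsqr; intros; lra.
Qed.

Lemma expi_neq_0 (t : R) : expi t <> RtoC 0.
Proof. apply Cmod_gt_0. rewrite Cmod_expi. lra. Qed.

Lemma expi_plus (a b : R) : expi (a + b) = (expi a * expi b)%C.
Proof. unfold expi, Cmult; simpl. rewrite cos_plus, sin_plus. f_equal; ring. Qed.

Lemma expi_0 : expi 0 = RtoC 1.
Proof. unfold expi. rewrite cos_0, sin_0. reflexivity. Qed.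

Lemma expi_2PI : expi (2 * PI) = RtoC 1.
Proof. unfold expi. rewrite cos_2PI, sin_2PI. reflexivity. Qed.

Lemma expi_period (t : R) : expi (t + 2 * PI) = expi t.
Proof. rewrite expi_plus, expi_2PI. ring. Qed.

Lemma Cconj_mult_self (z : C) : (Cconj z * z)%C = RtoC (Cmod z ^ 2).
Proof. rewrite Cmod2_conj. ring. Qed.

Lemma conj_unit_mult (z : C) : inT z -> (Cconj z * z)%C = RtoC 1.
Proof. intro h. rewrite Cconj_mult_self, h. f_equal. ring. Qed.

Lemma inT_expi (z : C) : inT z -> exists t, 0 <= t < 2 * PI /\ z = expi t.
Proof.
  intro h. pose proof PI_RGT_0 as hpi.
  assert (hz : Re z ^ 2 + Im z ^ 2 = 1).
  { rewrite <- Cmod2_alt, h. ring. }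
  destruct z as [x y]; simpl in hz.
  assert (hx : -1 <= x <= 1) by nra.
  destruct (Rle_dec 0 y) as [hy|hy].
  - exists (acos x). split. generalize (acos_bound x); lra.
    unfold expi. rewrite cos_acos by lra. rewrite sin_acos by lra.
    f_equal. replace (1 - Rsqr x) with (y ^ 2) by (unfold Rsqr; lra).
    symmetry. apply sqrt_pow2; auto.
  (* Lower half circle: the angle stays strictly below 2 PI because acos x = 0 would mean x = 1,
     hence y = 0. *)
  - exists (2 * PI - acos x).
    assert (acos x <> 0).
    { intro h0. assert (x = 1). { rewrite <- (cos_acos x) by lra. rewrite h0. apply cos_0. } nra. }
    split. generalize (acos_bound x); lra.
    unfold expi. unfold Rminus. rewrite cos_plus, sin_plus, cos_2PI, sin_2PI, cos_neg, sin_neg.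
    rewrite cos_acos by lra. rewrite sin_acos by lra.
    replace (1 - Rsqr x) with ((- y) ^ 2) by (unfold Rsqr; lra).
    rewrite sqrt_pow2 by lra. f_equal; ring.
Qed.

Lemma expi_lip (a b : R) : Cmod (expi a - expi b) <= 2 * Rabs (a - b).
Proof.
  assert (Hc : Rabs (cos a - cos b) <= 1 * Rabs (a - b)).
  { apply bounded_variation with (dh := fun t => - sin t). intros t _. split.
    auto_derive; auto; ring. rewrite Rabs_Ropp. apply Rabs_le. generalize (SIN_bound t); lra. }
  assert (Hs : Rabs (sin a - sin b) <= 1 * Rabs (a - b)).
  { apply bounded_variation with (dh := cos). intros t _. split.
    auto_derive; auto; ring. apply Rabs_le. generalize (COS_bound t); lra. }
  eapply Rle_trans. apply Cmod_le_sum.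
  replace (Re (expi a - expi b)) with (cos a - cos b) by reflexivity.
  replace (Im (expi a - expi b)) with (sin a - sin b) by reflexivity. lra.
Qed.

(** The balls of [C] are squares in the two coordinates. Halving the radius passes from coordinates
    to [Cmod], and later epsilon-delta arguments are stated with [Cmod] through such
    equivalences. *)
Lemma locally_C_iff (z : C) (P : C -> Prop) :
  locally z P <-> exists d, 0 < d /\ forall w, Cmod (w - z) < d -> P w.
Proof.
  split.
  - intros [e he]. exists e. split. apply e. intros w hw. apply he.
    apply C_NormedModule_mixin_compat1. exact hw.
  - intros [d [hd h]].
    assert (hd2 : 0 < d / 2) by lra.
    exists (mkposreal _ hd2). intros w [h1 h2]. apply h. simpl in *.
    eapply Rle_lt_trans. apply Cmod_le_sum.
    change (Rabs (Re w - Re z) < d / 2) in h1. change (Rabs (Im w - Im z) < d / 2) in h2.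
    replace (Re (w - z)) with (Re w - Re z) by reflexivity.
    replace (Im (w - z)) with (Im w - Im z) by reflexivity. lra.
Qed.

Lemma locally_CC_iff (z : C * C) (P : C * C -> Prop) :
  locally z P <-> exists d, 0 < d /\
    forall w, Cmod (fst w - fst z) < d -> Cmod (snd w - snd z) < d -> P w.
Proof.
  split.
  - intros [e he]. exists e. split. apply e. intros w h1 h2. apply he. split.
    apply C_NormedModule_mixin_compat1; exact h1.
    apply C_NormedModule_mixin_compat1; exact h2.
  - intros [d [hd h]].
    assert (hd2 : 0 < d / 2) by lra.
    exists (mkposreal _ hd2). intros w [[h1 h2] [h3 h4]].
    change (Rabs (Re (fst w) - Re (fst z)) < d / 2) in h1. change (Rabs (Im (fst w) - Im (fst z)) < d / 2) in h2.
    change (Rabs (Re (snd w) - Re (snd z)) < d / 2) in h3. change (Rabs (Im (snd w) - Im (snd z)) < d / 2) in h4.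
    apply h; (eapply Rle_lt_trans; [apply Cmod_le_sum|]).
    change (Rabs (Re (fst w) - Re (fst z)) + Rabs (Im (fst w) - Im (fst z)) < d). lra.
    change (Rabs (Re (snd w) - Re (snd z)) + Rabs (Im (snd w) - Im (snd z)) < d). lra.
Qed.

Lemma locally_R_iff (x : R) (P : R -> Prop) :
  locally x P <-> exists d, 0 < d /\ forall y, Rabs (y - x) < d -> P y.
Proof.
  split.
  - intros [e he]. exists e. split. apply e. intros y hy. apply he. exact hy.
  - intros [d [hd h]]. exists (mkposreal d hd). intros y hy. apply h. exact hy.
Qed.

Lemma locally_RR_iff (x : R * R) (P : R * R -> Prop) :
  locally x P <-> exists d, 0 < d /\
    forall y, Rabs (fst y - fst x) < d -> Rabs (snd y - snd x) < d -> P y.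
Proof.
  split.
  - intros [e he]. exists e. split. apply e. intros y h1 h2. apply he. split; assumption.
  - intros [d [hd h]]. exists (mkposreal d hd). intros y [h1 h2]. apply h; assumption.
Qed.

Lemma continuous_C_iff {U : UniformSpace} (f : U -> C) (x : U) :
  continuous f x <-> forall eps, 0 < eps -> locally x (fun y => Cmod (f y - f x) < eps).
Proof.
  split.
  - intros h eps heps. apply (h (fun w => Cmod (w - f x) < eps)).
    apply locally_C_iff. exists eps. auto.
  - intros h P hP. apply locally_C_iff in hP. destruct hP as [d [hd hP]].
    unfold filtermap. generalize (h d hd). apply filter_imp. intros y; apply hP.
Qed.

Lemma continuous_R_iff {U : UniformSpace} (f : U -> R) (x : U) :
  continuous f x <-> forall eps, 0 < eps -> locally x (fun y => Rabs (f y - f x) < eps).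
Proof.
  split.
  - intros h eps heps. apply (h (fun w => Rabs (w - f x) < eps)).
    apply locally_R_iff. exists eps. auto.
  - intros h P hP. apply locally_R_iff in hP. destruct hP as [d [hd hP]].
    unfold filtermap. generalize (h d hd). apply filter_imp. intros y; apply hP.
Qed.

Section Cont.
Context {U : UniformSpace}.
Implicit Types f g : U -> C.

Lemma continuous_Cplus f g x : continuous f x -> continuous g x -> continuous (fun y => f y + g y)%C x.
Proof.
  rewrite !continuous_C_iff. intros hf hg eps heps.
  generalize (filter_and _ _ (hf (eps / 2) (half_pos _ heps)) (hg (eps / 2) (half_pos _ heps))).
  apply filter_imp. intros y [h1 h2].
  replace (f y + g y - (f x + g x))%C with ((f y - f x) + (g y - g x))%C by ring.
  eapply Rle_lt_trans. apply Cmod_triangle. lra.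
Qed.

Lemma continuous_Copp f x : continuous f x -> continuous (fun y => - f y)%C x.
Proof.
  rewrite !continuous_C_iff. intros hf eps heps. generalize (hf eps heps). apply filter_imp.
  intros y h. replace (- f y - - f x)%C with (- (f y - f x))%C by ring. rewrite Cmod_opp. exact h.
Qed.

Lemma continuous_Cminus f g x : continuous f x -> continuous g x -> continuous (fun y => f y - g y)%C x.
Proof. intros. apply continuous_Cplus; auto. apply continuous_Copp; auto. Qed.

Lemma continuous_Cmult f g x : continuous f x -> continuous g x -> continuous (fun y => f y * g y)%C x.
Proof.
  rewrite !continuous_C_iff. intros hf hg eps heps.
  set (M := Cmod (f x) + Cmod (g x) + 1).
  assert (hM : 1 <= M) by (unfold M; generalize (Cmod_ge_0 (f x)) (Cmod_ge_0 (g x)); lra).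
  set (d := Rmin 1 (eps / (2 * M))).
  assert (hd : 0 < d). { apply Rmin_pos. lra. apply Rdiv_lt_0_compat; lra. }
  generalize (filter_and _ _ (hf d hd) (hg d hd)).
  apply filter_imp. intros y [h1 h2].
  replace (f y * g y - f x * g x)%C with ((f y - f x) * g y + f x * (g y - g x))%C by ring.
  eapply Rle_lt_trans. apply Cmod_triangle. rewrite !Cmod_mult.
  assert (hd1 : d <= 1) by apply Rmin_l. assert (hd2 : d <= eps / (2 * M)) by apply Rmin_r.
  assert (hgy : Cmod (g y) <= M).
  { generalize (Cmod_triangle_inv (g y) (g x)) (Cmod_ge_0 (f x)); unfold M; lra. }
  assert (hfx : Cmod (f x) <= M) by (unfold M; generalize (Cmod_ge_0 (g x)); lra).
  assert (hk : d * M <= eps / 2).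
  { apply Rle_trans with (eps / (2 * M) * M). apply Rmult_le_compat_r; lra. right; field; lra. }
  generalize (Cmod_ge_0 (f y - f x)) (Cmod_ge_0 (g y - g x)) (Cmod_ge_0 (f x)) (Cmod_ge_0 (g y)).
  intros. assert (Cmod (f y - f x) * Cmod (g y) <= Cmod (f y - f x) * M) by (apply Rmult_le_compat_l; lra).
  assert (Cmod (f y - f x) * M < d * M) by (apply Rmult_lt_compat_r; lra).
  assert (Cmod (f x) * Cmod (g y - g x) <= M * d) by (apply Rmult_le_compat; lra). lra.
Qed.

Lemma continuous_Cinv f x : continuous f x -> f x <> RtoC 0 -> continuous (fun y => / f y)%C x.
Proof.
  rewrite !continuous_C_iff. intros hf h0 eps heps.
  apply Cmod_gt_0 in h0 as hm. set (m := Cmod (f x)) in *.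
  assert (hd : 0 < Rmin (m / 2) (eps * (m * m) / 2)).
  { apply Rmin_pos. lra. apply Rdiv_lt_0_compat; [|lra]. apply Rmult_lt_0_compat; nra. }
  generalize (hf _ hd). apply filter_imp. intros y hy.
  assert (h1 : Cmod (f y - f x) < m / 2) by (eapply Rlt_le_trans; [exact hy|apply Rmin_l]).
  assert (h2 : Cmod (f y - f x) < eps * (m * m) / 2) by (eapply Rlt_le_trans; [exact hy|apply Rmin_r]).
  assert (hfy : m / 2 < Cmod (f y)).
  { generalize (Cmod_triangle_inv (f x) (f y)). rewrite (Cmod_sub_sym (f x)). fold m. lra. }
  assert (hn : f y <> RtoC 0) by (apply Cmod_gt_0; lra).
  replace (/ f y - / f x)%C with (- (f y - f x) / (f y * f x))%C by (field; auto).
  rewrite Cmod_div by (apply Cmult_neq_0; auto). rewrite Cmod_opp, Cmod_mult. fold m.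
  apply Rmult_lt_reg_r with (Cmod (f y) * m). apply Rmult_lt_0_compat; lra.
  unfold Rdiv. rewrite Rmult_assoc, Rinv_l by (apply Rgt_not_eq; apply Rmult_lt_0_compat; lra).
  rewrite Rmult_1_r. apply Rlt_le_trans with (1 := h2).
  replace (eps * (m * m) / 2) with (eps * ((m / 2) * m)) by field.
  apply Rmult_le_compat_l. lra. apply Rmult_le_compat_r; lra.
Qed.

Lemma continuous_Cdiv f g x : continuous f x -> continuous g x -> g x <> RtoC 0 -> continuous (fun y => f y / g y)%C x.
Proof. intros. apply continuous_Cmult; auto. apply continuous_Cinv; auto. Qed.

Lemma continuous_Cmod f x : continuous f x -> continuous (fun y => Cmod (f y)) x.
Proof.
  rewrite continuous_C_iff, continuous_R_iff. intros hf eps heps. generalize (hf eps heps). apply filter_imp.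
  intros y h. apply Rabs_def1.
  generalize (Cmod_triangle_inv (f y) (f x)); lra.
  generalize (Cmod_triangle_inv (f x) (f y)); rewrite (Cmod_sub_sym (f x)); lra.
Qed.

Lemma continuous_Re f x : continuous f x -> continuous (fun y => Re (f y)) x.
Proof.
  rewrite continuous_C_iff, continuous_R_iff. intros hf eps heps. generalize (hf eps heps). apply filter_imp.
  intros y h. eapply Rle_lt_trans; [|exact h]. apply (re_le_Cmod (f y - f x)).
Qed.

Lemma continuous_Im f x : continuous f x -> continuous (fun y => Im (f y)) x.
Proof.
  rewrite continuous_C_iff, continuous_R_iff. intros hf eps heps. generalize (hf eps heps). apply filter_imp.
  intros y h. eapply Rle_lt_trans; [|exact h]. apply (im_le_Cmod (f y - f x)).
Qed.

Lemma continuous_Cconj f x : continuous f x -> continuous (fun y => Cconj (f y)) x.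
Proof.
  rewrite !continuous_C_iff. intros hf eps heps. generalize (hf eps heps). apply filter_imp.
  intros y h. rewrite <- Cmod_conj. rewrite Cminus_conj, !Cconj_conj. exact h.
Qed.

Lemma continuous_RtoC (f : U -> R) x : continuous f x -> continuous (fun y => RtoC (f y)) x.
Proof.
  rewrite continuous_C_iff, continuous_R_iff. intros hf eps heps. generalize (hf eps heps). apply filter_imp.
  intros y h. rewrite <- RtoC_minus, Cmod_R. exact h.
Qed.

Lemma continuous_expi (f : U -> R) x : continuous f x -> continuous (fun y => expi (f y)) x.
Proof.
  rewrite continuous_C_iff, continuous_R_iff. intros hf eps heps. generalize (hf (eps / 2) (half_pos _ heps)). apply filter_imp.
  intros y h. eapply Rle_lt_trans. apply expi_lip. lra.
Qed.

Lemma continuous_Rmult (f g : U -> R) x : continuous f x -> continuous g x -> continuous (fun y => f y * g y) x.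
Proof. intros. apply (continuous_mult (K := R_AbsRing)); auto. Qed.

Lemma continuous_Rplus (f g : U -> R) x : continuous f x -> continuous g x -> continuous (fun y => f y + g y) x.
Proof. intros. apply (continuous_plus (V := R_NormedModule)); auto. Qed.

Lemma continuous_Rminus (f g : U -> R) x : continuous f x -> continuous g x -> continuous (fun y => f y - g y) x.
Proof. intros. apply (continuous_minus (V := R_NormedModule)); auto. Qed.

Lemma continuous_Rcomp (h : R -> R) (f : U -> R) x :
  continuous f x -> continuous h (f x) -> continuous (fun y => h (f y)) x.
Proof. intros. apply (continuous_comp f h); auto. Qed.

Lemma continuous_Rpow (f : U -> R) n x : continuous f x -> continuous (fun y => f y ^ n) x.
Proof.
  intros hf. induction n as [|n IH]. apply continuous_const. simpl. apply continuous_Rmult; auto.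
Qed.

Lemma continuous_Rinv (f : U -> R) x : continuous f x -> f x <> 0 -> continuous (fun y => / f y) x.
Proof.
  intros hf h0. apply continuous_Rcomp; auto.
  apply continuity_pt_filterlim. apply continuity_pt_inv. apply derivable_continuous_pt, derivable_pt_id. exact h0.
Qed.

Lemma continuous_Rdiv (f g : U -> R) x : continuous f x -> continuous g x -> g x <> 0 -> continuous (fun y => f y / g y) x.
Proof. intros. apply continuous_Rmult; auto. apply continuous_Rinv; auto. Qed.

Lemma continuous_Ropp (f : U -> R) x : continuous f x -> continuous (fun y => - f y) x.
Proof. intros. apply (continuous_opp (V := R_NormedModule)); auto. Qed.

Lemma continuous_Rabs (f : U -> R) x : continuous f x -> continuous (fun y => Rabs (f y)) x.
Proof. intros. apply (continuous_Rcomp Rabs); auto. apply (continuous_abs (K := R_AbsRing)). Qed.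

Lemma continuous_Rpower (f : U -> R) (a : R) x : continuous f x -> 0 < f x -> continuous (fun y => Rpower (f y) a) x.
Proof.
  intros hf h0. apply continuous_Rcomp with (h := fun t => Rpower t a); auto.
  apply (ex_derive_continuous (K := R_AbsRing) (V := R_NormedModule) (fun t : R => Rpower t a) (f x)). exists (a * Rpower (f x) (a - 1)).
  apply is_derive_Reals. apply derivable_pt_lim_power. exact h0.
Qed.
End Cont.

Lemma continuous_comp_gen {U V W : UniformSpace} (f : U -> V) (g : V -> W) (x : U) :
  continuous f x -> continuous g (f x) -> continuous (fun y => g (f y)) x.
Proof. apply continuous_comp. Qed.

Lemma continuous_pair {U V W : UniformSpace} (f : U -> V) (g : U -> W) (x : U) :
  continuous f x -> continuous g x -> continuous (fun y => (f y, g y)) x.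
Proof.
  intros hf hg P [e he].
  unfold filtermap.
  generalize (filter_and (F := locally x) _ _ (hf _ (locally_ball (f x) e)) (hg _ (locally_ball (g x) e))).
  apply (filter_imp (F := locally x)). intros y [h1 h2]. apply he. split; assumption.
Qed.

(** Directed by the head symbol. After [cont] the remaining goals are typically the side conditions,
    such as nonzero denominators and positive bases of [Rpower]. *)
Ltac cont1 :=
  first [ assumption | apply continuous_const | apply continuous_id |
  lazymatch goal with
  | |- continuous (fun y => Cplus _ _) _ => apply continuous_Cplus
  | |- continuous (fun y => Cminus _ _) _ => apply continuous_Cminus
  | |- continuous (fun y => Cmult _ _) _ => apply continuous_Cmult
  | |- continuous (fun y => Cdiv _ _) _ => apply continuous_Cdiv
  | |- continuous (fun y => Cinv _) _ => apply continuous_Cinv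
  | |- continuous (fun y => Cconj _) _ => apply continuous_Cconj
  | |- continuous (fun y => Copp _) _ => apply continuous_Copp
  | |- continuous (fun y => RtoC _) _ => apply continuous_RtoC
  | |- continuous (fun y => expi _) _ => apply continuous_expi
  | |- continuous (fun y => Cmod _) _ => apply continuous_Cmod
  | |- continuous (fun y => Re _) _ => apply continuous_Re
  | |- continuous (fun y => Im _) _ => apply continuous_Im
  | |- continuous (fun y => pow _ _) _ => apply continuous_Rpow
  | |- continuous (fun y => Rplus _ _) _ => apply continuous_Rplus
  | |- continuous (fun y => Rminus _ _) _ => apply continuous_Rminus
  | |- continuous (fun y => Rmult _ _) _ => apply continuous_Rmult
  | |- continuous (fun y => Rdiv _ _) _ => apply continuous_Rdiv
  | |- continuous (fun y => Rinv _) _ => apply continuous_Rinv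
  | |- continuous (fun y => Ropp _) _ => apply continuous_Ropp
  | |- continuous (fun y => Rabs _) _ => apply continuous_Rabs
  | |- continuous (fun y => Rpower _ _) _ => apply continuous_Rpower
  | |- continuous (fun y => fst y) _ => apply continuous_fst
  | |- continuous (fun y => snd y) _ => apply continuous_snd
  | |- continuous expi _ => apply (continuous_expi (fun t => t))
  | |- continuous RtoC _ => apply (continuous_RtoC (fun t => t))
  | |- continuous Cmod _ => apply (continuous_Cmod (fun t => t))
  | |- continuous Re _ => apply (continuous_Re (fun t => t))
  | |- continuous Im _ => apply (continuous_Im (fun t => t))
  | |- continuous Cconj _ => apply (continuous_Cconj (fun t => t))
  | |- continuous (Rmult ?s) _ => apply (continuous_Rmult (fun _ => s) (fun t => t))
  | |- continuous (Rplus ?s) _ => apply (continuous_Rplus (fun _ => s) (fun t => t))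
  | |- continuous (Rminus ?s) _ => apply (continuous_Rminus (fun _ => s) (fun t => t))
  | |- continuous (Cmult ?s) _ => apply (continuous_Cmult (fun _ => s) (fun t => t))
  | |- continuous (Cplus ?s) _ => apply (continuous_Cplus (fun _ => s) (fun t => t))
  | |- continuous (Cminus ?s) _ => apply (continuous_Cminus (fun _ => s) (fun t => t))
  | |- continuous fst _ => apply continuous_fst
  | |- continuous snd _ => apply continuous_snd
  | |- continuous (fun y => (_, _)) _ => apply continuous_pair
  end ].
Ltac cont := intros; repeat cont1.

(** * Integrals of continuous functions of one real variable *)

Lemma ex_RInt_cont (f : R -> R) a b : (forall x, continuous f x) -> ex_RInt f a b.
Proof. intros. apply (ex_RInt_continuous (V := R_CompleteNormedModule)). auto. Qed.

Section RealIntegrals.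
Variables (f g : R -> R) (a b : R).
Hypotheses (hf : forall x, continuous f x) (hg : forall x, continuous g x).

Lemma RInt_correct_cont : is_RInt f a b (RInt f a b).
Proof. apply (RInt_correct (V := R_CompleteNormedModule)). apply ex_RInt_cont; auto. Qed.

Lemma RInt_plus_cont : RInt (fun x => f x + g x) a b = RInt f a b + RInt g a b.
Proof. apply (RInt_plus (V := R_CompleteNormedModule) f g); apply ex_RInt_cont; auto. Qed.

Lemma RInt_minus_cont : RInt (fun x => f x - g x) a b = RInt f a b - RInt g a b.
Proof. apply (RInt_minus (V := R_CompleteNormedModule) f g); apply ex_RInt_cont; auto. Qed.

Lemma RInt_scal_cont k : RInt (fun x => k * f x) a b = k * RInt f a b.
Proof. apply (RInt_scal (V := R_CompleteNormedModule) f a b k); apply ex_RInt_cont; auto. Qed.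

Lemma RInt_Chasles_cont c : RInt f a c = RInt f a b + RInt f b c.
Proof. symmetry. apply (RInt_Chasles (V := R_CompleteNormedModule) f a b c); apply ex_RInt_cont; auto. Qed.

Lemma RInt_le_cont : a <= b -> (forall x, a <= x <= b -> f x <= g x) -> RInt f a b <= RInt g a b.
Proof. intros hab h. apply RInt_le; auto; try (apply ex_RInt_cont; auto). intros x hx. apply h; lra. Qed.

Lemma RInt_ge0_cont : a <= b -> (forall x, a <= x <= b -> 0 <= f x) -> 0 <= RInt f a b.
Proof. intros hab h. apply RInt_ge_0; auto; try (apply ex_RInt_cont; auto). intros x hx. apply h; lra. Qed.
End RealIntegrals.

Lemma RInt_const_R (a b c : R) : RInt (fun _ => c) a b = c * (b - a).
Proof. rewrite RInt_const. unfold scal; simpl. unfold mult; simpl. ring. Qed.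

Lemma RInt_ext_all (f g : R -> R) a b : (forall x, f x = g x) -> RInt f a b = RInt g a b.
Proof. intros. apply RInt_ext; auto. Qed.

Lemma RInt_subinterval (f : R -> R) a b c d : (forall x, continuous f x) ->
  (forall x, 0 <= f x) -> a <= c -> c <= d -> d <= b -> RInt f c d <= RInt f a b.
Proof.
  intros hf h0 h1 h2 h3.
  rewrite (RInt_Chasles_cont f a c hf b), (RInt_Chasles_cont f c d hf b).
  generalize (RInt_ge0_cont f a c hf h1 (fun x _ => h0 x)) (RInt_ge0_cont f d b hf h3 (fun x _ => h0 x)). lra.
Qed.

Lemma RInt_le_const (f : R -> R) a b M : (forall x, continuous f x) -> a <= b ->
  (forall x, a <= x <= b -> f x <= M) -> RInt f a b <= M * (b - a).
Proof.
  intros hf hab h. rewrite <- RInt_const_R. apply RInt_le_cont; auto. intro; apply continuous_const.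
Qed.

Lemma RInt_ge_const (f : R -> R) a b M : (forall x, continuous f x) -> a <= b ->
  (forall x, a <= x <= b -> M <= f x) -> M * (b - a) <= RInt f a b.
Proof.
  intros hf hab h. rewrite <- RInt_const_R. apply RInt_le_cont; auto. intro; apply continuous_const.
Qed.

(** * Subdivision of squares and parameter integrals *)

Section Cousin.
Variable P : R -> R -> R -> Prop.

(** One step of bisection: a quarter on which P fails, the upper right one being the default.
    Excluded middle turns the choice into a function that [Nat.iter] can iterate. *)
Definition bad_quarter (s : R * R * R) : R * R * R :=
  let '(x, y, w) := s in
  let h := w / 2 in
  if excluded_middle_informative (P x y h) then
    if excluded_middle_informative (P (x + h) y h) then
      if excluded_middle_informative (P x (y + h) h) then (x + h, y + h, h)
      else (x, y + h, h)
    else (x + h, y, h)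
  else (x, y, h).

Lemma bad_quarter_spec x y w : 0 < w ->
  (P x y (w / 2) -> P (x + w / 2) y (w / 2) -> P x (y + w / 2) (w / 2) ->
     P (x + w / 2) (y + w / 2) (w / 2) -> P x y w) ->
  ~ P x y w ->
  exists x' y', bad_quarter (x, y, w) = (x', y', w / 2) /\ ~ P x' y' (w / 2) /\
    x <= x' /\ x' + w / 2 <= x + w /\ y <= y' /\ y' + w / 2 <= y + w.
Proof.
  intros hw hP hn. unfold bad_quarter.
  destruct (excluded_middle_informative _) as [h1|h1].
  2: { exists x, y. repeat split; auto; lra. }
  destruct (excluded_middle_informative _) as [h2|h2].
  2: { exists (x + w / 2), y. repeat split; auto; lra. }
  destruct (excluded_middle_informative _) as [h3|h3].
  2: { exists x, (y + w / 2). repeat split; auto; lra. }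
  exists (x + w / 2), (y + w / 2). repeat split; auto; try lra.
Qed.

(** The point is the supremum of the left ends, each right end being an upper bound of all of
    them. *)
Lemma nested_limit (u w : nat -> R) :
  (forall n, u n <= u (S n)) -> (forall n, u (S n) + w (S n) <= u n + w n) -> (forall n, 0 < w n) ->
  exists p, forall n, u n <= p <= u n + w n.
Proof.
  intros h1 h2 hw.
  assert (hm : forall n k, u n <= u (n + k)%nat /\ u (n + k)%nat + w (n + k)%nat <= u n + w n).
  { intros n k. induction k as [|k [i1 i2]]. rewrite Nat.add_0_r. lra.
    rewrite Nat.add_succ_r. generalize (h1 (n + k)%nat) (h2 (n + k)%nat); lra. }
  assert (hub : forall m n, u m <= u n + w n).
  { intros m n. destruct (Nat.le_ge_cases m n) as [h|h].
    - destruct (hm m (n - m)%nat) as [h3 _]. replace (m + (n - m))%nat with n in h3 by lia.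
      generalize (hw n); lra.
    - destruct (hm n (m - n)%nat) as [_ h3]. replace (n + (m - n))%nat with m in h3 by lia.
      generalize (hw m); lra. }
  destruct (completeness (fun x => exists n, x = u n)) as [p [hp1 hp2]].
  - exists (u 0%nat + w 0%nat). intros x [n ->]. apply hub.
  - exists (u 0%nat), 0%nat. reflexivity.
  - exists p. intros n. split. apply hp1. exists n; auto. apply hp2. intros x [m ->]. apply hub.
Qed.

(** If P failed on the large square, bisection would give nested squares of failure shrinking to a
    point (p, q), where the local hypothesis contradicts failure. This form of compactness serves
    three times: for Goursat's theorem, for strict upper bounds of continuous functions on a square,
    and for gluing the local kernel bounds. *)
Lemma cousin_square x0 y0 w0 : 0 < w0 ->
  (forall x y w, 0 < w -> P x y (w / 2) -> P (x + w / 2) y (w / 2) -> P x (y + w / 2) (w / 2) ->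
     P (x + w / 2) (y + w / 2) (w / 2) -> P x y w) ->
  (forall p q, x0 <= p <= x0 + w0 -> y0 <= q <= y0 + w0 ->
     exists d, 0 < d /\ forall x y w, 0 < w < d ->
       x0 <= x -> x + w <= x0 + w0 -> y0 <= y -> y + w <= y0 + w0 ->
       x <= p <= x + w -> y <= q <= y + w -> P x y w) ->
  P x0 y0 w0.
Proof.
  intros hw0 hsub hloc. apply NNPP. intro hn.
  set (s := fun n => Nat.iter n bad_quarter (x0, y0, w0)).
  set (X := fun n => fst (fst (s n))). set (Y := fun n => snd (fst (s n))). set (W := fun n => w0 / 2 ^ n).
  assert (hW : forall n, 0 < W n). { intro n. apply Rdiv_lt_0_compat; auto. apply pow_lt; lra. }
  assert (hs : forall n, s n = (X n, Y n, W n) /\ ~ P (X n) (Y n) (W n)).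
  { induction n as [|n [e i]].
    - unfold X, Y, W, s; simpl. replace (w0 / 1) with w0 by field. auto.
    - destruct (bad_quarter_spec _ _ _ (hW n) (hsub _ _ _ (hW n)) i) as [x' [y' [e1 [e2 _]]]].
      assert (e3 : s (S n) = (x', y', W n / 2)). { rewrite <- e1, <- e. reflexivity. }
      assert (e4 : W (S n) = W n / 2). { unfold W; simpl. field. apply pow_nonzero; lra. }
      unfold X, Y. rewrite e3, e4. simpl. auto. }
  assert (hst : forall n, X n <= X (S n) /\ X (S n) + W (S n) <= X n + W n /\ Y n <= Y (S n) /\ Y (S n) + W (S n) <= Y n + W n).
  { intro n. destruct (hs n) as [e i].
    destruct (bad_quarter_spec _ _ _ (hW n) (hsub _ _ _ (hW n)) i) as [x' [y' [e1 [_ e2]]]].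
    assert (e3 : s (S n) = (x', y', W n / 2)). { rewrite <- e1, <- e. reflexivity. }
    destruct (hs (S n)) as [e5 _]. rewrite e3 in e5. injection e5; intros. subst x' y'. rewrite <- H.
    tauto. }
  destruct (nested_limit X W) as [p hp]; auto. 1,2: intro n; apply (hst n).
  destruct (nested_limit Y W) as [q hq]; auto. 1,2: intro n; apply (hst n).
  assert (hb : forall n, x0 <= X n /\ X n + W n <= x0 + w0 /\ y0 <= Y n /\ Y n + W n <= y0 + w0).
  { induction n as [|n IH]. unfold X, Y, W, s; simpl; lra. generalize (hst n); lra. }
  assert (W0 : W 0%nat = w0) by (unfold W; simpl; field).
  destruct (hloc p q) as [d [hd hl]].
  { generalize (hp 0%nat). rewrite W0. unfold X, s; simpl. auto. }
  { generalize (hq 0%nat). rewrite W0. unfold Y, s; simpl. auto. }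
  assert (exists n, W n < d) as [n hWn].
  { destruct (Pow_x_infinity 2 ltac:(rewrite Rabs_pos_eq; lra) (w0 / d + 1)) as [n h].
    exists n. specialize (h n (le_n _)). rewrite Rabs_pos_eq in h by (apply pow_le; lra).
    unfold W. apply Rmult_lt_reg_r with (2 ^ n). apply pow_lt; lra.
    unfold Rdiv. rewrite Rmult_assoc, Rinv_l by (apply pow_nonzero; lra). rewrite Rmult_1_r.
    apply Rlt_le_trans with (d * (w0 / d + 1)). rewrite Rmult_plus_distr_l. unfold Rdiv.
    replace (d * (w0 * / d)) with w0 by (field; lra). lra. apply Rmult_le_compat_l; lra. }
  destruct (hs n) as [_ hnP]. apply hnP. apply hl; try apply (hb n); auto.
Qed.
End Cousin.

(** Continuity at all points of {u0} x [a, b] becomes uniform in t by compactness of [a, b]. The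
    parameter space is arbitrary because angles, pairs of angles and products of these all occur as
    parameters. *)
Lemma tube {U : UniformSpace} (f : U -> R -> R) (u0 : U) (a b : R) :
  (forall t, a <= t <= b -> continuous (fun p : U * R => f (fst p) (snd p)) (u0, t)) ->
  forall eps, 0 < eps -> locally u0 (fun u => forall t, a <= t <= b -> Rabs (f u t - f u0 t) < eps).
Proof.
  intros hf eps heps.
  assert (hloc : forall t, exists e : posreal, a <= t <= b ->
    forall u s, ball u0 e u -> Rabs (s - t) < e -> Rabs (f u s - f u0 t) < eps / 2).
  { intro t. destruct (classic (a <= t <= b)) as [ht|ht].
    - generalize (hf t ht). rewrite continuous_R_iff. intros h.
      destruct (h (eps / 2) (half_pos _ heps)) as [e he]. exists e. intros _ u s hu hs.
      apply (he (u, s)). split; auto.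
    (* Default radius for t outside [a, b], where the condition is void. *)
    - exists (mkposreal 1 Rlt_0_1). tauto. }
  apply choice in hloc. destruct hloc as [delta hdelta].
  destruct (compactness_value_1d a b delta) as [d hd].
  exists d. intros u hu s hs.
  (* The covering centre is only available under a double negation, so the inequality is decided
     beforehand and its failure refuted. *)
  destruct (Rlt_dec (Rabs (f u s - f u0 s)) eps) as [|hn]; auto. exfalso.
  apply (hd s hs). intros [t [ht [h1 h2]]].
  assert (hu' : ball u0 (delta t) u) by (eapply ball_le; [exact h2|exact hu]).
  pose proof (hdelta t ht u s hu' h1). pose proof (hdelta t ht u0 s (ball_center _ _) h1).
  apply hn. apply Rabs_def2 in H. apply Rabs_def2 in H0. apply Rabs_def1; lra.
Qed.

Lemma continuous_slice {U : UniformSpace} (f : U -> R -> R) u t :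
  continuous (fun p : U * R => f (fst p) (snd p)) (u, t) -> continuous (f u) t.
Proof.
  intro h. apply (continuous_comp_gen (fun t => (u, t)) (fun p : U * R => f (fst p) (snd p)) t); auto.
  apply continuous_pair. apply continuous_const. apply continuous_id.
Qed.

Lemma continuous_slice1 {U : UniformSpace} (f : U -> R -> R) u t :
  continuous (fun p : U * R => f (fst p) (snd p)) (u, t) -> continuous (fun v => f v t) u.
Proof.
  intro h. apply (continuous_comp_gen (fun v => (v, t)) (fun p : U * R => f (fst p) (snd p)) u); auto.
  apply continuous_pair. apply continuous_id. apply continuous_const.
Qed.

Lemma continuous_RInt_param {U : UniformSpace} (f : U -> R -> R) (a b : R) (u0 : U) : a <= b ->
  (forall u t, continuous (fun p : U * R => f (fst p) (snd p)) (u, t)) ->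
  continuous (fun u => RInt (f u) a b) u0.
Proof.
  intros hab hf. rewrite continuous_R_iff. intros eps heps.
  assert (he : 0 < eps / (b - a + 1)). { apply Rdiv_lt_0_compat; lra. }
  generalize (tube f u0 a b (fun t _ => hf u0 t) _ he). apply filter_imp. intros u hu.
  assert (ex1 : forall v, ex_RInt (f v) a b).
  { intro v. apply ex_RInt_cont. intro t. apply continuous_slice, hf. }
  change (RInt (f u) a b - RInt (f u0) a b) with (minus (RInt (f u) a b) (RInt (f u0) a b)).
  rewrite <- (RInt_minus (f u) (f u0)) by auto.
  eapply Rle_lt_trans. apply abs_RInt_le_const with (M := eps / (b - a + 1)); auto.
  - apply (ex_RInt_minus (V := R_NormedModule)); auto.
  - intros t ht. left. apply hu; auto.
  - apply Rmult_lt_reg_r with (b - a + 1). lra. replace ((b - a) * (eps / (b - a + 1)) * (b - a + 1)) with ((b - a) * eps) by (field; lra). nra.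
Qed.

Lemma eq_of_derive_eq (f g d : R -> R) (a : R) :
  (forall x, is_derive f x (d x)) -> (forall x, is_derive g x (d x)) -> f a = g a -> forall x, f x = g x.
Proof.
  intros hf hg e x.
  destruct (MVT_gen (fun t => f t - g t) a x (fun _ => 0)) as [c [_ hc]].
  - intros t _. replace 0 with (d t - d t) by ring. apply (is_derive_minus (V := R_NormedModule)); auto.
  - intros t _. apply continuity_pt_filterlim.
    apply (ex_derive_continuous (K := R_AbsRing) (V := R_NormedModule) (fun t : R => f t - g t) t).
    exists (d t - d t). apply (is_derive_minus (V := R_NormedModule)); auto.
  - simpl in hc. lra.
Qed.

(** Both sides, as functions of the upper limit of the outer integral in x, have the derivative RInt
    (f x) c d and vanish at a. Differentiation under the integral sign replaces any theory of double
    integrals. *)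
Lemma RInt_swap (f : R -> R -> R) (a b c d : R) : c <= d ->
  (forall x y, continuous (fun p : R * R => f (fst p) (snd p)) (x, y)) ->
  RInt (fun x => RInt (fun y => f x y) c d) a b = RInt (fun y => RInt (fun x => f x y) a b) c d.
Proof.
  intros hcd hf.
  assert (hx : forall x y, continuous (f x) y) by (intros; apply continuous_slice, hf).
  assert (hy : forall x y, continuous (fun x => f x y) x) by (intros; apply continuous_slice1 with (f := f), hf).
  assert (hI : forall x, continuous (fun x => RInt (f x) c d) x).
  { intro x. apply continuous_RInt_param; auto. }
  assert (hD : forall u t, is_derive (fun z => RInt (fun s => f s t) a z) u (f u t)).
  { intros u t. apply (is_derive_RInt (V := R_NormedModule) (fun s => f s t) _ a).
    - apply filter_forall. intro z. apply RInt_correct_cont. auto.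
    - apply hy. }
  assert (hJ : forall x t, continuous (fun y => RInt (fun s => f s y) a x) t).
  (* [continuous_RInt_param] asks for ordered bounds; for x < a the orientation of the integral is
     reversed. *)
  { intros x t. destruct (Rle_dec a x) as [hax|hax].
    - apply (continuous_RInt_param (fun y s => f s y)); auto. intros u s.
      apply (continuous_comp_gen (fun p : R * R => (snd p, fst p)) (fun p : R * R => f (fst p) (snd p)) (u, s)); auto.
      apply continuous_pair; cont.
    - apply continuous_ext with (fun y => - RInt (fun s => f s y) x a).
      { intro y. apply (opp_RInt_swap (V := R_CompleteNormedModule) (fun s => f s y)). apply ex_RInt_cont. auto. }
      apply continuous_Ropp.
      apply (continuous_RInt_param (fun y s => f s y)). lra. intros u s.
      apply (continuous_comp_gen (fun p : R * R => (snd p, fst p)) (fun p : R * R => f (fst p) (snd p)) (u, s)); auto.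
      apply continuous_pair; cont. }
  apply (eq_of_derive_eq (fun z => RInt (fun x => RInt (fun y => f x y) c d) a z)
    (fun z => RInt (fun y => RInt (fun x => f x y) a z) c d) (fun x => RInt (f x) c d) a).
  - intros x. apply (is_derive_RInt (V := R_NormedModule) (fun x => RInt (f x) c d) _ a).
    + apply filter_forall. intro z. apply RInt_correct_cont. auto.
    + apply hI.
  - intros x.
    replace (RInt (f x) c d) with (RInt (fun t => Derive (fun z => RInt (fun s => f s t) a z) x) c d).
    2: { apply RInt_ext. intros t _. apply is_derive_unique. apply hD. }
    apply (is_derive_RInt_param (fun z y => RInt (fun s => f s y) a z)).
    + apply filter_forall. intros z t _. exists (f z t). apply hD.
    + intros t _. apply continuity_2d_pt_ext with f.
      { intros u v. symmetry. apply is_derive_unique. apply hD. }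
      apply continuity_2d_pt_filterlim. apply hf.
    + apply filter_forall. intros z. apply ex_RInt_cont. auto.
  - simpl. rewrite (RInt_point (V := R_CompleteNormedModule)).
    transitivity (RInt (fun _ => 0) c d). rewrite RInt_const. unfold zero, scal; simpl. unfold mult; simpl. ring.
    apply RInt_ext. intros. rewrite (RInt_point (V := R_CompleteNormedModule)). reflexivity.
Qed.

(** * Complex derivatives and derivatives along curves *)

(** The weak inequality, with |w - z| on the right instead of a quotient, makes a separate treatment
    of w = z unnecessary. *)
Definition cder (f : C -> C) (z d : C) : Prop :=
  forall eps, 0 < eps -> exists delta, 0 < delta /\
    forall w, Cmod (w - z) < delta -> Cmod (f w - f z - d * (w - z)) <= eps * Cmod (w - z).

Lemma is_derive_C_iff (f : C -> C) (z d : C) :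
  is_derive (K := C_AbsRing) (V := C_NormedModule) f z d <-> cder f z d.
Proof.
  split.
  - intros [_ h] eps heps.
    destruct (h z (fun P hP => hP) (mkposreal eps heps)) as [e he].
    exists e. split. apply e. intros w hw.
    generalize (he w hw). unfold norm, minus, scal, plus, opp; simpl. unfold mult; simpl.
    intro k. unfold Cminus. rewrite (Cmult_comm d). exact k.
  - intros h. split.
    + apply is_linear_scal_l.
    + intros x hx eps.
      apply (is_filter_lim_locally_unique (V := AbsRing_NormedModule C_AbsRing)) in hx. subst x.
      destruct (h eps (cond_pos eps)) as [e [he k]].
      exists (mkposreal e he). intros w hw.
      generalize (k w hw). unfold norm, minus, scal, plus, opp; simpl. unfold mult; simpl.
      unfold Cminus. rewrite (Cmult_comm d). auto.
Qed.

Lemma is_derive_R_iff (f : R -> R) (x d : R) :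
  is_derive f x d <-> forall eps, 0 < eps -> exists delta, 0 < delta /\
    forall y, Rabs (y - x) < delta -> Rabs (f y - f x - d * (y - x)) <= eps * Rabs (y - x).
Proof.
  split.
  - intros [_ h] eps heps.
    destruct (h x (fun P hP => hP) (mkposreal eps heps)) as [e he].
    exists e. split. apply e. intros w hw.
    generalize (he w hw). unfold norm, minus, scal, plus, opp; simpl. unfold abs, mult; simpl.
    intro k. unfold Rminus. rewrite (Rmult_comm d). exact k.
  - intros h. split.
    + apply is_linear_scal_l.
    + intros y hy eps.
      apply (is_filter_lim_locally_unique (V := AbsRing_NormedModule R_AbsRing)) in hy. subst y.
      destruct (h eps (cond_pos eps)) as [e [he k]].
      exists (mkposreal e he). intros w hw.
      generalize (k w hw). unfold norm, minus, scal, plus, opp; simpl. unfold abs, mult; simpl.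
      unfold Rminus. rewrite (Rmult_comm d). auto.
Qed.

Lemma cder_unique (f : C -> C) z d d' : cder f z d -> cder f z d' -> d = d'.
Proof.
  intros h1 h2. apply is_derive_C_iff in h1. apply is_derive_C_iff in h2.
  rewrite <- (is_C_derive_unique f z d h1), <- (is_C_derive_unique f z d' h2). reflexivity.
Qed.

Lemma cder_continuous f z d : cder f z d -> continuous f z.
Proof.
  intros h. rewrite continuous_C_iff. intros eps heps.
  destruct (h 1 Rlt_0_1) as [dl [hdl k]].
  assert (hm := Cmod_ge_0 d).
  apply locally_C_iff. exists (Rmin dl (eps / (Cmod d + 2))). split.
  apply Rmin_pos; auto. apply Rdiv_lt_0_compat; lra.
  intros w hw.
  assert (h1 : Cmod (w - z) < dl) by (eapply Rlt_le_trans; [exact hw|apply Rmin_l]).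
  assert (h2 : Cmod (w - z) < eps / (Cmod d + 2)) by (eapply Rlt_le_trans; [exact hw|apply Rmin_r]).
  specialize (k w h1).
  apply Rmult_lt_compat_r with (r := Cmod d + 2) in h2; [|lra].
  replace (eps / (Cmod d + 2) * (Cmod d + 2)) with eps in h2 by (field; lra).
  pose proof (Cmod_triangle_inv (f w - f z) (d * (w - z))) as h3. rewrite Cmod_mult in h3.
  generalize (Cmod_ge_0 (w - z)); nra.
Qed.

Lemma cder_const (c z : C) : cder (fun _ => c) z 0.
Proof.
  intros eps heps. exists 1. split. lra. intros w _. replace (c - c - 0 * (w - z))%C with (RtoC 0) by ring.
  rewrite Cmod_0. generalize (Cmod_ge_0 (w - z)); nra.
Qed.

Lemma cder_id (z : C) : cder (fun w => w) z 1.
Proof.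
  intros eps heps. exists 1. split. lra. intros w _. replace (w - z - 1 * (w - z))%C with (RtoC 0) by ring.
  rewrite Cmod_0. generalize (Cmod_ge_0 (w - z)); nra.
Qed.

Lemma cder_plus f g z a b : cder f z a -> cder g z b -> cder (fun w => f w + g w)%C z (a + b)%C.
Proof.
  intros hf hg eps heps.
  destruct (hf (eps / 2) (half_pos _ heps)) as [d1 [p1 k1]]. destruct (hg (eps / 2) (half_pos _ heps)) as [d2 [p2 k2]].
  exists (Rmin d1 d2). split. apply Rmin_pos; auto. intros w hw.
  specialize (k1 w (Rlt_le_trans _ _ _ hw (Rmin_l _ _))). specialize (k2 w (Rlt_le_trans _ _ _ hw (Rmin_r _ _))).
  replace (f w + g w - (f z + g z) - (a + b) * (w - z))%C with ((f w - f z - a * (w - z)) + (g w - g z - b * (w - z)))%C by ring.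
  eapply Rle_trans. apply Cmod_triangle. lra.
Qed.

Lemma cder_mult f g z a b : cder f z a -> cder g z b -> cder (fun w => f w * g w)%C z (a * g z + f z * b)%C.
Proof.
  intros hf hg eps heps.
  set (M := Cmod (f z) + Cmod (g z) + Cmod a + 3).
  assert (hM : 3 <= M /\ Cmod (f z) <= M /\ Cmod (g z) + 1 <= M /\ Cmod a <= M).
  { unfold M. generalize (Cmod_ge_0 (f z)) (Cmod_ge_0 (g z)) (Cmod_ge_0 a). intros; repeat split; lra. }
  destruct hM as [m1 [m2 [m3 m4]]].
  assert (heps3 : 0 < eps / (3 * M)) by (apply Rdiv_lt_0_compat; lra).
  assert (hgc := cder_continuous g z b hg). rewrite continuous_C_iff in hgc.
  assert (h31 : 0 < Rmin 1 (eps / (3 * M))) by (apply Rmin_pos; lra).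
  specialize (hgc _ h31). apply locally_C_iff in hgc. destruct hgc as [d3 [p3 k3]].
  destruct (hf _ heps3) as [d1 [p1 k1]]. destruct (hg _ heps3) as [d2 [p2 k2]].
  exists (Rmin d1 (Rmin d2 d3)). split. repeat apply Rmin_pos; auto. intros w hw.
  assert (w1 : Cmod (w - z) < d1) by (eapply Rlt_le_trans; [exact hw|apply Rmin_l]).
  assert (w2 : Cmod (w - z) < d2) by (eapply Rlt_le_trans; [exact hw|eapply Rle_trans; [apply Rmin_r|apply Rmin_l]]).
  assert (w3 : Cmod (w - z) < d3) by (eapply Rlt_le_trans; [exact hw|eapply Rle_trans; [apply Rmin_r|apply Rmin_r]]).
  specialize (k1 w w1). specialize (k2 w w2). specialize (k3 w w3).
  assert (k31 : Cmod (g w - g z) < 1) by (eapply Rlt_le_trans; [exact k3|apply Rmin_l]).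
  assert (k32 : Cmod (g w - g z) < eps / (3 * M)) by (eapply Rlt_le_trans; [exact k3|apply Rmin_r]).
  replace (f w * g w - f z * g z - (a * g z + f z * b) * (w - z))%C with
    ((f w - f z - a * (w - z)) * g w + a * (w - z) * (g w - g z) + f z * (g w - g z - b * (w - z)))%C by ring.
  eapply Rle_trans. apply Cmod_triangle.
  eapply Rle_trans. apply Rplus_le_compat_r. apply Cmod_triangle. rewrite !Cmod_mult.
  assert (hgw : Cmod (g w) <= M) by (generalize (Cmod_triangle_inv (g w) (g z)); lra).
  set (e3 := eps / (3 * M)) in *. set (u := Cmod (w - z)) in *.
  assert (e3 * M = eps / 3) by (unfold e3; field; lra).
  assert (0 <= u) by apply Cmod_ge_0.
  assert (t1 : Cmod (f w - f z - a * (w - z)) * Cmod (g w) <= (e3 * u) * M).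
  { apply Rmult_le_compat; auto; apply Cmod_ge_0. }
  assert (t2 : Cmod a * u * Cmod (g w - g z) <= (M * u) * e3).
  { apply Rmult_le_compat; try apply Cmod_ge_0; try lra. apply Rmult_le_pos; auto; apply Cmod_ge_0. apply Rmult_le_compat_r; auto. }
  assert (t3 : Cmod (f z) * Cmod (g w - g z - b * (w - z)) <= M * (e3 * u)).
  { apply Rmult_le_compat; auto; apply Cmod_ge_0. }
  replace (eps * u) with (eps / 3 * u + eps / 3 * u + eps / 3 * u) by field. rewrite <- H.
  lra.
Qed.

Lemma cder_inv z : z <> RtoC 0 -> cder (fun w => / w)%C z (- (/ (z * z)))%C.
Proof.
  intros hz eps heps. apply Cmod_gt_0 in hz as hm. set (m := Cmod z) in *.
  exists (Rmin (m / 2) (eps * (m * m * m) / 2)).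
  assert (0 < m * m * m) by (apply Rmult_lt_0_compat; nra).
  split. apply Rmin_pos. lra. apply Rdiv_lt_0_compat; nra.
  intros w hw.
  assert (w1 : Cmod (w - z) < m / 2) by (eapply Rlt_le_trans; [exact hw|apply Rmin_l]).
  assert (w2 : Cmod (w - z) < eps * (m * m * m) / 2) by (eapply Rlt_le_trans; [exact hw|apply Rmin_r]).
  assert (hwm : m / 2 < Cmod w).
  { generalize (Cmod_triangle_inv z w). rewrite (Cmod_sub_sym z). fold m. lra. }
  assert (hw0 : w <> RtoC 0) by (apply Cmod_gt_0; lra).
  replace (/ w - / z - - / (z * z) * (w - z))%C with ((w - z) * (w - z) / (w * (z * z)))%C by (field; auto).
  assert (hzz : (w * (z * z))%C <> RtoC 0) by (repeat apply Cmult_neq_0; auto).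
  rewrite Cmod_div by exact hzz. rewrite !Cmod_mult. fold m.
  set (u := Cmod (w - z)) in *. assert (0 <= u) by apply Cmod_ge_0.
  assert (hden : 0 < Cmod w * (m * m)) by (apply Rmult_lt_0_compat; nra).
  apply Rmult_le_reg_r with (Cmod w * (m * m)); auto.
  unfold Rdiv. rewrite Rmult_assoc, Rinv_l, Rmult_1_r by lra.
  replace (eps * u * (Cmod w * (m * m))) with (u * (eps * (Cmod w * (m * m)))) by ring.
  apply Rmult_le_compat_l; auto. left. eapply Rlt_le_trans. exact w2.
  replace (eps * (m * m * m) / 2) with (eps * ((m / 2) * (m * m))) by field.
  apply Rmult_le_compat_l. lra. apply Rmult_le_compat_r; nra.
Qed.

Lemma cder_comp f g z a b : cder g z a -> cder f (g z) b -> cder (fun w => f (g w)) z (b * a)%C.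
Proof.
  intros hg hf eps heps.
  set (M := Cmod a + Cmod b + 1).
  assert (hM : 1 <= M /\ Cmod a + 1 <= M /\ Cmod b <= M).
  { unfold M. generalize (Cmod_ge_0 a) (Cmod_ge_0 b). lra. }
  destruct hM as [m1 [m2 m3]].
  assert (he2 : 0 < eps / (2 * M)) by (apply Rdiv_lt_0_compat; lra).
  assert (he : 0 < Rmin 1 (eps / (2 * M))) by (apply Rmin_pos; lra).
  destruct (hg _ he) as [d1 [p1 k1]].
  destruct (hf _ he2) as [d2 [p2 k2]].
  exists (Rmin d1 (d2 / M)). split. apply Rmin_pos; auto. apply Rdiv_lt_0_compat; lra.
  intros s hs.
  specialize (k1 s (Rlt_le_trans _ _ _ hs (Rmin_l _ _))).
  assert (hs2 : Cmod (s - z) * M < d2).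
  { apply Rlt_le_trans with (d2 / M * M). apply Rmult_lt_compat_r. lra. eapply Rlt_le_trans; [exact hs|apply Rmin_r].
    right; field; lra. }
  set (u := Cmod (s - z)) in *. assert (0 <= u) by apply Cmod_ge_0.
  set (e := Rmin 1 (eps / (2 * M))) in *.
  assert (e <= 1) by apply Rmin_l. assert (e <= eps / (2 * M)) by apply Rmin_r.
  assert (hgb : Cmod (g s - g z) <= M * u).
  { pose proof (Cmod_triangle_inv (g s - g z) (a * (s - z))) as h3. rewrite Cmod_mult in h3. fold u in h3. nra. }
  assert (hk : Cmod (g s - g z) < d2) by lra.
  specialize (k2 _ hk).
  replace (f (g s) - f (g z) - b * a * (s - z))%C with
    ((f (g s) - f (g z) - b * (g s - g z)) + b * (g s - g z - a * (s - z)))%C by ring.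
  eapply Rle_trans. apply Cmod_triangle. rewrite Cmod_mult.
  assert (eps / (2 * M) * M = eps / 2) by (field; lra).
  assert (Cmod b * Cmod (g s - g z - a * (s - z)) <= M * (eps / (2 * M) * u)).
  { apply Rmult_le_compat; try apply Cmod_ge_0; auto. eapply Rle_trans. exact k1. apply Rmult_le_compat_r; auto. }
  assert (eps / (2 * M) * Cmod (g s - g z) <= eps / (2 * M) * (M * u)) by (apply Rmult_le_compat_l; lra).
  replace (eps * u) with (eps / 2 * u + eps / 2 * u) by field. rewrite <- H2. lra.
Qed.

(** * Derivatives of complex curves in a real parameter *)

Definition rderC (g : R -> C) (t : R) (d : C) : Prop :=
  is_derive (fun s => Re (g s)) t (Re d) /\ is_derive (fun s => Im (g s)) t (Im d).

Lemma rderC_iff g t d : rderC g t d <-> forall eps, 0 < eps -> exists delta, 0 < delta /\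
    forall s, Rabs (s - t) < delta -> Cmod (g s - g t - d * RtoC (s - t)) <= eps * Rabs (s - t).
Proof.
  unfold rderC. rewrite !is_derive_R_iff. split.
  - intros [h1 h2] eps heps.
    destruct (h1 (eps / 2) (half_pos _ heps)) as [d1 [p1 k1]]. destruct (h2 (eps / 2) (half_pos _ heps)) as [d2 [p2 k2]].
    exists (Rmin d1 d2). split. apply Rmin_pos; auto. intros s hs.
    specialize (k1 s (Rlt_le_trans _ _ _ hs (Rmin_l _ _))). specialize (k2 s (Rlt_le_trans _ _ _ hs (Rmin_r _ _))).
    eapply Rle_trans. apply Cmod_le_sum.
    replace (Re (g s - g t - d * RtoC (s - t))) with (Re (g s) - Re (g t) - Re d * (s - t)) by (rewrite !Re_minus, Re_mult, Re_RtoC, Im_RtoC; ring).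
    replace (Im (g s - g t - d * RtoC (s - t))) with (Im (g s) - Im (g t) - Im d * (s - t)) by (unfold Cminus, Cmult, Cplus, Copp, RtoC; simpl; unfold Im; ring).
    lra.
  - intros h. split; intros eps heps; destruct (h eps heps) as [dl [hd k]]; exists dl; split; auto; intros s hs; (eapply Rle_trans; [|apply (k s hs)]).
    + eapply Rle_trans; [|apply re_le_Cmod]. right. f_equal. rewrite !Re_minus, Re_mult, Re_RtoC, Im_RtoC; ring.
    + eapply Rle_trans; [|apply im_le_Cmod]. right. f_equal. unfold Cminus, Cmult, Cplus, Copp, RtoC; simpl; unfold Im; ring.
Qed.

Lemma rderC_const c t : rderC (fun _ => c) t 0.
Proof. split; apply (is_derive_const (V := R_NormedModule)). Qed.

Lemma rderC_plus f g t a b : rderC f t a -> rderC g t b -> rderC (fun s => f s + g s)%C t (a + b)%C.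
Proof. intros [h1 h2] [h3 h4]. split; apply (is_derive_plus (V := R_NormedModule)); auto. Qed.

Lemma rderC_minus f g t a b : rderC f t a -> rderC g t b -> rderC (fun s => f s - g s)%C t (a - b)%C.
Proof. intros [h1 h2] [h3 h4]. split; apply (is_derive_minus (V := R_NormedModule)); auto. Qed.

Lemma is_derive_Rmult (f g : R -> R) t a b : is_derive f t a -> is_derive g t b -> is_derive (fun s => f s * g s) t (a * g t + f t * b).
Proof. intros. apply (is_derive_mult (K := R_AbsRing) f g t a b); auto. intros; apply Rmult_comm. Qed.

Lemma rderC_mult f g t a b : rderC f t a -> rderC g t b -> rderC (fun s => f s * g s)%C t (a * g t + f t * b)%C.
Proof.
  intros [h1 h2] [h3 h4]. split.
  - replace (Re (a * g t + f t * b)) with ((Re a * Re (g t) + Re (f t) * Re b) - (Im a * Im (g t) + Im (f t) * Im b)) by (rewrite Re_plus, !Re_mult; ring).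
    apply (is_derive_minus (V := R_NormedModule) (fun s => Re (f s) * Re (g s)) (fun s => Im (f s) * Im (g s))); apply is_derive_Rmult; auto.
  - replace (Im (a * g t + f t * b)) with ((Re a * Im (g t) + Re (f t) * Im b) + (Im a * Re (g t) + Im (f t) * Re b)).
    apply (is_derive_plus (V := R_NormedModule) (fun s => Re (f s) * Im (g s)) (fun s => Im (f s) * Re (g s))); apply is_derive_Rmult; auto.
    change (Im (a * g t + f t * b)) with (Im (a * g t) + Im (f t * b)). rewrite !Im_mult; ring.
Qed.

Lemma rderC_RtoC (f : R -> R) t a : is_derive f t a -> rderC (fun s => RtoC (f s)) t (RtoC a).
Proof. intros h. split; simpl. exact h. apply (is_derive_const (V := R_NormedModule)). Qed.

Lemma rderC_expi (f : R -> R) t a : is_derive f t a -> rderC (fun s => expi (f s)) t (Ci * RtoC a * expi (f t))%C.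
Proof.
  intros h. split; unfold expi; simpl.
  - replace ((0 * a - 1 * 0) * cos (f t) - (0 * 0 + 1 * a) * sin (f t)) with (a * (- sin (f t))) by ring.
    apply (is_derive_comp (K := R_AbsRing) (V := R_NormedModule) cos f); auto. apply is_derive_cos.
  - replace ((0 * a - 1 * 0) * sin (f t) + (0 * 0 + 1 * a) * cos (f t)) with (a * (cos (f t))) by ring.
    apply (is_derive_comp (K := R_AbsRing) (V := R_NormedModule) sin f); auto. apply is_derive_sin.
Qed.

Lemma rderC_Re_scal g t d (c : C) : rderC g t d -> is_derive (fun s => Re (c * g s)) t (Re (c * d)).
Proof.
  intros h. destruct (rderC_mult (fun _ => c) g t 0 d (rderC_const c t) h) as [h1 _].
  replace (c * d)%C with (0 * g t + c * d)%C by ring. exact h1.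
Qed.

Lemma rderC_eq g t d d' : rderC g t d -> d = d' -> rderC g t d'.
Proof. intros h <-; auto. Qed.

Lemma rderC_comp f g t a b : rderC g t a -> cder f (g t) b -> rderC (fun s => f (g s)) t (b * a)%C.
Proof.
  rewrite !rderC_iff. intros hg hf eps heps.
  set (M := Cmod a + Cmod b + 1).
  assert (hM : 1 <= M /\ Cmod a + 1 <= M /\ Cmod b <= M).
  { unfold M. generalize (Cmod_ge_0 a) (Cmod_ge_0 b). lra. }
  destruct hM as [m1 [m2 m3]].
  assert (he : 0 < Rmin 1 (eps / (2 * M))) by (apply Rmin_pos; [lra|apply Rdiv_lt_0_compat; lra]).
  destruct (hg _ he) as [d1 [p1 k1]].
  assert (he2 : 0 < eps / (2 * M)) by (apply Rdiv_lt_0_compat; lra).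
  destruct (hf _ he2) as [d2 [p2 k2]].
  exists (Rmin d1 (d2 / M)). split. apply Rmin_pos; auto. apply Rdiv_lt_0_compat; lra.
  intros s hs.
  specialize (k1 s (Rlt_le_trans _ _ _ hs (Rmin_l _ _))).
  assert (hs2 : Rabs (s - t) * M < d2).
  { apply Rlt_le_trans with (d2 / M * M). apply Rmult_lt_compat_r. lra. eapply Rlt_le_trans; [exact hs|apply Rmin_r].
    right; field; lra. }
  set (u := Rabs (s - t)) in *. assert (0 <= u) by apply Rabs_pos.
  set (e := Rmin 1 (eps / (2 * M))) in *.
  assert (e <= 1) by apply Rmin_l. assert (e <= eps / (2 * M)) by apply Rmin_r.
  assert (hgb : Cmod (g s - g t) <= M * u).
  { pose proof (Cmod_triangle_inv (g s - g t) (a * RtoC (s - t))) as h3. rewrite Cmod_mult, Cmod_R in h3. fold u in h3. nra. }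
  assert (hk : Cmod (g s - g t) < d2) by lra.
  specialize (k2 _ hk).
  replace (f (g s) - f (g t) - b * a * RtoC (s - t))%C with
    ((f (g s) - f (g t) - b * (g s - g t)) + b * (g s - g t - a * RtoC (s - t)))%C by ring.
  eapply Rle_trans. apply Cmod_triangle. rewrite Cmod_mult.
  assert (eps / (2 * M) * M = eps / 2) by (field; lra).
  assert (Cmod b * Cmod (g s - g t - a * RtoC (s - t)) <= M * (eps / (2 * M) * u)).
  { apply Rmult_le_compat; try apply Cmod_ge_0; auto. eapply Rle_trans. exact k1. apply Rmult_le_compat_r; auto. }
  assert (eps / (2 * M) * Cmod (g s - g t) <= eps / (2 * M) * (M * u)) by (apply Rmult_le_compat_l; lra).
  replace (eps * u) with (eps / 2 * u + eps / 2 * u) by field. rewrite <- H2. lra.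
Qed.

Lemma rderC_continuous g t d : rderC g t d -> continuous g t.
Proof.
  intros [h1 h2].
  assert (k1 : continuous (fun s => Re (g s)) t).
  { apply (ex_derive_continuous (K := R_AbsRing) (V := R_NormedModule)). exists (Re d). exact h1. }
  assert (k2 : continuous (fun s => Im (g s)) t).
  { apply (ex_derive_continuous (K := R_AbsRing) (V := R_NormedModule)). exists (Im d). exact h2. }
  apply continuous_ext with (fun s => RtoC (Re (g s)) + Ci * RtoC (Im (g s)))%C.
  - intros s. destruct (g s) as [x y]. unfold Re, Im, Ci, RtoC, Cplus, Cmult; simpl. f_equal; ring.
  - cont.
Qed.

(** A complex curve has no mean value theorem. The real one is applied to Re (c g) with c the
    conjugate of the increment, for which Re (c (g b - g a)) is the squared length of the
    increment. *)
Lemma rderC_bound (g dg : R -> C) (a b M : R) : a <= b ->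
  (forall t, a <= t <= b -> rderC g t (dg t)) -> (forall t, a <= t <= b -> Cmod (dg t) <= M) ->
  Cmod (g b - g a) <= M * (b - a).
Proof.
  intros hab hd hM.
  destruct (classic ((g b - g a)%C = RtoC 0)) as [e|hn].
  { rewrite e, Cmod_0. apply Rmult_le_pos; [|lra]. eapply Rle_trans. apply Cmod_ge_0. apply (hM a); lra. }
  set (c := Cconj (g b - g a)).
  destruct (MVT_gen (fun t => Re (c * g t)) a b (fun t => Re (c * dg t))) as [t [ht k]].
  - intros t ht. rewrite Rmin_left, Rmax_right in ht by lra. apply rderC_Re_scal. apply hd; lra.
  - intros t ht. rewrite Rmin_left, Rmax_right in ht by lra. apply continuity_pt_filterlim.
    apply (ex_derive_continuous (K := R_AbsRing) (V := R_NormedModule) (fun t : R => Re (c * g t)) t).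
    eexists. apply rderC_Re_scal. apply hd; lra.
  - rewrite Rmin_left, Rmax_right in ht by lra. cbv beta in k.
    replace (Re (c * g b) - Re (c * g a)) with (Re (c * (g b - g a))) in k by (rewrite !Re_mult, Re_minus; change (Im (g b - g a)) with (Im (g b) - Im (g a)); ring).
    assert (hcc : Re (c * (g b - g a)) = Cmod (g b - g a) ^ 2) by (unfold c; rewrite Cconj_mult_self; reflexivity).
    rewrite hcc in k.
    assert (h1 : Re (c * dg t) <= Cmod (g b - g a) * M).
    { eapply Rle_trans. apply Re_le_mod. rewrite Cmod_mult. unfold c. rewrite Cmod_conj.
      apply Rmult_le_compat_l. apply Cmod_ge_0. apply hM; auto. }
    apply Cmod_gt_0 in hn. apply Rmult_le_reg_l with (Cmod (g b - g a)); auto.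
    replace (Cmod (g b - g a) * Cmod (g b - g a)) with (Cmod (g b - g a) ^ 2) by ring. rewrite k.
    apply Rle_trans with (Cmod (g b - g a) * M * (b - a)). apply Rmult_le_compat_r; lra. right; ring.
Qed.

(** * Goursat's theorem along a homotopy *)

(** A primitive of the affine function z |-> al + be (z - c). *)
Definition quad_prim (al be c z : C) : C := (al * z + be * ((z - c) * (z - c)) * RtoC (/ 2))%C.

Lemma RtoC_half_double : (RtoC (/ 2) + RtoC (/ 2))%C = RtoC 1.
Proof. rewrite <- RtoC_plus. f_equal. lra. Qed.

(** On an edge where g is affine up to M, the integral differs from the increment of the primitive
    [quad_prim] by at most M times the length. The increments cancel around a closed contour, and
    only the errors remain. *)
Lemma edge_integral (g : C -> C) (ga dga : R -> C) (a b M L : R) (al be c : C) : a <= b ->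
  (forall t, a <= t <= b -> rderC ga t (dga t)) ->
  (forall t, a <= t <= b -> continuous dga t) ->
  (forall t, a <= t <= b -> continuous g (ga t)) ->
  (forall t, a <= t <= b -> Cmod (dga t) <= L) ->
  (forall t, a <= t <= b -> Cmod (g (ga t) - (al + be * (ga t - c))) <= M) ->
  Rabs (RInt (fun t => Re (g (ga t) * dga t)) a b - (Re (quad_prim al be c (ga b)) - Re (quad_prim al be c (ga a))))
    <= (b - a) * (M * L).
Proof.
  intros hab hd hdc hgc hL hM.
  assert (hgac : forall t, a <= t <= b -> continuous ga t) by (intros; eapply rderC_continuous; apply hd; auto).
  assert (hc1 : forall t, a <= t <= b -> continuous (fun t => Re (g (ga t) * dga t)) t).
  { intros t ht. specialize (hdc t ht). apply continuous_Re. apply continuous_Cmult; auto. apply continuous_comp; auto. }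
  assert (hc2 : forall t, a <= t <= b -> continuous (fun t => Re ((al + be * (ga t - c)) * dga t)) t).
  { intros t ht. specialize (hdc t ht). specialize (hgac t ht). cont. }
  assert (hI : is_RInt (fun t => Re ((al + be * (ga t - c)) * dga t)) a b (Re (quad_prim al be c (ga b)) - Re (quad_prim al be c (ga a)))).
  { apply (is_RInt_derive (V := R_CompleteNormedModule) (fun t => Re (quad_prim al be c (ga t)))).
    - intros t ht. rewrite Rmin_left, Rmax_right in ht by lra.
      assert (h1 := hd t ht).
      assert (h2 := rderC_minus _ _ t _ _ h1 (rderC_const c t)).
      assert (h3 := rderC_plus _ _ t _ _ (rderC_mult _ _ t _ _ (rderC_const al t) h1)
         (rderC_mult _ _ t _ _ (rderC_mult _ _ t _ _ (rderC_const be t) (rderC_mult _ _ t _ _ h2 h2)) (rderC_const (RtoC (/ 2)) t))).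
      eapply rderC_eq in h3. destruct h3 as [h3 _]. exact h3.
      replace ((al + be * (ga t - c)) * dga t)%C with (al * dga t + be * (ga t - c) * dga t * RtoC 1)%C by ring.
      rewrite <- RtoC_half_double. ring.
    - intros t ht. rewrite Rmin_left, Rmax_right in ht by lra. auto. }
  rewrite <- (is_RInt_unique _ _ _ _ hI).
  assert (e1 : ex_RInt (fun t => Re (g (ga t) * dga t)) a b).
  { apply (ex_RInt_continuous (V := R_CompleteNormedModule)). intros t ht. rewrite Rmin_left, Rmax_right in ht by lra. auto. }
  assert (e2 : ex_RInt (fun t => Re ((al + be * (ga t - c)) * dga t)) a b).
  { eexists; exact hI. }
  match goal with |- Rabs (?A - ?B) <= _ => change (A - B) with (minus A B) end.
  rewrite <- (RInt_minus (V := R_CompleteNormedModule)) by auto.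
  apply abs_RInt_le_const; auto.
  - apply (ex_RInt_minus (V := R_NormedModule)); auto.
  - intros t ht.
    match goal with |- Rabs ?X <= _ => replace X with
      (Re ((g (ga t) - (al + be * (ga t - c))) * dga t)) end.
    + eapply Rle_trans. apply re_le_Cmod. rewrite Cmod_mult. apply Rmult_le_compat; auto using Cmod_ge_0.
    + change (Re ((g (ga t) - (al + be * (ga t - c))) * dga t) = Re (g (ga t) * dga t) - Re ((al + be * (ga t - c)) * dga t)).
      rewrite !Re_mult, !Re_minus.
      change (Im (g (ga t) - (al + be * (ga t - c)))) with (Im (g (ga t)) - Im (al + be * (ga t - c))). ring.
Qed.

Section Goursat.
Variables (g : C -> C) (h hx hy : R -> R -> C) (W L : R).
Hypotheses (hW : 0 < W) (hL0 : 0 <= L).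
Let inI x := 0 <= x <= W.
Hypothesis hdx : forall x y, inI x -> inI y -> rderC (fun s => h s y) x (hx x y).
Hypothesis hdy : forall x y, inI x -> inI y -> rderC (fun s => h x s) y (hy x y).
Hypothesis hcx : forall x y, inI x -> inI y -> continuous (fun s => hx s y) x.
Hypothesis hcy : forall x y, inI x -> inI y -> continuous (fun s => hy x s) y.
Hypothesis hbx : forall x y, inI x -> inI y -> Cmod (hx x y) <= L.
Hypothesis hby : forall x y, inI x -> inI y -> Cmod (hy x y) <= L.
Hypothesis hg : forall x y, inI x -> inI y -> exists d, cder g (h x y) d.

Let EX y x1 x2 := RInt (fun s => Re (g (h s y) * hx s y)) x1 x2.
Let EY x y1 y2 := RInt (fun s => Re (g (h x s) * hy x s)) y1 y2.
(** The real part of the contour integral of g along the image under h of the boundary of a square.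
    Complex statements are recovered afterwards by applying the real one to all multiples c f of the
    function. *)
Let I x y w := EX y x (x + w) + EY (x + w) y (y + w) - EX (y + w) x (x + w) - EY x y (y + w).

Let hgc x y : inI x -> inI y -> continuous g (h x y).
Proof. intros h1 h2. destruct (hg x y h1 h2) as [d hd]. apply cder_continuous in hd; auto. Qed.

Let exX y x1 x2 : inI y -> inI x1 -> inI x2 -> ex_RInt (fun s => Re (g (h s y) * hx s y)) x1 x2.
Proof.
  intros h1 h2 h3. apply (ex_RInt_continuous (V := R_CompleteNormedModule)). intros t ht.
  assert (inI t). { unfold inI in *. generalize (Rmin_glb _ _ _ (proj1 h2) (proj1 h3)) (Rmax_lub _ _ _ (proj2 h2) (proj2 h3)). lra. }
  apply continuous_Re, continuous_Cmult; auto. apply (continuous_comp_gen (fun s => h s y) g); auto.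
  eapply rderC_continuous. apply hdx; auto.
Qed.

Let exY x y1 y2 : inI x -> inI y1 -> inI y2 -> ex_RInt (fun s => Re (g (h x s) * hy x s)) y1 y2.
Proof.
  intros h1 h2 h3. apply (ex_RInt_continuous (V := R_CompleteNormedModule)). intros t ht.
  assert (inI t). { unfold inI in *. generalize (Rmin_glb _ _ _ (proj1 h2) (proj1 h3)) (Rmax_lub _ _ _ (proj2 h2) (proj2 h3)). lra. }
  apply continuous_Re, continuous_Cmult; auto. apply (continuous_comp_gen (fun s => h x s) g); auto.
  eapply rderC_continuous. apply hdy; auto.
Qed.

Let chX y x1 x2 x3 : inI y -> inI x1 -> inI x2 -> inI x3 -> EX y x1 x3 = EX y x1 x2 + EX y x2 x3.
Proof. intros. symmetry. apply (RInt_Chasles (V := R_CompleteNormedModule)); auto. Qed.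

Let chY x y1 y2 y3 : inI x -> inI y1 -> inI y2 -> inI y3 -> EY x y1 y3 = EY x y1 y2 + EY x y2 y3.
Proof. intros. symmetry. apply (RInt_Chasles (V := R_CompleteNormedModule)); auto. Qed.

Let hlip x y p q : inI x -> inI y -> inI p -> inI q -> Cmod (h x y - h p q) <= L * (Rabs (x - p) + Rabs (y - q)).
Proof.
  intros h1 h2 h3 h4.
  assert (k1 : Cmod (h x y - h p y) <= L * Rabs (x - p)).
  { destruct (Rle_dec p x) as [hp|hp].
    - rewrite Rabs_pos_eq by lra. apply (rderC_bound (fun s => h s y) (fun s => hx s y)); auto;
      intros t ht; (apply hdx || apply hbx); auto; unfold inI in *; lra.
    - rewrite Rabs_minus_sym, Cmod_sub_sym. rewrite Rabs_pos_eq by lra. apply (rderC_bound (fun s => h s y) (fun s => hx s y)); auto. lra.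
      all: intros t ht; (apply hdx || apply hbx); auto; unfold inI in *; lra. }
  assert (k2 : Cmod (h p y - h p q) <= L * Rabs (y - q)).
  { destruct (Rle_dec q y) as [hp|hp].
    - rewrite Rabs_pos_eq by lra. apply (rderC_bound (fun s => h p s) (fun s => hy p s)); auto;
      intros t ht; (apply hdy || apply hby); auto; unfold inI in *; lra.
    - rewrite Rabs_minus_sym, Cmod_sub_sym. rewrite Rabs_pos_eq by lra. apply (rderC_bound (fun s => h p s) (fun s => hy p s)); auto. lra.
      all: intros t ht; (apply hdy || apply hby); auto; unfold inI in *; lra. }
  generalize (Cmod_sub_triangle (h x y) (h p y) (h p q)). lra.
Qed.

(** The bound eps w^2 is additive under subdivision into four squares. On a small square containing
    (p, q), g is replaced by its first-order expansion at h p q, whose contribution cancels; the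
    Lipschitz bound of h makes the remaining error quadratic in w. *)
Lemma goursat_small eps : 0 < eps -> Rabs (I 0 0 W) <= eps * (W * W).
Proof.
  intros heps.
  (* The inclusion in the large square is part of the property proved by bisection, since
     [cousin_square] asks for the subdivision step on all squares. *)
  cut (0 <= 0 -> 0 + W <= W -> 0 <= 0 -> 0 + W <= W -> Rabs (I 0 0 W) <= eps * (W * W)).
  { intros k; apply k; lra. }
  apply (cousin_square (fun x y w => 0 <= x -> x + w <= W -> 0 <= y -> y + w <= W -> Rabs (I x y w) <= eps * (w * w))); auto.
  - intros x y w hw h1 h2 h3 h4 x0 x1 y0 y1.
    specialize (h1 ltac:(lra) ltac:(lra) ltac:(lra) ltac:(lra)). specialize (h2 ltac:(lra) ltac:(lra) ltac:(lra) ltac:(lra)).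
    specialize (h3 ltac:(lra) ltac:(lra) ltac:(lra) ltac:(lra)). specialize (h4 ltac:(lra) ltac:(lra) ltac:(lra) ltac:(lra)).
    assert (e : I x y w = I x y (w / 2) + I (x + w / 2) y (w / 2) + I x (y + w / 2) (w / 2) + I (x + w / 2) (y + w / 2) (w / 2)).
    { unfold I. replace (x + w / 2 + w / 2) with (x + w) by field. replace (y + w / 2 + w / 2) with (y + w) by field.
      rewrite (chX y x (x + w / 2) (x + w)), (chX (y + w) x (x + w / 2) (x + w)) by (unfold inI; lra).
      rewrite (chY x y (y + w / 2) (y + w)), (chY (x + w) y (y + w / 2) (y + w)) by (unfold inI; lra). ring. }
    rewrite e.
    pose proof (Rabs_triang (I x y (w / 2) + I (x + w / 2) y (w / 2) + I x (y + w / 2) (w / 2)) (I (x + w / 2) (y + w / 2) (w / 2))).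
    pose proof (Rabs_triang (I x y (w / 2) + I (x + w / 2) y (w / 2)) (I x (y + w / 2) (w / 2))).
    pose proof (Rabs_triang (I x y (w / 2)) (I (x + w / 2) y (w / 2))).
    replace (eps * (w * w)) with (eps * (w / 2 * (w / 2)) + eps * (w / 2 * (w / 2)) + eps * (w / 2 * (w / 2)) + eps * (w / 2 * (w / 2))) by field. lra.
  - intros p q hp hq. rewrite Rplus_0_l in hp, hq.
    destruct (hg p q hp hq) as [be hbe].
    (* Four edges of length at most L w, with error e' (2 L w) on each, give 8 L^2 e' w^2; the 1
       keeps the denominator positive when L = 0. *)
    set (e' := eps / (8 * (L * L) + 1)).
    assert (hLL : 0 <= L * L) by nra.
    assert (he' : 0 < e') by (apply Rdiv_lt_0_compat; lra).
    destruct (hbe e' he') as [dl [hdl k]].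
    exists (dl / (2 * L + 1)). split. apply Rdiv_lt_0_compat; lra.
    intros x y w [hw hwd] _ _ _ _ hpx hqy x0 x1 y0 y1.
    assert (hwL : w * (2 * L + 1) < dl).
    { apply Rlt_le_trans with (dl / (2 * L + 1) * (2 * L + 1)). apply Rmult_lt_compat_r; lra. right; field; lra. }
    assert (hloc : forall s t, x <= s <= x + w -> y <= t <= y + w ->
      Cmod (g (h s t) - (g (h p q) + be * (h s t - h p q))) <= e' * (L * (2 * w))).
    { intros s t hs ht.
      assert (hb : Cmod (h s t - h p q) <= L * (2 * w)).
      { eapply Rle_trans. apply hlip; auto; unfold inI; lra. apply Rmult_le_compat_l; auto.
        apply Rle_trans with (w + w); [|lra]. apply Rplus_le_compat; apply Rabs_le; lra. }
      replace (g (h s t) - (g (h p q) + be * (h s t - h p q)))%C with (g (h s t) - g (h p q) - be * (h s t - h p q))%C by ring.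
      eapply Rle_trans. apply k. lra. apply Rmult_le_compat_l; lra. }
    assert (ax : forall t, y <= t <= y + w -> Rabs (EX t x (x + w) - (Re (quad_prim (g (h p q)) be (h p q) (h (x + w) t)) - Re (quad_prim (g (h p q)) be (h p q) (h x t)))) <= (x + w - x) * (e' * (L * (2 * w)) * L)).
    { intros t ht. apply (edge_integral g (fun s => h s t) (fun s => hx s t)); try (intros s hs); try lra.
      - apply hdx; unfold inI; lra.
      - apply hcx; unfold inI; lra.
      - apply hgc; unfold inI; lra.
      - apply hbx; unfold inI; lra.
      - apply hloc; auto. }
    assert (ay : forall s, x <= s <= x + w -> Rabs (EY s y (y + w) - (Re (quad_prim (g (h p q)) be (h p q) (h s (y + w))) - Re (quad_prim (g (h p q)) be (h p q) (h s y)))) <= (y + w - y) * (e' * (L * (2 * w)) * L)).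
    { intros s hs. apply (edge_integral g (fun t => h s t) (fun t => hy s t)); try (intros t ht); try lra.
      - apply hdy; unfold inI; lra.
      - apply hcy; unfold inI; lra.
      - apply hgc; unfold inI; lra.
      - apply hby; unfold inI; lra.
      - apply hloc; auto. }
    pose proof (ax y ltac:(lra)) as b1. pose proof (ax (y + w) ltac:(lra)) as b2.
    pose proof (ay x ltac:(lra)) as b3. pose proof (ay (x + w) ltac:(lra)) as b4.
    replace (x + w - x) with w in * by ring. replace (y + w - y) with w in * by ring.
    apply Rle_trans with (4 * (w * (e' * (L * (2 * w)) * L))).
    + unfold I. apply Rabs_le. apply Rabs_le_between in b1. apply Rabs_le_between in b2. apply Rabs_le_between in b3. apply Rabs_le_between in b4. lra.
    + replace (4 * (w * (e' * (L * (2 * w)) * L))) with (e' * (8 * (L * L)) * (w * w)) by ring.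
      apply Rmult_le_compat_r. nra. apply Rle_trans with (e' * (8 * (L * L) + 1)). nra. unfold e'. right; field; lra.
Qed.

Lemma goursat : EX 0 0 W + EY W 0 W - EX W 0 W - EY 0 0 W = 0.
Proof.
  assert (h0 : I 0 0 W = EX 0 0 W + EY W 0 W - EX W 0 W - EY 0 0 W) by (unfold I; rewrite Rplus_0_l; reflexivity).
  rewrite <- h0. destruct (Req_dec (I 0 0 W) 0) as [|hn]; auto. exfalso.
  apply Rabs_pos_lt in hn.
  assert (hWW : 0 < W * W) by nra.
  pose proof (goursat_small (Rabs (I 0 0 W) / (2 * (W * W))) ltac:(apply Rdiv_lt_0_compat; lra)) as k.
  replace (Rabs (I 0 0 W) / (2 * (W * W)) * (W * W)) with (Rabs (I 0 0 W) / 2) in k by (field; lra). lra.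
Qed.
End Goursat.

(** * Circle means and the Cauchy formula *)

Lemma le_of_forall_eps (a b K : R) : 0 <= K -> (forall e, 0 < e -> a <= b + e * K) -> a <= b.
Proof.
  intros hK h. destruct (Rle_dec a b) as [|hn]; auto. exfalso.
  specialize (h ((a - b) / (2 * (K + 1))) ltac:(apply Rdiv_lt_0_compat; lra)).
  assert ((a - b) / (2 * (K + 1)) * (K + 1) = (a - b) / 2) by (field; lra).
  assert (0 < (a - b) / (2 * (K + 1))) by (apply Rdiv_lt_0_compat; lra). nra.
Qed.

Lemma eq_of_forall_eps (a b K : R) : 0 <= K -> (forall e, 0 < e -> Rabs (a - b) <= e * K) -> a = b.
Proof.
  intros hK h. apply Rle_antisym; apply le_of_forall_eps with K; auto; intros e he; specialize (h e he); apply Rabs_le_between in h; lra.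
Qed.

Lemma PI2_pos : 0 < 2 * PI.
Proof. generalize PI_RGT_0; lra. Qed.

Definition cm (g : R -> C) : C :=
  (RInt (fun t => Re (g t)) 0 (2 * PI) / (2 * PI), RInt (fun t => Im (g t)) 0 (2 * PI) / (2 * PI)).

Section CircleMean.
Implicit Types g h : R -> C.

Lemma Re_cm_scal g c : (forall t, continuous g t) ->
  Re (c * cm g) = RInt (fun t => Re (c * g t)) 0 (2 * PI) / (2 * PI).
Proof.
  intros hg. rewrite Re_mult. unfold cm; simpl.
  transitivity ((Re c * RInt (fun t => Re (g t)) 0 (2 * PI) - Im c * RInt (fun t => Im (g t)) 0 (2 * PI)) / (2 * PI)).
  { field. apply PI_neq0. }
  rewrite <- !RInt_scal_cont, <- RInt_minus_cont; try (intro x; specialize (hg x); cont; fail).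
  reflexivity.
Qed.

Lemma Re_cm g : Re (cm g) = RInt (fun t => Re (g t)) 0 (2 * PI) / (2 * PI).
Proof. reflexivity. Qed.

Lemma Im_eq_Re (c : C) : Im c = Re (- Ci * c).
Proof. rewrite Re_mult. simpl. ring. Qed.

(** Reduces complex identities between circle means to identities between real integrals; the
    imaginary part is the case c = - i. *)
Lemma C_ext_Re (a b : C) : (forall c, Re (c * a) = Re (c * b)) -> a = b.
Proof.
  intros h. apply C_ext.
  - specialize (h (RtoC 1)). rewrite !Cmult_1_l in h. exact h.
  - rewrite !Im_eq_Re. apply h.
Qed.

Lemma cm_ext g h : (forall t, g t = h t) -> cm g = cm h.
Proof. intros e. replace h with g by (apply functional_extensionality; auto). reflexivity. Qed.

Lemma cm_const c : cm (fun _ => c) = c.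
Proof.
  unfold cm. rewrite !RInt_const_R. destruct c as [x y]; simpl. f_equal; field; apply PI_neq0.
Qed.

Lemma cm_scal g c : (forall t, continuous g t) -> cm (fun t => c * g t)%C = (c * cm g)%C.
Proof.
  intros hg. apply C_ext_Re. intros d. rewrite Re_cm_scal.
  - rewrite Cmult_assoc, Re_cm_scal by auto. f_equal. apply RInt_ext_all. intro t. f_equal. ring.
  - intro t. specialize (hg t). cont.
Qed.

Lemma cm_plus g h : (forall t, continuous g t) -> (forall t, continuous h t) ->
  cm (fun t => g t + h t)%C = (cm g + cm h)%C.
Proof.
  intros hg hh. apply C_ext_Re. intros d.
  rewrite Cmult_plus_distr_l, Re_plus, !Re_cm_scal; auto.
  - transitivity (RInt (fun t => Re (d * g t) + Re (d * h t)) 0 (2 * PI) / (2 * PI)).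
    + f_equal. apply RInt_ext_all. intro t. rewrite Cmult_plus_distr_l. reflexivity.
    + rewrite RInt_plus_cont. field. apply PI_neq0.
      all: intro t; specialize (hg t); specialize (hh t); cont.
  - intro t; specialize (hg t); specialize (hh t); cont.
Qed.

(** Multiplication by the conjugate of the mean makes it real and nonnegative, so the estimate is
    one of real integrals. *)
Lemma cm_bound g (M : R) : (forall t, continuous g t) -> (forall t, 0 <= t <= 2 * PI -> Cmod (g t) <= M) -> Cmod (cm g) <= M.
Proof.
  intros hg hM. pose proof PI2_pos as hp.
  destruct (classic (cm g = RtoC 0)) as [e|hn].
  { rewrite e, Cmod_0. eapply Rle_trans. apply Cmod_ge_0. apply (hM 0); lra. }
  assert (k : Re (Cconj (cm g) * cm g) <= Cmod (cm g) * M).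
  { rewrite Re_cm_scal by auto. apply Rmult_le_reg_r with (2 * PI); auto.
    unfold Rdiv. rewrite Rmult_assoc, Rinv_l, Rmult_1_r by lra.
    replace (2 * PI) with (2 * PI - 0) at 2 by ring. apply RInt_le_const; try lra.
    - intro t; specialize (hg t); cont.
    - intros t ht. eapply Rle_trans. apply Re_le_mod. rewrite Cmod_mult, Cmod_conj.
      apply Rmult_le_compat_l; auto. apply Cmod_ge_0. }
  rewrite Cconj_mult_self, Re_RtoC in k. apply Cmod_gt_0 in hn. nra.
Qed.

Lemma cm_conj g : (forall t, continuous g t) -> cm (fun t => Cconj (g t)) = Cconj (cm g).
Proof.
  intros hg. unfold cm, Cconj; simpl. f_equal.
  transitivity ((-1 * RInt (fun t => Im (g t)) 0 (2 * PI)) / (2 * PI)).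
  - f_equal. rewrite <- RInt_scal_cont by (intro t; specialize (hg t); cont).
    apply RInt_ext_all. intro t. unfold Im; simpl; ring.
  - unfold Rdiv. ring.
Qed.
End CircleMean.

Lemma continuous_circle (f : C -> C) (rho R0 t : R) : 0 <= rho < R0 ->
  (forall w, Cmod w < R0 -> continuous f w) -> continuous (fun t => f (RtoC rho * expi t)%C) t.
Proof.
  intros h hf. apply (continuous_comp_gen (fun t => RtoC rho * expi t)%C f). cont.
  apply hf. rewrite Cmod_mult, Cmod_expi, Cmod_RtoC_pos; lra.
Qed.

Definition holD (R0 : R) (f : C -> C) : Prop := forall w, Cmod w < R0 -> exists d, cder f w d.

Lemma holD_continuous R0 f w : holD R0 f -> Cmod w < R0 -> continuous f w.
Proof. intros h hw. destruct (h w hw) as [d hd]. apply cder_continuous in hd. auto. Qed.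

(** The Cauchy kernel with respect to normalised angle: on w = rho e^{it}, dw / (i (w - z)) is w /
    (w - z) dt. *)
Definition ckern (rho : R) (z : C) (t : R) : C := (RtoC rho * expi t / (RtoC rho * expi t - z))%C.

Lemma circle_sub_ne rho z t : 0 <= rho -> Cmod z < rho -> (RtoC rho * expi t - z)%C <> RtoC 0.
Proof.
  intros h1 h2. apply Cmod_gt_0. generalize (Cmod_triangle_inv (RtoC rho * expi t) z).
  rewrite Cmod_mult, Cmod_expi, Cmod_RtoC_pos by lra. lra.
Qed.

Lemma circle_sub_ge rho z t : 0 <= rho -> rho - Cmod z <= Cmod (RtoC rho * expi t - z).
Proof.
  intros h1. generalize (Cmod_triangle_inv (RtoC rho * expi t) z).
  rewrite Cmod_mult, Cmod_expi, Cmod_RtoC_pos by lra. lra.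
Qed.

Lemma ckern_continuous rho z t : 0 <= rho -> Cmod z < rho -> continuous (ckern rho z) t.
Proof. intros. unfold ckern. cont. apply circle_sub_ne; auto. Qed.

Lemma ckern_bound rho z t : 0 <= rho -> Cmod z < rho -> Cmod (ckern rho z t) <= rho / (rho - Cmod z).
Proof.
  intros h1 h2. unfold ckern. rewrite Cmod_div by (apply circle_sub_ne; auto).
  rewrite Cmod_mult, Cmod_expi, Cmod_RtoC_pos, Rmult_1_r by lra.
  apply Rmult_le_compat_l; auto. apply Rinv_le_contravar. lra. apply circle_sub_ge; auto.
Qed.

(** Goursat's theorem for f(v) / (v - z) and the linear contraction of the circle towards z, stopped
    at the factor t0. The edges at angles 0 and 2 PI carry the same integral and cancel. *)
Lemma cauchy_homotopy (f : C -> C) (R0 rho t0 : R) (z : C) : holD R0 f -> 0 < rho < R0 -> Cmod z < rho -> 0 < t0 < 1 ->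
  RInt (fun t => Re (f (RtoC rho * expi t)%C * ckern rho z t)%C) 0 (2 * PI) =
  RInt (fun t => Re (f (z + RtoC t0 * (RtoC rho * expi t - z))%C * ckern rho z t)%C) 0 (2 * PI).
Proof.
  intros hf hr hz ht0. pose proof PI2_pos as hp.
  (* Affine map of [0, 2 PI] onto [t0, 1], so that both parameters of the homotopy range over the
     same square. *)
  set (T := fun x => t0 + (1 - t0) * x / (2 * PI)).
  set (w := fun t => (RtoC rho * expi t)%C).
  set (h := fun x t => (z + RtoC (T x) * (w t - z))%C).
  set (hx := fun (x t : R) => (RtoC ((1 - t0) / (2 * PI)) * (w t - z))%C).
  set (hy := fun x t => (RtoC (T x) * (Ci * w t))%C).
  (* The factor - i cancels the i of the angular derivative [hy], so that g times [hy] is f times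
     [ckern]. *)
  set (g := fun v => (- Ci * f v / (v - z))%C).
  assert (hw : forall t, Cmod (w t) = rho).
  { intro t. unfold w. rewrite Cmod_mult, Cmod_expi, Cmod_RtoC_pos; lra. }
  assert (hT : forall x, 0 <= x <= 2 * PI -> t0 <= T x <= 1).
  { intros x hx0. unfold T. assert (0 <= x / (2 * PI) <= 1).
    { split. apply Rle_div_r; lra. apply Rle_div_l; lra. }
    replace ((1 - t0) * x / (2 * PI)) with ((1 - t0) * (x / (2 * PI))) by (field; apply PI_neq0). nra. }
  assert (hwz : forall t, (w t - z)%C <> RtoC 0) by (intro t; apply circle_sub_ne; lra).
  assert (hT0 : T 0 = t0) by (unfold T; field; apply PI_neq0).
  assert (hT1 : T (2 * PI) = 1) by (unfold T; field; apply PI_neq0).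
  assert (hgo := goursat g h hx hy (2 * PI) (2 * rho + 1 / (2 * PI) * (2 * rho)) hp).
  assert (hwzb : forall t, Cmod (w t - z) <= 2 * rho) by (intro t; generalize (Cmod_sub_le (w t) z); rewrite hw; lra).
  assert (hi : 0 < 1 / (2 * PI)) by (apply Rdiv_lt_0_compat; lra).
  assert (pr : 0 < 1 / (2 * PI) * (2 * rho)) by (apply Rmult_lt_0_compat; lra).
  specialize (hgo ltac:(lra)).
  assert (E : forall x t, 0 <= x <= 2 * PI -> (g (h x t) * hy x t)%C = (f (h x t) * ckern rho z t)%C).
  { intros x t hx0. unfold g, hy, ckern. fold (w t).
    assert (h1 : RtoC (T x) <> RtoC 0). { intro e. apply RtoC_inj in e. specialize (hT x hx0). lra. }
    replace (h x t - z)%C with (RtoC (T x) * (w t - z))%C by (unfold h; ring).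
    transitivity (- (Ci * Ci) * f (h x t) * w t / (w t - z))%C. field. split; auto.
    replace (Ci * Ci)%C with (- RtoC 1)%C. field; auto. unfold Ci, Cmult, Copp, RtoC; simpl; f_equal; ring. }
  assert (fin : RInt (fun s => Re (g (h s 0) * hx s 0)) 0 (2 * PI) = RInt (fun s => Re (g (h s (2 * PI)) * hx s (2 * PI))) 0 (2 * PI)).
  { apply RInt_ext_all. intro s. unfold h, hx, w. rewrite expi_0, expi_2PI. reflexivity. }
  cut (RInt (fun s => Re (g (h (2 * PI) s) * hy (2 * PI) s)) 0 (2 * PI) = RInt (fun s => Re (g (h 0 s) * hy 0 s)) 0 (2 * PI)).
  { intros k. rewrite (RInt_ext_all (fun t => Re (f (RtoC rho * expi t)%C * ckern rho z t)%C) (fun s => Re (g (h (2 * PI) s) * hy (2 * PI) s))).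
    2: { intro s. rewrite E by lra. unfold h. rewrite hT1.
      replace (z + RtoC 1 * (w s - z))%C with (RtoC rho * expi s)%C by (unfold w; cbv beta; ring). reflexivity. }
    rewrite k. apply RInt_ext_all. intro s. rewrite E by lra. unfold h. rewrite hT0. reflexivity. }
  cbv beta in hgo. rewrite fin in hgo.
  assert (key : forall a b c : R, a + b - a - c = 0 -> b = c) by (intros; lra).
  eapply key; apply hgo; clear hgo fin key.
  - intros x y hx0 hy0. unfold h, hx.
    eapply rderC_eq. apply rderC_plus. apply rderC_const. apply rderC_mult. apply rderC_RtoC.
    { instantiate (1 := (1 - t0) / (2 * PI)). unfold T. auto_derive; auto. field; apply PI_neq0. }
    apply rderC_const. cbv beta; ring.
  - intros x y hx0 hy0. unfold h, hy.
    eapply rderC_eq. apply rderC_plus. apply rderC_const. apply rderC_mult. apply rderC_const.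
    apply rderC_minus. 2: apply rderC_const. unfold w. apply rderC_mult. apply rderC_const. apply rderC_expi.
    apply (is_derive_id (K := R_AbsRing)). change (@one R_AbsRing) with 1. unfold w. cbv beta. ring.
  - intros x y hx0 hy0. unfold hx. cont.
  - intros x y hx0 hy0. unfold hy, w. cont.
  - intros x y hx0 hy0. unfold hx. rewrite Cmod_mult, Cmod_RtoC_pos by (apply Rle_div_r; lra).
    apply Rle_trans with (1 / (2 * PI) * (2 * rho)); [|lra].
    apply Rmult_le_compat; auto using Cmod_ge_0. apply Rle_div_r; lra. apply Rmult_le_compat_r. left; apply Rinv_0_lt_compat; lra. lra.
  - intros x y hx0 hy0. unfold hy. specialize (hT x hx0). rewrite !Cmod_mult, Cmod_Ci, hw, Cmod_RtoC_pos by lra. nra.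
  - intros x y hx0 hy0. specialize (hT x hx0).
    assert (hh : Cmod (h x y) < R0).
    (* A convex combination of z and a point of the circle, hence inside the disc of radius R0. *)
    { replace (h x y) with (RtoC (1 - T x) * z + RtoC (T x) * w y)%C by (unfold h; rewrite RtoC_minus; ring).
      eapply Rle_lt_trans. apply Cmod_triangle. rewrite !Cmod_mult, hw, !Cmod_RtoC_pos by lra. nra. }
    destruct (hf _ hh) as [d hd].
    assert (hne : (h x y - z)%C <> RtoC 0).
    { unfold h. replace (z + RtoC (T x) * (w y - z) - z)%C with (RtoC (T x) * (w y - z))%C by ring. apply Cmult_neq_0; auto.
      intro e. apply RtoC_inj in e. lra. }
    eexists. unfold g, Cdiv. apply cder_mult. apply cder_mult. apply cder_const. exact hd.
    apply (cder_comp (fun v => / v)%C (fun v => v - z)%C). unfold Cminus. apply cder_plus. apply cder_id. apply cder_const. apply cder_inv. exact hne.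
Qed.

(** Let t0 tend to 0 in the homotopy: f tends to f z uniformly on the contracted circle, while the
    kernel stays bounded by rho / (rho - |z|). The mean of the kernel is left as a factor and
    computed separately. *)
Lemma cauchy_mean (f : C -> C) (R0 rho : R) (z : C) : holD R0 f -> 0 < rho < R0 -> Cmod z < rho ->
  cm (fun t => f (RtoC rho * expi t) * ckern rho z t)%C = (f z * cm (ckern rho z))%C.
Proof.
  intros hf hr hz. pose proof PI2_pos as hp.
  assert (key : forall f, holD R0 f -> Re (cm (fun t => f (RtoC rho * expi t) * ckern rho z t)%C) = Re (f z * cm (ckern rho z))%C).
  { clear f hf. intros f hf.
    assert (ck : forall t, continuous (ckern rho z) t) by (intro; apply ckern_continuous; lra).
    assert (cf : forall t, continuous (fun t => f (RtoC rho * expi t)%C) t).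
    { intro t. apply continuous_circle with R0; try lra. intros. apply holD_continuous with R0; auto. }
    rewrite Re_cm, Re_cm_scal by auto. f_equal.
    set (K := rho / (rho - Cmod z)). assert (hK : 0 < K) by (apply Rdiv_lt_0_compat; lra).
    apply eq_of_forall_eps with (K * (2 * PI)). nra. intros e he.
    assert (hc := holD_continuous R0 f z hf ltac:(lra)). rewrite continuous_C_iff in hc. specialize (hc e he).
    apply locally_C_iff in hc. destruct hc as [dl [hdl k]].
    (* Points of the contracted circle are within 2 rho t0 <= dl / 2 of z. *)
    set (t0 := Rmin (1 / 2) (dl / (4 * rho))).
    assert (ht0 : 0 < t0). { apply Rmin_pos. lra. apply Rdiv_lt_0_compat; lra. }
    assert (t0 <= 1 / 2) by apply Rmin_l. assert (t0 <= dl / (4 * rho)) by apply Rmin_r.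
    rewrite (cauchy_homotopy f R0 rho t0 z) by (auto; lra).
    assert (cfh : forall t, continuous (fun t => f (z + RtoC t0 * (RtoC rho * expi t - z))%C) t).
    { intro t. apply (continuous_comp_gen (fun t => z + RtoC t0 * (RtoC rho * expi t - z))%C f). cont.
      apply holD_continuous with R0; auto.
      replace (z + RtoC t0 * (RtoC rho * expi t - z))%C with (RtoC (1 - t0) * z + RtoC t0 * (RtoC rho * expi t))%C by (rewrite RtoC_minus; ring).
      eapply Rle_lt_trans. apply Cmod_triangle. rewrite !Cmod_mult, Cmod_expi, !Cmod_RtoC_pos by lra. nra. }
    rewrite <- RInt_minus_cont.
    2: { intro t. specialize (cfh t). specialize (ck t). cont. }
    2: { intro t. specialize (ck t). cont. }
    replace (e * (K * (2 * PI))) with ((2 * PI - 0) * (e * K)) by ring.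
    apply abs_RInt_le_const. lra.
    { apply ex_RInt_cont. intro t. specialize (cfh t). specialize (ck t). cont. }
    intros t ht. rewrite <- Re_minus. eapply Rle_trans. apply re_le_Cmod.
    match goal with |- Cmod ?X <= _ => replace X with ((f (z + RtoC t0 * (RtoC rho * expi t - z)) - f z) * ckern rho z t)%C by ring end.
    rewrite Cmod_mult. apply Rmult_le_compat; auto using Cmod_ge_0.
    - left. apply k. replace (z + RtoC t0 * (RtoC rho * expi t - z) - z)%C with (RtoC t0 * (RtoC rho * expi t - z))%C by ring.
      rewrite Cmod_mult, Cmod_RtoC_pos by lra.
      apply Rle_lt_trans with (t0 * (2 * rho)). apply Rmult_le_compat_l. lra.
      generalize (Cmod_sub_le (RtoC rho * expi t) z). rewrite Cmod_mult, Cmod_expi, Cmod_RtoC_pos by lra. lra.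
      apply Rle_lt_trans with (dl / (4 * rho) * (2 * rho)). apply Rmult_le_compat_r; lra.
      replace (dl / (4 * rho) * (2 * rho)) with (dl / 2) by (field; lra). lra.
    - apply ckern_bound; lra. }
  (* The real identity for c f, for every c, is the complex identity for f. *)
  apply C_ext_Re. intros c.
  assert (hcf : holD R0 (fun w => c * f w)%C).
  { intros w hw. destruct (hf w hw) as [d hd]. eexists. apply cder_mult. apply cder_const. exact hd. }
  specialize (key _ hcf). cbv beta in key. rewrite Cmult_assoc. rewrite <- key.
  rewrite <- cm_scal.
  - f_equal. apply cm_ext. intro t. ring.
  - intro t. assert (ck := ckern_continuous rho z t ltac:(lra) hz).
    assert (cf : continuous (fun t => f (RtoC rho * expi t)%C) t).
    { apply continuous_circle with R0; try lra. intros. apply holD_continuous with R0; auto. }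
    cont.
Qed.

Lemma ckern_0 rho t : 0 < rho -> ckern rho 0 t = RtoC 1.
Proof.
  intros h. unfold ckern. replace (RtoC rho * expi t - 0)%C with (RtoC rho * expi t)%C by ring.
  unfold Cdiv. apply Cinv_r. apply Cmult_neq_0. intro e; apply RtoC_inj in e; lra. apply expi_neq_0.
Qed.

Lemma mean_value (f : C -> C) (R0 rho : R) : holD R0 f -> 0 < rho < R0 -> cm (fun t => f (RtoC rho * expi t)%C) = f (RtoC 0).
Proof.
  intros hf hr. pose proof (cauchy_mean f R0 rho 0 hf hr ltac:(rewrite Cmod_0; lra)) as k.
  rewrite (cm_ext (ckern rho 0) (fun _ => RtoC 1)) in k by (intro; apply ckern_0; lra).
  rewrite cm_const, Cmult_1_r in k. rewrite <- k. apply cm_ext. intro t. rewrite ckern_0 by lra. ring.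
Qed.

Lemma cm_ckern rho z : 0 < rho -> Cmod z < rho -> cm (ckern rho z) = RtoC 1.
Proof.
  intros hr hz.
  (* the conjugate of the kernel is the boundary value of w |-> 1 / (1 - conj(z) w / rho^2) *)
  set (F := fun w : C => (/ (RtoC 1 + - (Cconj z * RtoC (/ rho ^ 2)) * w))%C).
  assert (hrr : 0 < rho ^ 2) by (apply pow_lt; auto).
  (* Chosen so that rho < R0 and |z| R0 < rho^2 (when z is not 0), both because |z| < rho; the
     denominator of F then has no zero of modulus less than R0. *)
  set (R0 := (rho + rho) * rho / (Cmod z + rho)).
  assert (hm := Cmod_ge_0 z).
  assert (hR0 : rho < R0). { unfold R0. apply Rlt_div_r. lra. nra. }
  assert (hF : holD R0 F).
  { intros w hw. assert (hne : (RtoC 1 + - (Cconj z * RtoC (/ rho ^ 2)) * w)%C <> RtoC 0).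
    { apply Cmod_gt_0. generalize (Cmod_triangle_inv (RtoC 1) ((RtoC 1 + - (Cconj z * RtoC (/ rho ^ 2)) * w))).
      rewrite Cmod_1. match goal with |- context [Cmod (RtoC 1 - ?X)] => replace (RtoC 1 - X)%C with (Cconj z * RtoC (/ rho ^ 2) * w)%C by ring end.
      rewrite !Cmod_mult, Cmod_conj, Cmod_RtoC_pos by (left; apply Rinv_0_lt_compat; auto).
      assert (Cmod z * Cmod w < rho ^ 2).
      { destruct (Rle_lt_or_eq_dec _ _ hm) as [h0|h0]; [|rewrite <- h0; lra].
        apply Rle_lt_trans with (Cmod z * R0). apply Rmult_le_compat_l; lra.
        unfold R0. replace (Cmod z * ((rho + rho) * rho / (Cmod z + rho))) with ((Cmod z * (rho + rho) * rho) / (Cmod z + rho)) by (field; lra).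
        apply Rlt_div_l. lra. nra. }
      intros k. replace (Cmod z * / rho ^ 2 * Cmod w) with (Cmod z * Cmod w / rho ^ 2) in k by (field; lra).
      assert (Cmod z * Cmod w / rho ^ 2 < 1) by (apply Rlt_div_l; lra). lra. }
    eexists. unfold F. apply (cder_comp (fun v => / v)%C (fun w => RtoC 1 + - (Cconj z * RtoC (/ rho ^ 2)) * w)%C).
    apply cder_plus. apply cder_const. apply cder_mult. apply cder_const. apply cder_id. apply cder_inv. exact hne. }
  pose proof (mean_value F R0 rho hF ltac:(lra)) as k.
  assert (F0 : F (RtoC 0) = RtoC 1). { unfold F. rewrite Cmult_0_r, Cplus_0_r. field. }
  rewrite F0 in k.
  transitivity (Cconj (cm (fun t => F (RtoC rho * expi t)%C))).
  - rewrite <- cm_conj.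
    + apply cm_ext. intro t. unfold F, ckern.
      assert (h1 := circle_sub_ne rho z t ltac:(lra) hz).
      assert (h2 : RtoC rho <> RtoC 0) by (intro e; apply RtoC_inj in e; lra).
      assert (h3 := expi_neq_0 t).
      assert (h4 : (expi t * Cconj (expi t))%C = RtoC 1).
      { rewrite Cmult_comm. apply conj_unit_mult. apply Cmod_expi. }
      assert (E : (RtoC rho * expi t - z)%C = (RtoC rho * expi t * Cconj (RtoC 1 + - (Cconj z * RtoC (/ rho ^ 2)) * (RtoC rho * expi t)))%C).
      { rewrite Cplus_conj, !Cmult_conj, Copp_conj, !Cmult_conj, Cconj_conj.
        replace (Cconj (RtoC (/ rho ^ 2))) with (RtoC (/ rho ^ 2)) by (unfold Cconj, RtoC; simpl; f_equal; ring).
        replace (Cconj (RtoC rho)) with (RtoC rho) by (unfold Cconj, RtoC; simpl; f_equal; ring).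
        replace (Cconj (RtoC 1)) with (RtoC 1) by (unfold Cconj, RtoC; simpl; f_equal; ring).
        transitivity (RtoC rho * expi t - z * (expi t * Cconj (expi t)) * (RtoC rho * RtoC rho * RtoC (/ rho ^ 2)))%C.
        rewrite h4. rewrite <- !RtoC_mult. replace (rho * rho * / rho ^ 2) with 1 by (field; lra). ring. ring. }
      set (X := (RtoC 1 + - (Cconj z * RtoC (/ rho ^ 2)) * (RtoC rho * expi t))%C) in *.
      assert (hX : Cconj X <> RtoC 0).
      { intro e. rewrite e, Cmult_0_r in E. auto. }
      assert (hX2 : X <> RtoC 0).
      { intro e. apply hX. rewrite e. unfold Cconj, RtoC; simpl; f_equal; ring. }
      rewrite Cinv_conj by exact hX2. rewrite E. field. repeat split; auto.
    + intro t. apply continuous_circle with R0. lra. intros; apply holD_continuous with R0; auto.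
  - rewrite k. unfold Cconj, RtoC; simpl; f_equal; ring.
Qed.

Theorem cauchy_formula (f : C -> C) (R0 rho : R) (z : C) : holD R0 f -> 0 < rho < R0 -> Cmod z < rho ->
  f z = cm (fun t => f (RtoC rho * expi t) * ckern rho z t)%C.
Proof.
  intros. rewrite (cauchy_mean f R0 rho z), cm_ckern; auto; try lra. ring.
Qed.

(** * Poisson kernel and Weierstrass' theorem in the disc *)

Lemma holD_le R0 R1 f : R1 <= R0 -> holD R0 f -> holD R1 f.
Proof. intros h hf w hw. apply hf. lra. Qed.

Lemma holD_mult R0 f g : holD R0 f -> holD R0 g -> holD R0 (fun w => f w * g w)%C.
Proof. intros hf hg w hw. destruct (hf w hw) as [a ha]. destruct (hg w hw) as [b hb]. eexists. apply cder_mult; eauto. Qed.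

Lemma holD_const R0 c : holD R0 (fun _ => c).
Proof. intros w hw. eexists. apply cder_const. Qed.

Lemma sub_mult_ne (a b w : C) (R1 : R) : Cmod b * R1 < Cmod a -> Cmod w < R1 -> (a - b * w)%C <> RtoC 0.
Proof.
  intros h hw. apply Cmod_gt_0. generalize (Cmod_triangle_inv a (a - b * w)).
  replace (a - (a - b * w))%C with (b * w)%C by ring. rewrite Cmod_mult.
  generalize (Cmod_ge_0 b) (Cmod_ge_0 w). nra.
Qed.

Lemma holD_inv_affine (a b : C) R1 : Cmod b * R1 < Cmod a -> holD R1 (fun w => / (a - b * w))%C.
Proof.
  intros h w hw. eexists. apply (cder_comp (fun v => / v)%C (fun w => a - b * w)%C).
  - unfold Cminus. apply cder_plus. apply cder_const. replace (fun w0 => (- (b * w0))%C) with (fun w0 => ((- b) * w0)%C) by (apply functional_extensionality; intro; ring).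
    apply cder_mult. apply cder_const. apply cder_id.
  - apply cder_inv. eapply sub_mult_ne; eauto.
Qed.

Definition poi (rho : R) (z : C) (t : R) : R := (rho ^ 2 - Cmod z ^ 2) / Cmod (RtoC rho * expi t - z) ^ 2.

Lemma poi_continuous rho z t : 0 <= rho -> Cmod z < rho -> continuous (poi rho z) t.
Proof.
  intros h1 h2. unfold poi. cont. apply pow_nonzero. apply Rgt_not_eq. apply Cmod_gt_0. apply circle_sub_ne; auto.
Qed.

Lemma poi_pos rho z t : 0 <= rho -> Cmod z < rho -> 0 <= poi rho z t.
Proof.
  intros h1 h2. unfold poi. apply Rmult_le_pos. generalize (Cmod_ge_0 z); nra.
  left. apply Rinv_0_lt_compat. apply pow_lt. apply Cmod_gt_0. apply circle_sub_ne; auto.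
Qed.

(** Cauchy's formula for g(w) = f(w) (rho^2 - |z|^2) / (rho^2 - conj z w). It has g(z) = f(z), and
    on |w| = rho its denominator is w conj (w - z), which turns the Cauchy kernel into the Poisson
    kernel. *)
Lemma poisson_formula f R0 rho z : holD R0 f -> 0 < rho < R0 -> Cmod z < rho ->
  cm (fun t => RtoC (poi rho z t) * f (RtoC rho * expi t))%C = f z.
Proof.
  intros hf hr hz. assert (hm := Cmod_ge_0 z).
  set (R' := 2 * rho ^ 2 / (Cmod z + rho)).
  assert (hR' : rho < R'). { unfold R'. apply Rlt_div_r. lra. nra. }
  assert (hzR : Cmod z * R' < rho ^ 2).
  { unfold R'. replace (Cmod z * (2 * rho ^ 2 / (Cmod z + rho))) with ((Cmod z * 2 * rho ^ 2) / (Cmod z + rho)) by (field; lra).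
    apply Rlt_div_l. lra. assert (0 < rho ^ 2) by (apply pow_lt; lra). nra. }
  set (R1 := Rmin R0 R').
  assert (h1 : rho < R1) by (apply Rmin_glb_lt; lra).
  assert (hrr : 0 < rho ^ 2) by (apply pow_lt; lra).
  assert (hb : Cmod (Cconj z) * R1 < Cmod (RtoC (rho ^ 2))).
  { rewrite Cmod_conj, Cmod_RtoC_pos by lra. eapply Rle_lt_trans; [|exact hzR]. apply Rmult_le_compat_l; auto. apply Rmin_r. }
  set (g := fun w => (f w * RtoC (rho ^ 2 - Cmod z ^ 2) * / (RtoC (rho ^ 2) - Cconj z * w))%C).
  assert (hg : holD R1 g).
  { unfold g. apply holD_mult. apply holD_mult. apply holD_le with R0; auto. apply Rmin_l. apply holD_const.
    apply holD_inv_affine. exact hb. }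
  assert (hgz : g z = f z).
  { unfold g. replace (RtoC (rho ^ 2) - Cconj z * z)%C with (RtoC (rho ^ 2 - Cmod z ^ 2)).
    - field. intro e; apply RtoC_inj in e. nra.
    - rewrite Cconj_mult_self, RtoC_minus. reflexivity. }
  rewrite <- hgz, (cauchy_formula g R1 rho z hg ltac:(lra) hz).
  apply cm_ext. intro t. unfold g, ckern, poi.
  set (w := (RtoC rho * expi t)%C).
  assert (hwz : (w - z)%C <> RtoC 0) by (apply circle_sub_ne; lra).
  assert (hw : w <> RtoC 0). { apply Cmod_gt_0. unfold w. rewrite Cmod_mult, Cmod_expi, Cmod_RtoC_pos; lra. }
  assert (E : (RtoC (rho ^ 2) - Cconj z * w)%C = (w * Cconj (w - z))%C).
  { rewrite Cminus_conj. replace (RtoC (rho ^ 2)) with (Cconj w * w)%C. ring.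
    rewrite Cconj_mult_self. unfold w. rewrite Cmod_mult, Cmod_expi, Cmod_RtoC_pos, Rmult_1_r by lra. reflexivity. }
  assert (hc : Cconj (w - z) <> RtoC 0).
  { apply Cmod_gt_0. rewrite Cmod_conj. apply Cmod_gt_0. auto. }
  rewrite E, RtoC_div by (apply pow_nonzero, Rgt_not_eq, Cmod_gt_0; auto).
  rewrite Cmod2_conj. field. auto.
Qed.

Lemma poi_mean rho z : 0 < rho -> Cmod z < rho -> RInt (poi rho z) 0 (2 * PI) = 2 * PI.
Proof.
  intros hr hz. pose proof (poisson_formula (fun _ => RtoC 1) (rho + 1) rho z (holD_const _ _) ltac:(lra) hz) as k.
  apply (f_equal Re) in k. rewrite Re_cm in k. simpl Re in k at 2.
  rewrite (RInt_ext_all _ (poi rho z)) in k by (intro t; rewrite Re_scal; simpl; ring).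
  apply Rmult_eq_reg_r with (/ (2 * PI)). 2: apply Rinv_neq_0_compat; generalize PI2_pos; lra.
  rewrite Rinv_r by (generalize PI2_pos; lra). exact k.
Qed.

(** With m = |f(z)| and v = |f| on the circle, the Poisson formula writes m^2 as a mean of Re (conj
    f(z) f), at most m v <= (v^2 + m^2) / 2. As the kernel has mean 1, the term m^2 / 2 is absorbed
    on the left. *)
Lemma subharmonic_sq f R0 rho z : holD R0 f -> 0 < rho < R0 -> Cmod z < rho ->
  Cmod (f z) ^ 2 <= RInt (fun t => poi rho z t * Cmod (f (RtoC rho * expi t)%C) ^ 2) 0 (2 * PI) / (2 * PI).
Proof.
  intros hf hr hz. pose proof PI2_pos as hp.
  assert (hpc : forall t, continuous (poi rho z) t) by (intro; apply poi_continuous; lra).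
  assert (hfc : forall t, continuous (fun t => f (RtoC rho * expi t)%C) t).
  { intro t. apply continuous_circle with R0. lra. intros; apply holD_continuous with R0; auto. }
  assert (hI0 : 0 <= RInt (fun t => poi rho z t * Cmod (f (RtoC rho * expi t)%C) ^ 2) 0 (2 * PI) / (2 * PI)).
  { apply Rdiv_le_0_compat; auto. apply RInt_ge0_cont; try lra.
    intro t; specialize (hpc t); specialize (hfc t); cont.
    intros t _. apply Rmult_le_pos. apply poi_pos; lra. apply pow2_ge_0. }
  set (m := Cmod (f z)). destruct (Rle_lt_or_eq_dec 0 m (Cmod_ge_0 _)) as [hm|hm].
  2: { rewrite <- hm. replace (0 ^ 2) with 0 by ring. auto. }
  assert (k : m ^ 2 <= RInt (fun t => (/ 2) * (poi rho z t * Cmod (f (RtoC rho * expi t)%C) ^ 2) + (m ^ 2 / 2) * poi rho z t) 0 (2 * PI) / (2 * PI)).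
  { replace (m ^ 2) with (Re (Cconj (f z) * f z)) at 1 by (rewrite Cconj_mult_self; reflexivity).
    rewrite <- (poisson_formula f R0 rho z) at 2 by auto.
    rewrite Re_cm_scal by (intro t; specialize (hpc t); specialize (hfc t); cont).
    apply Rmult_le_compat_r. left; apply Rinv_0_lt_compat; lra.
    apply RInt_le_cont; try lra.
    1, 2: intro t; specialize (hpc t); specialize (hfc t); cont.
    intros t _. replace (Cconj (f z) * (RtoC (poi rho z t) * f (RtoC rho * expi t)))%C with (RtoC (poi rho z t) * (Cconj (f z) * f (RtoC rho * expi t)))%C by ring.
    rewrite Re_scal. pose proof (poi_pos rho z t ltac:(lra) hz).
    pose proof (Re_le_mod (Cconj (f z) * f (RtoC rho * expi t)%C)%C) as h1. rewrite Cmod_mult, Cmod_conj in h1. fold m in h1.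
    set (v := Cmod (f (RtoC rho * expi t)%C)) in *.
    assert (h2 : m * v <= (v ^ 2 + m ^ 2) / 2) by (generalize (pow2_ge_0 (m - v)); nra).
    apply Rle_trans with (poi rho z t * ((v ^ 2 + m ^ 2) / 2)). apply Rmult_le_compat_l; lra. right; field. }
  rewrite RInt_plus_cont in k by (intro t; specialize (hpc t); specialize (hfc t); cont).
  rewrite !RInt_scal_cont, poi_mean in k by (try lra; intro t; specialize (hpc t); specialize (hfc t); cont).
  set (J := RInt _ _ _) in *.
  replace ((/ 2 * J + m ^ 2 / 2 * (2 * PI)) / (2 * PI)) with (/ 2 * (J / (2 * PI)) + m ^ 2 / 2) in k by (field; apply PI_neq0). lra.
Qed.

(** On |w| = R0 / 2 the Cauchy kernel is w / (w - h) = 1 + h / w + h^2 / (w (w - h)). The first two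
    terms give f(0) and the linear part; the last is estimated by |w - h| >= R0 / 4. *)
Lemma taylor_at_0 (f : C -> C) (R0 B : R) : 0 < R0 -> holD R0 f -> (forall w, Cmod w < R0 -> Cmod (f w) <= B) ->
  exists c, Cmod c <= 2 * B / R0 /\ forall h, Cmod h <= R0 / 4 -> Cmod (f h - f (RtoC 0) - c * h) <= 8 * B / R0 ^ 2 * Cmod h ^ 2.
Proof.
  intros hR hf hB. set (rho := R0 / 2).
  assert (hr : 0 < rho < R0) by (unfold rho; lra).
  set (w := fun t => (RtoC rho * expi t)%C).
  assert (hw : forall t, Cmod (w t) = rho) by (intro t; unfold w; rewrite Cmod_mult, Cmod_expi, Cmod_RtoC_pos; lra).
  assert (hw0 : forall t, w t <> RtoC 0) by (intro t; apply Cmod_gt_0; rewrite hw; lra).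
  assert (hwc : forall t, continuous w t) by (intro t; unfold w; cont).
  assert (hfc : forall t, continuous (fun t => f (w t)) t).
  { intro t. apply (continuous_circle f rho R0). lra. intros; apply holD_continuous with R0; auto. }
  assert (hB0 : 0 <= B) by (eapply Rle_trans; [apply Cmod_ge_0|apply (hB (RtoC 0)); rewrite Cmod_0; lra]).
  exists (cm (fun t => f (w t) / w t)%C). split.
  - apply cm_bound.
    + intro t. specialize (hfc t). specialize (hwc t). cont. auto.
    + intros t _. rewrite Cmod_div, hw by auto. replace (2 * B / R0) with (B / rho) by (unfold rho; field; lra).
      apply Rmult_le_compat_r. left; apply Rinv_0_lt_compat; lra. apply hB. rewrite hw; lra.
  - intros h hh. assert (hm := Cmod_ge_0 h).
    assert (hhr : Cmod h < rho) by (unfold rho; lra).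
    rewrite (cauchy_formula f R0 rho h) by auto.
    rewrite <- (mean_value f R0 rho hf hr).
    assert (hne : forall t, (w t - h)%C <> RtoC 0) by (intro t; apply circle_sub_ne; lra).
    assert (e : (cm (fun t => f (RtoC rho * expi t) * ckern rho h t)%C - cm (fun t => f (RtoC rho * expi t)%C) - cm (fun t => f (w t) / w t)%C * h)%C
      = cm (fun t => f (w t) * (h * h) / (w t * (w t - h)))%C).
    { rewrite Cmult_comm, <- cm_scal. 2: intro t; specialize (hfc t); specialize (hwc t); cont; auto.
      replace (cm (fun t => f (RtoC rho * expi t) * ckern rho h t)%C) with
        (cm (fun t => (f (w t) + h * (f (w t) / w t)) + f (w t) * (h * h) / (w t * (w t - h)))%C).
      - rewrite cm_plus, cm_plus. change (cm (fun t => f (RtoC rho * expi t)%C)) with (cm (fun t => f (w t))). ring.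
        all: intro t; specialize (hfc t); specialize (hwc t); cont; auto. apply Cmult_neq_0; auto.
      - apply cm_ext. intro t. unfold ckern. fold (w t). field. auto. }
    rewrite e. apply cm_bound.
    + intro t; specialize (hfc t); specialize (hwc t); cont; auto. apply Cmult_neq_0; auto.
    + intros t _. rewrite Cmod_div by (apply Cmult_neq_0; auto). rewrite !Cmod_mult, hw.
      assert (hs : R0 / 4 <= Cmod (w t - h)). { generalize (circle_sub_ge rho h t ltac:(lra)). unfold w, rho in *. lra. }
      assert (hfw : Cmod (f (w t)) <= B) by (apply hB; rewrite hw; lra).
      assert (hi : / (rho * Cmod (w t - h)) <= 8 / R0 ^ 2).
      { replace (8 / R0 ^ 2) with (/ (rho * (R0 / 4))) by (unfold rho; field; lra).
        apply Rinv_le_contravar. nra. apply Rmult_le_compat_l; lra. }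
      unfold Rdiv at 1. replace (8 * B / R0 ^ 2 * Cmod h ^ 2) with (B * (Cmod h * Cmod h) * (8 / R0 ^ 2)) by (field; lra).
      apply Rmult_le_compat; auto.
      * apply Rmult_le_pos. apply Cmod_ge_0. nra.
      * left. apply Rinv_0_lt_compat. nra.
      * apply Rmult_le_compat_r; nra.
Qed.

Definition holB (a : C) (R0 : R) (f : C -> C) : Prop := forall w, Cmod (w - a) < R0 -> exists d, cder f w d.

Lemma holB_shift a R0 f : holB a R0 f -> holD R0 (fun w => f (a + w)%C).
Proof.
  intros hf w hw. destruct (hf (a + w)%C) as [d hd]. replace (a + w - a)%C with w by ring. auto.
  eexists. apply (cder_comp f (fun w => a + w)%C). apply cder_plus. apply cder_const. apply cder_id. exact hd.
Qed.

Lemma taylor_at (f : C -> C) (a : C) (R0 B : R) : 0 < R0 -> holB a R0 f -> (forall w, Cmod (w - a) < R0 -> Cmod (f w) <= B) ->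
  exists c, Cmod c <= 2 * B / R0 /\ forall w, Cmod (w - a) <= R0 / 4 -> Cmod (f w - f a - c * (w - a)) <= 8 * B / R0 ^ 2 * Cmod (w - a) ^ 2.
Proof.
  intros hR hf hB. destruct (taylor_at_0 (fun w => f (a + w)%C) R0 B hR (holB_shift _ _ _ hf)) as [c [h1 h2]].
  - intros w hw. apply hB. replace (a + w - a)%C with w by ring. auto.
  - exists c. split; auto. intros w hw. specialize (h2 (w - a)%C hw). cbv beta in h2.
    replace (a + (w - a))%C with w in h2 by ring. replace (a + RtoC 0)%C with a in h2 by ring. exact h2.
Qed.

Lemma quad_remainder_cder (f : C -> C) (a c : C) (r K : R) : 0 < r -> 0 <= K ->
  (forall w, Cmod (w - a) <= r -> Cmod (f w - f a - c * (w - a)) <= K * Cmod (w - a) ^ 2) -> cder f a c.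
Proof.
  intros hr hK h eps heps. exists (Rmin r (eps / (K + 1))). split.
  apply Rmin_pos; auto. apply Rdiv_lt_0_compat; lra.
  intros w hw. assert (w1 : Cmod (w - a) < r) by (eapply Rlt_le_trans; [exact hw|apply Rmin_l]).
  assert (w2 : Cmod (w - a) < eps / (K + 1)) by (eapply Rlt_le_trans; [exact hw|apply Rmin_r]).
  eapply Rle_trans. apply h. lra. assert (h0 := Cmod_ge_0 (w - a)). simpl. rewrite Rmult_1_r, <- Rmult_assoc.
  apply Rmult_le_compat_r; auto.
  assert (Cmod (w - a) * (K + 1) <= eps). { apply Rlt_div_r in w2; lra. } nra.
Qed.

Lemma taylor_at_der (f : C -> C) (a d : C) (R0 B : R) : 0 < R0 -> holB a R0 f -> (forall w, Cmod (w - a) < R0 -> Cmod (f w) <= B) ->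
  cder f a d -> Cmod d <= 2 * B / R0 /\ forall w, Cmod (w - a) <= R0 / 4 -> Cmod (f w - f a - d * (w - a)) <= 8 * B / R0 ^ 2 * Cmod (w - a) ^ 2.
Proof.
  intros hR hf hB hd. destruct (taylor_at f a R0 B hR hf hB) as [c [h1 h2]].
  assert (hB0 : 0 <= B). { eapply Rle_trans; [apply Cmod_ge_0|apply (hB a)]. replace (a - a)%C with (RtoC 0) by ring. rewrite Cmod_0; lra. }
  assert (0 <= 8 * B / R0 ^ 2). { apply Rdiv_le_0_compat. lra. apply pow_lt; lra. }
  assert (cder f a c) by (apply (quad_remainder_cder f a c (R0 / 4) (8 * B / R0 ^ 2)); auto; lra).
  rewrite (cder_unique f a d c); auto.
Qed.

Lemma C_cauchy_seq (c : nat -> C) :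
  (forall eps, 0 < eps -> exists N, forall n m, (N <= n)%nat -> (N <= m)%nat -> Cmod (c n - c m) <= eps) ->
  exists l, forall eps, 0 < eps -> exists N, forall n, (N <= n)%nat -> Cmod (c n - l) <= eps.
Proof.
  intros h.
  assert (H : forall p : C -> R, (forall z w, Rabs (p z - p w) <= Cmod (z - w)) -> exists l, Un_cv (fun n => p (c n)) l).
  { intros p hp. assert (hcc : Cauchy_crit (fun n => p (c n))).
    - intros eps heps. destruct (h (eps / 2)) as [N hN]. lra. exists N. intros n m hn hm.
      unfold R_dist. eapply Rle_lt_trans. apply hp. generalize (hN n m hn hm). lra.
    - destruct (Rcomplete.R_complete _ hcc) as [l hl]. exists l. exact hl. }
  destruct (H Re) as [lx hx]. intros; apply (re_le_Cmod (z - w)).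
  destruct (H Im) as [ly hy]. intros; apply (im_le_Cmod (z - w)).
  exists (lx, ly). intros eps heps.
  destruct (hx (eps / 2)) as [N1 h1]. lra. destruct (hy (eps / 2)) as [N2 h2]. lra.
  exists (N1 + N2)%nat. intros n hn. specialize (h1 n ltac:(lia)). specialize (h2 n ltac:(lia)). unfold R_dist in *.
  eapply Rle_trans. apply Cmod_le_sum.
  change (Rabs (Re (c n) - lx) + Rabs (Im (c n) - ly) <= eps). lra.
Qed.

(** Cauchy's estimate for f_n - f_m shows that the derivatives at the centre form a Cauchy sequence,
    and the quadratic Taylor remainder, with a constant independent of n, passes to the limit.
    Concluding at the centre is enough, since the centre is arbitrary. *)
Lemma weierstrass1 (fn : nat -> C -> C) (f : C -> C) (a : C) (R0 : R) : 0 < R0 ->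
  (forall n, holB a R0 (fn n)) ->
  (exists B, forall n w, Cmod (w - a) < R0 -> Cmod (fn n w) <= B) ->
  (forall eps, 0 < eps -> exists N, forall n, (N <= n)%nat -> forall w, Cmod (w - a) < R0 -> Cmod (fn n w - f w) <= eps) ->
  exists d, cder f a d.
Proof.
  intros hR hhol [B hB] hcv.
  assert (ha : Cmod (a - a) < R0) by (replace (a - a)%C with (RtoC 0) by ring; rewrite Cmod_0; lra).
  assert (hc : forall n, exists c, cder (fn n) a c) by (intro n; apply (hhol n a ha)).
  apply choice in hc. destruct hc as [c hc].
  destruct (C_cauchy_seq c) as [l hl].
  { intros eps heps. destruct (hcv (eps * R0 / 4)) as [N hN]. nra. exists N. intros n m hn hm.
    destruct (taylor_at_der (fun w => fn n w + (- RtoC 1) * fn m w)%C a (c n + (0 * fn m a + (- RtoC 1) * c m)) R0 (eps * R0 / 2) hR) as [k _].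
    - intros w hw. destruct (hhol n w hw) as [d1 e1]. destruct (hhol m w hw) as [d2 e2].
      eexists. apply cder_plus; eauto. apply (cder_mult (fun _ => - RtoC 1)%C (fn m)); eauto. apply cder_const.
    - intros w hw. replace (fn n w + (- RtoC 1) * fn m w)%C with ((fn n w - f w) - (fn m w - f w))%C.
      + eapply Rle_trans. apply Cmod_sub_le. specialize (hN n hn w hw) as q1. specialize (hN m hm w hw) as q2. lra.
      + ring.
    - apply cder_plus; auto. apply (cder_mult (fun _ => - RtoC 1)%C (fn m)); auto. apply cder_const.
    - replace (c n - c m)%C with (c n + (0 * fn m a + (- RtoC 1) * c m))%C by ring.
      eapply Rle_trans. exact k. right; field; lra. }
  exists l. assert (hB0 : 0 <= B). { eapply Rle_trans. apply Cmod_ge_0. apply (hB 0%nat a ha). }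
  apply quad_remainder_cder with (R0 / 4) (8 * B / R0 ^ 2). lra.
  { apply Rdiv_le_0_compat. lra. apply pow_lt; lra. }
  intros w hw. apply le_of_forall_eps with (2 + Cmod (w - a)). generalize (Cmod_ge_0 (w - a)); lra.
  intros e he. destruct (hcv e he) as [N1 h1]. destruct (hl e he) as [N2 h2].
  set (n := (N1 + N2)%nat). specialize (h1 n ltac:(unfold n; lia)). specialize (h2 n ltac:(unfold n; lia)).
  destruct (taylor_at_der (fn n) a (c n) R0 B hR (hhol n) (hB n) (hc n)) as [_ k]. specialize (k w hw).
  pose proof (h1 w ltac:(lra)) as q1. pose proof (h1 a ha) as q2.
  replace (f w - f a - l * (w - a))%C with ((fn n w - fn n a - c n * (w - a)) + ((fn n a - f a) - (fn n w - f w)) + (c n - l) * (w - a))%C by ring.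
  eapply Rle_trans. apply Cmod_triangle. eapply Rle_trans. apply Rplus_le_compat_r. apply Cmod_triangle.
  rewrite (Cmod_mult (c n - l)). pose proof (Cmod_sub_le (fn n a - f a) (fn n w - f w)).
  assert (Cmod (c n - l) * Cmod (w - a) <= e * Cmod (w - a)) by (apply Rmult_le_compat_r; auto using Cmod_ge_0). lra.
Qed.

(** * Holomorphic functions on the bidisc *)

Lemma Cmod_self (z : C) : Cmod (z - z) = 0.
Proof. replace (z - z)%C with (RtoC 0) by ring. apply Cmod_0. Qed.

Lemma continuous_CC_iff (F : C * C -> C) z : continuous F z <->
  forall eps, 0 < eps -> exists d, 0 < d /\ forall w, Cmod (fst w - fst z) < d -> Cmod (snd w - snd z) < d -> Cmod (F w - F z) < eps.
Proof.
  rewrite continuous_C_iff. split.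
  - intros h eps heps. apply locally_CC_iff. apply h; auto.
  - intros h eps heps. apply locally_CC_iff. apply h; auto.
Qed.

Definition hd1 (F : C * C -> C) (z : C * C) (d : C) : Prop := cder (fun w => F (w, snd z)) (fst z) d.
Definition hd2 (F : C * C -> C) (z : C * C) (d : C) : Prop := cder (fun w => F (fst z, w)) (snd z) d.

Lemma holo_D2_iff F : holo_D2 F <-> forall z, inD2 z -> continuous F z /\ (exists d, hd1 F z d) /\ (exists d, hd2 F z d).
Proof.
  unfold holo_D2. split; intros h z hz; destruct (h z hz) as [h1 [[d1 h2] [d2 h3]]]; repeat split; auto.
  - exists d1. apply is_derive_C_iff in h2. exact h2.
  - exists d2. apply is_derive_C_iff in h3. exact h3.
  - exists d1. apply is_derive_C_iff. exact h2.
  - exists d2. apply is_derive_C_iff. exact h3.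
Qed.

(** Exchange of the variables, through which statements on the second variable are deduced from
    those on the first. *)
Definition swap (z : C * C) : C * C := (snd z, fst z).

Lemma holo_swap F : holo_D2 F -> holo_D2 (fun z => F (swap z)).
Proof.
  rewrite !holo_D2_iff. intros h z [h1 h2]. destruct (h (swap z)) as [k1 [[d1 k2] [d2 k3]]]. split; auto.
  repeat split.
  - apply (continuous_comp_gen swap F); auto. unfold swap. cont.
  - exists d2. exact k3.
  - exists d1. exact k2.
Qed.

Lemma holo_holD1 F z2 : holo_D2 F -> inD z2 -> holD 1 (fun w => F (w, z2)).
Proof. rewrite holo_D2_iff. intros h h2 w hw. destruct (h (w, z2)) as [_ [k _]]. split; auto. exact k. Qed.

Lemma holo_holD2 F z1 : holo_D2 F -> inD z1 -> holD 1 (fun w => F (z1, w)).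
Proof. rewrite holo_D2_iff. intros h h2 w hw. destruct (h (z1, w)) as [_ [_ k]]. split; auto. exact k. Qed.

Lemma inD2_ball z : inD2 z -> exists r, 0 < r /\ forall w, Cmod (fst w - fst z) < r -> Cmod (snd w - snd z) < r -> inD2 w.
Proof.
  intros [h1 h2]. unfold inD in *. exists (Rmin (1 - Cmod (fst z)) (1 - Cmod (snd z))). split. apply Rmin_pos; lra.
  intros w w1 w2. split; unfold inD.
  - generalize (Cmod_triangle_inv (fst w) (fst z)) (Rmin_l (1 - Cmod (fst z)) (1 - Cmod (snd z))). lra.
  - generalize (Cmod_triangle_inv (snd w) (snd z)) (Rmin_r (1 - Cmod (fst z)) (1 - Cmod (snd z))). lra.
Qed.

Lemma holo_local_bound F z : holo_D2 F -> inD2 z -> exists r B, 0 < r /\ 0 <= B /\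
  forall w, Cmod (fst w - fst z) < r -> Cmod (snd w - snd z) < r -> inD2 w /\ Cmod (F w) <= B.
Proof.
  intros h hz. destruct (inD2_ball z hz) as [r1 [p1 k1]].
  destruct (h z hz) as [hc _]. rewrite continuous_CC_iff in hc. destruct (hc 1 Rlt_0_1) as [r2 [p2 k2]].
  exists (Rmin r1 r2), (Cmod (F z) + 1). split. apply Rmin_pos; auto. split. generalize (Cmod_ge_0 (F z)); lra.
  intros w w1 w2. split.
  - apply k1; (eapply Rlt_le_trans; [eassumption|apply Rmin_l]).
  - assert (Cmod (F w - F z) < 1) by (apply k2; (eapply Rlt_le_trans; [eassumption|apply Rmin_r])).
    generalize (Cmod_triangle_inv (F w) (F z)). lra.
Qed.

Definition diff2 (F : C * C -> C) (z : C * C) (A B : C) : Prop :=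
  forall eps, 0 < eps -> exists d, 0 < d /\ forall w, Cmod (fst w - fst z) < d -> Cmod (snd w - snd z) < d ->
    Cmod (F w - F z - A * (fst w - fst z) - B * (snd w - snd z)) <= eps * (Cmod (fst w - fst z) + Cmod (snd w - snd z)).

(** The constants are uniform over a neighbourhood of z: discs of radius r / 2 around nearby points
    stay where |F| <= B, and K collects the constants of Cauchy's estimates. This uniformity gives
    both the holomorphy of the partial derivative and joint differentiability. *)
Lemma holo_local_taylor1 F z : holo_D2 F -> inD2 z -> exists r B, 0 < r /\ 0 <= B /\
  (forall w, Cmod (fst w - fst z) < r -> Cmod (snd w - snd z) < r -> inD2 w /\ Cmod (F w) <= B) /\
  forall w v d, Cmod (fst w - fst z) < r -> Cmod (snd w - snd z) < r -> hd1 F w d -> Cmod (v - fst w) <= r ->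
    Cmod d <= B /\ Cmod (F (v, snd w) - F w - d * (v - fst w)) <= B * Cmod (v - fst w) ^ 2.
Proof.
  intros h hz. destruct (holo_local_bound F z h hz) as [r [B [p [hB k]]]].
  set (r' := r / 8). assert (hr' : 0 < r') by (unfold r'; lra).
  set (K := B + 2 * B / (r / 2) + 8 * B / (r / 2) ^ 2).
  assert (q1 : 0 <= 2 * B / (r / 2)) by (apply Rdiv_le_0_compat; lra).
  assert (q2 : 0 <= 8 * B / (r / 2) ^ 2) by (apply Rdiv_le_0_compat; [lra|apply pow_lt; lra]).
  exists r', K. repeat split; auto; try (unfold K; lra).
  - apply k; unfold r' in *; lra.
  - apply k; unfold r' in *; lra.
  - eapply Rle_trans. apply k; unfold r' in *; lra. unfold K; lra.
  - destruct (taylor_at_der (fun v => F (v, snd w)) (fst w) d (r / 2) B ltac:(lra)) as [t1 t2]; auto.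
    + intros v' hv'. apply (holo_holD1 F (snd w) h). apply k; unfold r' in *; lra.
      apply (k (v', snd w)); simpl. generalize (Cmod_sub_triangle v' (fst w) (fst z)). unfold r' in *; lra. unfold r' in *; lra.
    + intros v' hv'. apply (k (v', snd w)); simpl. generalize (Cmod_sub_triangle v' (fst w) (fst z)). unfold r' in *; lra. unfold r' in *; lra.
    + unfold K; lra.
  - destruct (taylor_at_der (fun v => F (v, snd w)) (fst w) d (r / 2) B ltac:(lra)) as [t1 t2]; auto.
    + intros v' hv'. apply (holo_holD1 F (snd w) h). apply k; unfold r' in *; lra.
      apply (k (v', snd w)); simpl. generalize (Cmod_sub_triangle v' (fst w) (fst z)). unfold r' in *; lra. unfold r' in *; lra.
    + intros v' hv'. apply (k (v', snd w)); simpl. generalize (Cmod_sub_triangle v' (fst w) (fst z)). unfold r' in *; lra. unfold r' in *; lra.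
    + specialize (t2 v ltac:(unfold r' in *; lra)). cbv beta in t2. rewrite <- surjective_pairing in t2.
      eapply Rle_trans. exact t2. apply Rmult_le_compat_r. apply pow2_ge_0. unfold K; lra.
Qed.

(** F1 is locally the uniform limit of the difference quotients with real steps [hn n], the error
    being B [hn n] by the Taylor remainder. The quotients are continuous and holomorphic in each
    variable, so continuity passes to the limit and [weierstrass1] applies in each variable. *)
Lemma holo_partial1 F F1 : holo_D2 F -> (forall z, inD2 z -> hd1 F z (F1 z)) -> holo_D2 F1.
Proof.
  intros h h1. apply holo_D2_iff. intros z hz.
  destruct (holo_local_taylor1 F z h hz) as [r [B [hr [hB [k1 k2]]]]].
  set (hn := fun n : nat => r / 2 / (INR n + 1)).
  assert (hn0 : forall n, 0 < hn n <= r / 2).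
  { intro n. pose proof (pos_INR n). unfold hn. split. apply Rdiv_lt_0_compat; lra. apply Rle_div_l. lra. nra. }
  assert (hnl : forall eps, 0 < eps -> exists N, forall n, (N <= n)%nat -> hn n <= eps).
  { intros eps heps. destruct (INR_unbounded (r / 2 / eps)) as [N hN]. exists N. intros n hnn.
    apply le_INR in hnn. unfold hn. pose proof (pos_INR n). apply Rle_div_l. lra.
    apply Rlt_div_l in hN; [|lra]. nra. }
  set (r2 := r / 2). assert (hr2 : 0 < r2) by (unfold r2; lra).
  set (fn := fun n (w : C * C) => (RtoC (/ hn n) * (F ((fst w + RtoC (hn n))%C, snd w) + - RtoC 1 * F w))%C).
  assert (near : forall w, Cmod (fst w - fst z) < r2 -> Cmod (snd w - snd z) < r2 -> inD2 w).
  { intros w a b. apply k1; unfold r2 in *; lra. }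
  assert (near2 : forall n w, Cmod (fst w - fst z) < r2 -> Cmod (snd w - snd z) < r2 -> inD2 ((fst w + RtoC (hn n))%C, snd w)).
  { intros n w a b. apply k1; simpl.
    replace (fst w + RtoC (hn n) - fst z)%C with ((fst w - fst z) + RtoC (hn n))%C by ring.
    eapply Rle_lt_trans. apply Cmod_triangle. specialize (hn0 n). rewrite Cmod_RtoC_pos by lra. unfold r2 in *; lra. unfold r2 in *; lra. }
  assert (est : forall n w, Cmod (fst w - fst z) < r2 -> Cmod (snd w - snd z) < r2 -> Cmod (fn n w - F1 w) <= B * hn n /\ Cmod (F1 w) <= B).
  { intros n w a b. specialize (hn0 n).
    destruct (k2 w (fst w + RtoC (hn n))%C (F1 w)) as [q1 q2]; auto; try (unfold r2 in *; lra).
    replace (fst w + RtoC (hn n) - fst w)%C with (RtoC (hn n)) by ring. rewrite Cmod_RtoC_pos; lra.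
    replace (fst w + RtoC (hn n) - fst w)%C with (RtoC (hn n)) in q2 by ring. split; auto.
    assert (e : (fn n w - F1 w)%C = (RtoC (/ hn n) * (F ((fst w + RtoC (hn n))%C, snd w) - F w - F1 w * RtoC (hn n)))%C).
    { unfold fn. rewrite RtoC_inv by lra. field. intro e; apply RtoC_inj in e; lra. }
    rewrite e, Cmod_mult, Cmod_RtoC_pos by (left; apply Rinv_0_lt_compat; lra).
    rewrite Cmod_RtoC_pos in q2 by lra.
    apply Rmult_le_reg_l with (hn n). lra. rewrite <- Rmult_assoc, Rinv_r, Rmult_1_l by lra.
    eapply Rle_trans. exact q2. right; ring. }
  assert (bnd : forall n w, Cmod (fst w - fst z) < r2 -> Cmod (snd w - snd z) < r2 -> Cmod (fn n w) <= B * r + B).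
  { intros n w a b. destruct (est n w a b) as [q1 q2]. specialize (hn0 n).
    generalize (Cmod_triangle_inv (fn n w) (F1 w)). nra. }
  assert (cvg : forall eps, 0 < eps -> exists N, forall n, (N <= n)%nat -> forall w, Cmod (fst w - fst z) < r2 -> Cmod (snd w - snd z) < r2 -> Cmod (fn n w - F1 w) <= eps).
  { intros eps heps. destruct (hnl (eps / (B + 1))) as [N hN]. apply Rdiv_lt_0_compat; lra.
    exists N. intros n hnn w a b. destruct (est n w a b) as [q1 _]. specialize (hN n hnn).
    apply Rle_div_r in hN; [|lra]. specialize (hn0 n). nra. }
  pose proof (proj1 (holo_D2_iff F) h) as hF.
  assert (fc : forall n w, Cmod (fst w - fst z) < r2 -> Cmod (snd w - snd z) < r2 -> continuous (fn n) w).
  { intros n w a b. destruct (hF w (near w a b)) as [c1 _]. destruct (hF _ (near2 n w a b)) as [c2 _].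
    assert (c3 : continuous (fun w => F ((fst w + RtoC (hn n))%C, snd w)) w).
    { apply (continuous_comp_gen (fun w => ((fst w + RtoC (hn n))%C, snd w)) F); auto. cont. }
    unfold fn. cont. }
  split; [|split].
  - apply continuous_CC_iff. intros eps heps.
    destruct (cvg (eps / 4)) as [N hN]. lra. specialize (hN N (le_n _)).
    assert (fcz := fc N z ltac:(rewrite Cmod_self; auto) ltac:(rewrite Cmod_self; auto)).
    rewrite continuous_CC_iff in fcz. destruct (fcz (eps / 2)) as [d [hd kd]]. lra.
    exists (Rmin d r2). split. apply Rmin_pos; auto. intros w a b.
    assert (a1 := Rlt_le_trans _ _ _ a (Rmin_l _ _)). assert (a2 := Rlt_le_trans _ _ _ a (Rmin_r _ _)).
    assert (b1 := Rlt_le_trans _ _ _ b (Rmin_l _ _)). assert (b2 := Rlt_le_trans _ _ _ b (Rmin_r _ _)).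
    specialize (kd w a1 b1). pose proof (hN w a2 b2) as e1. pose proof (hN z ltac:(rewrite Cmod_self; auto) ltac:(rewrite Cmod_self; auto)) as e2.
    replace (F1 w - F1 z)%C with ((fn N w - fn N z) + ((fn N z - F1 z) - (fn N w - F1 w)))%C by ring.
    eapply Rle_lt_trans. apply Cmod_triangle. generalize (Cmod_sub_le (fn N z - F1 z) (fn N w - F1 w)). lra.
  - apply weierstrass1 with (fn := fun n w => fn n (w, snd z)) (R0 := r2); auto.
    + intros n w hw.
      destruct (hF (w, snd z)) as [_ [[d1 c1] _]]. apply near; auto. simpl; rewrite Cmod_self; auto.
      destruct (hF ((w + RtoC (hn n))%C, snd z)) as [_ [[d2 c2] _]]. apply (near2 n (w, snd z)); auto. simpl; rewrite Cmod_self; auto.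
      unfold hd1 in c1, c2; simpl in c1, c2.
      eexists. unfold fn; simpl. apply cder_mult. apply cder_const. apply cder_plus.
      apply (cder_comp (fun v => F (v, snd z)) (fun w => w + RtoC (hn n))%C). apply cder_plus. apply cder_id. apply cder_const. exact c2.
      apply (cder_mult (fun _ => - RtoC 1)%C (fun w => F (w, snd z))). apply cder_const. exact c1.
    + exists (B * r + B). intros n w hw. apply bnd; auto. simpl; rewrite Cmod_self; auto.
    + intros eps heps. destruct (cvg eps heps) as [N hN]. exists N. intros n hnn w hw. apply hN; auto. simpl; rewrite Cmod_self; auto.
  - apply weierstrass1 with (fn := fun n w => fn n (fst z, w)) (R0 := r2); auto.
    + intros n w hw.
      destruct (hF (fst z, w)) as [_ [_ [d1 c1]]]. apply near; auto. simpl; rewrite Cmod_self; auto.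
      destruct (hF ((fst z + RtoC (hn n))%C, w)) as [_ [_ [d2 c2]]]. apply (near2 n (fst z, w)); auto. simpl; rewrite Cmod_self; auto.
      unfold hd2 in c1, c2; simpl in c1, c2.
      eexists. unfold fn; simpl. apply cder_mult. apply cder_const. apply cder_plus. exact c2.
      apply (cder_mult (fun _ => - RtoC 1)%C (fun w => F (fst z, w))). apply cder_const. exact c1.
    + exists (B * r + B). intros n w hw. apply bnd; auto. simpl; rewrite Cmod_self; auto.
    + intros eps heps. destruct (cvg eps heps) as [N hN]. exists N. intros n hnn w hw. apply hN; auto. simpl; rewrite Cmod_self; auto.
Qed.

Lemma holo_partial2 F F2 : holo_D2 F -> (forall z, inD2 z -> hd2 F z (F2 z)) -> holo_D2 F2.
Proof.
  intros h h1. assert (k : holo_D2 (fun z => F2 (swap z))).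
  { apply holo_partial1 with (fun z => F (swap z)). apply holo_swap; auto.
    intros z [z1 z2]. apply (h1 (swap z)). split; auto. }
  apply holo_swap in k. replace F2 with (fun z => F2 (swap (swap z))). exact k.
  apply functional_extensionality. intros [a b]; reflexivity.
Qed.

Lemma holo_exists_partials F : holo_D2 F -> exists F1 F2, holo_D2 F1 /\ holo_D2 F2 /\
  (forall z, inD2 z -> hd1 F z (F1 z)) /\ (forall z, inD2 z -> hd2 F z (F2 z)).
Proof.
  intros h. pose proof (proj1 (holo_D2_iff F) h) as hF.
  assert (e1 : forall z, exists d, inD2 z -> hd1 F z d).
  { intro z. destruct (classic (inD2 z)) as [hz|hz]. destruct (hF z hz) as [_ [[d k] _]]. exists d; auto. exists (RtoC 0); tauto. }
  assert (e2 : forall z, exists d, inD2 z -> hd2 F z d).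
  { intro z. destruct (classic (inD2 z)) as [hz|hz]. destruct (hF z hz) as [_ [_ [d k]]]. exists d; auto. exists (RtoC 0); tauto. }
  apply choice in e1. apply choice in e2. destruct e1 as [F1 e1]. destruct e2 as [F2 e2].
  exists F1, F2. split; [apply (holo_partial1 F); auto|]. split; [apply (holo_partial2 F); auto|]. auto.
Qed.

(** Passing through w' = (z_1, w_2): the increment in the first variable is expanded at w', where F1
    is close to F1 z because F1 is continuous; the increment in the second variable uses only the
    derivative at z itself. *)
Lemma holo_diff2 F F1 F2 z : holo_D2 F -> (forall z, inD2 z -> hd1 F z (F1 z)) -> hd2 F z F2 -> inD2 z -> diff2 F z (F1 z) F2.
Proof.
  intros h h1 h2 hz eps heps.
  destruct (holo_local_taylor1 F z h hz) as [r [B [hr [hB [k1 k2]]]]].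
  assert (hc : continuous F1 z) by (apply (holo_partial1 F F1 h h1 z hz)).
  rewrite continuous_CC_iff in hc. destruct (hc (eps / 2)) as [d1 [p1 q1]]. lra.
  destruct (h2 (eps / 2)) as [d2 [p2 q2]]. lra.
  assert (p3 : 0 < eps / (2 * (B + 1))) by (apply Rdiv_lt_0_compat; lra).
  exists (Rmin (Rmin d1 d2) (Rmin r (eps / (2 * (B + 1))))). split. repeat apply Rmin_pos; auto.
  intros w a b.
  assert (a' := a). assert (b' := b).
  apply Rmin_Rgt in a. destruct a as [a1 a2]. apply Rmin_Rgt in a1. apply Rmin_Rgt in a2.
  apply Rmin_Rgt in b. destruct b as [b1 b2]. apply Rmin_Rgt in b1. apply Rmin_Rgt in b2.
  set (w' := (fst z, snd w)).
  assert (hw1 : Cmod (fst w' - fst z) < Rmin r d1) by (simpl; rewrite Cmod_self; apply Rmin_pos; auto).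
  apply Rmin_Rgt in hw1.
  assert (hw' : inD2 w'). { apply k1; simpl; try rewrite Cmod_self; lra. }
  destruct (k2 w' (fst w) (F1 w')) as [_ t]; simpl; try rewrite Cmod_self; try lra. { apply h1; auto. }
  simpl in t. rewrite <- surjective_pairing in t.
  specialize (q2 (snd w) ltac:(lra)). cbv beta in q2. rewrite <- surjective_pairing in q2.
  specialize (q1 w' (proj2 hw1) (proj1 b1)).
  fold w' in q2. fold w' in t.
  replace (F w - F z - F1 z * (fst w - fst z) - F2 * (snd w - snd z))%C with
    ((F w - F w' - F1 w' * (fst w - fst z)) + (F1 w' - F1 z) * (fst w - fst z) + (F w' - F z - F2 * (snd w - snd z)))%C by ring.
  eapply Rle_trans. apply Cmod_triangle. eapply Rle_trans. apply Rplus_le_compat_r. apply Cmod_triangle. rewrite (Cmod_mult (F1 w' - F1 z)).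
  set (u := Cmod (fst w - fst z)) in *. assert (hu : 0 <= u) by apply Cmod_ge_0.
  assert (u * (2 * (B + 1)) < eps). { destruct a2 as [_ a2]. apply Rgt_lt in a2. apply Rlt_div_r in a2; lra. }
  assert (Cmod (F1 w' - F1 z) * u <= eps / 2 * u) by (apply Rmult_le_compat_r; lra).
  assert (hBu : B * u <= eps / 2) by nra.
  assert (t' : B * (u * (u * 1)) <= eps / 2 * u).
  { replace (B * (u * (u * 1))) with (B * u * u) by ring. apply Rmult_le_compat_r; auto. }
  assert (0 <= eps * Cmod (snd w - snd z)) by (apply Rmult_le_pos; [lra|apply Cmod_ge_0]).
  rewrite Rmult_plus_distr_l. lra.
Qed.

(** The chain rule for an abstract gauge u, so that one proof covers complex parameters, u = |w -
    a|, and real ones, u = |s - t|. *)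
Lemma littleo_comp2 {T : Type} (u : T -> R) (F : C * C -> C) (g1 g2 L1 L2 : T -> C) (t0 : T) (A B : C) (M : R) :
  (forall t, 0 <= u t) -> (forall t, Cmod (L1 t) <= M * u t) -> (forall t, Cmod (L2 t) <= M * u t) -> 0 <= M ->
  (forall eps, 0 < eps -> exists d, 0 < d /\ forall t, u t < d -> Cmod (g1 t - g1 t0 - L1 t) <= eps * u t) ->
  (forall eps, 0 < eps -> exists d, 0 < d /\ forall t, u t < d -> Cmod (g2 t - g2 t0 - L2 t) <= eps * u t) ->
  diff2 F (g1 t0, g2 t0) A B ->
  (forall eps, 0 < eps -> exists d, 0 < d /\ forall t, u t < d ->
     Cmod (F (g1 t, g2 t) - F (g1 t0, g2 t0) - (A * L1 t + B * L2 t)) <= eps * u t).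
Proof.
  intros hu hL1 hL2 hM h1 h2 hF eps heps.
  set (N := Cmod A + Cmod B + 1).
  assert (hA := Cmod_ge_0 A). assert (hB := Cmod_ge_0 B).
  assert (p1 : 0 < eps / (4 * (M + 1))) by (apply Rdiv_lt_0_compat; lra).
  destruct (hF _ p1) as [d [hd k]].
  assert (p2 : 0 < Rmin 1 (eps / (2 * N))) by (apply Rmin_pos; [lra|apply Rdiv_lt_0_compat; unfold N; lra]).
  destruct (h1 _ p2) as [d1 [q1 r1]]. destruct (h2 _ p2) as [d2 [q2 r2]].
  set (e := Rmin 1 (eps / (2 * N))) in *.
  assert (he1 : e <= 1) by apply Rmin_l. assert (he2 : e <= eps / (2 * N)) by apply Rmin_r.
  exists (Rmin (Rmin d1 d2) (d / (M + 1))). split. repeat apply Rmin_pos; auto. apply Rdiv_lt_0_compat; lra.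
  intros t ht. apply Rmin_Rgt in ht. destruct ht as [ht1 ht2]. apply Rmin_Rgt in ht1. destruct ht1 as [ht1 ht3].
  specialize (r1 t ht1). specialize (r2 t ht3). specialize (hu t). specialize (hL1 t). specialize (hL2 t).
  apply Rgt_lt in ht2. apply Rlt_div_r in ht2; [|lra].
  assert (g1b : Cmod (g1 t - g1 t0) <= (M + 1) * u t) by (generalize (Cmod_triangle_inv (g1 t - g1 t0) (L1 t)); nra).
  assert (g2b : Cmod (g2 t - g2 t0) <= (M + 1) * u t) by (generalize (Cmod_triangle_inv (g2 t - g2 t0) (L2 t)); nra).
  specialize (k (g1 t, g2 t) ltac:(simpl; nra) ltac:(simpl; nra)). simpl in k.
  replace (F (g1 t, g2 t) - F (g1 t0, g2 t0) - (A * L1 t + B * L2 t))%C with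
    ((F (g1 t, g2 t) - F (g1 t0, g2 t0) - A * (g1 t - g1 t0) - B * (g2 t - g2 t0)) + (A * (g1 t - g1 t0 - L1 t) + B * (g2 t - g2 t0 - L2 t)))%C by ring.
  eapply Rle_trans. apply Cmod_triangle.
  assert (X : Cmod (A * (g1 t - g1 t0 - L1 t) + B * (g2 t - g2 t0 - L2 t)) <= eps / 2 * u t).
  { eapply Rle_trans. apply Cmod_triangle. rewrite !Cmod_mult.
    assert (Cmod A * Cmod (g1 t - g1 t0 - L1 t) <= Cmod A * (e * u t)) by (apply Rmult_le_compat_l; lra).
    assert (Cmod B * Cmod (g2 t - g2 t0 - L2 t) <= Cmod B * (e * u t)) by (apply Rmult_le_compat_l; lra).
    apply Rle_trans with (N * (eps / (2 * N) * u t)).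
    - apply Rle_trans with (N * (e * u t)). unfold N. assert (0 <= e * u t) by (apply Rmult_le_pos; lra). nra.
      apply Rmult_le_compat_l. unfold N; lra. apply Rmult_le_compat_r; lra.
    - right. field. unfold N; lra. }
  assert (Y : eps / (4 * (M + 1)) * (Cmod (g1 t - g1 t0) + Cmod (g2 t - g2 t0)) <= eps / 2 * u t).
  { apply Rle_trans with (eps / (4 * (M + 1)) * (2 * ((M + 1) * u t))). apply Rmult_le_compat_l; lra. right; field; lra. }
  lra.
Qed.

Lemma cder_comp2 F g1 g2 a A B a1 a2 : diff2 F (g1 a, g2 a) A B -> cder g1 a a1 -> cder g2 a a2 ->
  cder (fun w => F (g1 w, g2 w)) a (A * a1 + B * a2)%C.
Proof.
  intros hF h1 h2 eps heps.
  destruct (littleo_comp2 (fun w => Cmod (w - a)) F g1 g2 (fun w => a1 * (w - a))%C (fun w => a2 * (w - a))%C a A B (Cmod a1 + Cmod a2)) with (eps := eps) as [d [hd k]]; auto.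
  - intros; apply Cmod_ge_0.
  - intros t. rewrite Cmod_mult. generalize (Cmod_ge_0 a2) (Cmod_ge_0 (t - a)). nra.
  - intros t. rewrite Cmod_mult. generalize (Cmod_ge_0 a1) (Cmod_ge_0 (t - a)). nra.
  - generalize (Cmod_ge_0 a1) (Cmod_ge_0 a2). lra.
  - exists d. split; auto. intros w hw. specialize (k w hw).
    replace ((A * a1 + B * a2) * (w - a))%C with (A * (a1 * (w - a)) + B * (a2 * (w - a)))%C by ring. exact k.
Qed.

Lemma rderC_comp2 F g1 g2 t A B a1 a2 : diff2 F (g1 t, g2 t) A B -> rderC g1 t a1 -> rderC g2 t a2 ->
  rderC (fun s => F (g1 s, g2 s)) t (A * a1 + B * a2)%C.
Proof.
  rewrite !rderC_iff. intros hF h1 h2 eps heps.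
  destruct (littleo_comp2 (fun s => Rabs (s - t)) F g1 g2 (fun s => a1 * RtoC (s - t))%C (fun s => a2 * RtoC (s - t))%C t A B (Cmod a1 + Cmod a2)) with (eps := eps) as [d [hd k]]; auto.
  - intros; apply Rabs_pos.
  - intros s. rewrite Cmod_mult, Cmod_R. generalize (Cmod_ge_0 a2) (Rabs_pos (s - t)). nra.
  - intros s. rewrite Cmod_mult, Cmod_R. generalize (Cmod_ge_0 a1) (Rabs_pos (s - t)). nra.
  - generalize (Cmod_ge_0 a1) (Cmod_ge_0 a2). lra.
  - exists d. split; auto. intros w hw. specialize (k w hw).
    replace ((A * a1 + B * a2) * RtoC (w - t))%C with (A * (a1 * RtoC (w - t)) + B * (a2 * RtoC (w - t)))%C by ring. exact k.
Qed.

Lemma holo_comp (f : C * C -> C) (phi : C * C -> C * C) :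
  holo_D2 (fun z => fst (phi z)) -> holo_D2 (fun z => snd (phi z)) -> (forall z, inD2 z -> inD2 (phi z)) ->
  holo_D2 f -> holo_D2 (fun z => f (phi z)).
Proof.
  intros h1 h2 hm hf. destruct (holo_exists_partials f hf) as [f1 [f2 [_ [_ [e1 e2]]]]].
  rewrite holo_D2_iff in h1, h2 |- *. intros z hz.
  destruct (h1 z hz) as [c1 [[a1 p1] [b1 q1]]]. destruct (h2 z hz) as [c2 [[a2 p2] [b2 q2]]].
  assert (hd := holo_diff2 f f1 (f2 (phi z)) (phi z) hf e1 (e2 _ (hm z hz)) (hm z hz)).
  split; [|split].
  - apply (continuous_comp_gen phi f). 2: apply hf; auto.
    apply continuous_ext with (fun z => (fst (phi z), snd (phi z))). { intros x. destruct (phi x); reflexivity. }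
    apply continuous_pair; auto.
  - eexists. unfold hd1.
    replace (fun w => f (phi (w, snd z))) with (fun w => f (fst (phi (w, snd z)), snd (phi (w, snd z)))).
    2: { apply functional_extensionality. intro w. destruct (phi (w, snd z)); reflexivity. }
    apply (cder_comp2 f (fun w => fst (phi (w, snd z))) (fun w => snd (phi (w, snd z)))).
    + rewrite <- !surjective_pairing. exact hd.
    + exact p1.
    + exact p2.
  - eexists. unfold hd2.
    replace (fun w => f (phi (fst z, w))) with (fun w => f (fst (phi (fst z, w)), snd (phi (fst z, w)))).
    2: { apply functional_extensionality. intro w. destruct (phi (fst z, w)); reflexivity. }
    apply (cder_comp2 f (fun w => fst (phi (fst z, w))) (fun w => snd (phi (fst z, w)))).
    + rewrite <- !surjective_pairing. exact hd.
    + exact q1.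
    + exact q2.
Qed.

(** * Integrals over tori and the composition estimate *)

Definition tor (r t1 t2 : R) : C * C := ((RtoC r * expi t1)%C, (RtoC r * expi t2)%C).

Lemma tor_inD2 r t1 t2 : 0 <= r < 1 -> inD2 (tor r t1 t2).
Proof. intros h. split; unfold inD, tor; simpl; rewrite Cmod_mult, Cmod_expi, Cmod_RtoC_pos; lra. Qed.

Lemma tor_continuous r (p : R * R) : continuous (fun p : R * R => tor r (fst p) (snd p)) p.
Proof. unfold tor. cont. Qed.

Definition dens (f : C * C -> C) (r t1 t2 : R) : R := Cmod (f (tor r t1 t2)) ^ 2.

Definition cont2 (h : R -> R -> R) : Prop := forall p : R * R, continuous (fun p : R * R => h (fst p) (snd p)) p.

Lemma cont2_slice h x : cont2 h -> forall t, continuous (h x) t.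
Proof. intros hc t. apply continuous_slice. apply (hc (x, t)). Qed.

Lemma cont2_slice1 h y : cont2 h -> forall t, continuous (fun x => h x y) t.
Proof. intros hc t. apply (continuous_slice1 h t y). apply (hc (t, y)). Qed.

Lemma cont2_RInt h a b : a <= b -> cont2 h -> forall t, continuous (fun x => RInt (h x) a b) t.
Proof. intros hab hc t. apply continuous_RInt_param; auto. Qed.

Lemma cont2_swap h : cont2 h -> cont2 (fun x y => h y x).
Proof.
  intros hc p. apply (continuous_comp_gen (fun p : R * R => (snd p, fst p)) (fun p : R * R => h (fst p) (snd p))).
  cont. apply hc.
Qed.

Lemma holo_tor_continuous f r (p : R * R) : holo_D2 f -> 0 <= r < 1 -> continuous (fun p : R * R => f (tor r (fst p) (snd p))) p.
Proof.
  intros hf hr. apply (continuous_comp_gen (fun p : R * R => tor r (fst p) (snd p)) f).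
  apply tor_continuous. apply hf. apply tor_inD2; auto.
Qed.

Lemma dens_cont2 f r : holo_D2 f -> 0 <= r < 1 -> cont2 (dens f r).
Proof. intros hf hr p. unfold dens. pose proof (holo_tor_continuous f r p hf hr). cont. Qed.

Definition dbl (h : R -> R -> R) : R := RInt (fun t1 => RInt (h t1) 0 (2 * PI)) 0 (2 * PI).

Lemma circ_int_dbl f r : circ_int f r = dbl (dens f r) / (4 * PI ^ 2).
Proof. reflexivity. Qed.

Lemma fourPI2_pos : 0 < 4 * PI ^ 2.
Proof. generalize PI_RGT_0; intros; nra. Qed.

Lemma PI2_ge0 : 0 <= 2 * PI.
Proof. generalize PI2_pos; lra. Qed.

Lemma dbl_le g h : cont2 g -> cont2 h -> (forall t1 t2, g t1 t2 <= h t1 t2) -> dbl g <= dbl h.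
Proof.
  intros hg hh hle. pose proof PI2_ge0. apply RInt_le_cont; [apply cont2_RInt; auto|apply cont2_RInt; auto|auto|].
  intros x _. apply RInt_le_cont; [apply cont2_slice; auto|apply cont2_slice; auto|auto|auto].
Qed.

Lemma dbl_le_square g h : cont2 g -> cont2 h -> (forall t1 t2, 0 <= t1 <= 2 * PI -> 0 <= t2 <= 2 * PI -> g t1 t2 <= h t1 t2) -> dbl g <= dbl h.
Proof.
  intros hg hh hle. pose proof PI2_ge0. apply RInt_le_cont; [apply cont2_RInt; auto|apply cont2_RInt; auto|auto|].
  intros x hx. apply RInt_le_cont; [apply cont2_slice; auto|apply cont2_slice; auto|auto|auto].
Qed.

Lemma cont2_plus g h : cont2 g -> cont2 h -> cont2 (fun x y => g x y + h x y).
Proof. intros hg hh p. apply continuous_Rplus; [apply hg|apply hh]. Qed.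

Lemma cont2_scal k h : cont2 h -> cont2 (fun x y => k * h x y).
Proof. intros hh p. apply continuous_Rmult; [apply continuous_const|apply hh]. Qed.

Lemma dbl_plus g h : cont2 g -> cont2 h -> dbl (fun x y => g x y + h x y) = dbl g + dbl h.
Proof.
  intros hg hh. pose proof PI2_ge0. unfold dbl. rewrite <- RInt_plus_cont; try (apply cont2_RInt; auto).
  apply RInt_ext_all. intro x. apply RInt_plus_cont; apply cont2_slice; auto.
Qed.

Lemma dbl_scal h k : cont2 h -> dbl (fun x y => k * h x y) = k * dbl h.
Proof.
  intros hh. pose proof PI2_ge0. unfold dbl. rewrite <- RInt_scal_cont; try (apply cont2_RInt; auto).
  apply RInt_ext_all. intro x. apply RInt_scal_cont; apply cont2_slice; auto.
Qed.

Lemma dbl_const c : dbl (fun _ _ => c) = c * (4 * PI ^ 2).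
Proof.
  unfold dbl. rewrite (RInt_ext_all _ (fun _ => c * (2 * PI - 0))). 2: intro; apply RInt_const_R.
  rewrite RInt_const_R. ring.
Qed.

Lemma dbl_swap h : cont2 h -> dbl h = RInt (fun t2 => RInt (fun t1 => h t1 t2) 0 (2 * PI)) 0 (2 * PI).
Proof. intros hh. exact (RInt_swap h 0 (2 * PI) 0 (2 * PI) PI2_ge0 (fun x y => hh (x, y))). Qed.

Lemma dbl_ge0 h : cont2 h -> (forall x y, 0 <= h x y) -> 0 <= dbl h.
Proof.
  intros hh h0. replace 0 with (dbl (fun _ _ => 0)). apply dbl_le; auto. intro p; apply continuous_const.
  rewrite dbl_const. ring.
Qed.

Lemma cont2_const c : cont2 (fun _ _ => c).
Proof. intro p; apply continuous_const. Qed.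

Lemma circ_int_ge0 f r : holo_D2 f -> 0 <= r < 1 -> 0 <= circ_int f r.
Proof.
  intros hf hr. rewrite circ_int_dbl. apply Rdiv_le_0_compat; [|apply fourPI2_pos].
  apply dbl_ge0. apply dens_cont2; auto. intros; apply pow2_ge_0.
Qed.

Lemma circ_int_le_const f r M : holo_D2 f -> 0 <= r < 1 -> (forall t1 t2, dens f r t1 t2 <= M) -> circ_int f r <= M.
Proof.
  intros hf hr h. rewrite circ_int_dbl. apply Rle_div_l. apply fourPI2_pos. rewrite <- dbl_const.
  apply dbl_le; auto. apply dens_cont2; auto. apply cont2_const.
Qed.

Lemma Cmod_plus_sq (a b : C) : Cmod (a + b) ^ 2 <= 2 * Cmod a ^ 2 + 2 * Cmod b ^ 2.
Proof.
  pose proof (Cmod_triangle a b) as h. generalize (Cmod_ge_0 (a + b)) (Cmod_ge_0 a) (Cmod_ge_0 b). intros.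
  apply Rle_trans with ((Cmod a + Cmod b) ^ 2). apply pow_incr; auto.
  generalize (pow2_ge_0 (Cmod a - Cmod b)). lra.
Qed.

Lemma circ_int_plus f g k r : holo_D2 f -> holo_D2 g -> holo_D2 k -> 0 <= r < 1 ->
  (forall z, inD2 z -> k z = (f z + g z)%C) -> circ_int k r <= 2 * circ_int f r + 2 * circ_int g r.
Proof.
  intros hf hg hk hr e. rewrite !circ_int_dbl.
  apply Rle_trans with (dbl (fun x y => 2 * dens f r x y + 2 * dens g r x y) / (4 * PI ^ 2)).
  - apply Rmult_le_compat_r. left; apply Rinv_0_lt_compat, fourPI2_pos.
    pose proof (dens_cont2 f r hf hr) as cf. pose proof (dens_cont2 g r hg hr) as cg.
    apply dbl_le. apply dens_cont2; auto.
    + intro p. specialize (cf p). specialize (cg p). cont.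
    + intros x y. unfold dens. rewrite e by (apply tor_inD2; auto). apply Cmod_plus_sq.
  - pose proof (dens_cont2 f r hf hr) as cf. pose proof (dens_cont2 g r hg hr) as cg.
    assert (cf2 : cont2 (fun x y => 2 * dens f r x y)) by (intro p; specialize (cf p); cont).
    assert (cg2 : cont2 (fun x y => 2 * dens g r x y)) by (intro p; specialize (cg p); cont).
    rewrite (dbl_plus _ _ cf2 cg2), (dbl_scal _ 2 cf), (dbl_scal _ 2 cg).
    right; field; apply PI_neq0.
Qed.

(** Subharmonicity of |f|^2 is used in one variable after the other, which gives an iterated Poisson
    integral over the torus of radius R0. *)
Lemma bidisc_poisson f R0 z : holo_D2 f -> 0 < R0 < 1 -> Cmod (fst z) < R0 -> Cmod (snd z) < R0 ->
  Cmod (f z) ^ 2 <= RInt (fun t1 => poi R0 (fst z) t1 * RInt (fun t2 => poi R0 (snd z) t2 * dens f R0 t1 t2) 0 (2 * PI)) 0 (2 * PI) / (4 * PI ^ 2).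
Proof.
  intros hf hR h1 h2. pose proof PI2_pos as hp.
  pose proof (dens_cont2 f R0 hf ltac:(lra)) as hd.
  assert (hpc : forall z t, Cmod z < R0 -> continuous (poi R0 z) t) by (intros; apply poi_continuous; lra).
  pose proof (subharmonic_sq (fun w => f (w, snd z)) 1 R0 (fst z) (holo_holD1 f (snd z) hf ltac:(unfold inD; lra)) hR h1) as k.
  cbv beta in k. rewrite <- surjective_pairing in k.
  eapply Rle_trans. exact k. clear k.
  match goal with |- _ <= ?X / _ => replace (X / (4 * PI ^ 2)) with (/ (2 * PI) * X / (2 * PI)) by (field; apply PI_neq0) end.
  apply Rmult_le_compat_r. left; apply Rinv_0_lt_compat; auto.
  rewrite <- RInt_scal_cont.
  - assert (hc2 : forall t1, inD (RtoC R0 * expi t1)) by (intro; unfold inD; rewrite Cmod_mult, Cmod_expi, Cmod_RtoC_pos; lra).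
    apply RInt_le_cont; try lra.
    + intro t. pose proof (hpc (fst z) t h1).
      assert (continuous (fun t1 => f ((RtoC R0 * expi t1)%C, snd z)) t).
      { apply (continuous_comp_gen (fun t1 => ((RtoC R0 * expi t1)%C, snd z)) f). cont.
        apply hf. split; simpl. apply hc2. unfold inD; lra. }
      cont.
    + intro t. pose proof (hpc (fst z) t h1).
      assert (continuous (fun t1 => RInt (fun t2 => poi R0 (snd z) t2 * dens f R0 t1 t2) 0 (2 * PI)) t).
      { apply (cont2_RInt (fun t1 t2 => poi R0 (snd z) t2 * dens f R0 t1 t2)). lra. intro p. specialize (hd p).
        assert (continuous (fun p : R * R => poi R0 (snd z) (snd p)) p).
        { apply (continuous_comp_gen (fun p : R * R => snd p) (poi R0 (snd z))). cont. apply hpc; auto. }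
        cont. }
      cont.
    + intros t _.
      match goal with |- _ <= / _ * (?A * ?X) => replace (/ (2 * PI) * (A * X)) with (A * (X / (2 * PI))) by (field; apply PI_neq0) end.
      apply Rmult_le_compat_l. apply poi_pos; lra.
      apply (subharmonic_sq (fun w => f ((RtoC R0 * expi t)%C, w)) 1 R0 (snd z)); auto.
      apply holo_holD2; auto.
  - intro t. pose proof (hpc (fst z) t h1).
    assert (continuous (fun t1 => RInt (fun t2 => poi R0 (snd z) t2 * dens f R0 t1 t2) 0 (2 * PI)) t).
    { apply (cont2_RInt (fun t1 t2 => poi R0 (snd z) t2 * dens f R0 t1 t2)). lra. intro p. specialize (hd p).
      assert (continuous (fun p : R * R => poi R0 (snd z) (snd p)) p).
      { apply (continuous_comp_gen (fun p : R * R => snd p) (poi R0 (snd z))). cont. apply hpc; auto. }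
      cont. }
    cont.
Qed.

Lemma poi_le rho z t : 0 < rho <= 1 -> Cmod z < rho -> poi rho z t <= 2 / (rho - Cmod z).
Proof.
  intros hr hz. unfold poi. assert (hm := Cmod_ge_0 z).
  pose proof (circle_sub_ge rho z t ltac:(lra)) as h. set (D := Cmod (RtoC rho * expi t - z)) in *.
  apply Rle_div_l. apply pow_lt; lra.
  apply Rle_trans with (2 / (rho - Cmod z) * (rho - Cmod z) ^ 2).
  - replace (2 / (rho - Cmod z) * (rho - Cmod z) ^ 2) with (2 * (rho - Cmod z)) by (field; lra). nra.
  - apply Rmult_le_compat_l. left; apply Rdiv_lt_0_compat; lra. apply pow_incr; lra.
Qed.

(* the exponent 9/8 leaves the factor (1-|z|)^(1/8), whence compactness, while 9/8 = 3/4 + 3/8 keeps both one-dimensional integrals convergent *)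
Lemma poi_le_power rho z t : 0 < rho < 1 -> Cmod z < 1 -> 1 - rho <= (1 - Cmod z) / 2 ->
  poi rho z t <= 8 * Rpower (1 - Cmod z) (1 / 8) * Rpower (Cmod (expi t - z)) (- (9 / 8)).
Proof.
  intros hr hz h. assert (hm := Cmod_ge_0 z).
  set (d := 1 - Cmod z). assert (hd : 0 < d) by (unfold d; lra).
  pose proof (circle_sub_ge rho z t ltac:(lra)) as h1.
  pose proof (circle_sub_ge 1 z t ltac:(lra)) as h2. rewrite Cmult_1_l in h2.
  set (D := Cmod (expi t - z)) in *.
  assert (h3 : D / 2 <= Cmod (RtoC rho * expi t - z)).
  { pose proof (Cmod_sub_triangle (expi t) (RtoC rho * expi t) z) as k.
    replace (expi t - RtoC rho * expi t)%C with (RtoC (1 - rho) * expi t)%C in k by (rewrite RtoC_minus; ring).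
    rewrite Cmod_mult, Cmod_expi, Cmod_RtoC_pos in k by lra. unfold D, d in *. lra. }
  assert (hD : 0 < D) by (unfold d in *; lra).
  unfold poi. set (E := Cmod (RtoC rho * expi t - z)) in *.
  assert (e1 : (rho ^ 2 - Cmod z ^ 2) / E ^ 2 <= 8 * (d / D ^ 2)).
  { apply Rle_div_l. apply pow_lt; lra. apply Rle_trans with (8 * (d / D ^ 2) * (D / 2) ^ 2).
    - replace (8 * (d / D ^ 2) * (D / 2) ^ 2) with (2 * d) by (field; lra). unfold d. nra.
    - apply Rmult_le_compat_l. assert (0 <= d / D ^ 2) by (apply Rdiv_le_0_compat; [lra|apply pow_lt; lra]). lra. apply pow_incr; lra. }
  eapply Rle_trans. exact e1. rewrite Rmult_assoc. apply Rmult_le_compat_l. lra.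
  assert (hdD : d <= D) by (unfold d in *; lra).
  replace d with (Rpower d (1 / 8) * Rpower d (7 / 8)) at 1.
  2: { rewrite <- Rpower_plus. replace (1 / 8 + 7 / 8) with 1 by field. apply Rpower_1; auto. }
  replace (D ^ 2) with (Rpower D 2).
  2: { replace 2 with (INR 2) at 1 by (simpl; ring). apply Rpower_pow; auto. }
  unfold Rdiv at 1. rewrite <- Rpower_Ropp, Rmult_assoc. apply Rmult_le_compat_l. left; apply exp_pos.
  replace (- (9 / 8)) with (7 / 8 + - 2) by field. rewrite Rpower_plus. apply Rmult_le_compat_r. left; apply exp_pos.
  apply Rle_Rpower_l; lra.
Qed.

(** The only quantity through which the order-two condition enters the composition estimate. The
    exponent is that of the boundary bound for the Poisson kernel. *)
Definition kint (F : C * C -> C) (r : R) (eta : C) : R :=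
  dbl (fun t1 t2 => Rpower (Cmod (eta - F (tor r t1 t2))) (- (9 / 8))).

(** Compactness through [cousin_square]: near a point the value halfway between h and c works by
    continuity, and on a subdivided square the largest of the four bounds. *)
Lemma cont2_sup_lt h c : cont2 h -> (forall t1 t2, h t1 t2 < c) ->
  exists m, m < c /\ forall t1 t2, 0 <= t1 <= 2 * PI -> 0 <= t2 <= 2 * PI -> h t1 t2 <= m.
Proof.
  intros hc hlt. pose proof PI2_pos as hp.
  pose proof (cousin_square (fun x y w => exists m, m < c /\ forall t1 t2, x <= t1 <= x + w -> y <= t2 <= y + w -> h t1 t2 <= m) 0 0 (2 * PI) hp) as k.
  cbv beta in k. rewrite Rplus_0_l in k. apply k; clear k.
  - intros x y w hw [m1 [a1 b1]] [m2 [a2 b2]] [m3 [a3 b3]] [m4 [a4 b4]].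
    exists (Rmax (Rmax m1 m2) (Rmax m3 m4)). split. repeat apply Rmax_lub_lt; auto.
    intros t1 t2 h1 h2.
    destruct (Rle_dec t1 (x + w / 2)); destruct (Rle_dec t2 (y + w / 2)).
    + eapply Rle_trans. apply b1; lra. eapply Rle_trans; [apply Rmax_l|apply Rmax_l].
    + eapply Rle_trans. apply b3; lra. eapply Rle_trans; [apply Rmax_l|apply Rmax_r].
    + eapply Rle_trans. apply b2; lra. eapply Rle_trans; [apply Rmax_r|apply Rmax_l].
    + eapply Rle_trans. apply b4; lra. eapply Rle_trans; [apply Rmax_r|apply Rmax_r].
  - intros p q _ _. specialize (hc (p, q)). rewrite continuous_R_iff in hc. simpl in hc.
    destruct (proj1 (locally_RR_iff _ _) (hc ((c - h p q) / 2) ltac:(specialize (hlt p q); lra))) as [d [hd k]].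
    exists d. split; auto. intros x y w hw _ _ _ _ hpx hqy. exists ((c + h p q) / 2). specialize (hlt p q). split. lra.
    intros t1 t2 h1 h2. specialize (k (t1, t2)). simpl in k.
    assert (k' : Rabs (h t1 t2 - h p q) < (c - h p q) / 2) by (apply k; apply Rabs_def1; lra).
    apply Rabs_def2 in k'. lra.
Qed.

Lemma dbl_param_continuous (h : R -> R -> R -> R) t0 :
  (forall x y t, continuous (fun q : (R * R) * R => h (fst (fst q)) (snd (fst q)) (snd q)) ((x, y), t)) ->
  continuous (fun t => dbl (fun x y => h x y t)) t0.
Proof.
  intros hc. pose proof PI2_ge0 as hp.
  apply (continuous_RInt_param (fun t x => RInt (fun y => h x y t) 0 (2 * PI))); auto.
  intros u t. apply (continuous_RInt_param (fun (p : R * R) y => h (snd p) y (fst p)) 0 (2 * PI) (u, t)); auto.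
  intros p y. apply (continuous_comp_gen (fun q : (R * R) * R => ((snd (fst q), snd q), fst (fst q))) (fun q : (R * R) * R => h (fst (fst q)) (snd (fst q)) (snd q))).
  - cont; (apply (continuous_comp_gen fst snd) || apply (continuous_comp_gen fst fst)); cont.
  - apply hc.
Qed.

Lemma dbl_RInt_swap (h : R -> R -> R -> R) :
  (forall x y t, continuous (fun q : (R * R) * R => h (fst (fst q)) (snd (fst q)) (snd q)) ((x, y), t)) ->
  dbl (fun x y => RInt (fun t => h x y t) 0 (2 * PI)) = RInt (fun t => dbl (fun x y => h x y t)) 0 (2 * PI).
Proof.
  intros hc. pose proof PI2_ge0 as hp. unfold dbl.
  rewrite <- (RInt_swap (fun x t => RInt (fun y => h x y t) 0 (2 * PI)) 0 (2 * PI) 0 (2 * PI) hp).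
  - apply RInt_ext_all. intro x. apply (RInt_swap (fun y t => h x y t)); auto.
    intros y t. apply (continuous_comp_gen (fun q : R * R => ((x, fst q), snd q)) (fun q : (R * R) * R => h (fst (fst q)) (snd (fst q)) (snd q))).
    cont. apply hc.
  - intros x t. apply (continuous_RInt_param (fun (p : R * R) y => h (fst p) y (snd p)) 0 (2 * PI) (x, t)); auto.
    intros p y. apply (continuous_comp_gen (fun q : (R * R) * R => ((fst (fst q), snd q), snd (fst q))) (fun q : (R * R) * R => h (fst (fst q)) (snd (fst q)) (snd q))).
    + cont; (apply (continuous_comp_gen fst snd) || apply (continuous_comp_gen fst fst)); cont.
    + apply hc.
Qed.

(** * The mean of a composition over one torus *)

Section MainEstimate.
Variables (f : C * C -> C) (phi : C * C -> C * C) (r c delta S Ck M : R).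
Hypotheses (hf : holo_D2 f) (h1 : holo_D2 (fun z => fst (phi z))) (h2 : holo_D2 (fun z => snd (phi z)))
  (hm : forall z, inD2 z -> inD2 (phi z)) (hr : 0 < r < 1) (hc : 0 < c) (hdelta : 0 < delta <= c)
  (hsep : forall t1 t2, Cmod (fst (phi (tor r t1 t2))) <= 1 - c \/ Cmod (snd (phi (tor r t1 t2))) <= 1 - c)
  (hS0 : 0 <= S)
  (hS : forall z, Cmod (fst z) <= 1 - delta -> Cmod (snd z) <= 1 - delta -> Cmod (f z) ^ 2 <= S)
  (hk1 : forall t, kint (fun z => fst (phi z)) r (expi t) <= Ck)
  (hk2 : forall t, kint (fun z => snd (phi z)) r (expi t) <= Ck)
  (hCk : 0 <= Ck) (hM : forall s, 0 < s < 1 -> circ_int f s <= M).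

(** The marginals of |f|^2 on the torus of radius R0. By exchange of integrations both have integral
    4 PI^2 [circ_int f R0], hence at most 4 PI^2 M. *)
Let G1 R0 t1 := RInt (dens f R0 t1) 0 (2 * PI).
Let G2 R0 t2 := RInt (fun t1 => dens f R0 t1 t2) 0 (2 * PI).
Let kr (z : C) (t : R) := Rpower (Cmod (expi t - z)) (- (9 / 8)).

Let G1c R0 : 0 <= R0 < 1 -> forall t, continuous (G1 R0) t.
Proof. intros h t. apply cont2_RInt. apply PI2_ge0. apply dens_cont2; auto. Qed.

Let G2c R0 : 0 <= R0 < 1 -> forall t, continuous (G2 R0) t.
Proof. intros h t. apply (cont2_RInt (fun x y => dens f R0 y x)). apply PI2_ge0. apply cont2_swap, dens_cont2; auto. Qed.

Let G1pos R0 t : 0 <= R0 < 1 -> 0 <= G1 R0 t.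
Proof. intros h. apply RInt_ge0_cont. apply cont2_slice, dens_cont2; auto. apply PI2_ge0. intros; apply pow2_ge_0. Qed.

Let G2pos R0 t : 0 <= R0 < 1 -> 0 <= G2 R0 t.
Proof. intros h. apply RInt_ge0_cont. apply cont2_slice1, dens_cont2; auto. apply PI2_ge0. intros; apply pow2_ge_0. Qed.

Lemma expi_sub_pos z t : Cmod z < 1 -> 0 < Cmod (expi t - z).
Proof. intros hz. generalize (Cmod_triangle_inv (expi t) z). rewrite Cmod_expi. lra. Qed.

Let krc z t : Cmod z < 1 -> continuous (kr z) t.
Proof. intros hz. unfold kr. cont. apply expi_sub_pos; auto. Qed.

Let krpos z t : 0 <= kr z t.
Proof. left; apply exp_pos. Qed.

(** Here 32 / c = 8 (4 / c): the constant of the boundary bound for one Poisson kernel times the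
    interior bound for the other, over the normalisation of means. *)
Let K := 32 / c * Rpower delta (1 / 8) / (4 * PI ^ 2).

Let K0 : 0 <= K.
Proof.
  unfold K. apply Rdiv_le_0_compat; [|apply fourPI2_pos]. apply Rmult_le_pos. left; apply Rdiv_lt_0_compat; lra. left; apply exp_pos.
Qed.

Lemma poi_le_interior R0 z t : 0 < R0 < 1 -> Cmod z <= 1 - c -> 1 - R0 <= (1 - Cmod z) / 2 -> poi R0 z t <= 4 / c.
Proof.
  intros hR hz h. assert (hh := Cmod_ge_0 z). eapply Rle_trans. apply poi_le; lra.
  apply Rle_div_l. lra. apply Rle_trans with (4 / c * (c / 2)). right; field; lra.
  apply Rmult_le_compat_l. left; apply Rdiv_lt_0_compat; lra. lra.
Qed.

Lemma poi_le_boundary R0 z t : 0 < R0 < 1 -> Cmod z < 1 -> 1 - delta <= Cmod z -> 1 - R0 <= (1 - Cmod z) / 2 ->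
  poi R0 z t <= 8 * Rpower delta (1 / 8) * kr z t.
Proof.
  intros hR hz hzd h. eapply Rle_trans. apply poi_le_power; auto.
  apply Rmult_le_compat_r. apply krpos. apply Rmult_le_compat_l. lra. apply Rle_Rpower_l; lra.
Qed.

(** If both coordinates are at distance at least delta from the circle, S suffices. Otherwise, as
    delta <= c, exactly one is close to it and the Poisson kernel of the other is at most 4 / c. The
    double integral then collapses to one integral of the power kernel against a marginal of |f|^2,
    with the small factor delta^(1/8). *)
Lemma pointwise_estimate R0 v : 0 < R0 < 1 -> inD2 v -> 1 - R0 <= (1 - Cmod (fst v)) / 2 -> 1 - R0 <= (1 - Cmod (snd v)) / 2 ->
  Cmod (fst v) <= 1 - c \/ Cmod (snd v) <= 1 - c ->
  Cmod (f v) ^ 2 <= S + K * (RInt (fun t => kr (fst v) t * G1 R0 t) 0 (2 * PI) + RInt (fun t => kr (snd v) t * G2 R0 t) 0 (2 * PI)).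
Proof.
  intros hR [v1 v2] r1 r2 hs. unfold inD in *. pose proof PI2_ge0 as hp.
  pose proof (dens_cont2 f R0 hf ltac:(lra)) as hd.
  assert (hc1 : forall t, continuous (fun t => kr (fst v) t * G1 R0 t) t).
  { intro t. pose proof (krc (fst v) t v1). pose proof (G1c R0 ltac:(lra) t). cont. }
  assert (hc2 : forall t, continuous (fun t => kr (snd v) t * G2 R0 t) t).
  { intro t. pose proof (krc (snd v) t v2). pose proof (G2c R0 ltac:(lra) t). cont. }
  assert (p1 : 0 <= RInt (fun t => kr (fst v) t * G1 R0 t) 0 (2 * PI)).
  { apply RInt_ge0_cont; auto. intros. apply Rmult_le_pos; auto. apply G1pos; lra. }
  assert (p2 : 0 <= RInt (fun t => kr (snd v) t * G2 R0 t) 0 (2 * PI)).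
  { apply RInt_ge0_cont; auto. intros. apply Rmult_le_pos; auto. apply G2pos; lra. }
  assert (hpc : forall z t, Cmod z < R0 -> continuous (poi R0 z) t) by (intros; apply poi_continuous; lra).
  assert (q1 : Cmod (fst v) < R0) by lra. assert (q2 : Cmod (snd v) < R0) by lra.
  assert (hcc : 0 < 4 / c) by (apply Rdiv_lt_0_compat; lra).
  assert (hpd : 0 < Rpower delta (1 / 8)) by apply exp_pos.
  assert (cI2 : cont2 (fun t1 t2 => poi R0 (snd v) t2 * dens f R0 t1 t2)).
  { intro p. specialize (hd p).
    assert (continuous (fun p : R * R => poi R0 (snd v) (snd p)) p).
    { apply (continuous_comp_gen (fun p : R * R => snd p) (poi R0 (snd v))). cont. apply hpc; auto. }
    cont. }
  assert (cI1 : forall t, continuous (fun t1 => poi R0 (fst v) t1 * RInt (fun t2 => poi R0 (snd v) t2 * dens f R0 t1 t2) 0 (2 * PI)) t).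
  { intro t. pose proof (hpc (fst v) t q1). pose proof (cont2_RInt _ 0 (2 * PI) hp cI2 t). cont. }
  pose proof (bidisc_poisson f R0 v hf hR q1 q2) as B.
  destruct (Rle_dec (Cmod (fst v)) (1 - delta)) as [d1|d1]; [destruct (Rle_dec (Cmod (snd v)) (1 - delta)) as [d2|d2]|].
  - specialize (hS v d1 d2). assert (0 <= K * (RInt (fun t => kr (fst v) t * G1 R0 t) 0 (2 * PI) + RInt (fun t => kr (snd v) t * G2 R0 t) 0 (2 * PI))) by (apply Rmult_le_pos; auto; lra). lra.
  - assert (e1 : Cmod (fst v) <= 1 - c) by lra.
    apply Rle_trans with (K * RInt (fun t => kr (snd v) t * G2 R0 t) 0 (2 * PI)); [|nra].
    eapply Rle_trans. exact B. unfold K. match goal with |- ?X / ?Q <= ?A / ?Q * ?Y => replace (A / Q * Y) with (A * Y / Q) by (unfold Rdiv; ring) end.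
    apply Rmult_le_compat_r. left; apply Rinv_0_lt_compat, fourPI2_pos.
    rewrite <- RInt_scal_cont by auto.
    apply Rle_trans with (RInt (fun t1 => RInt (fun t2 => 32 / c * Rpower delta (1 / 8) * (kr (snd v) t2 * dens f R0 t1 t2)) 0 (2 * PI)) 0 (2 * PI)).
    + assert (cc : cont2 (fun t1 t2 => 32 / c * Rpower delta (1 / 8) * (kr (snd v) t2 * dens f R0 t1 t2))).
      { intro p. specialize (hd p).
        assert (continuous (fun p : R * R => kr (snd v) (snd p)) p).
        { apply (continuous_comp_gen (fun p : R * R => snd p) (kr (snd v))). cont. apply krc; auto. }
        cont. }
      apply RInt_le_cont; auto.
      { apply cont2_RInt; auto. }
      intros t1 _. rewrite <- RInt_scal_cont by (apply cont2_slice with (h := fun t1 t2 => poi R0 (snd v) t2 * dens f R0 t1 t2); auto).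
      apply RInt_le_cont; auto.
      { intro t. pose proof (cont2_slice _ t1 cI2 t) as X. cbv beta in X. cont. }
      { apply (cont2_slice _ t1 cc). }
      intros t2 _. pose proof (poi_le_interior R0 (fst v) t1 hR e1 r1). pose proof (poi_le_boundary R0 (snd v) t2 hR v2 ltac:(lra) r2).
      replace (32 / c * Rpower delta (1 / 8) * (kr (snd v) t2 * dens f R0 t1 t2)) with (4 / c * (8 * Rpower delta (1 / 8) * kr (snd v) t2 * dens f R0 t1 t2)) by (field; lra).
      assert (0 <= dens f R0 t1 t2) by apply pow2_ge_0.
      apply Rmult_le_compat; auto. apply poi_pos; lra. apply Rmult_le_pos; auto. apply poi_pos; lra.
      apply Rmult_le_compat_r; auto.
    (* The singular kernel sits in the inner variable here, so the marginal [G2] appears only after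
       exchanging the integrations. *)
    + right. rewrite (RInt_swap (fun t1 t2 => 32 / c * Rpower delta (1 / 8) * (kr (snd v) t2 * dens f R0 t1 t2)) 0 (2 * PI) 0 (2 * PI)); auto.
      * apply RInt_ext_all. intro t2. unfold G2. pose proof (cont2_slice1 _ t2 hd) as hs2. cbv beta in hs2.
        rewrite (RInt_scal_cont (fun t1 => kr (snd v) t2 * dens f R0 t1 t2)), (RInt_scal_cont (fun t1 => dens f R0 t1 t2)); auto.
        intro t. specialize (hs2 t). cont.
      * intros x y. specialize (hd (x, y)). cbv beta.
        assert (continuous (fun p : R * R => kr (snd v) (snd p)) (x, y)).
        { apply (continuous_comp_gen (fun p : R * R => snd p) (kr (snd v))). cont. apply krc; auto. }
        cont.
  - assert (e1 : Cmod (snd v) <= 1 - c) by lra.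
    apply Rle_trans with (K * RInt (fun t => kr (fst v) t * G1 R0 t) 0 (2 * PI)); [|nra].
    eapply Rle_trans. exact B. unfold K. match goal with |- ?X / ?Q <= ?A / ?Q * ?Y => replace (A / Q * Y) with (A * Y / Q) by (unfold Rdiv; ring) end.
    apply Rmult_le_compat_r. left; apply Rinv_0_lt_compat, fourPI2_pos.
    rewrite <- RInt_scal_cont by auto. apply RInt_le_cont; auto.
    { intro t. specialize (hc1 t). cont. }
    intros t1 _.
    replace (32 / c * Rpower delta (1 / 8) * (kr (fst v) t1 * G1 R0 t1)) with ((8 * Rpower delta (1 / 8) * kr (fst v) t1) * (4 / c * G1 R0 t1)) by (field; lra).
    apply Rmult_le_compat.
    + apply poi_pos; lra.
    + apply RInt_ge0_cont; auto. { apply (cont2_slice _ t1 cI2). } intros. apply Rmult_le_pos. apply poi_pos; lra. apply pow2_ge_0.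
    + apply poi_le_boundary; auto; lra.
    + unfold G1. rewrite <- RInt_scal_cont by (apply cont2_slice; auto). apply RInt_le_cont; auto.
      { apply (cont2_slice _ t1 cI2). }
      { intro t. pose proof (cont2_slice _ t1 hd t). cont. }
      intros t2 _. apply Rmult_le_compat_r. apply pow2_ge_0. apply poi_le_interior; auto.
Qed.

(** The pointwise estimate is integrated over the torus and the integrals exchanged, so that for
    each boundary point e^{it} the kernel is integrated over the torus first and bounded by Ck; what
    remains is the integral of a marginal. *)
Lemma circ_int_comp_le : circ_int (fun z => f (phi z)) r <= S + 2 * (K * (Ck * M)).
Proof.
  pose proof PI2_ge0 as hp. pose proof fourPI2_pos as hq.
  assert (hcomp : holo_D2 (fun z => f (phi z))) by (apply holo_comp; auto).
  assert (c1 : forall p, continuous (fun p : R * R => fst (phi (tor r (fst p) (snd p)))) p).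
  { intro p. apply (holo_tor_continuous (fun z => fst (phi z))); auto; lra. }
  assert (c2 : forall p, continuous (fun p : R * R => snd (phi (tor r (fst p) (snd p)))) p).
  { intro p. apply (holo_tor_continuous (fun z => snd (phi z))); auto; lra. }
  assert (hin : forall x y, inD2 (phi (tor r x y))) by (intros; apply hm, tor_inD2; lra).
  destruct (cont2_sup_lt (fun x y => Cmod (fst (phi (tor r x y)))) 1) as [m1 [hm1 k1]].
  { intro p. specialize (c1 p). cont. } { intros; apply (hin t1 t2). }
  destruct (cont2_sup_lt (fun x y => Cmod (snd (phi (tor r x y)))) 1) as [m2 [hm2 k2]].
  { intro p. specialize (c2 p). cont. } { intros; apply (hin t1 t2). }
  set (m := Rmax 0 (Rmax m1 m2)).
  assert (hmm : 0 <= m < 1) by (unfold m; split; [apply Rmax_l|apply Rmax_lub_lt; [lra|apply Rmax_lub_lt; auto]]).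
  assert (m1 <= m) by (unfold m; eapply Rle_trans; [apply Rmax_l|apply Rmax_r]).
  assert (m2 <= m) by (unfold m; eapply Rle_trans; [apply Rmax_r|apply Rmax_r]).
  (* The outer radius depends on r through the largest modulus m of the coordinates of phi on the
     torus, so that 1 - R0 is at most half the distance to the circle there. The final bound no
     longer contains R0. *)
  set (R0 := 1 - (1 - m) / 2). assert (hR0 : 0 < R0 < 1) by (unfold R0; lra).
  set (I1 := fun x y => RInt (fun t => kr (fst (phi (tor r x y))) t * G1 R0 t) 0 (2 * PI)).
  set (I2 := fun x y => RInt (fun t => kr (snd (phi (tor r x y))) t * G2 R0 t) 0 (2 * PI)).
  (* Stated for a general coordinate g and marginal G because it is applied to each coordinate of
     phi. *)
  assert (est : forall (g : C * C -> C) (G : R -> R), (forall p, continuous (fun p : R * R => g (tor r (fst p) (snd p))) p) ->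
    (forall x y, Cmod (g (tor r x y)) < 1) -> (forall t, continuous G t) -> (forall t, 0 <= G t) -> (forall t, kint g r (expi t) <= Ck) ->
    cont2 (fun x y => RInt (fun t => kr (g (tor r x y)) t * G t) 0 (2 * PI)) /\
    dbl (fun x y => RInt (fun t => kr (g (tor r x y)) t * G t) 0 (2 * PI)) <= Ck * RInt G 0 (2 * PI)).
  { intros g G cg hg1 cG hG0 hk.
    assert (cgh : forall q : (R * R) * R, continuous (fun q : (R * R) * R => kr (g (tor r (fst (fst q)) (snd (fst q)))) (snd q) * G (snd q)) q).
    { intro q.
      assert (X : continuous (fun q : (R * R) * R => g (tor r (fst (fst q)) (snd (fst q)))) q).
      { apply (continuous_comp_gen (fun q : (R * R) * R => fst q) (fun p : R * R => g (tor r (fst p) (snd p)))). cont. apply cg. }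
      assert (Y : continuous (fun q : (R * R) * R => G (snd q)) q).
      { apply (continuous_comp_gen (fun q : (R * R) * R => snd q) G). cont. apply cG. }
      unfold kr. cont. apply expi_sub_pos. auto. }
    split.
    - intro p. apply (continuous_RInt_param (fun (p : R * R) t => kr (g (tor r (fst p) (snd p))) t * G t) 0 (2 * PI) p); auto.
    - rewrite (dbl_RInt_swap (fun x y t => kr (g (tor r x y)) t * G t)) by (intros x y t; apply (cgh ((x, y), t))).
      assert (ck : forall t, cont2 (fun x y => kr (g (tor r x y)) t)).
      { intros t p. specialize (cg p). unfold kr. cont. apply expi_sub_pos; auto. }
      rewrite <- RInt_scal_cont by auto. apply RInt_le_cont; auto.
      + intro t. apply (dbl_param_continuous (fun x y t => kr (g (tor r x y)) t * G t)). intros x y s; apply (cgh ((x, y), s)).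
      + intro t. specialize (cG t). cont.
      + intros t _. rewrite (Rmult_comm Ck).
        replace (dbl (fun x y => kr (g (tor r x y)) t * G t)) with (G t * dbl (fun x y => kr (g (tor r x y)) t)).
        apply Rmult_le_compat_l; auto. apply hk.
        rewrite <- dbl_scal by auto. f_equal. apply functional_extensionality; intro x. apply functional_extensionality; intro y. ring. }
  destruct (est (fun z => fst (phi z)) (G1 R0)) as [cI1 e1]; auto. { intros; apply (hin x y). } { intro; apply G1c; lra. } { intro; apply G1pos; lra. }
  destruct (est (fun z => snd (phi z)) (G2 R0)) as [cI2 e2]; auto. { intros; apply (hin x y). } { intro; apply G2c; lra. } { intro; apply G2pos; lra. }
  fold I1 in cI1, e1. fold I2 in cI2, e2.
  assert (g1 : RInt (G1 R0) 0 (2 * PI) <= 4 * PI ^ 2 * M).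
  { specialize (hM R0 hR0). rewrite circ_int_dbl in hM. apply Rle_div_l in hM; auto. rewrite (Rmult_comm (4 * PI ^ 2) M). exact hM. }
  assert (g2 : RInt (G2 R0) 0 (2 * PI) <= 4 * PI ^ 2 * M).
  { specialize (hM R0 hR0). rewrite circ_int_dbl, dbl_swap in hM by (apply dens_cont2; auto; lra). apply Rle_div_l in hM; auto. rewrite (Rmult_comm (4 * PI ^ 2) M). exact hM. }
  rewrite circ_int_dbl. apply Rle_div_l; auto.
  pose proof (cont2_plus I1 I2 cI1 cI2) as cS.
  pose proof (cont2_scal K _ cS) as cKS.
  apply Rle_trans with (dbl (fun x y => S + K * (I1 x y + I2 x y))).
  - apply dbl_le_square. apply dens_cont2; auto; lra.
    { apply (cont2_plus (fun _ _ => S)); auto. apply cont2_const. }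
    intros x y hx hy. apply (pointwise_estimate R0 (phi (tor r x y))); auto; unfold R0.
    + specialize (k1 x y hx hy). lra.
    + specialize (k2 x y hx hy). lra.
  - rewrite (dbl_plus (fun _ _ => S) (fun x y => K * (I1 x y + I2 x y)) (cont2_const S) cKS), dbl_const, (dbl_scal (fun x y => I1 x y + I2 x y) K cS), (dbl_plus I1 I2 cI1 cI2).
    assert (dbl I1 + dbl I2 <= 2 * (Ck * (4 * PI ^ 2 * M))) by (assert (Ck * RInt (G1 R0) 0 (2 * PI) <= Ck * (4 * PI ^ 2 * M)) by (apply Rmult_le_compat_l; auto); assert (Ck * RInt (G2 R0) 0 (2 * PI) <= Ck * (4 * PI ^ 2 * M)) by (apply Rmult_le_compat_l; auto); lra).
    assert (K * (dbl I1 + dbl I2) <= K * (2 * (Ck * (4 * PI ^ 2 * M)))) by (apply Rmult_le_compat_l; auto). lra.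
Qed.
End MainEstimate.

(** * Integrals of negative powers *)

Lemma Rpower_le_self (x a : R) : 1 <= x -> 0 <= a <= 1 -> Rpower x a <= x.
Proof. intros hx ha. rewrite <- (Rpower_1 x) at 2 by lra. apply Rle_Rpower; lra. Qed.

Lemma Rpower_neg_le (x y a : R) : 0 < x <= y -> 0 <= a -> Rpower y (- a) <= Rpower x (- a).
Proof.
  intros h ha. rewrite !Rpower_Ropp. apply Rinv_le_contravar. apply exp_pos. apply Rle_Rpower_l; lra.
Qed.

(** The sign s treats both sides of the singularity of |x - tau| at once. *)
Lemma is_derive_quarter_power (s c k x : R) : 0 < s * x + c -> s = 1 \/ s = -1 ->
  is_derive (fun x => 4 * s * Rpower (s * x + c) (1 / 4)) x (Rpower (s * x + c) (- (3 / 4))).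
Proof.
  intros h hs.
  assert (k1 : is_derive (fun x => Rpower (s * x + c) (1 / 4)) x (s * (1 / 4 * Rpower (s * x + c) (1 / 4 - 1)))).
  { apply (is_derive_comp (K := R_AbsRing) (V := R_NormedModule) (fun y : R => Rpower y (1 / 4)) (fun x : R => s * x + c)).
    - apply is_derive_Reals. apply derivable_pt_lim_power. exact h.
    - auto_derive; auto. ring. }
  apply (is_derive_scal _ _ (4 * s)) in k1.
  replace (Rpower (s * x + c) (- (3 / 4))) with (4 * s * (s * (1 / 4 * Rpower (s * x + c) (1 / 4 - 1)))).
  exact k1. replace (1 / 4 - 1) with (- (3 / 4)) by field. destruct hs; subst; field.
Qed.

(** The exponent 3/4 is integrable, so the bound is free of kap, which only keeps the integrand
    finite at tau. On each side the primitive is 4 u^(1/4) up to sign, with u <= b - a + 1 and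
    u^(1/4) <= b - a + 1. *)
Lemma RInt_power_bound (a b tau kap : R) : 0 < kap <= 1 -> a <= tau <= b ->
  RInt (fun x => Rpower (Rabs (x - tau) + kap) (- (3 / 4))) a b <= 8 * (b - a + 1).
Proof.
  intros hk ht.
  assert (hc : forall x, continuous (fun x => Rpower (Rabs (x - tau) + kap) (- (3 / 4))) x).
  { intro x. cont. generalize (Rabs_pos (x - tau)); lra. }
  assert (hc2 : forall s c x, 0 < s * x + c -> continuous (fun x => Rpower (s * x + c) (- (3 / 4))) x) by (intros; cont; auto).
  rewrite (RInt_Chasles_cont (fun x : R => Rpower (Rabs (x - tau) + kap) (- (3 / 4))) a tau hc b).
  assert (i1 : RInt (fun x => Rpower (Rabs (x - tau) + kap) (- (3 / 4))) a tau <= 4 * (b - a + 1)).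
  { rewrite (RInt_ext _ (fun x => Rpower (-1 * x + (tau + kap)) (- (3 / 4)))).
    2: { intros x hx. rewrite Rmin_left, Rmax_right in hx by lra. f_equal. rewrite Rabs_left1 by lra. ring. }
    erewrite is_RInt_unique.
    2: { apply (is_RInt_derive (V := R_CompleteNormedModule) (fun x => 4 * -1 * Rpower (-1 * x + (tau + kap)) (1 / 4))).
      - intros x hx. rewrite Rmin_left, Rmax_right in hx by lra. apply is_derive_quarter_power; auto. lra.
      - intros x hx. rewrite Rmin_left, Rmax_right in hx by lra. apply hc2. lra. }
    change (4 * -1 * Rpower (-1 * tau + (tau + kap)) (1 / 4) - 4 * -1 * Rpower (-1 * a + (tau + kap)) (1 / 4) <= 4 * (b - a + 1)).
    assert (0 < Rpower (-1 * tau + (tau + kap)) (1 / 4)) by apply exp_pos.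
    assert (Rpower (-1 * a + (tau + kap)) (1 / 4) <= b - a + 1).
    { eapply Rle_trans. 2: apply (Rpower_le_self (b - a + 1) (1 / 4)); lra. apply Rle_Rpower_l; lra. }
    lra. }
  assert (i2 : RInt (fun x => Rpower (Rabs (x - tau) + kap) (- (3 / 4))) tau b <= 4 * (b - a + 1)).
  { rewrite (RInt_ext _ (fun x => Rpower (1 * x + (kap - tau)) (- (3 / 4)))).
    2: { intros x hx. rewrite Rmin_left, Rmax_right in hx by lra. f_equal. rewrite Rabs_pos_eq by lra. ring. }
    erewrite is_RInt_unique.
    2: { apply (is_RInt_derive (V := R_CompleteNormedModule) (fun x => 4 * 1 * Rpower (1 * x + (kap - tau)) (1 / 4))).
      - intros x hx. rewrite Rmin_left, Rmax_right in hx by lra. apply is_derive_quarter_power; auto. lra.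
      - intros x hx. rewrite Rmin_left, Rmax_right in hx by lra. apply hc2. lra. }
    change (4 * 1 * Rpower (1 * b + (kap - tau)) (1 / 4) - 4 * 1 * Rpower (1 * tau + (kap - tau)) (1 / 4) <= 4 * (b - a + 1)).
    assert (0 < Rpower (1 * tau + (kap - tau)) (1 / 4)) by apply exp_pos.
    assert (Rpower (1 * b + (kap - tau)) (1 / 4) <= b - a + 1).
    { eapply Rle_trans. 2: apply (Rpower_le_self (b - a + 1) (1 / 4)); lra. apply Rle_Rpower_l; lra. }
    lra. }
  lra.
Qed.

(** A minimum up to the factor 2, which requires neither continuity nor compactness. Without one,
    every value -D x would be at most 2 m, where m is the supremum of the values of -D; then m <= 2
    m, which m <= - kap < 0 forbids. *)
Lemma almost_min {T : Type} (S : T -> Prop) (D : T -> R) (kap : R) : 0 < kap -> (exists x, S x) ->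
  (forall x, S x -> kap <= D x) -> exists p, S p /\ forall x, S x -> D p <= 2 * D x.
Proof.
  intros hk [x0 hx0] hD.
  destruct (completeness (fun y => exists x, S x /\ y = - D x)) as [m [hm1 hm2]].
  - exists (- kap). intros y [x [hx ->]]. specialize (hD x hx). lra.
  - exists (- D x0), x0. auto.
  - assert (hmk : m <= - kap). { apply hm2. intros y [x [hx ->]]. specialize (hD x hx). lra. }
    apply NNPP. intro hn.
    assert (hub : m <= 2 * m).
    { apply hm2. intros y [x [hx ->]]. apply NNPP. intro hlt. apply hn. exists x. split; auto.
      intros x' hx'. assert (- D x' <= m) by (apply hm1; exists x'; auto). lra. }
    lra.
Qed.

(** Comparing (x, y) with an approximate minimiser on the whole square bounds D below by |x - xs|^2;
    comparing with one on the vertical line through x bounds it below by |y - tau|. The point tau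
    depends on x, but the bound of the inner integral does not, so the two integrals separate.
    Neither does the result depend on kap. *)
Lemma local_kernel_bound (D : R -> R -> R) (x0 y0 w c1 kap : R) : 0 < w -> 0 < c1 -> 0 < kap <= 1 -> cont2 D ->
  (forall x y, 0 < D x y) ->
  (forall x y, x0 <= x <= x0 + w -> y0 <= y <= y0 + w -> kap <= D x y) ->
  (forall x y y', x0 <= x <= x0 + w -> y0 <= y <= y0 + w -> y0 <= y' <= y0 + w -> c1 * Rabs (y - y') <= D x y + D x y') ->
  (forall x x' y y', x0 <= x <= x0 + w -> x0 <= x' <= x0 + w -> y0 <= y <= y0 + w -> y0 <= y' <= y0 + w -> c1 * (x - x') ^ 2 <= D x y + D x' y') ->
  RInt (fun x => RInt (fun y => Rpower (D x y) (- (9 / 8))) y0 (y0 + w)) x0 (x0 + w) <=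
    Rpower (Rmin (c1 / 3) 1 / 4) (- (9 / 8)) * (8 * (w + 1)) * (8 * (w + 1)).
Proof.
  intros hw hc1 hk hD hpos hkD hy hx.
  (* D plus its value at an approximate minimiser is at most 3 D, whence c1 / 3; kap <= D gives the
     1. The factor 4 pays for adding two lower bounds and for (u + v)^2 <= 2 u^2 + 2 v^2. *)
  set (c2 := Rmin (c1 / 3) 1 / 4).
  assert (hc2 : 0 < c2). { unfold c2. apply Rdiv_lt_0_compat; [|lra]. apply Rmin_pos; lra. }
  assert (hc2a : 4 * c2 <= c1 / 3) by (unfold c2; generalize (Rmin_l (c1 / 3) 1); lra).
  assert (hc2b : 4 * c2 <= 1) by (unfold c2; generalize (Rmin_r (c1 / 3) 1); lra).
  (* D controls |x - xs| quadratically, so the regularisation matching kap in this variable is its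
     square root. *)
  set (k2 := sqrt kap).
  assert (hk2 : 0 < k2 <= 1). { unfold k2. split. apply sqrt_lt_R0; lra. rewrite <- sqrt_1. apply sqrt_le_1_alt; lra. }
  assert (hkk : k2 * k2 = kap) by (apply sqrt_sqrt; lra).
  destruct (almost_min (fun p : R * R => x0 <= fst p <= x0 + w /\ y0 <= snd p <= y0 + w) (fun p => D (fst p) (snd p)) kap) as [[xs ys] [[hxs hys] hs]].
  { lra. } { exists (x0, y0); simpl; lra. } { intros p [h1 h2]; auto. }
  simpl in hxs, hys, hs.
  assert (cD : cont2 (fun x y => Rpower (D x y) (- (9 / 8)))).
  { intro p. specialize (hD p). cont. auto. }
  assert (low : forall x, x0 <= x <= x0 + w -> exists tau, y0 <= tau <= y0 + w /\ forall y, y0 <= y <= y0 + w ->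
    Rpower (D x y) (- (9 / 8)) <= Rpower c2 (- (9 / 8)) * Rpower (Rabs (x - xs) + k2) (- (3 / 4)) * Rpower (Rabs (y - tau) + kap) (- (3 / 4))).
  { intros x hxr.
    destruct (almost_min (fun y => y0 <= y <= y0 + w) (fun y => D x y) kap) as [tau [ht hm]].
    { lra. } { exists y0; lra. } { intros y h; auto. }
    exists tau. split; auto. intros y hyr.
    assert (l1 : c2 * (Rabs (y - tau) + kap) <= D x y).
    { specialize (hy x y tau hxr hyr ht). specialize (hm y hyr). specialize (hkD x y hxr hyr).
      generalize (Rabs_pos (y - tau)). intros. nra. }
    assert (l2 : c2 * (Rabs (x - xs) + k2) ^ 2 <= D x y).
    { specialize (hx x xs y ys hxr hxs hyr hys). specialize (hs (x, y) (conj hxr hyr)). simpl in hs. specialize (hkD x y hxr hyr).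
      assert (e : (x - xs) ^ 2 = Rabs (x - xs) ^ 2) by (rewrite pow2_abs; reflexivity). rewrite e in hx.
      set (u := Rabs (x - xs)) in *. assert (0 <= u) by apply Rabs_pos.
      assert ((u + k2) ^ 2 <= 2 * u ^ 2 + 2 * kap) by (rewrite <- hkk; generalize (pow2_ge_0 (u - k2)); lra).
      assert (0 <= u ^ 2) by apply pow2_ge_0. nra. }
    assert (0 <= Rabs (x - xs)) by apply Rabs_pos. assert (0 <= Rabs (y - tau)) by apply Rabs_pos.
    (* The exponent 3/8 goes with the quadratic bound [l2], where it becomes 3/4 in |x - xs|, and
       3/4 with the linear bound [l1]. *)
    replace (- (9 / 8)) with (- (3 / 8) + - (3 / 4)) at 1 by field. rewrite Rpower_plus.
    replace (- (9 / 8)) with (- (3 / 8) + - (3 / 4)) by field. rewrite Rpower_plus.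
    replace (Rpower (Rabs (x - xs) + k2) (- (3 / 4))) with (Rpower ((Rabs (x - xs) + k2) ^ 2) (- (3 / 8))).
    2: { rewrite <- Rpower_pow by lra. rewrite Rpower_mult. f_equal. simpl. field. }
    replace (Rpower c2 (- (3 / 8)) * Rpower c2 (- (3 / 4)) * Rpower ((Rabs (x - xs) + k2) ^ 2) (- (3 / 8)) * Rpower (Rabs (y - tau) + kap) (- (3 / 4)))
      with ((Rpower c2 (- (3 / 8)) * Rpower ((Rabs (x - xs) + k2) ^ 2) (- (3 / 8))) * (Rpower c2 (- (3 / 4)) * Rpower (Rabs (y - tau) + kap) (- (3 / 4)))) by ring.
    assert (0 < (Rabs (x - xs) + k2) ^ 2) by (apply pow_lt; lra).
    rewrite !Rpower_mult_distr by lra.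
    apply Rmult_le_compat; try (left; apply exp_pos); apply Rpower_neg_le; try lra; split; try lra; apply Rmult_lt_0_compat; lra. }
  assert (hRc : forall tau k, 0 < k -> forall x, continuous (fun x => Rpower (Rabs (x - tau) + k) (- (3 / 4))) x).
  { intros tau k hk0 x. cont. generalize (Rabs_pos (x - tau)); lra. }
  apply Rle_trans with (RInt (fun x => Rpower c2 (- (9 / 8)) * (8 * (w + 1)) * Rpower (Rabs (x - xs) + k2) (- (3 / 4))) x0 (x0 + w)).
  - apply RInt_le_cont. apply cont2_RInt; auto; lra. intro x. pose proof (hRc xs k2 (proj1 hk2) x). cont. lra.
    intros x hxr. destruct (low x hxr) as [tau [ht l]].
    apply Rle_trans with (RInt (fun y => (Rpower c2 (- (9 / 8)) * Rpower (Rabs (x - xs) + k2) (- (3 / 4))) * Rpower (Rabs (y - tau) + kap) (- (3 / 4))) y0 (y0 + w)).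
    + apply RInt_le_cont; auto; try lra. apply (cont2_slice _ x cD). intro y. pose proof (hRc tau kap (proj1 hk) y). cont.
    + rewrite (RInt_scal_cont (fun y => Rpower (Rabs (y - tau) + kap) (- (3 / 4)))) by (apply hRc; lra).
      pose proof (RInt_power_bound y0 (y0 + w) tau kap hk ht) as b. replace (y0 + w - y0 + 1) with (w + 1) in b by ring.
      apply Rle_trans with (Rpower c2 (- (9 / 8)) * Rpower (Rabs (x - xs) + k2) (- (3 / 4)) * (8 * (w + 1))).
      apply Rmult_le_compat_l; auto. apply Rmult_le_pos; left; apply exp_pos. right; ring.
  - rewrite (RInt_scal_cont (fun x => Rpower (Rabs (x - xs) + k2) (- (3 / 4)))) by (apply hRc; lra).
    apply Rmult_le_compat_l. apply Rmult_le_pos. left; apply exp_pos. lra.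
    pose proof (RInt_power_bound x0 (x0 + w) xs k2 hk2 hxs) as b. replace (x0 + w - x0 + 1) with (w + 1) in b by ring. exact b.
Qed.

(** * Symbols smooth up to the boundary *)

Lemma Cmod_lt_of_parts (z w : C) e : Rabs (Re z - Re w) < e -> Rabs (Im z - Im w) < e -> Cmod (z - w) < 2 * e.
Proof.
  intros h1 h2. eapply Rle_lt_trans. apply Cmod_le_sum.
  change (Rabs (Re z - Re w) + Rabs (Im z - Im w) < 2 * e). lra.
Qed.

(** Compactness is applied to the cube [-1, 1]^4. A point of it outside the closed bidisc receives a
    radius so small that no point of the bidisc is near it; such centres are therefore never
    selected for a point of the bidisc. *)
Lemma lebesgue_number_bidisc (delta : C * C -> R) : (forall z, inclD2 z -> 0 < delta z) ->
  exists d, 0 < d /\ forall z, inclD2 z -> exists t, inclD2 t /\ Cmod (fst z - fst t) < delta t /\ Cmod (snd z - snd t) < delta t /\ d <= delta t.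
Proof.
  intros hd.
  set (pt := fun t : Compactness.Tn 4 R => let '(a, (b, (c, (d, _)))) := t in ((a, b), (c, d)) : C * C).
  assert (H : forall t, exists e : posreal, (inclD2 (pt t) /\ 2 * e <= delta (pt t)) \/
    (forall z, inclD2 z -> ~ (Cmod (fst z - fst (pt t)) < 2 * e /\ Cmod (snd z - snd (pt t)) < 2 * e))).
  { intro t. destruct (classic (inclD2 (pt t))) as [h|h].
    - specialize (hd _ h). exists (mkposreal (delta (pt t) / 2) (half_pos _ hd)). left. simpl. split; auto. lra.
    - apply not_and_or in h. destruct h as [h|h]; apply Rnot_le_lt in h.
      + exists (mkposreal ((Cmod (fst (pt t)) - 1) / 2) ltac:(lra)). right. simpl. intros z [z1 z2] [k1 k2].
        generalize (Cmod_triangle_inv (fst (pt t)) (fst z)). rewrite (Cmod_sub_sym (fst (pt t))). lra.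
      + exists (mkposreal ((Cmod (snd (pt t)) - 1) / 2) ltac:(lra)). right. simpl. intros z [z1 z2] [k1 k2].
        generalize (Cmod_triangle_inv (snd (pt t)) (snd z)). rewrite (Cmod_sub_sym (snd (pt t))). lra. }
  apply choice in H. destruct H as [dl hdl].
  destruct (compactness_value 4 (-1, (-1, (-1, (-1, tt)))) (1, (1, (1, (1, tt)))) dl) as [d k].
  exists d. split. apply cond_pos. intros [[a b] [c e]] hz.
  specialize (k (a, (b, (c, (e, tt))))).
  apply NNPP. intro hn. apply k.
  { assert (h1 := re_le_Cmod (a, b)). assert (h2 := im_le_Cmod (a, b)). assert (h3 := re_le_Cmod (c, e)). assert (h4 := im_le_Cmod (c, e)).
    simpl in h1, h2, h3, h4. destruct hz as [z1 z2]. simpl in z1, z2.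
    assert (h1' := Rle_trans _ _ _ h1 z1). assert (h2' := Rle_trans _ _ _ h2 z1). assert (h3' := Rle_trans _ _ _ h3 z2). assert (h4' := Rle_trans _ _ _ h4 z2).
    apply Rabs_le_between in h1', h2', h3', h4'. simpl. repeat split; auto; lra. }
  intros [[t1 [t2 [t3 [t4 []]]]] [_ [hc hdd]]]. apply hn.
  simpl in hc. destruct hc as [c1 [c2 [c3 [c4 _]]]].
  destruct (hdl (t1, (t2, (t3, (t4, tt))))) as [[q1 q2]|q].
  - set (dt := dl (t1, (t2, (t3, (t4, tt))))) in *.
    exists ((t1, t2), (t3, t4)). simpl in q1, q2. split; auto. simpl.
    change (d <= dt) in hdd. assert (0 < dt) by apply cond_pos.
    repeat split; try lra; (eapply Rlt_le_trans; [apply Cmod_lt_of_parts; simpl; eassumption|exact q2]).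
  - exfalso. apply (q ((a, b), (c, e)) hz). simpl. split; apply Cmod_lt_of_parts; simpl; auto.
Qed.

(** * Uniform continuity on the closed bidisc and dilations *)

Definition ucont (f : C * C -> C) : Prop := forall eps, 0 < eps -> exists d, 0 < d /\ forall z w, inclD2 z -> inclD2 w ->
  Cmod (fst z - fst w) < d -> Cmod (snd z - snd w) < d -> Cmod (f z - f w) < eps.

Lemma ucont_of_continuous f : (forall z, inclD2 z -> continuous f z) -> ucont f.
Proof.
  intros hc eps heps.
  assert (H : forall z, exists d, inclD2 z -> 0 < d /\ forall w, Cmod (fst w - fst z) < 2 * d -> Cmod (snd w - snd z) < 2 * d -> Cmod (f w - f z) < eps / 2).
  { intro z. destruct (classic (inclD2 z)) as [h|h]; [|exists 0; tauto].
    specialize (hc z h). rewrite continuous_CC_iff in hc. destruct (hc (eps / 2) (half_pos _ heps)) as [d [hd k]].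
    exists (d / 2). intros _. split; [lra|]. replace (2 * (d / 2)) with d by field. exact k. }
  apply choice in H. destruct H as [dl hdl].
  destruct (lebesgue_number_bidisc dl) as [d [hd k]]. intros z hz; apply (hdl z hz).
  exists d. split; auto. intros z w hz hw a b.
  destruct (k z hz) as [t [ht [t1 [t2 t3]]]]. destruct (hdl t ht) as [p q].
  pose proof (q z ltac:(lra) ltac:(lra)) as e1.
  assert (e2 : Cmod (f w - f t) < eps / 2).
  { apply q.
    - generalize (Cmod_sub_triangle (fst w) (fst z) (fst t)). rewrite (Cmod_sub_sym (fst w) (fst z)). lra.
    - generalize (Cmod_sub_triangle (snd w) (snd z) (snd t)). rewrite (Cmod_sub_sym (snd w) (snd z)). lra. }
  generalize (Cmod_sub_triangle (f z) (f t) (f w)). rewrite (Cmod_sub_sym (f t)). lra.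
Qed.

Lemma inD2_incl z : inD2 z -> inclD2 z.
Proof. intros [h1 h2]. unfold inD in *. split; lra. Qed.

Definition dil (s : R) (z : C * C) : C * C := ((RtoC s * fst z)%C, (RtoC s * snd z)%C).

Lemma dil_inD2 s z : 0 <= s < 1 -> inclD2 z -> inD2 (dil s z).
Proof.
  intros hs [h1 h2]. split; unfold inD; simpl; rewrite Cmod_mult, Cmod_RtoC_pos by lra.
  generalize (Cmod_ge_0 (fst z)); nra. generalize (Cmod_ge_0 (snd z)); nra.
Qed.

Lemma dil_near s z : 0 <= s <= 1 -> inclD2 z -> Cmod (fst (dil s z) - fst z) <= 1 - s /\ Cmod (snd (dil s z) - snd z) <= 1 - s.
Proof.
  intros hs [h1 h2]. simpl.
  replace (RtoC s * fst z - fst z)%C with (- (RtoC (1 - s) * fst z))%C by (rewrite RtoC_minus; ring).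
  replace (RtoC s * snd z - snd z)%C with (- (RtoC (1 - s) * snd z))%C by (rewrite RtoC_minus; ring).
  rewrite !Cmod_opp, !Cmod_mult, Cmod_RtoC_pos by lra.
  generalize (Cmod_ge_0 (fst z)) (Cmod_ge_0 (snd z)). split; nra.
Qed.

Lemma ucont_dil f : ucont f -> forall eps, 0 < eps -> exists s0, 0 <= s0 < 1 /\ forall s z, s0 <= s < 1 -> inclD2 z -> Cmod (f (dil s z) - f z) < eps.
Proof.
  intros hf eps heps. destruct (hf eps heps) as [d [hd k]].
  exists (Rmax 0 (1 - d / 2)). split. split. apply Rmax_l. apply Rmax_lub_lt; lra.
  intros s z hs hz. assert (Rmax 0 (1 - d / 2) >= 1 - d / 2) by apply Rle_ge, Rmax_r. assert (0 <= Rmax 0 (1 - d / 2)) by apply Rmax_l.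
  destruct (dil_near s z ltac:(lra) hz). apply k; auto; try lra. apply inD2_incl, dil_inD2; auto; lra.
Qed.

(** The segment from 0 to z is walked in n steps shorter than d, each of which changes f by less
    than 1. *)
Lemma ucont_bounded f : ucont f -> exists B, 0 <= B /\ forall z, inclD2 z -> Cmod (f z) <= B.
Proof.
  intros hf. destruct (hf 1 Rlt_0_1) as [d [hd k]].
  destruct (INR_unbounded (1 / d)) as [n hn].
  assert (hn0 : 0 < INR n). { assert (0 < 1 / d) by (apply Rdiv_lt_0_compat; lra). lra. }
  set (z0 := (RtoC 0, RtoC 0)).
  exists (Cmod (f z0) + INR n). split. generalize (Cmod_ge_0 (f z0)); lra. intros z hz.
  assert (H : forall m, (m <= n)%nat -> Cmod (f (dil (INR m / INR n) z)) <= Cmod (f z0) + INR m).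
  { induction m as [|m IH]; intros hm.
    - simpl INR. replace (dil (0 / INR n) z) with z0. lra. unfold dil, z0. replace (0 / INR n) with 0 by (field; lra). f_equal; ring.
    - specialize (IH ltac:(lia)). rewrite S_INR.
      assert (hfr : forall j, (j <= n)%nat -> 0 <= INR j / INR n <= 1).
      { intros j hj. split. apply Rdiv_le_0_compat; auto. apply pos_INR. apply Rle_div_l; auto. apply le_INR in hj; lra. }
      assert (hincl : forall j, (j <= n)%nat -> inclD2 (dil (INR j / INR n) z)).
      { intros j hj. specialize (hfr j hj). destruct hz as [h1 h2]. split; simpl; rewrite Cmod_mult, Cmod_RtoC_pos by lra; generalize (Cmod_ge_0 (fst z)) (Cmod_ge_0 (snd z)); nra. }
      assert (st : forall v : C, Cmod v <= 1 -> Cmod (RtoC (INR (S m) / INR n) * v - RtoC (INR m / INR n) * v) < d).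
      { intros v hv. replace (RtoC (INR (S m) / INR n) * v - RtoC (INR m / INR n) * v)%C with (RtoC (1 / INR n) * v)%C.
        - rewrite Cmod_mult, Cmod_RtoC_pos by (apply Rdiv_le_0_compat; lra).
          apply Rle_lt_trans with (1 / INR n * 1). apply Rmult_le_compat_l; auto. apply Rdiv_le_0_compat; lra. rewrite Rmult_1_r.
          apply Rlt_div_l; auto. apply Rlt_div_l in hn; lra.
        - rewrite S_INR. replace (RtoC (1 / INR n)) with (RtoC ((INR m + 1) / INR n) - RtoC (INR m / INR n))%C. ring.
          rewrite <- RtoC_minus. f_equal. field; lra. }
      destruct hz as [z1 z2].
      assert (Cmod (f (dil (INR (S m) / INR n) z) - f (dil (INR m / INR n) z)) < 1).
      { apply k; try (apply hincl; lia); simpl; apply st; auto. }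
      rewrite <- S_INR. generalize (Cmod_triangle_inv (f (dil (INR (S m) / INR n) z)) (f (dil (INR m / INR n) z))). rewrite S_INR. rewrite S_INR in H. lra. }
  specialize (H n (le_n _)). replace (dil (INR n / INR n) z) with z in H. exact H.
  destruct z as [a b]. unfold dil; simpl. replace (INR n / INR n) with 1 by (field; lra). f_equal; ring.
Qed.

(* F with its first and second complex derivatives on the open bidisc; by [ucont] they extend continuously to the closed one. *)
Record symbol (F F1 F2 F11 F12 F21 F22 : C * C -> C) : Prop := {
  sy_holo : holo_D2 F; sy_holo1 : holo_D2 F1; sy_holo2 : holo_D2 F2;
  sy_maps : forall z, inD2 z -> Cmod (F z) < 1;
  sy_d1 : forall z, inD2 z -> hd1 F z (F1 z);
  sy_d2 : forall z, inD2 z -> hd2 F z (F2 z);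
  sy_d11 : forall z, inD2 z -> hd1 F1 z (F11 z);
  sy_d12 : forall z, inD2 z -> hd2 F1 z (F12 z);
  sy_d21 : forall z, inD2 z -> hd1 F2 z (F21 z);
  sy_d22 : forall z, inD2 z -> hd2 F2 z (F22 z);
  sy_u : ucont F; sy_u1 : ucont F1; sy_u2 : ucont F2;
  sy_u11 : ucont F11; sy_u12 : ucont F12; sy_u21 : ucont F21; sy_u22 : ucont F22 }.

(** The smoothness hypothesis provides derivatives along real directions only. For a holomorphic
    function the complex derivative is also the derivative along real increments, and agreement of
    the curves near t = 0 identifies the two. *)
Lemma real_directional1 F z d (g : R -> C) e : holo_D2 F -> inD2 z -> hd1 F z d -> rderC g 0 e ->
  (exists r, 0 < r /\ forall t, Rabs t < r -> g t = F ((fst z + RtoC t)%C, snd z)) -> d = e.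
Proof.
  intros hF hz hd hg [r [hr he]].
  assert (k : rderC (fun t => F ((fst z + RtoC t)%C, snd z)) 0 (d * RtoC 1)).
  { apply (rderC_comp (fun w => F (w, snd z)) (fun t => fst z + RtoC t)%C).
    - eapply rderC_eq. apply rderC_plus. apply rderC_const. apply rderC_RtoC. apply (is_derive_id (K := R_AbsRing)). unfold one; simpl; ring.
    - replace (fst z + RtoC 0)%C with (fst z) by ring. exact hd. }
  destruct k as [k1 k2]. destruct hg as [g1 g2].
  assert (hl : locally 0 (fun t => F ((fst z + RtoC t)%C, snd z) = g t)).
  { apply locally_R_iff. exists r. split; auto. intros t ht. rewrite Rminus_0_r in ht. symmetry; auto. }
  rewrite Cmult_1_r in k1, k2.
  apply C_ext.
  - apply (is_derive_ext_loc _ (fun t => Re (g t))) in k1.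
    rewrite <- (is_derive_unique _ _ _ k1), <- (is_derive_unique _ _ _ g1). reflexivity.
    revert hl. apply filter_imp. intros t ->; auto.
  - apply (is_derive_ext_loc _ (fun t => Im (g t))) in k2.
    rewrite <- (is_derive_unique _ _ _ k2), <- (is_derive_unique _ _ _ g2). reflexivity.
    revert hl. apply filter_imp. intros t ->; auto.
Qed.

Lemma real_directional2 F z d (g : R -> C) e : holo_D2 F -> inD2 z -> hd2 F z d -> rderC g 0 e ->
  (exists r, 0 < r /\ forall t, Rabs t < r -> g t = F (fst z, (snd z + RtoC t)%C)) -> d = e.
Proof.
  intros hF [z1 z2] hd hg hr.
  apply (real_directional1 (fun z => F (swap z)) (swap z) d g e); auto. apply holo_swap; auto. split; auto.
Qed.

Lemma is_derive_fst {U V : NormedModule R_AbsRing} (f : R -> U * V) x l :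
  is_derive (V := prod_NormedModule R_AbsRing U V) f x l -> is_derive (fun t => fst (f t)) x (fst l).
Proof.
  intros h. refine (filterdiff_comp' (U := AbsRing_NormedModule R_AbsRing) (V := prod_NormedModule R_AbsRing U V) (W := U) f fst x (fun y => scal y l) fst h _).
  apply (filterdiff_linear (U := prod_NormedModule R_AbsRing U V) (V := U) (fun y => fst y)). apply is_linear_fst.
Qed.

Lemma is_derive_snd {U V : NormedModule R_AbsRing} (f : R -> U * V) x l :
  is_derive (V := prod_NormedModule R_AbsRing U V) f x l -> is_derive (fun t => snd (f t)) x (snd l).
Proof.
  intros h. refine (filterdiff_comp' (U := AbsRing_NormedModule R_AbsRing) (V := prod_NormedModule R_AbsRing U V) (W := V) f snd x (fun y => scal y l) snd h _).
  apply (filterdiff_linear (U := prod_NormedModule R_AbsRing U V) (V := V) (fun y => snd y)). apply is_linear_snd.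
Qed.

Definition selC (j : bool) (z : C * C) : C := if j then snd z else fst z.

Lemma continuous_selC {U : UniformSpace} j (g : U -> C * C) x : continuous g x -> continuous (fun y => selC j (g y)) x.
Proof.
  intros h. destruct j; unfold selC.
  - apply (continuous_comp_gen g snd); auto. apply continuous_snd.
  - apply (continuous_comp_gen g fst); auto. apply continuous_fst.
Qed.

(** The real normed module structure on [C * C] in which [Ck] differentiates, written out for
    explicit annotations. *)
Notation CCmod := (prod_NormedModule R_AbsRing (prod_NormedModule R_AbsRing R_NormedModule R_NormedModule) (prod_NormedModule R_AbsRing R_NormedModule R_NormedModule)).

Lemma is_derive_selC j (f : R -> C * C) x (l : C * C) :
  is_derive (V := CCmod) f x l -> rderC (fun t => selC j (f t)) x (selC j l).
Proof.
  intros h. destruct j; unfold selC.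
  - apply (is_derive_snd (U := prod_NormedModule R_AbsRing R_NormedModule R_NormedModule) (V := prod_NormedModule R_AbsRing R_NormedModule R_NormedModule)) in h.
    split. apply (is_derive_fst (U := R_NormedModule) (V := R_NormedModule)) in h. exact h. apply (is_derive_snd (U := R_NormedModule) (V := R_NormedModule)) in h. exact h.
  - apply (is_derive_fst (U := prod_NormedModule R_AbsRing R_NormedModule R_NormedModule) (V := prod_NormedModule R_AbsRing R_NormedModule R_NormedModule)) in h.
    split. apply (is_derive_fst (U := R_NormedModule) (V := R_NormedModule)) in h. exact h. apply (is_derive_snd (U := R_NormedModule) (V := R_NormedModule)) in h. exact h.
Qed.

Lemma plus_scal_e1 (x : C * C) (t : R) : plus (x : CCmod) (scal t ((RtoC 1, RtoC 0) : CCmod)) = ((fst x + RtoC t)%C, snd x).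
Proof.
  destruct x as [[a b] [c d]]. unfold plus, scal; simpl. unfold prod_plus, prod_scal; simpl.
  unfold plus, scal, Cplus, RtoC; simpl. unfold prod_plus, prod_scal; simpl. unfold plus, scal, mult; simpl. unfold mult; simpl.
  f_equal; f_equal; ring.
Qed.

Lemma plus_scal_e2 (x : C * C) (t : R) : plus (x : CCmod) (scal t ((RtoC 0, RtoC 1) : CCmod)) = (fst x, (snd x + RtoC t)%C).
Proof.
  destruct x as [[a b] [c d]]. unfold plus, scal; simpl. unfold prod_plus, prod_scal; simpl.
  unfold plus, scal, Cplus, RtoC; simpl. unfold prod_plus, prod_scal; simpl. unfold plus, scal, mult; simpl. unfold mult; simpl.
  f_equal; f_equal; ring.
Qed.

Section Extract.
Variables (W : C * C -> Prop) (j : bool).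
Hypothesis hW : forall z, inclD2 z -> W z.

Lemma partial1_of_real (g dg : C * C -> C * C) F : holo_D2 F -> (forall z, inD2 z -> F z = selC j (g z)) ->
  (forall x : CCmod, W x -> is_derive (V := CCmod) (fun t : R => g (plus x (scal t ((RtoC 1, RtoC 0) : CCmod)))) 0 (dg x)) ->
  forall z, inD2 z -> hd1 F z (selC j (dg z)).
Proof.
  intros hF he hd z hz. destruct (proj1 (holo_D2_iff F) hF z hz) as [_ [[d k] _]].
  assert (e : d = selC j (dg z)); [|subst; exact k].
  apply (real_directional1 F z d (fun t => selC j (g (plus (z : CCmod) (scal t ((RtoC 1, RtoC 0) : CCmod)))))); auto.
  - apply is_derive_selC. apply hd. apply hW, inD2_incl; auto.
  - destruct (inD2_ball z hz) as [r [hr q]]. exists r. split; auto. intros t ht.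
    rewrite plus_scal_e1. symmetry. apply he. apply q; simpl.
    replace (fst z + RtoC t - fst z)%C with (RtoC t) by ring. rewrite Cmod_R; auto. rewrite Cmod_self; auto.
Qed.

Lemma partial2_of_real (g dg : C * C -> C * C) F : holo_D2 F -> (forall z, inD2 z -> F z = selC j (g z)) ->
  (forall x : CCmod, W x -> is_derive (V := CCmod) (fun t : R => g (plus x (scal t ((RtoC 0, RtoC 1) : CCmod)))) 0 (dg x)) ->
  forall z, inD2 z -> hd2 F z (selC j (dg z)).
Proof.
  intros hF he hd z hz. destruct (proj1 (holo_D2_iff F) hF z hz) as [_ [_ [d k]]].
  assert (e : d = selC j (dg z)); [|subst; exact k].
  apply (real_directional2 F z d (fun t => selC j (g (plus (z : CCmod) (scal t ((RtoC 0, RtoC 1) : CCmod)))))); auto.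
  - apply is_derive_selC. apply hd. apply hW, inD2_incl; auto.
  - destruct (inD2_ball z hz) as [r [hr q]]. exists r. split; auto. intros t ht.
    rewrite plus_scal_e2. symmetry. apply he. apply q; simpl.
    rewrite Cmod_self; auto. replace (snd z + RtoC t - snd z)%C with (RtoC t) by ring. rewrite Cmod_R; auto.
Qed.
End Extract.

(** The extension g agrees with phi on the closed bidisc, so its derivatives along the directions
    (1, 0) and (0, 1) are the complex partial derivatives inside. Their continuity on the
    neighbourhood W makes them uniformly continuous on the closed bidisc by compactness. *)
Lemma symbol_of_smooth (phi : C * C -> C * C) (j : bool) :
  holo_D2 (fun z => fst (phi z)) -> holo_D2 (fun z => snd (phi z)) -> (forall z, inD2 z -> inD2 (phi z)) ->
  Ck_closed_bidisc 3 phi -> exists F1 F2 F11 F12 F21 F22, symbol (phi_j phi j) F1 F2 F11 F12 F21 F22.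
Proof.
  intros h1 h2 hm [W [g [_ [hW [hg hCk]]]]].
  assert (hF : holo_D2 (phi_j phi j)) by (destruct j; [exact h2|exact h1]).
  destruct hCk as [c0 hk].
  assert (i1 : In (RtoC 1, RtoC 0) basisC2) by (simpl; auto).
  assert (i2 : In (RtoC 0, RtoC 1) basisC2) by (simpl; auto).
  destruct (hk _ i1) as [g1 [d1 [c1 k1]]]. destruct (hk _ i2) as [g2 [d2 [c2 k2]]].
  destruct (k1 _ i1) as [g11 [d11 [c11 _]]]. destruct (k1 _ i2) as [g12 [d12 [c12 _]]].
  destruct (k2 _ i1) as [g21 [d21 [c21 _]]]. destruct (k2 _ i2) as [g22 [d22 [c22 _]]].
  assert (e0 : forall z, inclD2 z -> phi_j phi j z = selC j (g z)).
  { intros z hz. rewrite hg by auto. destruct j; reflexivity. }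
  assert (p1 := partial1_of_real W j hW g g1 _ hF (fun z hz => e0 z (inD2_incl z hz)) d1).
  assert (p2 := partial2_of_real W j hW g g2 _ hF (fun z hz => e0 z (inD2_incl z hz)) d2).
  assert (hF1 := holo_partial1 _ _ hF p1). assert (hF2 := holo_partial2 _ _ hF p2).
  assert (uc : forall q : C * C -> C * C, (forall x : CCmod, W x -> continuous (T := CCmod) (U := CCmod) q x) -> ucont (fun z => selC j (q z))).
  { intros q hq. apply ucont_of_continuous. intros z hz. apply continuous_selC. apply hq. auto. }
  exists (fun z => selC j (g1 z)), (fun z => selC j (g2 z)), (fun z => selC j (g11 z)), (fun z => selC j (g12 z)), (fun z => selC j (g21 z)), (fun z => selC j (g22 z)).
  constructor; auto.
  - intros z hz. destruct (hm z hz). destruct j; auto.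
  - apply (partial1_of_real W j hW g1 g11); auto.
  - apply (partial2_of_real W j hW g1 g12); auto.
  - apply (partial1_of_real W j hW g2 g21); auto.
  - apply (partial2_of_real W j hW g2 g22); auto.
  - intros eps heps. destruct (uc g c0 eps heps) as [d [hd k]]. exists d. split; auto. intros. rewrite !e0; auto.
Qed.

(** * Taylor expansion on the distinguished boundary *)

Lemma ucont_const c : ucont (fun _ => c).
Proof. intros eps heps. exists 1. split. lra. intros. rewrite Cmod_self. auto. Qed.

Lemma ucont_fst : ucont fst.
Proof. intros eps heps. exists eps. auto. Qed.

Lemma ucont_snd : ucont snd.
Proof. intros eps heps. exists eps. auto. Qed.

Lemma ucont_plus f g : ucont f -> ucont g -> ucont (fun z => f z + g z)%C.
Proof.
  intros hf hg eps heps. destruct (hf _ (half_pos _ heps)) as [d1 [p1 k1]]. destruct (hg _ (half_pos _ heps)) as [d2 [p2 k2]].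
  exists (Rmin d1 d2). split. apply Rmin_pos; auto. intros z w hz hw a b.
  apply Rmin_Rgt in a. apply Rmin_Rgt in b. destruct a as [a1 a2]. destruct b as [b1 b2].
  specialize (k1 z w hz hw a1 b1). specialize (k2 z w hz hw a2 b2).
  replace (f z + g z - (f w + g w))%C with ((f z - f w) + (g z - g w))%C by ring.
  eapply Rle_lt_trans. apply Cmod_triangle. lra.
Qed.

Lemma ucont_mult f g : ucont f -> ucont g -> ucont (fun z => f z * g z)%C.
Proof.
  intros hf hg eps heps. destruct (ucont_bounded f hf) as [B1 [q1 b1]]. destruct (ucont_bounded g hg) as [B2 [q2 b2]].
  assert (p1 : 0 < eps / (2 * (B2 + 1))) by (apply Rdiv_lt_0_compat; lra).
  assert (p2 : 0 < eps / (2 * (B1 + 1))) by (apply Rdiv_lt_0_compat; lra).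
  destruct (hf _ p1) as [d1 [r1 k1]]. destruct (hg _ p2) as [d2 [r2 k2]].
  exists (Rmin d1 d2). split. apply Rmin_pos; auto. intros z w hz hw a b.
  apply Rmin_Rgt in a. apply Rmin_Rgt in b. destruct a as [a1 a2]. destruct b as [c1 c2].
  specialize (k1 z w hz hw a1 c1). specialize (k2 z w hz hw a2 c2).
  replace (f z * g z - f w * g w)%C with ((f z - f w) * g z + f w * (g z - g w))%C by ring.
  eapply Rle_lt_trans. apply Cmod_triangle. rewrite !Cmod_mult.
  specialize (b1 w hw). specialize (b2 z hz).
  apply Rlt_div_r in k1; [|lra]. apply Rlt_div_r in k2; [|lra].
  generalize (Cmod_ge_0 (f z - f w)) (Cmod_ge_0 (g z - g w)) (Cmod_ge_0 (f w)) (Cmod_ge_0 (g z)). intros.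
  assert (Cmod (f z - f w) * Cmod (g z) <= Cmod (f z - f w) * (B2 + 1)) by (apply Rmult_le_compat_l; lra).
  assert (Cmod (f w) * Cmod (g z - g w) <= (B1 + 1) * Cmod (g z - g w)) by (apply Rmult_le_compat_r; lra).
  lra.
Qed.

Lemma tor1_incl t1 t2 : inclD2 (tor 1 t1 t2).
Proof. split; simpl; rewrite Cmult_1_l, Cmod_expi; lra. Qed.

Lemma tor_incl r t1 t2 : 0 <= r <= 1 -> inclD2 (tor r t1 t2).
Proof. intros h. split; simpl; rewrite Cmod_mult, Cmod_expi, Cmod_RtoC_pos; lra. Qed.

Lemma tor_dil r t1 t2 : tor r t1 t2 = dil r (tor 1 t1 t2).
Proof. unfold tor, dil; simpl. f_equal; ring. Qed.

Lemma circle_near r t a : 0 <= r <= 1 -> Cmod (RtoC r * expi t - RtoC 1 * expi a) <= (1 - r) + 2 * Rabs (t - a).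
Proof.
  intros hr. replace (RtoC r * expi t - RtoC 1 * expi a)%C with ((expi t - expi a) - RtoC (1 - r) * expi t)%C by (rewrite RtoC_minus; ring).
  eapply Rle_trans. apply Cmod_sub_le. rewrite Cmod_mult, Cmod_expi, Cmod_RtoC_pos by lra.
  generalize (expi_lip t a). lra.
Qed.

Lemma ucont_near_tor f a1 a2 eps : ucont f -> 0 < eps ->
  exists d, 0 < d /\ forall r t1 t2, 1 - d <= r <= 1 -> 0 <= r -> Rabs (t1 - a1) <= d -> Rabs (t2 - a2) <= d -> Cmod (f (tor r t1 t2) - f (tor 1 a1 a2)) < eps.
Proof.
  intros hf heps. destruct (hf eps heps) as [d [hd k]]. exists (d / 4). split. lra.
  intros r t1 t2 hr hr0 h1 h2. apply k. apply tor_incl; lra. apply tor1_incl.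
  - simpl. eapply Rle_lt_trans. apply circle_near; lra. lra.
  - simpl. eapply Rle_lt_trans. apply circle_near; lra. lra.
Qed.

Lemma tor_rderC1 r x b s : rderC (fun s => (RtoC r * expi (x + s * b))%C) s (Ci * RtoC b * (RtoC r * expi (x + s * b)))%C.
Proof.
  eapply rderC_eq. apply rderC_mult. apply rderC_const. apply rderC_expi.
  instantiate (1 := b). auto_derive; auto; ring. cbv beta. ring.
Qed.

Lemma rderC_torus G G1 G2 r x1 x2 b1 b2 s : holo_D2 G -> (forall z, inD2 z -> hd1 G z (G1 z)) -> (forall z, inD2 z -> hd2 G z (G2 z)) -> 0 <= r < 1 ->
  rderC (fun s => G (tor r (x1 + s * b1) (x2 + s * b2))) s
    (let z := tor r (x1 + s * b1) (x2 + s * b2) in Ci * (RtoC b1 * (fst z * G1 z) + RtoC b2 * (snd z * G2 z)))%C.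
Proof.
  intros hG h1 h2 hr. eapply rderC_eq.
  apply (rderC_comp2 G (fun s => RtoC r * expi (x1 + s * b1))%C (fun s => RtoC r * expi (x2 + s * b2))%C).
  - apply (holo_diff2 G G1 (G2 (tor r (x1 + s * b1) (x2 + s * b2)))); auto. apply (h2 (tor r (x1 + s * b1) (x2 + s * b2))). all: apply (tor_inD2 r (x1 + s * b1) (x2 + s * b2)); auto.
  - apply tor_rderC1.
  - apply tor_rderC1.
  - unfold tor; simpl. ring.
Qed.

(** The mean value inequality is used twice, for m1 s - kap s and then for m minus its quadratic
    polynomial. Only closeness of m2 to kap is needed, which holds uniformly in the radius of the
    torus. *)
Lemma taylor2_real (m m1 m2 : R -> R) (t kap eps : R) :
  (forall s, is_derive m s (m1 s)) -> (forall s, is_derive m1 s (m2 s)) -> (forall s, Rabs s <= Rabs t -> Rabs (m2 s - kap) <= eps) ->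
  Rabs (m t - m 0 - t * m1 0 - kap * t ^ 2 / 2) <= eps * t ^ 2.
Proof.
  intros h1 h2 hb.
  assert (k1 : forall s, Rabs s <= Rabs t -> Rabs (m1 s - m1 0 - kap * s) <= eps * Rabs t).
  { intros s hs.
    assert (K : Rabs ((m1 s - kap * s) - (m1 0 - kap * 0)) <= eps * Rabs (s - 0)).
    { apply (bounded_variation (fun s => m1 s - kap * s) (fun s => m2 s - kap)). intros u hu. split.
      - apply (is_derive_minus (V := R_NormedModule) m1 (fun s => kap * s)); auto. auto_derive; auto; ring.
      - apply hb. rewrite !Rminus_0_r in hu. lra. }
    replace (m1 s - m1 0 - kap * s) with ((m1 s - kap * s) - (m1 0 - kap * 0)) by ring. rewrite Rminus_0_r in K.
    eapply Rle_trans. exact K. apply Rmult_le_compat_l; auto.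
    specialize (hb 0). rewrite Rabs_R0 in hb. eapply Rle_trans. apply Rabs_pos. apply hb. apply Rabs_pos. }
  assert (K : Rabs ((m t - t * m1 0 - kap * t ^ 2 / 2) - (m 0 - 0 * m1 0 - kap * 0 ^ 2 / 2)) <= (eps * Rabs t) * Rabs (t - 0)).
  { apply (bounded_variation (fun s => m s - s * m1 0 - kap * s ^ 2 / 2) (fun s => m1 s - m1 0 - kap * s)). intros u hu. split.
    - apply (is_derive_minus (V := R_NormedModule) (fun s => m s - s * m1 0) (fun s => kap * s ^ 2 / 2)).
      + apply (is_derive_minus (V := R_NormedModule) m (fun s => s * m1 0)); auto. auto_derive; auto; ring.
      + auto_derive; auto. field.
    - apply k1. rewrite !Rminus_0_r in hu. lra. }
  replace (m t - m 0 - t * m1 0 - kap * t ^ 2 / 2) with ((m t - t * m1 0 - kap * t ^ 2 / 2) - (m 0 - 0 * m1 0 - kap * 0 ^ 2 / 2)) by field.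
  eapply Rle_trans. exact K. rewrite Rminus_0_r. rewrite <- (pow2_abs t). right; ring.
Qed.

(** Adding kap s^2 / 2 leaves a concave function, to which the midpoint inequality applies; the gain
    is kap / 2 - kap / 4 = kap / 4. *)
Lemma concave_midpoint (m m1 m2 : R -> R) (kap : R) :
  (forall s, is_derive m s (m1 s)) -> (forall s, is_derive m1 s (m2 s)) -> (forall s, 0 <= s <= 1 -> m2 s <= - kap) ->
  m 0 + m 1 <= 2 * m (1 / 2) - kap / 4.
Proof.
  intros h1 h2 hb.
  set (g := fun s => m s + kap * s ^ 2 / 2). set (g1 := fun s => m1 s + kap * s).
  assert (hg : forall s, is_derive g s (g1 s)).
  { intro s. apply (is_derive_plus (V := R_NormedModule) m (fun s => kap * s ^ 2 / 2)); auto. auto_derive; auto; field. }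
  assert (hg1 : forall s, is_derive g1 s (m2 s + kap)).
  { intro s. apply (is_derive_plus (V := R_NormedModule) m1 (fun s => kap * s)); auto. auto_derive; auto; ring. }
  assert (mvt : forall (f f' : R -> R) a b, a <= b -> (forall s, is_derive f s (f' s)) -> exists c, a <= c <= b /\ f b - f a = f' c * (b - a)).
  { intros f f' a b hab hf. destruct (MVT_gen f a b f') as [c [hc k]]; auto.
    - intros x _. apply continuity_pt_filterlim. apply (ex_derive_continuous (K := R_AbsRing) (V := R_NormedModule)). eexists; apply hf.
    - rewrite Rmin_left, Rmax_right in hc by lra. exists c; auto. }
  destruct (mvt g g1 0 (1 / 2)) as [c0 [hc0 k0]]; auto; try lra.
  destruct (mvt g g1 (1 / 2) 1) as [c1 [hc1 k1]]; auto; try lra.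
  destruct (mvt g1 (fun s => m2 s + kap) c0 c1) as [c2 [hc2 k2]]; auto; try lra.
  assert (g1 c1 - g1 c0 <= 0). { rewrite k2. specialize (hb c2 ltac:(lra)). nra. }
  unfold g in k0, k1. lra.
Qed.

(** * Angular derivatives of a symbol *)

Section Symbol.
Variables (F F1 F2 F11 F12 F21 F22 : C * C -> C).
Hypothesis sy : symbol F F1 F2 F11 F12 F21 F22.

(** On the torus the derivative of F in the j-th angle is i times z_j dF/dz_j; [dir1] and [dir2] are
    the first and second derivatives of F along a line of direction (b1, b2) in the angles. *)
Definition tang1 (z : C * C) : C := (fst z * F1 z)%C.
Definition tang2 (z : C * C) : C := (snd z * F2 z)%C.
Definition hess11 (z : C * C) : C := (fst z * (fst z * F11 z + F1 z))%C.
(** The coefficient of b1 b2 in the second derivative. Both mixed derivatives are kept, so that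
    their equality does not have to be proved. *)
Definition hess12 (z : C * C) : C := (fst z * snd z * (F12 z + F21 z))%C.
Definition hess22 (z : C * C) : C := (snd z * (snd z * F22 z + F2 z))%C.
Definition dir1 (b1 b2 : R) (z : C * C) : C := (Ci * (RtoC b1 * tang1 z + RtoC b2 * tang2 z))%C.
Definition dir2 (b1 b2 : R) (z : C * C) : C :=
  (- (RtoC (b1 ^ 2) * hess11 z + RtoC (b1 * b2) * hess12 z + RtoC (b2 ^ 2) * hess22 z))%C.

Lemma ucont_tang1 : ucont tang1.
Proof. apply ucont_mult. apply ucont_fst. apply (sy_u1 _ _ _ _ _ _ _ sy). Qed.
Lemma ucont_tang2 : ucont tang2.
Proof. apply ucont_mult. apply ucont_snd. apply (sy_u2 _ _ _ _ _ _ _ sy). Qed.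
Lemma ucont_hess11 : ucont hess11.
Proof. apply ucont_mult. apply ucont_fst. apply ucont_plus. apply ucont_mult. apply ucont_fst. apply (sy_u11 _ _ _ _ _ _ _ sy). apply (sy_u1 _ _ _ _ _ _ _ sy). Qed.
Lemma ucont_hess12 : ucont hess12.
Proof. apply ucont_mult. apply ucont_mult. apply ucont_fst. apply ucont_snd. apply ucont_plus. apply (sy_u12 _ _ _ _ _ _ _ sy). apply (sy_u21 _ _ _ _ _ _ _ sy). Qed.
Lemma ucont_hess22 : ucont hess22.
Proof. apply ucont_mult. apply ucont_snd. apply ucont_plus. apply ucont_mult. apply ucont_snd. apply (sy_u22 _ _ _ _ _ _ _ sy). apply (sy_u2 _ _ _ _ _ _ _ sy). Qed.

Lemma ucont_dir1 b1 b2 : ucont (dir1 b1 b2).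
Proof.
  apply ucont_mult. apply ucont_const. apply ucont_plus; apply ucont_mult; try apply ucont_const. apply ucont_tang1. apply ucont_tang2.
Qed.

Lemma ucont_dir2 b1 b2 : ucont (dir2 b1 b2).
Proof.
  intros eps heps. assert (k : ucont (fun z => RtoC (b1 ^ 2) * hess11 z + RtoC (b1 * b2) * hess12 z + RtoC (b2 ^ 2) * hess22 z)%C).
  { apply ucont_plus. apply ucont_plus. all: apply ucont_mult; try apply ucont_const. apply ucont_hess11. apply ucont_hess12. apply ucont_hess22. }
  destruct (k eps heps) as [d [hd q]]. exists d. split; auto. intros z w hz hw a b.
  unfold dir2. match goal with |- Cmod (- ?X - - ?Y) < _ => replace (- X - - Y)%C with (- (X - Y))%C by ring end.
  rewrite Cmod_opp. apply q; auto.
Qed.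

Lemma rderC_line r x1 x2 b1 b2 s : 0 <= r < 1 ->
  rderC (fun s => F (tor r (x1 + s * b1) (x2 + s * b2))) s (dir1 b1 b2 (tor r (x1 + s * b1) (x2 + s * b2))).
Proof. intros hr. apply (rderC_torus F F1 F2); auto; apply sy. Qed.

Lemma rderC_line2 r x1 x2 b1 b2 s : 0 <= r < 1 ->
  rderC (fun s => dir1 b1 b2 (tor r (x1 + s * b1) (x2 + s * b2))) s (dir2 b1 b2 (tor r (x1 + s * b1) (x2 + s * b2))).
Proof.
  intros hr.
  assert (q1 := rderC_torus F1 F11 F12 r x1 x2 b1 b2 s (sy_holo1 _ _ _ _ _ _ _ sy) (sy_d11 _ _ _ _ _ _ _ sy) (sy_d12 _ _ _ _ _ _ _ sy) hr).
  assert (q2 := rderC_torus F2 F21 F22 r x1 x2 b1 b2 s (sy_holo2 _ _ _ _ _ _ _ sy) (sy_d21 _ _ _ _ _ _ _ sy) (sy_d22 _ _ _ _ _ _ _ sy) hr).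
  eapply rderC_eq.
  - unfold dir1, tang1, tang2. apply rderC_mult. apply rderC_const. apply rderC_plus.
    + apply rderC_mult. apply rderC_const. apply rderC_mult. apply tor_rderC1. exact q1.
    + apply rderC_mult. apply rderC_const. apply rderC_mult. apply tor_rderC1. exact q2.
  - cbv beta zeta. unfold dir2, hess11, hess12, hess22. set (z := tor r (x1 + s * b1) (x2 + s * b2)).
    change (RtoC r * expi (x1 + s * b1))%C with (fst z). change (RtoC r * expi (x2 + s * b2))%C with (snd z).
    rewrite !RtoC_pow, RtoC_mult.
    assert (hi : (Ci * Ci)%C = (- RtoC 1)%C) by (unfold Ci, Cmult, Copp, RtoC; simpl; f_equal; ring).
    transitivity ((Ci * Ci) * (RtoC b1 ^ 2 * (fst z * (fst z * F11 z + F1 z)) + RtoC b1 * RtoC b2 * (fst z * snd z * (F12 z + F21 z)) + RtoC b2 ^ 2 * (snd z * (snd z * F22 z + F2 z))))%C. ring.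
    rewrite hi. ring.
Qed.

(** Holomorphy and the chain rule hold only inside, while the expansion is wanted on the
    distinguished boundary. It is proved on tori of radius r < 1 with a remainder independent of r,
    because the second derivative is uniformly continuous, and then r tends to 1. *)
Lemma boundary_taylor (c : C) a1 a2 b1 b2 : Cmod c = 1 -> forall eps, 0 < eps -> exists t0, 0 < t0 /\ forall t, Rabs t <= t0 ->
  Rabs (Re (c * F (tor 1 (a1 + t * b1) (a2 + t * b2))) - Re (c * F (tor 1 a1 a2)) - t * Re (c * dir1 b1 b2 (tor 1 a1 a2)) - Re (c * dir2 b1 b2 (tor 1 a1 a2)) * t ^ 2 / 2) <= eps * t ^ 2.
Proof.
  intros hc eps heps.
  destruct (ucont_near_tor _ a1 a2 eps (ucont_dir2 b1 b2) heps) as [d [hd kd]].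
  set (B := Rabs b1 + Rabs b2 + 1). assert (hB : 1 <= B /\ Rabs b1 <= B /\ Rabs b2 <= B) by (unfold B; generalize (Rabs_pos b1) (Rabs_pos b2); lra).
  exists (d / B). split. apply Rdiv_lt_0_compat; lra. intros t ht.
  apply le_of_forall_eps with (2 + Rabs t). generalize (Rabs_pos t); lra.
  intros e he.
  destruct (ucont_dil F (sy_u _ _ _ _ _ _ _ sy) e he) as [s1 [hs1 k1]].
  destruct (ucont_dil _ (ucont_dir1 b1 b2) e he) as [s2 [hs2 k2]].
  (* Close enough to 1 for dilation to change F and its first derivative by less than e, and for the
     second derivative to be within eps of its value at the contact point. *)
  set (r := Rmax (Rmax s1 s2) (Rmax 0 (1 - d))).
  assert (hr : s1 <= r /\ s2 <= r /\ 0 <= r /\ 1 - d <= r /\ r < 1).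
  { unfold r. repeat split.
    eapply Rle_trans; [apply Rmax_l|apply Rmax_l]. eapply Rle_trans; [apply Rmax_r|apply Rmax_l].
    eapply Rle_trans; [apply Rmax_l|apply Rmax_r]. eapply Rle_trans; [apply Rmax_r|apply Rmax_r].
    repeat apply Rmax_lub_lt; lra. }
  assert (T := taylor2_real (fun s => Re (c * F (tor r (a1 + s * b1) (a2 + s * b2)))) (fun s => Re (c * dir1 b1 b2 (tor r (a1 + s * b1) (a2 + s * b2))))
    (fun s => Re (c * dir2 b1 b2 (tor r (a1 + s * b1) (a2 + s * b2)))) t (Re (c * dir2 b1 b2 (tor 1 a1 a2))) eps).
  cbv beta in T. rewrite !Rmult_0_l, !Rplus_0_r in T.
  assert (T' : Rabs (Re (c * F (tor r (a1 + t * b1) (a2 + t * b2))) - Re (c * F (tor r a1 a2)) - t * Re (c * dir1 b1 b2 (tor r a1 a2)) - Re (c * dir2 b1 b2 (tor 1 a1 a2)) * t ^ 2 / 2) <= eps * t ^ 2).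
  { apply T; clear T.
    - intro s. apply rderC_Re_scal. apply rderC_line; lra.
    - intro s. apply rderC_Re_scal. apply rderC_line2; lra.
    - intros s hs. rewrite <- Re_minus. eapply Rle_trans. apply re_le_Cmod.
      replace (c * dir2 b1 b2 (tor r (a1 + s * b1) (a2 + s * b2)) - c * dir2 b1 b2 (tor 1 a1 a2))%C with (c * (dir2 b1 b2 (tor r (a1 + s * b1) (a2 + s * b2)) - dir2 b1 b2 (tor 1 a1 a2)))%C by ring.
      rewrite Cmod_mult, hc, Rmult_1_l. left.
      assert (hsB : forall b, Rabs b <= B -> Rabs (s * b) <= d).
      { intros b hb. rewrite Rabs_mult. apply Rle_trans with (d / B * B). apply Rmult_le_compat; try apply Rabs_pos; lra. right; field; lra. }
      apply kd; try lra. replace (a1 + s * b1 - a1) with (s * b1) by ring. apply hsB; lra. replace (a2 + s * b2 - a2) with (s * b2) by ring. apply hsB; lra. }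
  assert (cl : forall (G : C * C -> C) s0, (forall s z, s0 <= s < 1 -> inclD2 z -> Cmod (G (dil s z) - G z) < e) -> s0 <= r -> forall u v, Rabs (Re (c * G (tor r u v)) - Re (c * G (tor 1 u v))) <= e).
  { intros G s0 kG hs u v. rewrite <- Re_minus. eapply Rle_trans. apply re_le_Cmod.
    replace (c * G (tor r u v) - c * G (tor 1 u v))%C with (c * (G (tor r u v) - G (tor 1 u v)))%C by ring.
    rewrite Cmod_mult, hc, Rmult_1_l, tor_dil. left. apply kG. lra. apply tor1_incl. }
  pose proof (cl F s1 k1 ltac:(lra) (a1 + t * b1) (a2 + t * b2)) as e1.
  pose proof (cl F s1 k1 ltac:(lra) a1 a2) as e2.
  pose proof (cl (dir1 b1 b2) s2 k2 ltac:(lra) a1 a2) as e3.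
  set (X1 := Re (c * F (tor r (a1 + t * b1) (a2 + t * b2)))) in *. set (X2 := Re (c * F (tor r a1 a2))) in *. set (X3 := Re (c * dir1 b1 b2 (tor r a1 a2))) in *.
  set (Y1 := Re (c * F (tor 1 (a1 + t * b1) (a2 + t * b2)))) in *. set (Y2 := Re (c * F (tor 1 a1 a2))) in *. set (Y3 := Re (c * dir1 b1 b2 (tor 1 a1 a2))) in *.
  set (Z := Re (c * dir2 b1 b2 (tor 1 a1 a2)) * t ^ 2 / 2) in *.
  replace (Y1 - Y2 - t * Y3 - Z) with ((X1 - X2 - t * X3 - Z) + (- (X1 - Y1) + (X2 - Y2) + t * (X3 - Y3))) by ring.
  eapply Rle_trans. apply Rabs_triang. apply Rplus_le_compat; auto.
  eapply Rle_trans. apply Rabs_triang. eapply Rle_trans. apply Rplus_le_compat_r. apply Rabs_triang.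
  rewrite Rabs_Ropp, Rabs_mult. assert (Rabs t * Rabs (X3 - Y3) <= Rabs t * e) by (apply Rmult_le_compat_l; auto; apply Rabs_pos). lra.
Qed.
End Symbol.

Lemma psi_of_tor F a1 a2 t1 t2 : psi_of F (tor 1 a1 a2) (t1, t2) = (Cconj (F (tor 1 a1 a2)) * F (tor 1 (a1 + t1) (a2 + t2)))%C.
Proof.
  unfold psi_of, phitilde. f_equal. f_equal. unfold tor; simpl. rewrite !expi_plus. f_equal; ring.
Qed.

Lemma posdef_lower_bound a b c : signature_2_0 a b c -> exists kap, 0 < kap /\ forall b1 b2, kap * (b1 ^ 2 + b2 ^ 2) <= quad a b c (b1, b2).
Proof.
  intros h.
  assert (ha : 0 < a). { specialize (h (1, 0)). unfold quad in h; simpl in h. assert ((1, 0) <> (0, 0)) by (intro e; injection e; lra). specialize (h H). lra. }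
  assert (hc : 0 < c). { specialize (h (0, 1)). unfold quad in h; simpl in h. assert ((0, 1) <> (0, 0)) by (intro e; injection e; lra). specialize (h H). lra. }
  assert (hd : b ^ 2 < 4 * a * c).
  (* At this vector the form takes the value a (4 a c - b^2). *)
  { specialize (h (b, - 2 * a)). unfold quad in h; simpl in h.
    assert ((b, - 2 * a) <> (0, 0)) by (intro e; injection e; lra). specialize (h H).
    replace (a * (b * (b * 1)) + b * b * (- 2 * a) + c * (- 2 * a * (- 2 * a * 1))) with (a * (4 * a * c - b ^ 2)) in h by ring.
    apply Rmult_lt_reg_l with a; nra. }
  set (D := 4 * a * c - b ^ 2). assert (0 < D) by (unfold D; lra).
  (* Determinant over trace of the symmetric matrix, a lower bound for its smallest eigenvalue. *)
  exists (D / (4 * (a + c))). split. apply Rdiv_lt_0_compat; lra.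
  intros x y. unfold quad; simpl fst; simpl snd.
  apply Rmult_le_reg_l with (4 * (a + c)). lra.
  replace (4 * (a + c) * (D / (4 * (a + c)) * (x ^ 2 + y ^ 2))) with (D * (x ^ 2 + y ^ 2)) by (field; lra).
  unfold D.
  assert (0 <= (2 * a * x + b * y) ^ 2) by apply pow2_ge_0. assert (0 <= (b * x + 2 * c * y) ^ 2) by apply pow2_ge_0. nra.
Qed.

(** Uniqueness of a second-order expansion along a line, used to compare the expansion in the
    definition of order 2 with the one given by derivatives. *)
Lemma linear_quadratic_vanish (L q : R) : (forall eps, 0 < eps -> exists t0, 0 < t0 /\ forall t, Rabs t <= t0 -> Rabs (t * L + q * t ^ 2) <= eps * t ^ 2) -> L = 0 /\ q = 0.
Proof.
  intros h.
  assert (hL : L = 0).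
  { apply eq_of_forall_eps with (2 + Rabs q). generalize (Rabs_pos q); lra. intros e he. rewrite Rminus_0_r.
    destruct (h 1 Rlt_0_1) as [t0 [p k]]. set (t := Rmin t0 e). assert (0 < t) by (apply Rmin_pos; auto).
    specialize (k t). rewrite Rabs_pos_eq in k by lra. specialize (k (Rmin_l _ _)).
    assert (ht : t <= e) by apply Rmin_r.
    apply Rmult_le_reg_l with t; auto.
    replace (t * Rabs L) with (Rabs (t * L)) by (rewrite Rabs_mult, (Rabs_pos_eq t); lra).
    replace (t * L) with ((t * L + q * t ^ 2) + - (q * t ^ 2)) by ring.
    eapply Rle_trans. apply Rabs_triang. rewrite Rabs_Ropp, Rabs_mult, (Rabs_pos_eq (t ^ 2)) by (apply pow2_ge_0).
    assert (Rabs q * t ^ 2 <= Rabs q * (t * e)) by (apply Rmult_le_compat_l; [apply Rabs_pos|simpl; nra]).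
    assert (0 <= Rabs q) by apply Rabs_pos. nra. }
  split; auto. subst L.
  apply eq_of_forall_eps with 1. lra. intros e he. destruct (h e he) as [t0 [p k]]. specialize (k t0). rewrite Rabs_pos_eq in k by lra. specialize (k (Rle_refl _)).
  replace (t0 * 0 + q * t0 ^ 2) with (q * t0 ^ 2) in k by ring.
  rewrite Rabs_mult, (Rabs_pos_eq (t0 ^ 2)) in k by apply pow2_ge_0. rewrite Rminus_0_r.
  assert (0 < t0 ^ 2) by (apply pow_lt; auto). apply Rmult_le_reg_r with (t0 ^ 2); lra.
Qed.

(** * Symbols at a contact point *)

Section Symbol2.
Variables (F F1 F2 F11 F12 F21 F22 : C * C -> C).
Hypothesis sy : symbol F F1 F2 F11 F12 F21 F22.
Notation D1 := (dir1 F1 F2).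
Notation D2 := (dir2 F1 F2 F11 F12 F21 F22).

Lemma symbol_closed_bound z : inclD2 z -> Cmod (F z) <= 1.
Proof.
  intros hz. apply le_of_forall_eps with 1. lra. intros e he.
  destruct (ucont_dil F (sy_u _ _ _ _ _ _ _ sy) e he) as [s [hs k]]. specialize (k s z ltac:(lra) hz).
  pose proof (sy_maps _ _ _ _ _ _ _ sy (dil s z) (dil_inD2 s z hs hz)).
  generalize (Cmod_triangle_inv (F z) (F (dil s z))). rewrite (Cmod_sub_sym (F z)). lra.
Qed.

(** Along the line t (b1, b2), Re psi has the expansion of [boundary_taylor] and also 1 - Q +
    o(t^2). Comparison kills the linear term and identifies the second derivative with -2 Q(b),
    where Q >= kap |b|^2. *)
Lemma order2_facts a1 a2 : Cmod (F (tor 1 a1 a2)) = 1 -> truly_2d_order2 F (tor 1 a1 a2) ->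
  exists kap, 0 < kap /\ forall b1 b2,
    Re (Cconj (F (tor 1 a1 a2)) * D1 b1 b2 (tor 1 a1 a2)) = 0 /\
    Re (Cconj (F (tor 1 a1 a2)) * D2 b1 b2 (tor 1 a1 a2)) <= - (2 * kap) * (b1 ^ 2 + b2 ^ 2).
Proof.
  intros h1 [_ [a [b [c [hQ hpd]]]]]. destruct (posdef_lower_bound a b c hpd) as [kap [hk kq]].
  exists kap. split; auto. intros b1 b2.
  set (xi := tor 1 a1 a2) in *. set (c0 := Cconj (F xi)) in *.
  assert (hc0 : Cmod c0 = 1) by (unfold c0; rewrite Cmod_conj; auto).
  assert (hc1 : Re (c0 * F xi) = 1) by (unfold c0; rewrite Cconj_mult_self, h1; simpl; ring).
  destruct (linear_quadratic_vanish (Re (c0 * D1 b1 b2 xi)) (Re (c0 * D2 b1 b2 xi) / 2 + quad a b c (b1, b2))) as [v1 v2].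
  - intros eps heps. set (N := b1 ^ 2 + b2 ^ 2 + 1).
    assert (hN : 1 <= N) by (unfold N; generalize (pow2_ge_0 b1) (pow2_ge_0 b2); lra).
    destruct (boundary_taylor _ _ _ _ _ _ _ sy c0 a1 a2 b1 b2 hc0 (eps / 2) (half_pos _ heps)) as [t1 [p1 k1]].
    destruct (hQ (eps / (2 * N))) as [d [pd kd]]. apply Rdiv_lt_0_compat; lra.
    exists (Rmin t1 (d / (2 * N))). split. apply Rmin_pos; auto. apply Rdiv_lt_0_compat; lra.
    intros t ht. assert (ht1 : Rabs t <= t1) by (eapply Rle_trans; [exact ht|apply Rmin_l]).
    assert (ht2 : Rabs t <= d / (2 * N)) by (eapply Rle_trans; [exact ht|apply Rmin_r]).
    specialize (k1 t ht1). fold xi in k1. rewrite hc1 in k1.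
    assert (E : (t * b1) ^ 2 + (t * b2) ^ 2 = t ^ 2 * (b1 ^ 2 + b2 ^ 2)) by ring.
    specialize (kd (t * b1, t * b2)). simpl fst in kd; simpl snd in kd. rewrite E in kd.
    assert (small : t ^ 2 * (b1 ^ 2 + b2 ^ 2) < d ^ 2).
    { apply Rle_lt_trans with ((d / (2 * N)) ^ 2 * N).
      apply Rmult_le_compat. apply pow2_ge_0. generalize (pow2_ge_0 b1) (pow2_ge_0 b2); lra.
      rewrite <- (pow2_abs t). apply pow_incr. split; auto. apply Rabs_pos. unfold N; lra.
      replace ((d / (2 * N)) ^ 2 * N) with (d ^ 2 / (4 * N)) by (field; lra).
      apply Rlt_div_l. lra. assert (0 < d ^ 2) by (apply pow_lt; auto). nra. }
    specialize (kd small). unfold xi in kd at 1. rewrite psi_of_tor in kd. fold xi in kd. fold c0 in kd.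
    replace (quad a b c (t * b1, t * b2)) with (t ^ 2 * quad a b c (b1, b2)) in kd by (unfold quad; simpl; ring).
    assert (hN2 : eps / (2 * N) * (t ^ 2 * (b1 ^ 2 + b2 ^ 2)) <= eps / 2 * t ^ 2).
    { replace (eps / 2 * t ^ 2) with (eps / (2 * N) * (t ^ 2 * N)) by (field; lra). apply Rmult_le_compat_l.
      left; apply Rdiv_lt_0_compat; lra. apply Rmult_le_compat_l. apply pow2_ge_0. unfold N; lra. }
    set (X := Re (c0 * F (tor 1 (a1 + t * b1) (a2 + t * b2)))) in *.
    set (q := quad a b c (b1, b2)) in *. set (e1 := Re (c0 * D1 b1 b2 xi)) in *. set (e2 := Re (c0 * D2 b1 b2 xi)) in *.
    apply Rabs_le_between in k1. apply Rabs_le_between in kd. apply Rabs_le. split; nra.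
  - split; auto. specialize (kq b1 b2). nra.
Qed.

(** At the diagonal point (s, s) the derivative of [phitilde] is a unimodular multiple of conj (F
    xi) times F2 at (s xi_1, s xi_2). If F2 vanished at xi it would tend to 0 as s tends to 1,
    against the nonzero limit l. *)
Lemma dz2_tang2 a1 a2 : dz2_nonzero_at_e (phitilde F (tor 1 a1 a2)) -> tang2 F2 (tor 1 a1 a2) <> RtoC 0.
Proof.
  intros [d [l [hl [hd hlim]]]] h0. set (xi := tor 1 a1 a2) in *.
  assert (hm1 : Cmod (fst xi) = 1) by (simpl; rewrite Cmult_1_l; apply Cmod_expi).
  assert (hm2 : Cmod (snd xi) = 1) by (simpl; rewrite Cmult_1_l; apply Cmod_expi).
  assert (hF2 : F2 xi = RtoC 0).
  { unfold tang2 in h0. apply Cmod_eq_0. rewrite <- (Rmult_1_l (Cmod (F2 xi))), <- hm2, <- Cmod_mult, h0. apply Cmod_0. }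
  apply Cmod_gt_0 in hl.
  assert (hloc : locally e2 (fun z => inD2 z -> Cmod (d z - l) < Cmod l / 2)).
  { apply (hlim (fun w => Cmod (w - l) < Cmod l / 2)). apply locally_C_iff. exists (Cmod l / 2). split; auto. lra. }
  apply locally_CC_iff in hloc. destruct hloc as [dl [hdl k]].
  assert (hb := symbol_closed_bound xi (tor1_incl a1 a2)).
  destruct (sy_u2 _ _ _ _ _ _ _ sy (Cmod l / 2) ltac:(lra)) as [dd [hdd kk]].
  set (s := Rmax (1 / 2) (1 - Rmin dl dd / 2)).
  assert (hs : 1 / 2 <= s < 1). { unfold s. split. apply Rmax_l. apply Rmax_lub_lt. lra. assert (0 < Rmin dl dd) by (apply Rmin_pos; auto). lra. }
  assert (hs2 : 1 - s < dl /\ 1 - s < dd).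
  { assert (1 - Rmin dl dd / 2 <= s) by apply Rmax_r. assert (0 < Rmin dl dd) by (apply Rmin_pos; auto).
    generalize (Rmin_l dl dd) (Rmin_r dl dd). lra. }
  set (z := (RtoC s, RtoC s) : C * C).
  assert (hz : inD2 z) by (split; unfold inD; simpl; rewrite Cmod_RtoC_pos; lra).
  assert (hs1 : Cmod (RtoC s - RtoC 1) = 1 - s).
  { rewrite <- RtoC_minus, Cmod_R, Rabs_left1; lra. }
  specialize (k z). simpl in k. rewrite hs1 in k. specialize (k ltac:(lra) ltac:(lra) hz).
  set (zz := ((fst xi * RtoC s)%C, (snd xi * RtoC s)%C) : C * C).
  assert (hzz : inD2 zz) by (split; unfold inD; simpl; rewrite !Cmod_mult, ?Cmod_1, ?Cmod_expi, Cmod_RtoC_pos; lra).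
  assert (D : cder (fun w => phitilde F xi (fst z, w)) (snd z) (Cconj (F xi) * (F2 zz * snd xi))%C).
  { unfold phitilde. replace (Cconj (F xi) * (F2 zz * snd xi))%C with (0 * F ((fst xi * RtoC s)%C, (snd xi * RtoC s)%C) + Cconj (F xi) * (F2 zz * snd xi))%C by ring.
    apply (cder_mult (fun _ => Cconj (F xi)) (fun w => F ((fst xi * fst z)%C, (snd xi * w)%C))). apply cder_const.
    apply (cder_comp (fun v => F ((fst xi * fst z)%C, v)) (fun w => snd xi * w)%C).
    - assert (X := cder_mult (fun _ => snd xi) (fun w => w) (RtoC s) _ _ (cder_const (snd xi) (RtoC s)) (cder_id (RtoC s))).
      cbv beta in X. replace (0 * RtoC s + snd xi * 1)%C with (snd xi) in X by ring. exact X.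
    - apply (sy_d2 _ _ _ _ _ _ _ sy zz hzz). }
  specialize (hd z hz). apply is_derive_C_iff in hd. rewrite (cder_unique _ _ _ _ hd D) in k.
  assert (s2 : Cmod (Cconj (F xi) * (F2 zz * snd xi)) < Cmod l / 2).
  { rewrite !Cmod_mult, Cmod_conj, hm2, Rmult_1_r. apply Rle_lt_trans with (1 * Cmod (F2 zz)). apply Rmult_le_compat_r; auto; apply Cmod_ge_0.
    rewrite Rmult_1_l. replace (F2 zz) with (F2 zz - F2 xi)%C by (rewrite hF2; ring). apply kk.
    apply inD2_incl; auto. apply tor1_incl.
    - simpl. replace (1 * expi a1 * RtoC s - 1 * expi a1)%C with (expi a1 * (RtoC s - RtoC 1))%C by ring. rewrite Cmod_mult, Cmod_expi, hs1. lra.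
    - simpl. replace (1 * expi a2 * RtoC s - 1 * expi a2)%C with (expi a2 * (RtoC s - RtoC 1))%C by ring. rewrite Cmod_mult, Cmod_expi, hs1. lra. }
  generalize (Cmod_triangle_inv l (Cconj (F xi) * (F2 zz * snd xi))). rewrite (Cmod_sub_sym l). lra.
Qed.

(** The unimodular factor varies together with the point, since eta runs near F xi and not only
    through it. *)
Lemma near_product f a1 a2 c0 eps : ucont f -> Cmod c0 = 1 -> 0 < eps ->
  exists d, 0 < d /\ forall c r t1 t2, Cmod (c - c0) <= d -> 1 - d <= r <= 1 -> 0 <= r -> Rabs (t1 - a1) <= d -> Rabs (t2 - a2) <= d ->
    Cmod (c * f (tor r t1 t2) - c0 * f (tor 1 a1 a2)) <= eps.
Proof.
  intros hf hc0 heps. destruct (ucont_bounded f hf) as [B [hB kB]].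
  destruct (ucont_near_tor f a1 a2 (eps / 2) hf (half_pos _ heps)) as [d [hd k]].
  exists (Rmin d (eps / (2 * (B + 1)))). split. apply Rmin_pos; auto. apply Rdiv_lt_0_compat; lra.
  intros c r t1 t2 h1 h2 h3 h4 h5.
  assert (q1 := Rmin_l d (eps / (2 * (B + 1)))). assert (q2 := Rmin_r d (eps / (2 * (B + 1)))).
  specialize (k r t1 t2 ltac:(lra) h3 ltac:(lra) ltac:(lra)). specialize (kB (tor r t1 t2) ltac:(apply tor_incl; lra)).
  replace (c * f (tor r t1 t2) - c0 * f (tor 1 a1 a2))%C with ((c - c0) * f (tor r t1 t2) + c0 * (f (tor r t1 t2) - f (tor 1 a1 a2)))%C by ring.
  eapply Rle_trans. apply Cmod_triangle. rewrite !Cmod_mult, hc0, Rmult_1_l.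
  assert (Cmod (c - c0) * Cmod (f (tor r t1 t2)) <= eps / (2 * (B + 1)) * (B + 1)).
  { apply Rmult_le_compat; try apply Cmod_ge_0; lra. }
  replace (eps / (2 * (B + 1)) * (B + 1)) with (eps / 2) in H by (field; lra). lra.
Qed.
End Symbol2.

(** * Uniform kernel bound for symbols of order two *)

Lemma unit_conj_dist (eta v : C) : Cmod eta = 1 -> Cmod (Cconj eta * v - 1) = Cmod (eta - v).
Proof.
  intros h. rewrite <- (conj_unit_mult eta h), <- (Rmult_1_l (Cmod (eta - v))), <- h, <- (Cmod_conj eta), <- Cmod_mult.
  rewrite <- Cmod_opp. f_equal. ring.
Qed.

Section Kernel.
Variables (F F1 F2 F11 F12 F21 F22 : C * C -> C).
Hypothesis sy : symbol F F1 F2 F11 F12 F21 F22.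

Definition kdist (r : R) (eta : C) (x y : R) : R := Cmod (eta - F (tor r x y)).
Definition ksq (r : R) (eta : C) (x y w : R) : R :=
  RInt (fun t1 => RInt (fun t2 => Rpower (kdist r eta t1 t2) (- (9 / 8))) y (y + w)) x (x + w).
(** Both constants may depend on the square but not on r and eta, so that bounds on four quarters
    can be combined. *)
Definition ksq_bounded (x y w : R) : Prop :=
  exists C0 r0, 0 <= r0 < 1 /\ forall r eta, r0 <= r < 1 -> Cmod eta = 1 -> ksq r eta x y w <= C0.

Lemma kdist_pos r eta x y : 0 <= r < 1 -> Cmod eta = 1 -> 0 < kdist r eta x y.
Proof.
  intros hr he. unfold kdist. pose proof (sy_maps _ _ _ _ _ _ _ sy _ (tor_inD2 r x y hr)).
  generalize (Cmod_triangle_inv eta (F (tor r x y))). lra.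
Qed.

Lemma kdist_cont2 r eta : 0 <= r < 1 -> cont2 (kdist r eta).
Proof.
  intros hr p. unfold kdist. pose proof (holo_tor_continuous F r p (sy_holo _ _ _ _ _ _ _ sy) hr). cont.
Qed.

Lemma kpow_cont2 r eta : 0 <= r < 1 -> Cmod eta = 1 -> cont2 (fun x y => Rpower (kdist r eta x y) (- (9 / 8))).
Proof. intros hr he p. pose proof (kdist_cont2 r eta hr p). cont. apply kdist_pos; auto. Qed.

Lemma ksq_split r eta x y w : 0 <= r < 1 -> Cmod eta = 1 -> 0 < w ->
  ksq r eta x y w = ksq r eta x y (w / 2) + ksq r eta (x + w / 2) y (w / 2) + ksq r eta x (y + w / 2) (w / 2) + ksq r eta (x + w / 2) (y + w / 2) (w / 2).
Proof.
  intros hr he hw. pose proof (kpow_cont2 r eta hr he) as hc. unfold ksq.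
  set (k := fun t1 t2 => Rpower (kdist r eta t1 t2) (- (9 / 8))) in *.
  replace (x + w / 2 + w / 2) with (x + w) by field. replace (y + w / 2 + w / 2) with (y + w) by field.
  assert (h1 : forall a b, a <= b -> forall t, continuous (fun t1 => RInt (k t1) a b) t) by (intros; apply cont2_RInt; auto).
  assert (hy : forall t1, RInt (k t1) y (y + w) = RInt (k t1) y (y + w / 2) + RInt (k t1) (y + w / 2) (y + w)).
  { intro t1. apply RInt_Chasles_cont. apply cont2_slice; auto. }
  change (RInt (fun t1 => RInt (k t1) y (y + w)) x (x + w) = RInt (fun t1 => RInt (k t1) y (y + w / 2)) x (x + w / 2) +
    RInt (fun t1 => RInt (k t1) y (y + w / 2)) (x + w / 2) (x + w) + RInt (fun t1 => RInt (k t1) (y + w / 2) (y + w)) x (x + w / 2) +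
    RInt (fun t1 => RInt (k t1) (y + w / 2) (y + w)) (x + w / 2) (x + w)).
  rewrite (RInt_ext_all _ _ _ _ hy).
  rewrite (RInt_plus_cont (fun t1 => RInt (k t1) y (y + w / 2)) (fun t1 => RInt (k t1) (y + w / 2) (y + w))) by (apply h1; lra).
  rewrite (RInt_Chasles_cont (fun t1 => RInt (k t1) y (y + w / 2)) x (x + w / 2) (h1 y (y + w / 2) ltac:(lra)) (x + w)).
  rewrite (RInt_Chasles_cont (fun t1 => RInt (k t1) (y + w / 2) (y + w)) x (x + w / 2) (h1 (y + w / 2) (y + w) ltac:(lra)) (x + w)).
  match goal with |- @eq _ ?a ?b => change (@eq R a b) end. ring.
Qed.

(** When eta stays away from F at the base point, the integrand is bounded near it; d < 1 makes the
    area of the square at most 1. *)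
Lemma kernel_far a1 a2 e1 : 0 < e1 -> exists d, 0 < d < 1 /\ forall r eta x y w, 1 - d <= r < 1 -> Cmod eta = 1 -> e1 <= Cmod (eta - F (tor 1 a1 a2)) ->
  0 < w < d -> x <= a1 <= x + w -> y <= a2 <= y + w -> ksq r eta x y w <= Rpower (e1 / 2) (- (9 / 8)).
Proof.
  intros he1. destruct (ucont_near_tor F a1 a2 (e1 / 2) (sy_u _ _ _ _ _ _ _ sy) (half_pos _ he1)) as [d [hd k]].
  exists (Rmin d (1 / 2)). assert (q1 := Rmin_l d (1 / 2)). assert (q2 := Rmin_r d (1 / 2)).
  split. split. apply Rmin_pos; lra. lra.
  intros r eta x y w hr heta hfar hw hx hy.
  assert (hc := kpow_cont2 r eta ltac:(lra) heta).
  assert (hpt : forall t1 t2, x <= t1 <= x + w -> y <= t2 <= y + w -> Rpower (kdist r eta t1 t2) (- (9 / 8)) <= Rpower (e1 / 2) (- (9 / 8))).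
  { intros t1 t2 h1 h2. apply Rpower_neg_le; [|lra]. split. lra.
    specialize (k r t1 t2 ltac:(lra) ltac:(lra) ltac:(apply Rabs_le; lra) ltac:(apply Rabs_le; lra)).
    unfold kdist. generalize (Cmod_sub_triangle eta (F (tor r t1 t2)) (F (tor 1 a1 a2))). lra. }
  assert (hp0 : 0 < Rpower (e1 / 2) (- (9 / 8))) by apply exp_pos.
  assert (hin : forall t1, x <= t1 <= x + w -> RInt (fun t2 => Rpower (kdist r eta t1 t2) (- (9 / 8))) y (y + w) <= Rpower (e1 / 2) (- (9 / 8))).
  { intros t1 h1. eapply Rle_trans. apply RInt_le_const with (M := Rpower (e1 / 2) (- (9 / 8))).
    apply (cont2_slice _ t1 hc). lra. intros t2 h2. apply hpt; auto. nra. }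
  unfold ksq. eapply Rle_trans. apply RInt_le_const with (M := Rpower (e1 / 2) (- (9 / 8))).
  apply (cont2_RInt _ y (y + w) ltac:(lra) hc). lra. intros t1 h1. apply hin; auto. nra.
Qed.

(** Supplies the two inequalities of [local_kernel_bound] for D = |eta - F|. With v = conj eta F one
    has D >= |Im v| and D >= 1 - Re v. In the second angle, Im v has a derivative close to lam,
    which is not 0; in all directions Re v has second derivative at most - kap |b|^2. *)
Lemma kernel_near a1 a2 : Cmod (F (tor 1 a1 a2)) = 1 -> truly_2d_order2 F (tor 1 a1 a2) -> exists d, 0 < d < 1 /\ exists C0,
  forall r eta x y w, 1 - d <= r < 1 -> Cmod eta = 1 -> Cmod (eta - F (tor 1 a1 a2)) <= d ->
  0 < w < d -> 0 <= x -> x + w <= 2 * PI -> 0 <= y -> y + w <= 2 * PI -> x <= a1 <= x + w -> y <= a2 <= y + w -> ksq r eta x y w <= C0.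
Proof.
  intros h1 hord. set (xi := tor 1 a1 a2) in *.
  destruct (order2_facts _ _ _ _ _ _ _ sy a1 a2 h1 hord) as [kap [hk facts]]. fold xi in facts.
  assert (ht2 := dz2_tang2 _ _ _ _ _ _ _ sy a1 a2 (proj1 (proj2 (proj1 hord)))). fold xi in ht2.
  set (c0 := Cconj (F xi)) in *.
  assert (hc0 : Cmod c0 = 1) by (unfold c0; rewrite Cmod_conj; auto).
  (* The first fact in the direction (0, 1) says that c0 [tang2] is real at the contact point; being
     nonzero, it has nonzero real part. *)
  set (lam := Re (c0 * tang2 F2 xi)).
  assert (hlam : 0 < Rabs lam).
  { destruct (facts 0 1) as [f1 _]. unfold dir1 in f1.
    replace (c0 * (Ci * (RtoC 0 * tang1 F1 xi + RtoC 1 * tang2 F2 xi)))%C with (Ci * (c0 * tang2 F2 xi))%C in f1 by ring.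
    assert (hne : (c0 * tang2 F2 xi)%C <> RtoC 0) by (apply Cmult_neq_0; auto; apply Cmod_gt_0; lra).
    rewrite Re_mult in f1. simpl in f1.
    apply Rabs_pos_lt. intro e. apply hne. apply C_ext. exact e. simpl. unfold Im, Re in *. simpl in *. lra. }
  destruct (near_product (tang2 F2) a1 a2 c0 (Rabs lam / 2) (ucont_tang2 _ _ _ _ _ _ _ sy) hc0 ltac:(lra)) as [d1 [p1 k1]].
  destruct (near_product (hess11 F1 F11) a1 a2 c0 (kap / 2) (ucont_hess11 _ _ _ _ _ _ _ sy) hc0 ltac:(lra)) as [d2 [p2 k2]].
  destruct (near_product (hess12 F12 F21) a1 a2 c0 (kap / 2) (ucont_hess12 _ _ _ _ _ _ _ sy) hc0 ltac:(lra)) as [d3 [p3 k3]].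
  destruct (near_product (hess22 F2 F22) a1 a2 c0 (kap / 2) (ucont_hess22 _ _ _ _ _ _ _ sy) hc0 ltac:(lra)) as [d4 [p4 k4]].
  fold xi in k1, k2, k3, k4.
  set (d := Rmin (Rmin (Rmin d1 d2) (Rmin d3 d4)) (1 / 2)).
  assert (hd : 0 < d) by (repeat apply Rmin_pos; lra).
  assert (hdd : d <= d1 /\ d <= d2 /\ d <= d3 /\ d <= d4 /\ d <= 1 / 2).
  { unfold d. generalize (Rmin_l (Rmin (Rmin d1 d2) (Rmin d3 d4)) (1 / 2)) (Rmin_r (Rmin (Rmin d1 d2) (Rmin d3 d4)) (1 / 2)) (Rmin_l (Rmin d1 d2) (Rmin d3 d4)) (Rmin_r (Rmin d1 d2) (Rmin d3 d4)) (Rmin_l d1 d2) (Rmin_r d1 d2) (Rmin_l d3 d4) (Rmin_r d3 d4). lra. }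
  clearbody d. exists d. split. lra.
  set (c1 := Rmin (Rabs lam / 2) (kap / 4)).
  assert (hc1 : 0 < c1) by (apply Rmin_pos; lra).
  assert (hc1a : c1 <= Rabs lam / 2) by apply Rmin_l. assert (hc1b : c1 <= kap / 4) by apply Rmin_r.
  exists (Rpower (Rmin (c1 / 3) 1 / 4) (- (9 / 8)) * (8 * (1 + 1)) * (8 * (1 + 1))).
  intros r eta x0 y0 w hr heta hclose hw hx0 hx1 hy0 hy1 hax hay.
  set (c := Cconj eta). assert (hc : Cmod c = 1) by (unfold c; rewrite Cmod_conj; auto).
  assert (hcc : Cmod (c - c0) <= d).
  { unfold c, c0. rewrite <- Cminus_conj, Cmod_conj. exact hclose. }
  destruct (cont2_sup_lt (fun s t => Cmod (F (tor r s t))) 1) as [m [hm km]].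
  { intro p. pose proof (holo_tor_continuous F r p (sy_holo _ _ _ _ _ _ _ sy) ltac:(lra)). cont. }
  { intros. apply (sy_maps _ _ _ _ _ _ _ sy). apply tor_inD2; lra. }
  assert (boxx : forall t, x0 <= t <= x0 + w -> Rabs (t - a1) <= d) by (intros; apply Rabs_le; lra).
  assert (boxy : forall t, y0 <= t <= y0 + w -> Rabs (t - a2) <= d) by (intros; apply Rabs_le; lra).
  assert (dre : forall s t, 1 - Re (c * F (tor r s t)) <= kdist r eta s t).
  { intros s t. unfold kdist. rewrite <- (unit_conj_dist eta (F (tor r s t)) heta). fold c.
    eapply Rle_trans; [|apply re_le_Cmod]. rewrite Re_minus, Re_RtoC. rewrite <- Rabs_Ropp. eapply Rle_trans; [|apply Rle_abs]. lra. }
  assert (dim : forall s t, Rabs (Re ((- Ci * c) * F (tor r s t))) <= kdist r eta s t).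
  { intros s t. unfold kdist. rewrite <- (unit_conj_dist eta (F (tor r s t)) heta). fold c.
    eapply Rle_trans; [|apply im_le_Cmod]. right. f_equal. rewrite (Im_eq_Re (c * F (tor r s t) - 1)).
    replace (- Ci * c * F (tor r s t))%C with (- Ci * (c * F (tor r s t) - 1) - Ci)%C by ring. rewrite Re_minus.
    replace (Re Ci) with 0 by reflexivity. ring. }
  apply Rle_trans with (Rpower (Rmin (c1 / 3) 1 / 4) (- (9 / 8)) * (8 * (w + 1)) * (8 * (w + 1))).
  2: { assert (0 < Rpower (Rmin (c1 / 3) 1 / 4) (- (9 / 8))) by apply exp_pos.
    rewrite !Rmult_assoc. apply Rmult_le_compat_l. lra. nra. }
  (* 1 - m is a lower bound of D on this particular torus. It degenerates as r tends to 1, which is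
     harmless because the bound does not contain kap. *)
  unfold ksq. apply local_kernel_bound with (kap := Rmin 1 (1 - m)); auto; try lra.
  - split. apply Rmin_pos; lra. apply Rmin_l.
  - apply kdist_cont2; lra.
  - intros; apply kdist_pos; auto; lra.
  - intros s t hs ht. eapply Rle_trans. apply Rmin_r. eapply Rle_trans; [|apply dre].
    specialize (km s t ltac:(lra) ltac:(lra)). cbv beta in km.
    pose proof (Re_le_mod (c * F (tor r s t))) as q. rewrite Cmod_mult, hc, Rmult_1_l in q. lra.
  - intros s t t' hs ht ht'.
    set (mm := fun u => Re ((- Ci * c) * F (tor r (s + u * 0) (0 + u * 1)))).
    set (mm1 := fun u => Re ((- Ci * c) * dir1 F1 F2 0 1 (tor r (s + u * 0) (0 + u * 1)))).
    assert (hmm : forall u, is_derive mm u (mm1 u)).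
    { intro u. apply rderC_Re_scal. apply (rderC_line _ _ _ _ _ _ _ sy); lra. }
    assert (emm : forall u, mm u = Re ((- Ci * c) * F (tor r s u))).
    { intro u. unfold mm. replace (s + u * 0) with s by ring. replace (0 + u * 1) with u by ring. reflexivity. }
    destruct (MVT_gen mm t t' mm1) as [u [hu ku]].
    { intros; apply hmm. }
    { intros v _. apply continuity_pt_filterlim. apply (ex_derive_continuous (K := R_AbsRing) (V := R_NormedModule)). eexists; apply hmm. }
    assert (hub : y0 <= u <= y0 + w).
    { generalize (Rmin_glb _ _ _ (proj1 ht) (proj1 ht')) (Rmax_lub _ _ _ (proj2 ht) (proj2 ht')). lra. }
    assert (lb : Rabs lam / 2 <= Rabs (mm1 u)).
    { assert (e : mm1 u = Re (c * tang2 F2 (tor r s u))).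
      { unfold mm1, dir1. replace (s + u * 0) with s by ring. replace (0 + u * 1) with u by ring. f_equal.
        transitivity (- (Ci * Ci) * (c * tang2 F2 (tor r s u)))%C. ring.
        replace (Ci * Ci)%C with (- RtoC 1)%C by (unfold Ci, Cmult, Copp, RtoC; simpl; f_equal; ring). ring. }
      rewrite e. specialize (k1 c r s u ltac:(lra) ltac:(lra) ltac:(lra) ltac:(specialize (boxx s hs); lra) ltac:(specialize (boxy u hub); lra)).
      pose proof (Rle_trans _ _ _ (re_le_Cmod _) k1) as k. rewrite Re_minus in k. fold lam in k.
      generalize (Rabs_triang_inv lam (Re (c * tang2 F2 (tor r s u)))). rewrite (Rabs_minus_sym lam). lra. }
    pose proof (dim s t) as e1. pose proof (dim s t') as e2. rewrite <- emm in e1, e2.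
    assert (ku' : Rabs (mm t' - mm t) = Rabs (mm1 u) * Rabs (t - t')) by (rewrite ku, Rabs_mult, (Rabs_minus_sym t'); auto).
    assert (Rabs (mm t' - mm t) <= Rabs (mm t') + Rabs (mm t)).
    { unfold Rminus. eapply Rle_trans. apply Rabs_triang. rewrite Rabs_Ropp. lra. }
    assert (c1 * Rabs (t - t') <= Rabs (mm1 u) * Rabs (t - t')) by (apply Rmult_le_compat_r; [apply Rabs_pos|lra]). lra.
  - intros s s' t t' hs hs' ht ht'.
    set (b1 := s' - s). set (b2 := t' - t).
    assert (cm := concave_midpoint (fun u => Re (c * F (tor r (s + u * b1) (t + u * b2)))) (fun u => Re (c * dir1 F1 F2 b1 b2 (tor r (s + u * b1) (t + u * b2))))
      (fun u => Re (c * dir2 F1 F2 F11 F12 F21 F22 b1 b2 (tor r (s + u * b1) (t + u * b2)))) (kap * (b1 ^ 2 + b2 ^ 2))).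
    cbv beta in cm. rewrite !Rmult_0_l, !Rmult_1_l, !Rplus_0_r in cm.
    replace (s + b1) with s' in cm by (unfold b1; ring). replace (t + b2) with t' in cm by (unfold b2; ring).
    assert (cm' : Re (c * F (tor r s t)) + Re (c * F (tor r s' t')) <= 2 * Re (c * F (tor r (s + 1 / 2 * b1) (t + 1 / 2 * b2))) - kap * (b1 ^ 2 + b2 ^ 2) / 4).
    { apply cm; clear cm.
      - intro u. apply rderC_Re_scal. apply (rderC_line _ _ _ _ _ _ _ sy); lra.
      - intro u. apply rderC_Re_scal. apply (rderC_line2 _ _ _ _ _ _ _ sy); lra.
      - intros u hu. destruct (facts b1 b2) as [_ f2].
        assert (us : x0 <= s + u * b1 <= x0 + w) by (unfold b1; nra). assert (ut : y0 <= t + u * b2 <= y0 + w) by (unfold b2; nra).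
        pose proof (boxx _ us) as v1. pose proof (boxy _ ut) as v2.
        set (z := tor r (s + u * b1) (t + u * b2)).
        specialize (k2 c r (s + u * b1) (t + u * b2) ltac:(lra) ltac:(lra) ltac:(lra) ltac:(lra) ltac:(lra)).
        specialize (k3 c r (s + u * b1) (t + u * b2) ltac:(lra) ltac:(lra) ltac:(lra) ltac:(lra) ltac:(lra)).
        specialize (k4 c r (s + u * b1) (t + u * b2) ltac:(lra) ltac:(lra) ltac:(lra) ltac:(lra) ltac:(lra)).
        fold z in k2, k3, k4.
        apply (fun h => Rle_trans _ _ _ (re_le_Cmod _) h) in k2. apply (fun h => Rle_trans _ _ _ (re_le_Cmod _) h) in k3. apply (fun h => Rle_trans _ _ _ (re_le_Cmod _) h) in k4.
        rewrite Re_minus in k2, k3, k4.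
        assert (ex : forall (q : C) v, Re (q * dir2 F1 F2 F11 F12 F21 F22 b1 b2 v) = - (b1 ^ 2 * Re (q * hess11 F1 F11 v) + (b1 * b2) * Re (q * hess12 F12 F21 v) + b2 ^ 2 * Re (q * hess22 F2 F22 v))).
        { intros q v. unfold dir2.
          replace (q * - (RtoC (b1 ^ 2) * hess11 F1 F11 v + RtoC (b1 * b2) * hess12 F12 F21 v + RtoC (b2 ^ 2) * hess22 F2 F22 v))%C with
            (- (RtoC (b1 ^ 2) * (q * hess11 F1 F11 v) + RtoC (b1 * b2) * (q * hess12 F12 F21 v) + RtoC (b2 ^ 2) * (q * hess22 F2 F22 v)))%C by ring.
          rewrite Re_opp, !Re_plus, !Re_scal. reflexivity. }
        rewrite ex in f2 |- *.
        set (A := Re (c * hess11 F1 F11 z)) in *. set (B := Re (c * hess12 F12 F21 z)) in *. set (E := Re (c * hess22 F2 F22 z)) in *.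
        set (A0 := Re (c0 * hess11 F1 F11 xi)) in *. set (B0 := Re (c0 * hess12 F12 F21 xi)) in *. set (E0 := Re (c0 * hess22 F2 F22 xi)) in *.
        apply Rabs_le_between in k2. apply Rabs_le_between in k3. apply Rabs_le_between in k4.
        (* A deviation of kap / 2 in each Hessian coefficient costs at most (3/4) kap |b|^2 against
           the margin 2 kap |b|^2, which leaves at least kap |b|^2. *)
        assert (w1 : - (b1 ^ 2) * (A - A0) <= b1 ^ 2 * (kap / 2)) by (generalize (pow2_ge_0 b1); nra).
        assert (w2 : - (b2 ^ 2) * (E - E0) <= b2 ^ 2 * (kap / 2)) by (generalize (pow2_ge_0 b2); nra).
        assert (w3 : - (b1 * b2) * (B - B0) <= (b1 ^ 2 + b2 ^ 2) / 2 * (kap / 2)).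
        { assert (- (b1 ^ 2 + b2 ^ 2) / 2 <= b1 * b2 <= (b1 ^ 2 + b2 ^ 2) / 2) by (generalize (pow2_ge_0 (b1 - b2)) (pow2_ge_0 (b1 + b2)); nra).
          assert (Habs : Rabs (b1 * b2) * Rabs (B - B0) <= (b1 ^ 2 + b2 ^ 2) / 2 * (kap / 2)) by (apply Rmult_le_compat; try apply Rabs_pos; apply Rabs_le; lra).
          rewrite <- Rabs_mult in Habs. generalize (Rle_abs (- (b1 * b2 * (B - B0)))). rewrite Rabs_Ropp. nra. }
        nra. }
    (* D(s,t) + D(s',t') is at least 2 minus the two real parts. By concavity, and as the real part
       at the midpoint is below 1, this is at least kap (b1^2 + b2^2) / 4, of which the b1 part is
       kept. *)
    pose proof (dre s t) as e1. pose proof (dre s' t') as e2.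
    pose proof (Re_le_mod (c * F (tor r (s + 1 / 2 * b1) (t + 1 / 2 * b2)))) as q.
    pose proof (sy_maps _ _ _ _ _ _ _ sy _ (tor_inD2 r (s + 1 / 2 * b1) (t + 1 / 2 * b2) ltac:(lra))) as q2.
    rewrite Cmod_mult, hc, Rmult_1_l in q.
    assert (w0 : (s - s') ^ 2 = b1 ^ 2) by (unfold b1; ring). rewrite w0.
    assert (0 <= b1 ^ 2) by apply pow2_ge_0. assert (0 <= b2 ^ 2) by apply pow2_ge_0.
    assert (c1 * b1 ^ 2 <= kap / 4 * b1 ^ 2) by (apply Rmult_le_compat_r; auto). nra.
Qed.

(** Bisection of the square of angles. Near a contact point, values of eta close to F there are
    handled by [kernel_near] and the others by [kernel_far]; near any other point all unimodular eta
    are far. *)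
Theorem kernel_bound : (forall xi, inT2 xi -> inT (F xi) -> truly_2d_order2 F xi) ->
  exists C0 r0, 0 <= C0 /\ 0 <= r0 < 1 /\ forall r t, r0 <= r < 1 -> kint F r (expi t) <= C0.
Proof.
  intros hord. pose proof PI2_pos as hp.
  assert (K : ksq_bounded 0 0 (2 * PI)).
  { apply (cousin_square ksq_bounded 0 0 (2 * PI)); auto.
    - intros x y w hw [C1 [r1 [p1 k1]]] [C2 [r2 [p2 k2]]] [C3 [r3 [p3 k3]]] [C4 [r4 [p4 k4]]].
      exists (C1 + C2 + C3 + C4), (Rmax (Rmax r1 r2) (Rmax r3 r4)). split.
      + split. eapply Rle_trans; [|eapply Rle_trans; [apply Rmax_l|apply Rmax_l]]; lra. repeat apply Rmax_lub_lt; lra.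
      + intros r eta hr he.
        assert (hr' : r1 <= r /\ r2 <= r /\ r3 <= r /\ r4 <= r).
        { generalize (Rmax_l (Rmax r1 r2) (Rmax r3 r4)) (Rmax_r (Rmax r1 r2) (Rmax r3 r4)) (Rmax_l r1 r2) (Rmax_r r1 r2) (Rmax_l r3 r4) (Rmax_r r3 r4). lra. }
        rewrite ksq_split by (auto; lra).
        specialize (k1 r eta ltac:(lra) he). specialize (k2 r eta ltac:(lra) he). specialize (k3 r eta ltac:(lra) he). specialize (k4 r eta ltac:(lra) he). lra.
    - intros a1 a2 _ _. rewrite !Rplus_0_l.
      destruct (Req_dec (Cmod (F (tor 1 a1 a2))) 1) as [h1|h1].
      + assert (hT2 : inT2 (tor 1 a1 a2)) by (split; unfold inT; simpl; rewrite Cmult_1_l; apply Cmod_expi).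
        destruct (kernel_near a1 a2 h1 (hord _ hT2 h1)) as [d [hd [C0 k]]].
        (* The distance d is the limit of validity of the near estimate, so the two cases cover all
           eta. *)
        destruct (kernel_far a1 a2 d ltac:(lra)) as [d' [hd' k']].
        exists (Rmin d d'). split. apply Rmin_pos; lra. intros x y w hw hx0 hx1 hy0 hy1 hx hy.
        assert (q1 := Rmin_l d d'). assert (q2 := Rmin_r d d').
        exists (Rmax C0 (Rpower (d / 2) (- (9 / 8)))), (1 - Rmin d d'). split. assert (0 < Rmin d d') by (apply Rmin_pos; lra). lra.
        intros r eta hr he. destruct (Rle_dec (Cmod (eta - F (tor 1 a1 a2))) d) as [hc|hc].
        * eapply Rle_trans; [|apply Rmax_l]. apply k; auto; lra.
        * eapply Rle_trans; [|apply Rmax_r]. apply k'; auto; lra.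
      (* No contact: every unimodular eta is at distance at least 1 - |F| > 0 from the value. *)
      + pose proof (symbol_closed_bound _ _ _ _ _ _ _ sy _ (tor1_incl a1 a2)) as h2.
        destruct (kernel_far a1 a2 (1 - Cmod (F (tor 1 a1 a2))) ltac:(lra)) as [d' [hd' k']].
        exists d'. split. lra. intros x y w hw hx0 hx1 hy0 hy1 hx hy.
        exists (Rpower ((1 - Cmod (F (tor 1 a1 a2))) / 2) (- (9 / 8))), (1 - d'). split. lra.
        intros r eta hr he. apply k'; auto.
        generalize (Cmod_triangle_inv eta (F (tor 1 a1 a2))). lra. }
  destruct K as [C0 [r0 [hr0 k]]]. exists (Rmax 0 C0), r0. split. apply Rmax_l. split; auto.
  intros r t hr. eapply Rle_trans; [|apply Rmax_r].
  specialize (k r (expi t) hr (Cmod_expi t)). unfold ksq in k. rewrite !Rplus_0_l in k. exact k.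
Qed.
End Kernel.

(** * Normal families *)

Definition inK (delta : R) (z : C * C) : Prop := Cmod (fst z) <= 1 - delta /\ Cmod (snd z) <= 1 - delta.

Lemma inK_inD2 delta z : 0 < delta -> inK delta z -> inD2 z.
Proof. intros h [h1 h2]. split; unfold inD; lra. Qed.

Lemma inD2_inK z : inD2 z -> exists delta, 0 < delta < 1 /\ inK delta z.
Proof.
  intros [h1 h2]. unfold inD in *. exists (Rmin (1 / 2) (Rmin (1 - Cmod (fst z)) (1 - Cmod (snd z)))).
  generalize (Rmin_l (1 / 2) (Rmin (1 - Cmod (fst z)) (1 - Cmod (snd z)))) (Rmin_r (1 / 2) (Rmin (1 - Cmod (fst z)) (1 - Cmod (snd z))))
    (Rmin_l (1 - Cmod (fst z)) (1 - Cmod (snd z))) (Rmin_r (1 - Cmod (fst z)) (1 - Cmod (snd z))). intros.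
  split. split. repeat apply Rmin_pos; lra. lra. split; lra.
Qed.

(** On the torus of radius 1 - delta / 2 each of the two Poisson kernels is at most 4 / delta,
    whence 16 / delta^2. *)
Lemma h2_point_bound f M delta z : holo_D2 f -> (forall r, 0 < r < 1 -> circ_int f r <= M) -> 0 < delta < 1 -> inK delta z ->
  Cmod (f z) ^ 2 <= 16 / delta ^ 2 * M.
Proof.
  intros hf hM hd [h1 h2]. set (R0 := 1 - delta / 2). assert (hR : 0 < R0 < 1) by (unfold R0; lra).
  pose proof PI2_ge0 as hp. pose proof (dens_cont2 f R0 hf ltac:(lra)) as hdc.
  pose proof (bidisc_poisson f R0 z hf hR ltac:(unfold R0; lra) ltac:(unfold R0; lra)) as B.
  eapply Rle_trans. exact B. clear B.
  apply Rle_trans with (16 / delta ^ 2 * circ_int f R0).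
  2: { apply Rmult_le_compat_l. apply Rdiv_le_0_compat. lra. apply pow_lt; lra. apply hM; auto. }
  rewrite circ_int_dbl. unfold Rdiv at 1 3. rewrite <- Rmult_assoc. apply Rmult_le_compat_r. left; apply Rinv_0_lt_compat, fourPI2_pos.
  assert (hpb : forall v t, Cmod v <= 1 - delta -> 0 <= poi R0 v t <= 4 / delta).
  { intros v t hv. split. apply poi_pos; unfold R0 in *; lra.
    eapply Rle_trans. apply poi_le; unfold R0 in *; lra. apply Rle_div_l. unfold R0; lra.
    apply Rle_trans with (4 / delta * (delta / 2)). right; field; lra. apply Rmult_le_compat_l. left; apply Rdiv_lt_0_compat; lra. unfold R0; lra. }
  assert (hpc : forall v t, Cmod v <= 1 - delta -> continuous (poi R0 v) t) by (intros; apply poi_continuous; unfold R0 in *; lra).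
  assert (cI2 : cont2 (fun t1 t2 => poi R0 (snd z) t2 * dens f R0 t1 t2)).
  { intro p. specialize (hdc p).
    assert (continuous (fun p : R * R => poi R0 (snd z) (snd p)) p).
    { apply (continuous_comp_gen (fun p : R * R => snd p) (poi R0 (snd z))). cont. apply hpc; auto. }
    cont. }
  replace (16 / delta ^ 2) with (4 / delta * (4 / delta)) by (field; lra). rewrite Rmult_assoc.
  rewrite <- (dbl_scal _ (4 / delta) hdc). unfold dbl.
  assert (cG : forall t, continuous (fun t1 => RInt (fun t2 => 4 / delta * dens f R0 t1 t2) 0 (2 * PI)) t).
  { apply (cont2_RInt (fun t1 t2 => 4 / delta * dens f R0 t1 t2)); auto. apply cont2_scal; auto. }
  rewrite <- RInt_scal_cont by auto. apply RInt_le_cont; auto.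
  - intro t. pose proof (hpc (fst z) t h1). pose proof (cont2_RInt _ 0 (2 * PI) hp cI2 t). cont.
  - intro t. specialize (cG t). cont.
  - intros t _. apply Rmult_le_compat; try apply hpb; auto.
    + apply RInt_ge0_cont; auto. apply (cont2_slice _ t cI2). intros. apply Rmult_le_pos. apply hpb; auto. apply pow2_ge_0.
    + apply RInt_le_cont; auto. apply (cont2_slice _ t cI2). apply (cont2_slice _ t (cont2_scal (4 / delta) _ hdc)).
      intros t2 _. apply Rmult_le_compat_r. apply pow2_ge_0. apply hpb; auto.
Qed.

(** Discs of radius delta around the segment from a to b stay where |f| <= B, so Cauchy's estimate
    bounds the derivative by 2 B / delta. This is the equicontinuity behind Montel's theorem. *)
Lemma holo_lipschitz1 f B delta a b w : holo_D2 f -> 0 < delta -> (forall z, inK delta z -> Cmod (f z) <= B) ->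
  Cmod a <= 1 - 2 * delta -> Cmod b <= 1 - 2 * delta -> Cmod w <= 1 - delta -> Cmod (f (b, w) - f (a, w)) <= 2 * B / delta * Cmod (b - a).
Proof.
  intros hf hd hB ha hb hw.
  assert (hw1 : inD w) by (unfold inD; lra).
  destruct (holo_exists_partials f hf) as [f1 [f2 [_ [_ [e1 _]]]]].
  set (g := fun t : R => (a + RtoC t * (b - a))%C).
  assert (hg : forall t, 0 <= t <= 1 -> Cmod (g t) <= 1 - 2 * delta).
  { intros t ht. unfold g. replace (a + RtoC t * (b - a))%C with (RtoC (1 - t) * a + RtoC t * b)%C by (rewrite RtoC_minus; ring).
    eapply Rle_trans. apply Cmod_triangle. rewrite !Cmod_mult, !Cmod_RtoC_pos by lra. nra. }
  replace (f (b, w) - f (a, w))%C with (f (g 1, w) - f (g 0, w))%C.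
  2: { unfold g. replace (a + RtoC 1 * (b - a))%C with b by ring. replace (a + RtoC 0 * (b - a))%C with a by ring. reflexivity. }
  replace (2 * B / delta * Cmod (b - a)) with (2 * B / delta * Cmod (b - a) * (1 - 0)) by ring.
  apply (rderC_bound (fun t => f (g t, w)) (fun t => (f1 (g t, w) * (b - a))%C)). lra.
  - intros t ht. eapply rderC_eq. apply (rderC_comp (fun v => f (v, w)) g).
    + unfold g. apply rderC_plus. apply rderC_const. apply rderC_mult. apply rderC_RtoC. apply (is_derive_id (K := R_AbsRing)). apply rderC_const.
    + apply (e1 (g t, w)). split; auto. unfold inD; simpl. specialize (hg t ht). lra.
    + change (@one R_AbsRing) with 1. cbv beta. ring.
  - intros t ht. specialize (hg t ht). rewrite Cmod_mult. apply Rmult_le_compat_r. apply Cmod_ge_0.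
    apply (taylor_at_der (fun v => f (v, w)) (g t) (f1 (g t, w)) delta B hd).
    + intros v hv. apply (holo_holD1 f w hf hw1). generalize (Cmod_triangle_inv v (g t)). lra.
    + intros v hv. apply hB. split; simpl; auto. generalize (Cmod_triangle_inv v (g t)). lra.
    + apply (e1 (g t, w)). split; auto. unfold inD; simpl. lra.
Qed.

Lemma holo_lipschitz f B delta z w : holo_D2 f -> 0 < delta -> (forall z, inK delta z -> Cmod (f z) <= B) ->
  inK (2 * delta) z -> inK (2 * delta) w -> Cmod (f w - f z) <= 2 * B / delta * (Cmod (fst w - fst z) + Cmod (snd w - snd z)).
Proof.
  intros hf hd hB [z1 z2] [w1 w2].
  pose proof (holo_lipschitz1 f B delta (fst z) (fst w) (snd w) hf hd hB z1 w1 ltac:(lra)) as k1.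
  pose proof (holo_lipschitz1 (fun z => f (swap z)) B delta (snd z) (snd w) (fst z) (holo_swap f hf) hd) as k2.
  unfold swap in k2; simpl in k2. rewrite <- !surjective_pairing in k1.
  assert (k2' : Cmod (f (fst z, snd w) - f z) <= 2 * B / delta * Cmod (snd w - snd z)).
  { rewrite (surjective_pairing z) at 2. apply k2; auto; try lra. intros v [v1 v2]. apply hB. split; auto. }
  generalize (Cmod_sub_triangle (f w) (f (fst z, snd w)) (f z)). lra.
Qed.

Lemma holo_limit (fn : nat -> C * C -> C) f : (forall n, holo_D2 (fn n)) ->
  (forall delta eps, 0 < delta < 1 -> 0 < eps -> exists N, forall n, (N <= n)%nat -> forall z, inK delta z -> Cmod (fn n z - f z) <= eps) ->
  (forall delta, 0 < delta < 1 -> exists B, forall n z, inK delta z -> Cmod (fn n z) <= B) ->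
  holo_D2 f.
Proof.
  intros hfn hcv hbd. apply holo_D2_iff. intros z hz.
  destruct (inD2_inK z hz) as [d [hd hK]].
  assert (hnear : forall w, Cmod (fst w - fst z) < d / 2 -> Cmod (snd w - snd z) < d / 2 -> inK (d / 2) w).
  { intros w h1 h2. destruct hK as [k1 k2]. split. generalize (Cmod_triangle_inv (fst w) (fst z)); lra. generalize (Cmod_triangle_inv (snd w) (snd z)); lra. }
  assert (hd2 : 0 < d / 2 < 1) by lra.
  assert (hzz : inK (d / 2) z) by (apply hnear; rewrite Cmod_self; lra).
  destruct (hbd (d / 2) hd2) as [B hB].
  split; [|split].
  - apply continuous_CC_iff. intros eps heps. destruct (hcv (d / 2) (eps / 4) hd2 ltac:(lra)) as [N hN]. specialize (hN N (le_n _)).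
    destruct (hfn N z hz) as [c _]. rewrite continuous_CC_iff in c. destruct (c (eps / 4) ltac:(lra)) as [r [hr k]].
    exists (Rmin r (d / 2)). split. apply Rmin_pos; lra. intros w h1 h2.
    apply Rmin_Rgt in h1. apply Rmin_Rgt in h2. destruct h1 as [h1 h1']. destruct h2 as [h2 h2'].
    specialize (k w h1 h2). pose proof (hN w (hnear w h1' h2')) as e1. pose proof (hN z hzz) as e2.
    replace (f w - f z)%C with ((fn N w - fn N z) + ((fn N z - f z) - (fn N w - f w)))%C by ring.
    eapply Rle_lt_trans. apply Cmod_triangle. generalize (Cmod_sub_le (fn N z - f z) (fn N w - f w)). lra.
  - apply (weierstrass1 (fun n w => fn n (w, snd z)) (fun w => f (w, snd z)) (fst z) (d / 2)); try lra.
    + intros n w hw. apply (holo_holD1 (fn n) (snd z) (hfn n) (proj2 hz)). destruct hK. generalize (Cmod_triangle_inv w (fst z)); lra.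
    + exists B. intros n w hw. apply hB. apply hnear; auto. simpl; rewrite Cmod_self; lra.
    + intros eps heps. destruct (hcv (d / 2) eps hd2 heps) as [N hN]. exists N. intros n hn w hw. apply hN; auto. apply hnear; auto. simpl; rewrite Cmod_self; lra.
  - apply (weierstrass1 (fun n w => fn n (fst z, w)) (fun w => f (fst z, w)) (snd z) (d / 2)); try lra.
    + intros n w hw. apply (holo_holD2 (fn n) (fst z) (hfn n) (proj1 hz)). destruct hK. generalize (Cmod_triangle_inv w (snd z)); lra.
    + exists B. intros n w hw. apply hB. apply hnear; auto. simpl; rewrite Cmod_self; lra.
    + intros eps heps. destruct (hcv (d / 2) eps hd2 heps) as [N hN]. exists N. intros n hn w hw. apply hN; auto. apply hnear; auto. simpl; rewrite Cmod_self; lra.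
Qed.

(** * Subsequences *)

Definition incr (s : nat -> nat) : Prop := forall n, (s n < s (S n))%nat.

Lemma incr_lt s : incr s -> forall m n, (m < n)%nat -> (s m < s n)%nat.
Proof. intros h m n hmn. induction hmn. apply h. generalize (h m0). lia. Qed.

Lemma incr_ge s : incr s -> forall n, (n <= s n)%nat.
Proof. intros h n. induction n. lia. generalize (h n). lia. Qed.

Lemma incr_comp s t : incr s -> incr t -> incr (fun n => s (t n)).
Proof. intros hs ht n. apply incr_lt; auto. Qed.

Lemma real_subseq (u : nat -> R) (B : R) : (forall n, Rabs (u n) <= B) -> exists s l, incr s /\ forall eps, 0 < eps -> exists N, forall n, (N <= n)%nat -> Rabs (u (s n) - l) <= eps.
Proof.
  intros hB. destruct (Bolzano_Weierstrass u (fun x => - B <= x <= B)) as [l hl].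
  { apply compact_P3. } { intro n. apply Rabs_le_between. apply hB. }
  assert (H : forall p : nat * nat, exists m, (fst p < m)%nat /\ Rabs (u m - l) < / (INR (snd p) + 1)).
  { intros [N k]. assert (hk : 0 < / (INR k + 1)) by (apply Rinv_0_lt_compat; generalize (pos_INR k); lra).
    destruct (hl (disc l (mkposreal _ hk)) (S N)) as [m [hm1 hm2]].
    { exists (mkposreal _ hk). intros x hx; exact hx. }
    exists m. simpl. split. lia. exact hm2. }
  apply choice in H. destruct H as [nx hnx].
  (* Each index exceeds the preceding one, and u (s n) is within 1 / (n + 1) of the cluster
     point. *)
  set (s := fix s n := match n with O => nx (0%nat, 0%nat) | S k => nx (s k, S k) end).
  exists s, l. split.
  - intro n. apply (hnx (s n, S n)).
  - intros eps heps. destruct (INR_unbounded (/ eps)) as [N hN]. exists N. intros n hn.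
    assert (hs : Rabs (u (s n) - l) < / (INR n + 1)). { destruct n. apply (hnx (0%nat, 0%nat)). apply (hnx (s n, S n)). }
    apply le_INR in hn. left. eapply Rlt_trans. exact hs. rewrite <- (Rinv_inv eps). apply Rinv_lt_contravar.
    apply Rmult_lt_0_compat. apply Rinv_0_lt_compat; auto. assert (0 < / eps) by (apply Rinv_0_lt_compat; auto). lra. lra.
Qed.

Definition cauchyC (u : nat -> C) : Prop := forall eps, 0 < eps -> exists N, forall n m, (N <= n)%nat -> (N <= m)%nat -> Cmod (u n - u m) <= eps.

Lemma C_subseq (u : nat -> C) (B : R) : (forall n, Cmod (u n) <= B) -> exists s, incr s /\ cauchyC (fun n => u (s n)).
Proof.
  intros hB.
  destruct (real_subseq (fun n => Re (u n)) B) as [s [x [hs hx]]].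
  { intro n. eapply Rle_trans. apply re_le_Cmod. auto. }
  destruct (real_subseq (fun n => Im (u (s n))) B) as [t [y [ht hy]]].
  { intro n. eapply Rle_trans. apply im_le_Cmod. auto. }
  exists (fun n => s (t n)). split. apply incr_comp; auto.
  intros eps heps. destruct (hx (eps / 4) ltac:(lra)) as [N1 h1]. destruct (hy (eps / 4) ltac:(lra)) as [N2 h2].
  exists (N1 + N2)%nat. intros n m hn hm.
  pose proof (h1 (t n) ltac:(generalize (incr_ge t ht n); lia)) as a1. pose proof (h1 (t m) ltac:(generalize (incr_ge t ht m); lia)) as a2.
  pose proof (h2 n ltac:(lia)) as a3. pose proof (h2 m ltac:(lia)) as a4.
  eapply Rle_trans. apply Cmod_le_sum.
  change (Rabs (Re (u (s (t n))) - Re (u (s (t m)))) + Rabs (Im (u (s (t n))) - Im (u (s (t m)))) <= eps).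
  apply Rabs_le_between in a1. apply Rabs_le_between in a2. apply Rabs_le_between in a3. apply Rabs_le_between in a4.
  assert (Rabs (Re (u (s (t n))) - Re (u (s (t m)))) <= eps / 2) by (apply Rabs_le; lra).
  assert (Rabs (Im (u (s (t n))) - Im (u (s (t m)))) <= eps / 2) by (apply Rabs_le; lra). lra.
Qed.

(** Nested extractions T i, the (i + 1)-st making u i a Cauchy sequence; the diagonal T n n is
    eventually a subsequence of each of them. *)
Lemma diagonal_subseq (u : nat -> nat -> C) : (forall i, exists B, forall n, Cmod (u i n) <= B) ->
  exists s, incr s /\ forall i, cauchyC (fun n => u i (s n)).
Proof.
  intros hB.
  assert (H : forall p : nat * (nat -> nat), exists t, incr t /\ cauchyC (fun n => u (fst p) (snd p (t n)))).
  { intros [i s]. destruct (hB i) as [B hBi]. apply (C_subseq (fun n => u i (s n)) B). intro; apply hBi. }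
  apply choice in H. destruct H as [ex hex].
  (* T carries the whole extraction, and the choice function [ex] depends on it, because convergence
     of u i is sought along what has already been extracted. *)
  set (T := fix T i := match i with O => (fun n => n) | S k => (fun n => T k (ex (k, T k) n)) end).
  assert (hT : forall i, incr (T i)).
  { induction i. intro n; simpl; lia. simpl. apply incr_comp; auto. apply hex. }
  assert (hTT : forall i k, exists t, incr t /\ forall n, T (i + k)%nat n = T i (t n)).
  { intros i k. induction k as [|k [t [ht e]]].
    - exists (fun n => n). split. intro n; lia. intro n. rewrite Nat.add_0_r. reflexivity.
    - exists (fun n => t (ex ((i + k)%nat, T (i + k)%nat) n)). split. apply incr_comp; auto. apply hex.
      intro n. rewrite Nat.add_succ_r. simpl. apply e. }
  exists (fun n => T n n). split.
  - intro n. simpl. apply Nat.lt_le_trans with (T n (S n)). apply hT.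
    destruct (Nat.eq_dec (S n) (ex (n, T n) (S n))) as [e|e]. rewrite <- e; lia.
    apply Nat.lt_le_incl.
    assert (h := incr_ge (ex (n, T n)) (proj1 (hex (n, T n))) (S n)).
    apply incr_lt; auto. lia.
  - intros i eps heps. destruct (proj2 (hex (i, T i)) eps heps) as [N hN]. simpl in hN.
    exists (N + S i)%nat. intros n m hn hm.
    destruct (hTT (S i) (n - S i)%nat) as [t1 [ht1 e1]]. destruct (hTT (S i) (m - S i)%nat) as [t2 [ht2 e2]].
    replace (S i + (n - S i))%nat with n in e1 by lia. replace (S i + (m - S i))%nat with m in e2 by lia.
    rewrite e1, e2. simpl. apply hN. generalize (incr_ge t1 ht1 n); lia. generalize (incr_ge t2 ht2 m); lia.
Qed.

(** * A countable dense set and Montel's theorem *)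

Definition grid (N k : nat) : R := INR k / (INR N + 1) - 1.

Lemma grid_approx (N : nat) (x : R) : -1 <= x <= 1 -> exists k, (k <= 2 * (N + 1))%nat /\ Rabs (x - grid N k) <= / (INR N + 1).
Proof.
  intros hx. pose proof (pos_INR N) as hN. set (n := INR N + 1) in *.
  assert (hn : 0 < n) by (unfold n; lra).
  destruct (nfloor_ex ((x + 1) * n)) as [k [h1 h2]]. nra.
  exists k. split.
  - apply INR_le. rewrite mult_INR, plus_INR. simpl. fold n. nra.
  - unfold grid. fold n. replace (x - (INR k / n - 1)) with (((x + 1) * n - INR k) * / n) by (field; lra).
    rewrite Rabs_mult, (Rabs_pos_eq (/ n)) by (left; apply Rinv_0_lt_compat; auto).
    rewrite <- (Rmult_1_l (/ n)) at 2. apply Rmult_le_compat_r. left; apply Rinv_0_lt_compat; auto. apply Rabs_le; lra.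
Qed.

(** One sequence that contains the grids of all mesh sizes: the Cantor code of i holds the mesh N
    and the four grid indices. *)
Definition grid_point (i : nat) : C * C :=
  let (N, i1) := of_nat i in let (a, i2) := of_nat i1 in let (b, i3) := of_nat i2 in let (c, d) := of_nat i3 in
  ((grid N a, grid N b), (grid N c, grid N d)).

(** One threshold for finitely many indices. It bounds the codes of a grid one index at a time, and
    gives a common rank of convergence at finitely many grid points. *)
Lemma bounded_code (P : nat -> nat -> Prop) (m : nat) : (forall a n n', P a n -> (n <= n')%nat -> P a n') ->
  (forall a, exists n, P a n) -> exists n, forall a, (a <= m)%nat -> P a n.
Proof.
  intros hmon hex. induction m as [|m [n hn]].
  - destruct (hex 0%nat) as [n hn]. exists n. intros a ha. replace a with 0%nat by lia. auto.
  - destruct (hex (S m)) as [n' hn']. exists (n + n')%nat. intros a ha. destruct (Nat.eq_dec a (S m)) as [->|e].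
    + apply hmon with n'; auto. lia.
    + apply hmon with n. apply hn; lia. lia.
Qed.

Lemma grid_point_dense eps : 0 < eps -> exists n, forall z, inclD2 z -> exists i, (i < n)%nat /\
  Cmod (fst z - fst (grid_point i)) < eps /\ Cmod (snd z - snd (grid_point i)) < eps.
Proof.
  intros heps. destruct (INR_unbounded (/ (eps / 4))) as [N hN].
  set (m := (2 * (N + 1))%nat).
  set (code := fun a b c d => to_nat (N, to_nat (a, to_nat (b, to_nat (c, d))))).
  destruct (bounded_code (fun a n => forall b c d, (b <= m)%nat -> (c <= m)%nat -> (d <= m)%nat -> (code a b c d < n)%nat) m) as [n hn].
  { intros a n n' h hl b c d hb hc hd. generalize (h b c d hb hc hd); lia. }
  { intro a. destruct (bounded_code (fun b n => forall c d, (c <= m)%nat -> (d <= m)%nat -> (code a b c d < n)%nat) m) as [n hn].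
    { intros b n n' h hl c d hc hd. generalize (h c d hc hd); lia. }
    { intro b. destruct (bounded_code (fun c n => forall d, (d <= m)%nat -> (code a b c d < n)%nat) m) as [n hn].
      { intros c n n' h hl d hd. generalize (h d hd); lia. }
      { intro c. destruct (bounded_code (fun d n => (code a b c d < n)%nat) m) as [n hn].
        { intros d n n' h hl. lia. } { intro d. exists (S (code a b c d)). lia. }
        exists n. auto. }
      exists n. auto. }
    exists n. auto. }
  exists n. intros [[x1 x2] [x3 x4]] [h1 h2]. simpl in h1, h2.
  assert (hs : / (INR N + 1) < eps / 4).
  { rewrite <- (Rinv_inv (eps / 4)). assert (0 < / (eps / 4)) by (apply Rinv_0_lt_compat; lra). apply Rinv_lt_contravar; [apply Rmult_lt_0_compat; lra|lra]. }
  assert (b1 := Rle_trans _ _ _ (re_le_Cmod (x1, x2)) h1). assert (b2 := Rle_trans _ _ _ (im_le_Cmod (x1, x2)) h1).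
  assert (b3 := Rle_trans _ _ _ (re_le_Cmod (x3, x4)) h2). assert (b4 := Rle_trans _ _ _ (im_le_Cmod (x3, x4)) h2).
  simpl in b1, b2, b3, b4. apply Rabs_le_between in b1, b2, b3, b4.
  destruct (grid_approx N x1 b1) as [a [ha ka]]. destruct (grid_approx N x2 b2) as [b [hb kb]].
  destruct (grid_approx N x3 b3) as [c [hc kc]]. destruct (grid_approx N x4 b4) as [d [hd kd]].
  exists (code a b c d). split. apply hn; auto.
  assert (e : grid_point (code a b c d) = ((grid N a, grid N b), (grid N c, grid N d))).
  { unfold grid_point, code. rewrite !cancel_of_to. reflexivity. }
  rewrite e. simpl. split; (apply Rlt_trans with (2 * (eps / 4)); [apply Cmod_lt_of_parts; simpl; lra|lra]).
Qed.

(** A subsequence converging at all grid points is uniformly Cauchy on each [inK delta] by the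
    common Lipschitz bound. The bound 2 M + 2 for the limit is crude: on a given torus the limit is
    within 1 of some fn, and |a + b|^2 <= 2 |a|^2 + 2 |b|^2. *)
Theorem montel_h2 (fn : nat -> C * C -> C) (M : R) : (forall n, holo_D2 (fn n)) -> (forall n r, 0 < r < 1 -> circ_int (fn n) r <= M) ->
  exists s f, incr s /\ holo_D2 f /\ (forall r, 0 < r < 1 -> circ_int f r <= 2 * M + 2) /\
    forall delta eps, 0 < delta < 1 -> 0 < eps -> exists N, forall k, (N <= k)%nat -> forall z, inK delta z -> Cmod (fn (s k) z - f z) <= eps.
Proof.
  intros hfn hM.
  assert (hbd : forall delta, 0 < delta < 1 -> exists B, 0 <= B /\ forall n z, inK delta z -> Cmod (fn n z) <= B).
  { intros delta hd. exists (16 / delta ^ 2 * M + 1).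
    assert (hq : forall n z, inK delta z -> Cmod (fn n z) ^ 2 <= 16 / delta ^ 2 * M) by (intros; apply h2_point_bound; auto).
    assert (0 <= 16 / delta ^ 2 * M). { eapply Rle_trans. apply pow2_ge_0. apply (hq 0%nat (RtoC 0, RtoC 0)). split; simpl; rewrite Cmod_0; lra. }
    split. lra. intros n z hz. specialize (hq n z hz). generalize (Cmod_ge_0 (fn n z)). nra. }
  (* Grid points outside the open bidisc are replaced by the origin, so that every sequence of
     values is bounded. *)
  set (gp := fun i => if excluded_middle_informative (inD2 (grid_point i)) then grid_point i else (RtoC 0, RtoC 0)).
  assert (hgp : forall i, inD2 (gp i)).
  { intro i. unfold gp. destruct (excluded_middle_informative _); auto. split; unfold inD; simpl; rewrite Cmod_0; lra. }
  destruct (diagonal_subseq (fun i n => fn n (gp i))) as [s [hs hc]].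
  { intro i. destruct (inD2_inK _ (hgp i)) as [d [hd hk]]. destruct (hbd d hd) as [B [_ hB]]. exists B. intro n; apply hB; auto. }
  assert (unif : forall delta eps, 0 < delta < 1 -> 0 < eps -> exists N, forall k l, (N <= k)%nat -> (N <= l)%nat -> forall z, inK delta z -> Cmod (fn (s k) z - fn (s l) z) <= eps).
  (* A grid point within delta / 4 of [inK delta] lies in [inK (2 * d4)], where the Lipschitz
     estimate uses the bound B valid on [inK d4]. *)
  { intros delta eps hd heps. set (d4 := delta / 4). assert (hd4 : 0 < d4 < 1) by (unfold d4; lra).
    destruct (hbd d4 hd4) as [B [hB0 hB]].
    set (L := 2 * B / d4). assert (hL : 0 <= L) by (apply Rdiv_le_0_compat; lra).
    set (e := Rmin d4 (eps / (8 * (L + 1)))). assert (he : 0 < e). { apply Rmin_pos. lra. apply Rdiv_lt_0_compat; lra. }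
    assert (he1 : e <= d4) by apply Rmin_l. assert (he2 : e <= eps / (8 * (L + 1))) by apply Rmin_r.
    destruct (grid_point_dense e he) as [n hn].
    destruct (bounded_code (fun i N => forall k l, (N <= k)%nat -> (N <= l)%nat -> Cmod (fn (s k) (gp i) - fn (s l) (gp i)) <= eps / 2) n) as [N hN].
    { intros i N N' h hl k l hk hl'. apply h; lia. }
    { intro i. apply (hc i (eps / 2) (half_pos _ heps)). }
    exists N. intros k l hk hl z hz.
    destruct (hn z (inD2_incl z (inK_inD2 delta z ltac:(lra) hz))) as [i [hi [g1 g2]]].
    assert (hgi : inK (2 * d4) (grid_point i)).
    { destruct hz as [z1 z2]. split.
      - generalize (Cmod_triangle_inv (fst (grid_point i)) (fst z)). rewrite (Cmod_sub_sym (fst (grid_point i))). unfold d4 in *; lra.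
      - generalize (Cmod_triangle_inv (snd (grid_point i)) (snd z)). rewrite (Cmod_sub_sym (snd (grid_point i))). unfold d4 in *; lra. }
    assert (egp : gp i = grid_point i).
    { unfold gp. destruct (excluded_middle_informative _) as [h|h]; auto. exfalso. apply h. apply inK_inD2 with (2 * d4); auto; lra. }
    specialize (hN i ltac:(lia) k l hk hl). rewrite egp in hN.
    assert (hzz : inK (2 * d4) z) by (destruct hz; split; unfold d4; lra).
    assert (lip : forall j, Cmod (fn (s j) z - fn (s j) (grid_point i)) <= eps / 4).
    { intro j. eapply Rle_trans. apply (holo_lipschitz (fn (s j)) B d4); auto. lra. fold L.
      apply Rle_trans with (L * (2 * e)). apply Rmult_le_compat_l; lra.
      apply Rle_trans with ((L + 1) * (2 * (eps / (8 * (L + 1))))). apply Rmult_le_compat; lra. right; field; lra. }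
    pose proof (lip k) as l1. pose proof (lip l) as l2.
    replace (fn (s k) z - fn (s l) z)%C with ((fn (s k) z - fn (s k) (grid_point i)) + (fn (s k) (grid_point i) - fn (s l) (grid_point i)) - (fn (s l) z - fn (s l) (grid_point i)))%C by ring.
    eapply Rle_trans. apply Cmod_sub_le.
    generalize (Cmod_triangle (fn (s k) z - fn (s k) (grid_point i)) (fn (s k) (grid_point i) - fn (s l) (grid_point i))). lra. }
  assert (lim : forall z, exists v, inD2 z -> forall eps, 0 < eps -> exists N, forall n, (N <= n)%nat -> Cmod (fn (s n) z - v) <= eps).
  { intro z. destruct (classic (inD2 z)) as [hz|hz]; [|exists (RtoC 0); tauto].
    destruct (inD2_inK z hz) as [d [hd hk]].
    destruct (C_cauchy_seq (fun n => fn (s n) z)) as [v hv].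
    { intros eps heps. destruct (unif d eps hd heps) as [N hN]. exists N. intros n m hn hm. apply hN; auto. }
    exists v. intros _. exact hv. }
  apply choice in lim. destruct lim as [f hf].
  assert (cv : forall delta eps, 0 < delta < 1 -> 0 < eps -> exists N, forall k, (N <= k)%nat -> forall z, inK delta z -> Cmod (fn (s k) z - f z) <= eps).
  { intros delta eps hd heps. destruct (unif delta eps hd heps) as [N hN]. exists N. intros k hk z hz.
    apply le_of_forall_eps with 1. lra. intros e he.
    destruct (hf z (inK_inD2 delta z ltac:(lra) hz) e he) as [N' hN'].
    specialize (hN k (N + N')%nat hk ltac:(lia) z hz). specialize (hN' (N + N')%nat ltac:(lia)).
    generalize (Cmod_sub_triangle (fn (s k) z) (fn (s (N + N')%nat) z) (f z)). lra. }
  assert (hol : holo_D2 f).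
  { apply (holo_limit (fun n => fn (s n))); auto. intros delta hd. destruct (hbd delta hd) as [B [_ hB]]. exists B. auto. }
  exists s, f. repeat split; auto; try (apply hol; auto).
  intros r hr.
  destruct (cv (1 - r) 1 ltac:(lra) Rlt_0_1) as [N hN]. specialize (hN N (le_n _)).
  assert (hdiff : holo_D2 (fun z => f z - fn (s N) z)%C).
  { apply holo_D2_iff. intros z hz. destruct (proj1 (holo_D2_iff _) hol z hz) as [c1 [[d1 q1] [d2 q2]]].
    destruct (proj1 (holo_D2_iff _) (hfn (s N)) z hz) as [c2 [[d3 q3] [d4 q4]]].
    split. apply continuous_Cminus; auto.
    split; eexists; unfold hd1, hd2.
    - replace (fun w => f (w, snd z) - fn (s N) (w, snd z))%C with (fun w => f (w, snd z) + (- RtoC 1) * fn (s N) (w, snd z))%C by (apply functional_extensionality; intro; ring).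
      apply cder_plus. exact q1. apply (cder_mult (fun _ => - RtoC 1)%C (fun w => fn (s N) (w, snd z))). apply cder_const. exact q3.
    - replace (fun w => f (fst z, w) - fn (s N) (fst z, w))%C with (fun w => f (fst z, w) + (- RtoC 1) * fn (s N) (fst z, w))%C by (apply functional_extensionality; intro; ring).
      apply cder_plus. exact q2. apply (cder_mult (fun _ => - RtoC 1)%C (fun w => fn (s N) (fst z, w))). apply cder_const. exact q4. }
  eapply Rle_trans. apply (circ_int_plus (fun z => f z - fn (s N) z)%C (fn (s N))); auto; try lra. intros; ring.
  assert (circ_int (fun z => f z - fn (s N) z)%C r <= 1).
  { apply circ_int_le_const; auto; try lra. intros t1 t2. unfold dens.
    assert (Cmod (f (tor r t1 t2) - fn (s N) (tor r t1 t2)) <= 1).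
    { rewrite Cmod_sub_sym. apply hN. split; simpl; rewrite Cmod_mult, Cmod_expi, Cmod_RtoC_pos by lra; lra. }
    generalize (Cmod_ge_0 (f (tor r t1 t2) - fn (s N) (tor r t1 t2))). nra. }
  specialize (hM (s N) r hr). lra.
Qed.

(** * Sufficiency *)

Lemma holo_minus f g : holo_D2 f -> holo_D2 g -> holo_D2 (fun z => f z - g z)%C.
Proof.
  intros hf hg. apply holo_D2_iff. intros z hz. destruct (proj1 (holo_D2_iff _) hf z hz) as [c1 [[d1 q1] [d2 q2]]].
  destruct (proj1 (holo_D2_iff _) hg z hz) as [c2 [[d3 q3] [d4 q4]]].
  split. apply continuous_Cminus; auto.
  split; eexists; unfold hd1, hd2.
  - replace (fun w => f (w, snd z) - g (w, snd z))%C with (fun w => f (w, snd z) + (- RtoC 1) * g (w, snd z))%C by (apply functional_extensionality; intro; ring).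
    apply cder_plus. exact q1. apply (cder_mult (fun _ => - RtoC 1)%C (fun w => g (w, snd z))). apply cder_const. exact q3.
  - replace (fun w => f (fst z, w) - g (fst z, w))%C with (fun w => f (fst z, w) + (- RtoC 1) * g (fst z, w))%C by (apply functional_extensionality; intro; ring).
    apply cder_plus. exact q2. apply (cder_mult (fun _ => - RtoC 1)%C (fun w => g (fst z, w))). apply cder_const. exact q4.
Qed.

(** |G| < 1 on the dilated closed bidisc, which lies in the open bidisc; the Lebesgue number makes
    the gap uniform. *)
Lemma interior_sup G : ucont G -> (forall z, inD2 z -> Cmod (G z) < 1) -> forall r0, 0 <= r0 < 1 ->
  exists d, 0 < d < 1 /\ forall z, inclD2 z -> Cmod (G (dil r0 z)) <= 1 - d.
Proof.
  intros hG hmap r0 hr.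
  assert (H : forall z, exists e, inclD2 z -> 0 < e /\ forall w, inclD2 w -> Cmod (fst w - fst z) < e -> Cmod (snd w - snd z) < e -> Cmod (G (dil r0 w)) <= 1 - e).
  { intro z. destruct (classic (inclD2 z)) as [hz|hz]; [|exists 0; tauto].
    pose proof (hmap _ (dil_inD2 r0 z hr hz)) as h. set (eta := (1 - Cmod (G (dil r0 z))) / 2).
    destruct (hG eta ltac:(unfold eta; lra)) as [d [hd k]].
    exists (Rmin d eta). intros _. assert (q1 := Rmin_l d eta). assert (q2 := Rmin_r d eta). split. apply Rmin_pos; auto; unfold eta; lra.
    intros w hw h1 h2.
    assert (sc : forall a b : C, Cmod (RtoC r0 * a - RtoC r0 * b) <= Cmod (a - b)).
    { intros a b. replace (RtoC r0 * a - RtoC r0 * b)%C with (RtoC r0 * (a - b))%C by ring. rewrite Cmod_mult, Cmod_RtoC_pos by lra.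
      generalize (Cmod_ge_0 (a - b)); nra. }
    assert (Cmod (G (dil r0 w) - G (dil r0 z)) < eta).
    { apply k. apply inD2_incl, dil_inD2; auto. apply inD2_incl, dil_inD2; auto.
      simpl. eapply Rle_lt_trans. apply sc. lra. simpl. eapply Rle_lt_trans. apply sc. lra. }
    generalize (Cmod_triangle_inv (G (dil r0 w)) (G (dil r0 z))). unfold eta in *. lra. }
  apply choice in H. destruct H as [dl hdl].
  destruct (lebesgue_number_bidisc dl) as [d [hd k]]. { intros z hz. apply (hdl z hz). }
  exists (Rmin d (1 / 2)). assert (q1 := Rmin_l d (1 / 2)). assert (q2 := Rmin_r d (1 / 2)).
  split. split. apply Rmin_pos; lra. lra. intros z hz.
  destruct (k z hz) as [t [ht [t1 [t2 t3]]]]. destruct (hdl t ht) as [_ q]. specialize (q z hz t1 t2). lra.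
Qed.

Lemma tor_dil_le r r0 t1 t2 : 0 <= r <= r0 -> 0 < r0 -> exists z, inclD2 z /\ tor r t1 t2 = dil r0 z.
Proof.
  intros h h0. assert (hq : 0 <= r / r0 <= 1). { split. apply Rdiv_le_0_compat; lra. apply Rle_div_l; lra. }
  exists (tor (r / r0) t1 t2). split. apply tor_incl; auto.
  unfold tor, dil; simpl. rewrite !Cmult_assoc, <- !RtoC_mult. replace (r0 * (r / r0)) with r by (field; lra). reflexivity.
Qed.

Lemma inT_reduce t : exists s, 0 <= s <= 2 * PI /\ expi t = expi s.
Proof. destruct (inT_expi (expi t) (Cmod_expi t)) as [s [hs e]]. exists s. split; auto. lra. Qed.

(** The smaller of the two moduli is below 1 everywhere on the distinguished boundary, hence at most
    some m < 1. Half of the gap 1 - m is spent on passing to radii close to 1. *)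
Lemma torus_separation G1 G2 : ucont G1 -> ucont G2 -> (forall z, inclD2 z -> Cmod (G1 z) <= 1) -> (forall z, inclD2 z -> Cmod (G2 z) <= 1) ->
  (forall t1 t2, ~ (Cmod (G1 (tor 1 t1 t2)) = 1 /\ Cmod (G2 (tor 1 t1 t2)) = 1)) ->
  exists c r0, 0 < c < 1 /\ 0 <= r0 < 1 /\ forall r t1 t2, r0 <= r < 1 -> Cmod (G1 (tor r t1 t2)) <= 1 - c \/ Cmod (G2 (tor r t1 t2)) <= 1 - c.
Proof.
  intros u1 u2 b1 b2 hsep.
  assert (uc : forall G, ucont G -> forall p : R * R, continuous (fun p : R * R => G (tor 1 (fst p) (snd p))) p).
  { intros G uG [p q]. apply continuous_C_iff. intros eps heps. destruct (ucont_near_tor G p q eps uG heps) as [d [hd k]].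
    apply locally_RR_iff. exists d. split; auto. intros y h1 h2. simpl in *. apply k; lra. }
  destruct (cont2_sup_lt (fun t1 t2 => Rmin (Cmod (G1 (tor 1 t1 t2))) (Cmod (G2 (tor 1 t1 t2)))) 1) as [m [hm km]].
  { intro p. pose proof (uc G1 u1 p) as c1. pose proof (uc G2 u2 p) as c2.
    (* The minimum is rewritten as (a + b - |a - b|) / 2, whose continuity is automatic. *)
    apply continuous_ext with (fun p : R * R => / 2 * (Cmod (G1 (tor 1 (fst p) (snd p))) + Cmod (G2 (tor 1 (fst p) (snd p))) - Rabs (Cmod (G1 (tor 1 (fst p) (snd p))) - Cmod (G2 (tor 1 (fst p) (snd p)))))).
    { intro x. match goal with |- @eq _ ?a ?b => change (@eq R a b) end. unfold Rmin. destruct (Rle_dec _ _). rewrite Rabs_left1 by lra. field. rewrite Rabs_pos_eq by lra. field. }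
    cont. }
  { intros t1 t2. specialize (hsep t1 t2). pose proof (b1 _ (tor1_incl t1 t2)). pose proof (b2 _ (tor1_incl t1 t2)).
    unfold Rmin. destruct (Rle_dec _ _).
    - destruct (Req_dec (Cmod (G1 (tor 1 t1 t2))) 1); [|lra]. exfalso. apply hsep. split; lra.
    - lra. }
  assert (hm0 : 0 <= m). { eapply Rle_trans; [|apply (km 0 0); generalize PI2_pos; lra]. apply Rmin_glb; apply Cmod_ge_0. }
  set (c := (1 - m) / 2).
  destruct (ucont_dil G1 u1 c ltac:(unfold c; lra)) as [s1 [hs1 k1]]. destruct (ucont_dil G2 u2 c ltac:(unfold c; lra)) as [s2 [hs2 k2]].
  exists c, (Rmax s1 s2). split. unfold c; lra. split. split. eapply Rle_trans; [|apply Rmax_l]; lra. apply Rmax_lub_lt; lra.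
  intros r t1 t2 hr. assert (q1 := Rmax_l s1 s2). assert (q2 := Rmax_r s1 s2).
  (* The bound m is known for angles in [0, 2 PI] only. *)
  destruct (inT_reduce t1) as [v1 [hv1 e1]]. destruct (inT_reduce t2) as [v2 [hv2 e2]].
  assert (e : forall r, tor r t1 t2 = tor r v1 v2) by (intro; unfold tor; rewrite e1, e2; reflexivity).
  rewrite e, tor_dil. specialize (km v1 v2 hv1 hv2). cbv beta in km.
  pose proof (k1 r (tor 1 v1 v2) ltac:(lra) (tor1_incl v1 v2)) as l1. pose proof (k2 r (tor 1 v1 v2) ltac:(lra) (tor1_incl v1 v2)) as l2.
  unfold Rmin in km. destruct (Rle_dec _ _) in km.
  - left. generalize (Cmod_triangle_inv (G1 (dil r (tor 1 v1 v2))) (G1 (tor 1 v1 v2))). unfold c in *. lra.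
  - right. generalize (Cmod_triangle_inv (G2 (dil r (tor 1 v1 v2))) (G2 (tor 1 v1 v2))). unfold c in *. lra.
Qed.

(** * Boundedness and compactness of the composition operator *)

Section PartB.
Variable phi : C * C -> C * C.
Hypotheses (hol1 : holo_D2 (fun z => fst (phi z))) (hol2 : holo_D2 (fun z => snd (phi z)))
  (hmaps : forall z, inD2 z -> inD2 (phi z)) (hsm : Ck_closed_bidisc 3 phi)
  (hsep : forall xi, inT2 xi -> ~ inT2 (phi xi))
  (hord : forall xi (j : bool), inT2 xi -> inT (phi_j phi j xi) -> truly_2d_order2 (phi_j phi j) xi).

(** For r >= r0 the estimate on one torus applies, with constants independent of r. For smaller r
    the image of the torus stays in [inK d0], contained in [inK delta], so S alone is enough. *)
Lemma comp_estimate : exists c d0 A, 0 < c < 1 /\ 0 < d0 <= c /\ 0 <= A /\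
  forall delta f S M r, 0 < delta <= d0 -> holo_D2 f -> 0 <= S -> 0 <= M -> (forall z, inK delta z -> Cmod (f z) ^ 2 <= S) ->
    (forall s, 0 < s < 1 -> circ_int f s <= M) -> 0 < r < 1 -> circ_int (fun z => f (phi z)) r <= S + A * Rpower delta (1 / 8) * M.
Proof.
  destruct (symbol_of_smooth phi false hol1 hol2 hmaps hsm) as [F1 [F2 [F11 [F12 [F21 [F22 sF]]]]]].
  destruct (symbol_of_smooth phi true hol1 hol2 hmaps hsm) as [G1 [G2 [G11 [G12 [G21 [G22 sG]]]]]].
  assert (uF := sy_u _ _ _ _ _ _ _ sF). assert (uG := sy_u _ _ _ _ _ _ _ sG).
  destruct (torus_separation _ _ uF uG (symbol_closed_bound _ _ _ _ _ _ _ sF) (symbol_closed_bound _ _ _ _ _ _ _ sG)) as [c [r1 [hc [hr1 sep]]]].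
  { intros t1 t2 [h1 h2]. apply (hsep (tor 1 t1 t2)). split; unfold inT; simpl; rewrite Cmult_1_l; apply Cmod_expi. split; [exact h1|exact h2]. }
  destruct (kernel_bound _ _ _ _ _ _ _ sF (fun xi => hord xi false)) as [C1 [r2 [hC1 [hr2 k1]]]].
  destruct (kernel_bound _ _ _ _ _ _ _ sG (fun xi => hord xi true)) as [C2 [r3 [hC2 [hr3 k2]]]].
  set (r0 := Rmax (1 / 2) (Rmax r1 (Rmax r2 r3))).
  assert (hr0 : 1 / 2 <= r0 < 1 /\ r1 <= r0 /\ r2 <= r0 /\ r3 <= r0).
  { unfold r0. generalize (Rmax_l (1 / 2) (Rmax r1 (Rmax r2 r3))) (Rmax_r (1 / 2) (Rmax r1 (Rmax r2 r3))) (Rmax_l r1 (Rmax r2 r3)) (Rmax_r r1 (Rmax r2 r3)) (Rmax_l r2 r3) (Rmax_r r2 r3).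
    intros. repeat split; try lra. repeat apply Rmax_lub_lt; lra. }
  clearbody r0.
  destruct (interior_sup _ uF (sy_maps _ _ _ _ _ _ _ sF) r0 ltac:(lra)) as [d1 [hd1 i1]].
  destruct (interior_sup _ uG (sy_maps _ _ _ _ _ _ _ sG) r0 ltac:(lra)) as [d2 [hd2 i2]].
  set (d0 := Rmin c (Rmin d1 d2)).
  assert (hd0 : 0 < d0 /\ d0 <= c /\ d0 <= d1 /\ d0 <= d2).
  { unfold d0. generalize (Rmin_l c (Rmin d1 d2)) (Rmin_r c (Rmin d1 d2)) (Rmin_l d1 d2) (Rmin_r d1 d2). intros. repeat split; try lra. repeat apply Rmin_pos; lra. }
  set (Cm := Rmax C1 C2). assert (hCm : 0 <= Cm) by (eapply Rle_trans; [exact hC1|apply Rmax_l]).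
  assert (h4 := fourPI2_pos).
  exists c, d0, (2 * (32 / c / (4 * PI ^ 2) * Cm)). split; auto. split. lra. split.
  { apply Rmult_le_pos. lra. apply Rmult_le_pos; auto. apply Rdiv_le_0_compat; auto. left; apply Rdiv_lt_0_compat; lra. }
  intros delta f S M r hdl hf hS0 hM0 hS hM hr.
  destruct (Rle_dec r0 r) as [hrr|hrr].
  - eapply Rle_trans. apply (circ_int_comp_le f phi r c delta S Cm M); auto; try lra.
    + intros t1 t2. apply sep. lra.
    + intros z z1 z2. apply hS. split; auto.
    + intro t. eapply Rle_trans. apply k1; lra. apply Rmax_l.
    + intro t. eapply Rle_trans. apply k2; lra. apply Rmax_r.
    + right. field. split. lra. apply PI_neq0.
  - apply Rle_trans with S.
    + apply circ_int_le_const. apply holo_comp; auto. lra. intros t1 t2. unfold dens. apply hS.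
      destruct (tor_dil_le r r0 t1 t2 ltac:(lra) ltac:(lra)) as [z [hz e]]. rewrite e. specialize (i1 z hz). specialize (i2 z hz).
      unfold phi_j in i1, i2. split; lra.
    + assert (0 <= 2 * (32 / c / (4 * PI ^ 2) * Cm) * Rpower delta (1 / 8) * M); [|lra].
      apply Rmult_le_pos; auto. apply Rmult_le_pos. apply Rmult_le_pos. lra. apply Rmult_le_pos; auto. apply Rdiv_le_0_compat; auto. left; apply Rdiv_lt_0_compat; lra. left; apply exp_pos.
Qed.

Theorem sufficiency : compact_Cphi phi.
Proof.
  destruct comp_estimate as [c [d0 [A [hc [hd0 [hA est]]]]]].
  assert (bounded : forall f M, holo_D2 f -> (forall r, 0 < r < 1 -> circ_int f r <= M) -> exists M', forall r, 0 < r < 1 -> circ_int (fun z => f (phi z)) r <= M').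
  { intros f M hf hM. assert (hM0 : 0 <= M). { eapply Rle_trans. apply (circ_int_ge0 f (1 / 2)); auto; lra. apply hM; lra. }
    (* [comp_estimate] with delta = d0, S being the pointwise bound on [inK d0]. *)
    exists (16 / d0 ^ 2 * M + A * Rpower d0 (1 / 8) * M). intros r hr. apply est; auto; try lra.
    - apply Rmult_le_pos; auto. apply Rdiv_le_0_compat. lra. apply pow_lt; lra.
    - intros z hz. apply h2_point_bound; auto. lra. }
  split.
  - intros f [hf [M hM]]. split. apply holo_comp; auto. apply (bounded f M); auto.
  - intros fn hfn [M hM].
    destruct (montel_h2 fn M (fun n => proj1 (hfn n)) hM) as [s [f [hs [hf [hfM cv]]]]].
    exists s, (fun z => f (phi z)). split; auto. split.
    { split. apply holo_comp; auto. apply (bounded f (2 * M + 2)); auto. }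
    intros eps heps.
    assert (hM0 : 0 <= M). { eapply Rle_trans. apply (circ_int_ge0 (fn 0%nat) (1 / 2)). apply hfn. lra. apply hM; lra. }
    (* M' bounds the means of fn - f, as the limit has means at most 2 M + 2. The number q is a
       value of delta^(1/8) that makes the second term of the estimate at most eps / 2, whence delta
       <= q^8. *)
    set (M' := 2 * M + 2 * (2 * M + 2)). assert (hM' : 0 < M') by (unfold M'; lra).
    set (q := eps / (2 * (A + 1) * M')). assert (hq : 0 < q) by (apply Rdiv_lt_0_compat; [lra|apply Rmult_lt_0_compat; lra]).
    set (delta := Rmin d0 (Rpower q 8)). assert (hdl : 0 < delta) by (apply Rmin_pos; [lra|apply exp_pos]).
    assert (hdl1 : delta <= d0) by apply Rmin_l. assert (hdl2 : delta <= Rpower q 8) by apply Rmin_r.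
    assert (hpq : Rpower delta (1 / 8) <= q).
    { apply Rle_trans with (Rpower (Rpower q 8) (1 / 8)). apply Rle_Rpower_l; lra. rewrite Rpower_mult. replace (8 * (1 / 8)) with 1 by field. rewrite Rpower_1; lra. }
    (* A distance that is at most 1 and at most eps / 2 has its square at most eps / 2. *)
    destruct (cv delta (Rmin 1 (eps / 2)) ltac:(lra) ltac:(apply Rmin_pos; lra)) as [N hN].
    exists N. intros k hk r hr.
    assert (hfk := proj1 (hfn (s k))).
    assert (hdiff : holo_D2 (fun z => fn (s k) z - f z)%C) by (apply holo_minus; auto).
    apply Rle_trans with (eps / 2 + A * Rpower delta (1 / 8) * M').
    + apply (est delta (fun z => fn (s k) z - f z)%C); auto; try lra.
      * intros z hz. specialize (hN k hk z hz). set (u := Cmod (fn (s k) z - f z)) in *. assert (0 <= u) by apply Cmod_ge_0.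
        assert (u <= 1) by (eapply Rle_trans; [exact hN|apply Rmin_l]). assert (u <= eps / 2) by (eapply Rle_trans; [exact hN|apply Rmin_r]). nra.
      * intros t ht. assert (hnf : holo_D2 (fun z => RtoC 0 - f z)%C).
        { apply holo_minus; auto. apply holo_D2_iff. intros z hz. split. cont. split; exists 0%C; apply cder_const. }
        eapply Rle_trans. apply (circ_int_plus (fn (s k)) (fun z => RtoC 0 - f z)%C); auto; try lra. intros; ring.
        assert (circ_int (fun z => RtoC 0 - f z)%C t = circ_int f t).
        { rewrite !circ_int_dbl. f_equal. f_equal. apply functional_extensionality; intro x. apply functional_extensionality; intro y. unfold dens. rewrite <- Cmod_opp. f_equal. f_equal. ring. }
        rewrite H. specialize (hM (s k) t ht). specialize (hfM t ht). unfold M'. lra.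
    + assert (A * Rpower delta (1 / 8) * M' <= (A + 1) * q * M').
      { apply Rmult_le_compat_r. lra. apply Rmult_le_compat; try lra. left; apply exp_pos. }
      replace ((A + 1) * q * M') with (eps / 2) in H by (unfold q; field; lra). lra.
Qed.
End PartB.

(** * Test functions *)

Lemma periodic_RInt (G : R -> R) (a : R) : (forall t, continuous G t) -> (forall t, G (t + 2 * PI) = G t) ->
  RInt G a (a + 2 * PI) = RInt G 0 (2 * PI).
Proof.
  intros hc hper.
  assert (sh : RInt G (0 + 2 * PI) (a + 2 * PI) = RInt G 0 a).
  { pose proof (RInt_comp_lin (V := R_CompleteNormedModule) G 1 (2 * PI) 0 a (ex_RInt_cont G _ _ hc)) as k.
    replace (1 * 0 + 2 * PI) with (0 + 2 * PI) in k by ring. replace (1 * a + 2 * PI) with (a + 2 * PI) in k by ring.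
    rewrite <- k. apply RInt_ext_all. intro y. unfold scal; simpl. unfold mult; simpl. rewrite !Rmult_1_l. apply hper. }
  rewrite Rplus_0_l in sh.
  rewrite (RInt_Chasles_cont G a 0 hc (a + 2 * PI)), (RInt_Chasles_cont G 0 (2 * PI) hc (a + 2 * PI)), sh.
  assert (RInt G a 0 + RInt G 0 a = 0).
  { rewrite <- (RInt_Chasles_cont G a 0 hc a). apply (RInt_point (V := R_CompleteNormedModule)). }
  lra.
Qed.

(** Periodicity is used because the interval starting at tau may leave [0, 2 PI]. *)
Lemma periodic_lower (G : R -> R) (tau d m : R) : (forall t, continuous G t) -> (forall t, G (t + 2 * PI) = G t) -> (forall t, 0 <= G t) ->
  0 <= d <= 2 * PI -> (forall t, tau <= t <= tau + d -> m <= G t) -> m * d <= RInt G 0 (2 * PI).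
Proof.
  intros hc hper h0 hd hm. rewrite <- (periodic_RInt G tau hc hper).
  replace (m * d) with (m * (tau + d - tau)) by ring. eapply Rle_trans. apply RInt_ge_const with (f := G); auto; lra.
  apply RInt_subinterval; auto; lra.
Qed.

(** The start tau of the interval in x may depend on y without any regularity: the inner integral is
    at least m d for every admissible y, and only that number is integrated in y. *)
Lemma dbl_lower (h : R -> R -> R) (beta eps d m : R) : cont2 h -> (forall x y, 0 <= h x y) ->
  (forall x y, h (x + 2 * PI) y = h x y) -> (forall x y, h x (y + 2 * PI) = h x y) -> 0 <= d <= 2 * PI -> 0 <= eps <= 2 * PI ->
  (forall y, beta <= y <= beta + eps -> exists tau, forall x, tau <= x <= tau + d -> m <= h x y) ->
  m * d * eps <= dbl h.
Proof.
  intros hc h0 hp1 hp2 hd he hm. pose proof PI2_ge0 as hp. rewrite dbl_swap by auto.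
  pose proof (cont2_swap h hc) as hs.
  apply periodic_lower with (tau := beta); auto.
  - apply (cont2_RInt (fun y x => h x y)); auto.
  - intro t. apply RInt_ext_all. intro; apply hp2.
  - intro t. apply RInt_ge0_cont; auto. apply cont2_slice1; auto.
  - intros y hy. destruct (hm y hy) as [tau ht]. apply periodic_lower with (tau := tau); auto. apply cont2_slice1; auto.
Qed.

(** The normalised reproducing kernel of the Hardy space of the disc at the point rho eta. *)
Definition szego (rho : R) (eta w : C) : C := (RtoC (sqrt (1 - rho ^ 2)) / (RtoC 1 - RtoC rho * Cconj eta * w))%C.

Section Szego.
Variables (rho : R) (eta : C).
Hypotheses (hr : 0 <= rho < 1) (he : Cmod eta = 1).

Lemma one_minus_sq_pos : 0 < 1 - rho ^ 2.
Proof. nra. Qed.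

Lemma szego_den_ge w : Cmod w < 1 -> 1 - Cmod w <= Cmod (RtoC 1 - RtoC rho * Cconj eta * w).
Proof.
  intros hw. generalize (Cmod_triangle_inv (RtoC 1) (RtoC rho * Cconj eta * w)). rewrite !Cmod_mult, Cmod_conj, he, Cmod_1, Cmod_RtoC_pos by lra.
  generalize (Cmod_ge_0 w). nra.
Qed.

Lemma szego_den_ne w : Cmod w < 1 -> (RtoC 1 - RtoC rho * Cconj eta * w)%C <> RtoC 0.
Proof. intros hw. apply Cmod_gt_0. generalize (szego_den_ge w hw). lra. Qed.

Lemma szego_sq w : Cmod w < 1 -> Cmod (szego rho eta w) ^ 2 = (1 - rho ^ 2) / Cmod (RtoC 1 - RtoC rho * Cconj eta * w) ^ 2.
Proof.
  intros hw. unfold szego. rewrite Cmod_div by (apply szego_den_ne; auto).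
  rewrite Cmod_RtoC_pos by apply sqrt_pos. unfold Rdiv. rewrite Rpow_mult_distr, pow_inv. f_equal.
  rewrite <- Rsqr_pow2, Rsqr_sqrt; auto. generalize one_minus_sq_pos; lra.
Qed.

Lemma szego_holD : holD 1 (szego rho eta).
Proof.
  intros w hw. eexists. unfold szego, Cdiv. apply cder_mult. apply cder_const.
  apply (cder_comp (fun v => / v)%C (fun w => RtoC 1 - RtoC rho * Cconj eta * w)%C).
  - replace (fun w0 => (RtoC 1 - RtoC rho * Cconj eta * w0)%C) with (fun w0 => (RtoC 1 + (- (RtoC rho * Cconj eta)) * w0)%C) by (apply functional_extensionality; intro; ring).
    apply cder_plus. apply cder_const. apply cder_mult. apply cder_const. apply cder_id.
  - apply cder_inv. apply szego_den_ne; auto.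
Qed.

Lemma szego_small w d : 0 < d -> Cmod w <= 1 - d -> Cmod (szego rho eta w) ^ 2 <= (1 - rho ^ 2) / d ^ 2.
Proof.
  intros hd hw. rewrite szego_sq by lra. apply Rmult_le_compat_l. generalize one_minus_sq_pos; lra.
  apply Rinv_le_contravar. apply pow_lt; auto. apply pow_incr. split. lra. generalize (szego_den_ge w ltac:(lra)). lra.
Qed.

(** For w = r e^{it}, |1 - rho conj eta w| = |e^{it} - rho r eta|, and 1 - rho^2 <= 1 - (rho r)^2.
    As Poisson kernels have mean 1, the means of |[szego]|^2 over all circles are at most 1. *)
Lemma szego_circle r t : 0 <= r < 1 -> Cmod (szego rho eta (RtoC r * expi t)) ^ 2 <= poi 1 (RtoC (rho * r) * eta) t.
Proof.
  intros h. assert (hw : Cmod (RtoC r * expi t) < 1) by (rewrite Cmod_mult, Cmod_expi, Cmod_RtoC_pos; lra).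
  rewrite szego_sq by auto. unfold poi.
  assert (e : Cmod (RtoC 1 * expi t - RtoC (rho * r) * eta) = Cmod (RtoC 1 - RtoC rho * Cconj eta * (RtoC r * expi t))).
  { transitivity (Cmod (expi t * Cconj (RtoC 1 * expi t - RtoC (rho * r) * eta))).
    { rewrite Cmod_mult, Cmod_expi, Cmod_conj. ring. }
    f_equal. rewrite Cminus_conj, !Cmult_conj.
    replace (Cconj (RtoC 1)) with (RtoC 1) by (unfold Cconj, RtoC; simpl; f_equal; ring).
    replace (Cconj (RtoC (rho * r))) with (RtoC (rho * r)) by (unfold Cconj, RtoC; simpl; f_equal; ring).
    transitivity (Cconj (expi t) * expi t - RtoC (rho * r) * Cconj eta * expi t)%C. ring. rewrite conj_unit_mult by apply Cmod_expi. rewrite RtoC_mult. ring. }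
  rewrite e. apply Rmult_le_compat_r. left. apply Rinv_0_lt_compat, pow_lt, Cmod_gt_0, szego_den_ne; auto.
  rewrite Cmod_mult, he, Cmod_RtoC_pos by (apply Rmult_le_pos; lra). assert (0 <= rho * r <= rho) by nra. nra.
Qed.

(** Within L (1 - rho) of eta the denominator is at most (1 + L)(1 - rho), while the numerator 1 -
    rho^2 is at least 1 - rho. *)
Lemma szego_lower w L : Cmod w < 1 -> 0 <= L -> Cmod (w - eta) <= L * (1 - rho) -> / ((1 + L) ^ 2 * (1 - rho)) <= Cmod (szego rho eta w) ^ 2.
Proof.
  intros hw hL h. rewrite szego_sq by auto.
  assert (hden : Cmod (RtoC 1 - RtoC rho * Cconj eta * w) <= (1 + L) * (1 - rho)).
  { replace (RtoC 1 - RtoC rho * Cconj eta * w)%C with (RtoC (1 - rho) * RtoC 1 - RtoC rho * (Cconj eta * w - RtoC 1))%C by (rewrite RtoC_minus; ring).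
    eapply Rle_trans. apply Cmod_sub_le. rewrite !Cmod_mult, (unit_conj_dist eta w he), (Cmod_sub_sym eta), Cmod_1, !Cmod_RtoC_pos by lra.
    generalize (Cmod_ge_0 (w - eta)). nra. }
  assert (h0 : 0 < Cmod (RtoC 1 - RtoC rho * Cconj eta * w)) by (apply Cmod_gt_0, szego_den_ne; auto).
  apply Rle_trans with ((1 - rho) / ((1 + L) * (1 - rho)) ^ 2). right; field; lra.
  apply Rmult_le_compat; try nra. left; apply Rinv_0_lt_compat, pow_lt; nra.
  apply Rinv_le_contravar. apply pow_lt; auto. apply pow_incr; lra.
Qed.
End Szego.

Lemma holo_of_holD1 k : holD 1 k -> holo_D2 (fun z => k (fst z)).
Proof.
  intros hk. apply holo_D2_iff. intros z [z1 z2]. split; [|split].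
  - apply (continuous_comp_gen fst k). apply continuous_fst. apply holD_continuous with 1; auto.
  - destruct (hk (fst z) z1) as [d hd]. exists d. exact hd.
  - exists (RtoC 0). apply (cder_const (k (fst z))).
Qed.

Lemma holo_of_holD2 k : holD 1 k -> holo_D2 (fun z => k (snd z)).
Proof. intros hk. apply (holo_swap (fun z => k (fst z))). apply holo_of_holD1; auto. Qed.

Lemma holo_mult f g : holo_D2 f -> holo_D2 g -> holo_D2 (fun z => f z * g z)%C.
Proof.
  intros hf hg. apply holo_D2_iff. intros z hz. destruct (proj1 (holo_D2_iff _) hf z hz) as [c1 [[d1 q1] [d2 q2]]].
  destruct (proj1 (holo_D2_iff _) hg z hz) as [c2 [[d3 q3] [d4 q4]]].
  split. apply continuous_Cmult; auto.
  split; eexists; unfold hd1, hd2.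
  - apply (cder_mult (fun w => f (w, snd z)) (fun w => g (w, snd z))). exact q1. exact q3.
  - apply (cder_mult (fun w => f (fst z, w)) (fun w => g (fst z, w))). exact q2. exact q4.
Qed.

(** * Compact operators and null sequences *)

Section Necessity.
Variable phi : C * C -> C * C.
Hypotheses (hol1 : holo_D2 (fun z => fst (phi z))) (hol2 : holo_D2 (fun z => snd (phi z)))
  (hmaps : forall z, inD2 z -> inD2 (phi z)) (hcomp : compact_Cphi phi).

(** Compactness gives a subsequence of fn o phi with a limit g in mean. For each fixed r, phi maps
    the torus of radius r into a compact part of the bidisc, where fn tends to 0 uniformly, so the
    mean of |g|^2 vanishes there. The convergence is uniform in r, which allows r to be chosen
    depending on n afterwards. *)
Lemma compact_null_sequence (fn : nat -> C * C -> C) (M : R) : (forall n, holo_D2 (fn n)) ->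
  (forall n r, 0 < r < 1 -> circ_int (fn n) r <= M) ->
  (forall delta eps, 0 < delta < 1 -> 0 < eps -> exists N, forall n, (N <= n)%nat -> forall z, inK delta z -> Cmod (fn n z) ^ 2 <= eps) ->
  forall eps N, 0 < eps -> exists n, (N <= n)%nat /\ forall r, 0 < r < 1 -> circ_int (fun z => fn n (phi z)) r <= eps.
Proof.
  intros hh hM hnull eps N heps.
  destruct hcomp as [_ hc]. destruct (hc fn) as [s [g [hs [[hg _] hlim]]]].
  { intro n. split; auto. exists M. apply hM. } { exists M. apply hM. }
  assert (hfc : forall n, holo_D2 (fun z => fn n (phi z))) by (intro; apply holo_comp; auto).
  assert (hdf : forall k, holo_D2 (fun z => fn (s k) (phi z) - g z)%C) by (intro; apply holo_minus; auto).
  assert (hneg : holo_D2 (fun z => RtoC 0 - g z)%C).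
  { apply holo_minus; auto. apply holo_D2_iff. intros z hz. split. apply continuous_const. split; exists 0%C; apply cder_const. }
  assert (hsym : forall a b : C * C -> C, forall r, circ_int (fun z => a z - b z)%C r = circ_int (fun z => b z - a z)%C r).
  { intros a b r. rewrite !circ_int_dbl. f_equal. f_equal. apply functional_extensionality; intro x. apply functional_extensionality; intro y. unfold dens. rewrite Cmod_sub_sym. reflexivity. }
  assert (g0 : forall r, 0 < r < 1 -> circ_int g r <= 0).
  { intros r hr. apply le_of_forall_eps with 4. lra. intros e he. rewrite Rplus_0_l.
    assert (cc : forall j, cont2 (fun t1 t2 => Cmod (selC j (phi (tor r t1 t2))))).
    { intros j p. pose proof (holo_tor_continuous _ r p hol1 ltac:(lra)). pose proof (holo_tor_continuous _ r p hol2 ltac:(lra)). destruct j; unfold selC; cont. }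
    assert (hin : forall j x y, Cmod (selC j (phi (tor r x y))) < 1) by (intros j x y; destruct (hmaps _ (tor_inD2 r x y ltac:(lra))); destruct j; auto).
    destruct (cont2_sup_lt _ 1 (cc false) (hin false)) as [m1 [hm1 k1]]. destruct (cont2_sup_lt _ 1 (cc true) (hin true)) as [m2 [hm2 k2]].
    (* m1 and m2 bound the coordinates of phi on the torus of radius r, whose image therefore lies
       in [inK delta]. *)
    set (delta := Rmin (1 / 2) (Rmin (1 - m1) (1 - m2))).
    assert (hdl : 0 < delta /\ delta <= 1 / 2 /\ delta <= 1 - m1 /\ delta <= 1 - m2).
    { unfold delta. generalize (Rmin_l (1 / 2) (Rmin (1 - m1) (1 - m2))) (Rmin_r (1 / 2) (Rmin (1 - m1) (1 - m2))) (Rmin_l (1 - m1) (1 - m2)) (Rmin_r (1 - m1) (1 - m2)).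
      intros; repeat split; try lra. repeat apply Rmin_pos; lra. }
    destruct (hlim e he) as [N1 h1]. destruct (hnull delta e ltac:(lra) he) as [N2 h2].
    set (k := (N1 + N2)%nat). specialize (h1 k ltac:(unfold k; lia) r hr).
    specialize (h2 (s k) ltac:(generalize (incr_ge s hs k); unfold k; lia)).
    eapply Rle_trans. apply (circ_int_plus (fun z => g z - fn (s k) (phi z))%C (fun z => fn (s k) (phi z))); auto; try lra.
    { apply holo_minus; auto. } { intros; ring. }
    rewrite hsym.
    assert (circ_int (fun z => fn (s k) (phi z)) r <= e).
    { rewrite circ_int_dbl. apply Rle_div_l. apply fourPI2_pos. rewrite <- dbl_const. apply dbl_le_square.
      apply (dens_cont2 (fun z => fn (s k) (phi z))); auto; lra. apply cont2_const.
      intros t1 t2 ht1 ht2. apply (h2 (phi (tor r t1 t2))). specialize (k1 t1 t2 ht1 ht2). specialize (k2 t1 t2 ht1 ht2). simpl in k1, k2. split; lra. }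
    lra. }
  destruct (hlim (eps / 2) (half_pos _ heps)) as [N1 h1].
  exists (s (N + N1)%nat). split. generalize (incr_ge s hs (N + N1)%nat); lia.
  intros r hr. specialize (h1 (N + N1)%nat ltac:(lia) r hr).
  eapply Rle_trans. apply (circ_int_plus (fun z => fn (s (N + N1)%nat) (phi z) - g z)%C g); auto; try lra. intros; ring.
  specialize (g0 r hr). lra.
Qed.
End Necessity.

(** * Expansions on the closed bidisc *)

Lemma segment_inD (a b : C) t : inD a -> inD b -> 0 <= t <= 1 -> inD (a + RtoC t * (b - a)).
Proof.
  unfold inD. intros ha hb ht. replace (a + RtoC t * (b - a))%C with (RtoC (1 - t) * a + RtoC t * b)%C by (rewrite RtoC_minus; ring).
  eapply Rle_lt_trans. apply Cmod_triangle. rewrite !Cmod_mult, !Cmod_RtoC_pos by lra.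
  destruct (Req_dec t 0) as [->|]; nra.
Qed.

Lemma segment_rderC (f : C -> C) a b t d : cder f (a + RtoC t * (b - a))%C d -> rderC (fun t => f (a + RtoC t * (b - a))%C) t (d * (b - a))%C.
Proof.
  intros h. eapply rderC_eq. apply (rderC_comp f (fun t => a + RtoC t * (b - a))%C).
  - apply rderC_plus. apply rderC_const. apply rderC_mult. apply rderC_RtoC. apply (is_derive_id (K := R_AbsRing)). apply rderC_const.
  - exact h.
  - change (@one R_AbsRing) with 1. cbv beta. ring.
Qed.

Lemma holD_lipschitz (f : C -> C) B a b : (forall w d, inD w -> cder f w d -> Cmod d <= B) -> holD 1 f -> inD a -> inD b -> Cmod (f b - f a) <= B * Cmod (b - a).
Proof.
  intros hB hf ha hb.
  assert (H : forall t, exists d, 0 <= t <= 1 -> cder f (a + RtoC t * (b - a))%C d).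
  { intro t. destruct (classic (0 <= t <= 1)) as [ht|ht]; [|exists (RtoC 0); tauto].
    destruct (hf _ (segment_inD a b t ha hb ht)) as [d hd]. exists d; auto. }
  apply choice in H. destruct H as [df hdf].
  pose proof (rderC_bound (fun t => f (a + RtoC t * (b - a))%C) (fun t => (df t * (b - a))%C) 0 1 (B * Cmod (b - a)) Rle_0_1) as k.
  cbv beta in k. replace (a + RtoC 1 * (b - a))%C with b in k by ring. replace (a + RtoC 0 * (b - a))%C with a in k by ring.
  replace (B * Cmod (b - a)) with (B * Cmod (b - a) * (1 - 0)) by ring. apply k.
  - intros t ht. apply segment_rderC. auto.
  - intros t ht. rewrite Cmod_mult. apply Rmult_le_compat_r. apply Cmod_ge_0. apply (hB _ _ (segment_inD a b t ha hb ht)). auto.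
Qed.

Lemma holD_taylor2 (f : C -> C) (f1 : C -> C) B a b : (forall w, inD w -> cder f w (f1 w)) -> holD 1 f1 -> (forall w d, inD w -> cder f1 w d -> Cmod d <= B) ->
  inD a -> inD b -> 0 <= B -> Cmod (f b - f a - f1 a * (b - a)) <= B * Cmod (b - a) ^ 2.
Proof.
  intros hf hf1 hB ha hb hB0.
  pose proof (rderC_bound (fun t => f (a + RtoC t * (b - a)) - f1 a * (b - a) * RtoC t)%C (fun t => ((f1 (a + RtoC t * (b - a)) - f1 a) * (b - a))%C) 0 1 (B * Cmod (b - a) ^ 2) Rle_0_1) as k.
  cbv beta in k. replace (a + RtoC 1 * (b - a))%C with b in k by ring. replace (a + RtoC 0 * (b - a))%C with a in k by ring.
  replace (f b - f a - f1 a * (b - a))%C with (f b - f1 a * (b - a) * RtoC 1 - (f a - f1 a * (b - a) * RtoC 0))%C by ring.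
  replace (B * Cmod (b - a) ^ 2) with (B * Cmod (b - a) ^ 2 * (1 - 0)) by ring. apply k.
  - intros t ht. eapply rderC_eq. apply rderC_minus. apply segment_rderC. apply hf. apply segment_inD; auto.
    apply rderC_mult. apply rderC_const. apply rderC_RtoC. apply (is_derive_id (K := R_AbsRing)). change (@one R_AbsRing) with 1. cbv beta. ring.
  - intros t ht. rewrite Cmod_mult. simpl. rewrite Rmult_1_r, <- Rmult_assoc. apply Rmult_le_compat_r. apply Cmod_ge_0.
    eapply Rle_trans. apply (holD_lipschitz f1 B a (a + RtoC t * (b - a))%C); auto. apply segment_inD; auto.
    replace (a + RtoC t * (b - a) - a)%C with (RtoC t * (b - a))%C by ring. rewrite Cmod_mult, Cmod_RtoC_pos by lra.
    apply Rmult_le_compat_l; auto. generalize (Cmod_ge_0 (b - a)); nra.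
Qed.

Lemma symbol_swap F F1 F2 F11 F12 F21 F22 : symbol F F1 F2 F11 F12 F21 F22 ->
  symbol (fun z => F (swap z)) (fun z => F2 (swap z)) (fun z => F1 (swap z)) (fun z => F22 (swap z)) (fun z => F21 (swap z)) (fun z => F12 (swap z)) (fun z => F11 (swap z)).
Proof.
  intros s. assert (us : forall f, ucont f -> ucont (fun z => f (swap z))).
  { intros f hf eps heps. destruct (hf eps heps) as [d [hd k]]. exists d. split; auto. intros z w [z1 z2] [w1 w2] a b. apply k; auto; split; auto. }
  assert (is : forall z, inD2 z -> inD2 (swap z)) by (intros z [h1 h2]; split; auto).
  constructor; try (apply holo_swap; apply s); try (apply us; apply s); intros z hz; apply is in hz.
  - apply (sy_maps _ _ _ _ _ _ _ s); auto.
  - apply (sy_d2 _ _ _ _ _ _ _ s _ hz).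
  - apply (sy_d1 _ _ _ _ _ _ _ s _ hz).
  - apply (sy_d22 _ _ _ _ _ _ _ s _ hz).
  - apply (sy_d21 _ _ _ _ _ _ _ s _ hz).
  - apply (sy_d12 _ _ _ _ _ _ _ s _ hz).
  - apply (sy_d11 _ _ _ _ _ _ _ s _ hz).
Qed.

Section SymbolEstimates.
Variables (F F1 F2 F11 F12 F21 F22 : C * C -> C).
Hypothesis sy : symbol F F1 F2 F11 F12 F21 F22.

Lemma dil_dist s (a b : C) : 0 <= s <= 1 -> Cmod (RtoC s * a - RtoC s * b) <= Cmod (a - b).
Proof.
  intros hs. replace (RtoC s * a - RtoC s * b)%C with (RtoC s * (a - b))%C by ring. rewrite Cmod_mult, Cmod_RtoC_pos by lra.
  generalize (Cmod_ge_0 (a - b)); nra.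
Qed.

(** The mean value inequality along the two coordinate segments inside, then the limit of dilations.
    The estimate is needed between points of the torus of radius rho and contact points on the
    boundary. *)
Lemma symbol_lipschitz : exists L, 0 <= L /\ forall z w, inclD2 z -> inclD2 w -> Cmod (F w - F z) <= L * (Cmod (fst w - fst z) + Cmod (snd w - snd z)).
Proof.
  destruct (ucont_bounded F1 (sy_u1 _ _ _ _ _ _ _ sy)) as [B1 [p1 k1]]. destruct (ucont_bounded F2 (sy_u2 _ _ _ _ _ _ _ sy)) as [B2 [p2 k2]].
  exists (B1 + B2). split. lra. intros z w hz hw.
  assert (inner : forall z w, inD2 z -> inD2 w -> Cmod (F w - F z) <= (B1 + B2) * (Cmod (fst w - fst z) + Cmod (snd w - snd z))).
  { clear z w hz hw. intros [z1 z2] [w1 w2] [hz1 hz2] [hw1 hw2]. simpl in *.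
    assert (e1 : Cmod (F (w1, w2) - F (z1, w2)) <= B1 * Cmod (w1 - z1)).
    { apply (holD_lipschitz (fun v => F (v, w2))); auto. 2: apply holo_holD1; auto; apply sy.
      intros v d hv hd. rewrite (cder_unique _ _ _ _ hd (sy_d1 _ _ _ _ _ _ _ sy (v, w2) (conj hv hw2))). apply k1, inD2_incl; split; auto. }
    assert (e2 : Cmod (F (z1, w2) - F (z1, z2)) <= B2 * Cmod (w2 - z2)).
    { apply (holD_lipschitz (fun v => F (z1, v))); auto. 2: apply holo_holD2; auto; apply sy.
      intros v d hv hd. rewrite (cder_unique _ _ _ _ hd (sy_d2 _ _ _ _ _ _ _ sy (z1, v) (conj hz1 hv))). apply k2, inD2_incl; split; auto. }
    generalize (Cmod_sub_triangle (F (w1, w2)) (F (z1, w2)) (F (z1, z2))) (Cmod_ge_0 (w1 - z1)) (Cmod_ge_0 (w2 - z2)). nra. }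
  apply le_of_forall_eps with 2. lra. intros e he.
  destruct (ucont_dil F (sy_u _ _ _ _ _ _ _ sy) e he) as [s [hs k]].
  pose proof (k s z ltac:(lra) hz) as q1. pose proof (k s w ltac:(lra) hw) as q2.
  pose proof (inner _ _ (dil_inD2 s z hs hz) (dil_inD2 s w hs hw)) as q. simpl in q.
  pose proof (dil_dist s (fst w) (fst z) ltac:(lra)). pose proof (dil_dist s (snd w) (snd z) ltac:(lra)).
  assert ((B1 + B2) * (Cmod (RtoC s * fst w - RtoC s * fst z) + Cmod (RtoC s * snd w - RtoC s * snd z)) <= (B1 + B2) * (Cmod (fst w - fst z) + Cmod (snd w - snd z))) by (apply Rmult_le_compat_l; lra).
  replace (F w - F z)%C with ((F (dil s w) - F (dil s z)) + ((F (dil s z) - F z) - (F (dil s w) - F w)))%C by ring.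
  eapply Rle_trans. apply Cmod_triangle. generalize (Cmod_sub_le (F (dil s z) - F z) (F (dil s w) - F w)). lra.
Qed.

(** All three points may lie on the boundary, as Hopf's lemma expands F at a contact point along a
    radius. The inner estimate for the dilated points passes to the limit. *)
Lemma symbol_taylor2 : exists B, 0 <= B /\ forall z v w, Cmod z <= 1 -> Cmod v <= 1 -> Cmod w <= 1 -> Cmod (F (z, w) - F (z, v) - F2 (z, v) * (w - v)) <= B * Cmod (w - v) ^ 2.
Proof.
  destruct (ucont_bounded F22 (sy_u22 _ _ _ _ _ _ _ sy)) as [B [p k]].
  exists B. split; auto. intros z v w hz hv hw.
  assert (inner : forall z v w, inD z -> inD v -> inD w -> Cmod (F (z, w) - F (z, v) - F2 (z, v) * (w - v)) <= B * Cmod (w - v) ^ 2).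
  { clear z v w hz hv hw. intros z v w hz hv hw.
    apply (holD_taylor2 (fun u => F (z, u)) (fun u => F2 (z, u))); auto.
    - intros u hu. apply (sy_d2 _ _ _ _ _ _ _ sy (z, u)). split; auto.
    - apply (holo_holD2 F2); auto. apply sy.
    - intros u d hu hd. rewrite (cder_unique _ _ _ _ hd (sy_d22 _ _ _ _ _ _ _ sy (z, u) (conj hz hu))). apply k, inD2_incl; split; auto. }
  apply le_of_forall_eps with 5. lra. intros e he.
  destruct (ucont_dil F (sy_u _ _ _ _ _ _ _ sy) e he) as [s1 [hs1 k1]]. destruct (ucont_dil F2 (sy_u2 _ _ _ _ _ _ _ sy) e he) as [s2 [hs2 k2]].
  destruct (ucont_bounded F2 (sy_u2 _ _ _ _ _ _ _ sy)) as [B2 [p2 b2]].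
  (* Beyond s3, replacing s (w - v) by w - v in the linear term costs at most e, because |F2| <= B2
     and |w - v| <= 2. *)
  set (s3 := 1 - e / (2 * (B2 + 1))).
  assert (he3 : 0 < e / (2 * (B2 + 1))) by (apply Rdiv_lt_0_compat; lra).
  set (s := Rmax (Rmax s1 s2) s3).
  assert (hs : s1 <= s /\ s2 <= s /\ s3 <= s /\ s < 1).
  { unfold s. generalize (Rmax_l (Rmax s1 s2) s3) (Rmax_r (Rmax s1 s2) s3) (Rmax_l s1 s2) (Rmax_r s1 s2). intros; repeat split; try lra. repeat apply Rmax_lub_lt; unfold s3; lra. }
  clearbody s.
  assert (izw : inclD2 (z, w)) by (split; auto). assert (izv : inclD2 (z, v)) by (split; auto).
  pose proof (k1 s _ ltac:(lra) izw) as q1. pose proof (k1 s _ ltac:(lra) izv) as q2. pose proof (k2 s _ ltac:(lra) izv) as q3.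
  assert (hin : forall u : C, Cmod u <= 1 -> inD (RtoC s * u)) by (intros u hu; unfold inD; rewrite Cmod_mult, Cmod_RtoC_pos by lra; generalize (Cmod_ge_0 u); nra).
  pose proof (inner _ _ _ (hin z hz) (hin v hv) (hin w hw)) as q.
  assert (hd := dil_dist s w v ltac:(lra)).
  assert (hd2 : B * Cmod (RtoC s * w - RtoC s * v) ^ 2 <= B * Cmod (w - v) ^ 2) by (apply Rmult_le_compat_l; auto; apply pow_incr; split; auto using Cmod_ge_0).
  change (RtoC s * z, RtoC s * w)%C with (dil s (z, w)) in q. change (RtoC s * z, RtoC s * v)%C with (dil s (z, v)) in q.
  assert (hwv : Cmod (w - v) <= 2) by (generalize (Cmod_sub_le w v); lra).
  assert (q4 : Cmod (F2 (dil s (z, v)) * (RtoC s * w - RtoC s * v) - F2 (z, v) * (w - v)) <= e + 2 * e).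
  { replace (F2 (dil s (z, v)) * (RtoC s * w - RtoC s * v) - F2 (z, v) * (w - v))%C with ((F2 (dil s (z, v)) - F2 (z, v)) * (w - v) - F2 (dil s (z, v)) * (RtoC (1 - s) * (w - v)))%C by (rewrite RtoC_minus; ring).
    eapply Rle_trans. apply Cmod_sub_le. rewrite !Cmod_mult, Cmod_RtoC_pos by lra.
    assert (t1 : Cmod (F2 (dil s (z, v)) - F2 (z, v)) * Cmod (w - v) <= e * 2) by (apply Rmult_le_compat; auto using Cmod_ge_0; lra).
    assert (t2 : Cmod (F2 (dil s (z, v))) * ((1 - s) * Cmod (w - v)) <= (B2 + 1) * ((1 - s) * 2)).
    { assert (hb2 := b2 (dil s (z, v)) (inD2_incl _ (dil_inD2 s (z, v) ltac:(lra) izv))).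
      apply Rmult_le_compat; auto using Cmod_ge_0; try lra. apply Rmult_le_pos; auto using Cmod_ge_0; lra. apply Rmult_le_compat_l; lra. }
    assert (t3 : (B2 + 1) * ((1 - s) * 2) <= e).
    { apply Rle_trans with ((B2 + 1) * (e / (2 * (B2 + 1)) * 2)). apply Rmult_le_compat_l. lra. apply Rmult_le_compat_r. lra. unfold s3 in hs. lra. right; field; lra. }
    lra. }
  assert (le5 : Cmod (F (z, w) - F (z, v) - F2 (z, v) * (w - v)) <= B * Cmod (w - v) ^ 2 + e * 5 ).
  { replace (F (z, w) - F (z, v) - F2 (z, v) * (w - v))%C with ((F (dil s (z, w)) - F (dil s (z, v)) - F2 (dil s (z, v)) * (RtoC s * w - RtoC s * v)) + ((F (dil s (z, v)) - F (z, v)) - (F (dil s (z, w)) - F (z, w))) + (F2 (dil s (z, v)) * (RtoC s * w - RtoC s * v) - F2 (z, v) * (w - v)))%C by ring.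
    eapply Rle_trans. apply Cmod_triangle. eapply Rle_trans. apply Rplus_le_compat_r. apply Cmod_triangle.
    generalize (Cmod_sub_le (F (dil s (z, v)) - F (z, v)) (F (dil s (z, w)) - F (z, w))). lra. }
  lra.
Qed.
End SymbolEstimates.

(** * Contact sets of compact composition operators *)

Lemma dbl_prod (a b : R -> R) : (forall t, continuous a t) -> (forall t, continuous b t) ->
  dbl (fun x y => a x * b y) = RInt a 0 (2 * PI) * RInt b 0 (2 * PI).
Proof.
  intros ha hb. unfold dbl.
  transitivity (RInt (fun x => RInt b 0 (2 * PI) * a x) 0 (2 * PI)).
  - apply RInt_ext_all. intro x. rewrite (RInt_scal_cont b 0 (2 * PI) hb (a x)). ring.
  - rewrite (RInt_scal_cont a 0 (2 * PI) ha (RInt b 0 (2 * PI))). ring.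
Qed.

(** Both the modulus of the pole of the n-th test function and the radius of the torus on which its
    composition with phi is measured; with h = 1 - [radius n], both scales are h. *)
Definition radius (n : nat) : R := 1 - / (INR n + 2).

Lemma radius_bounds n : / 2 <= radius n < 1.
Proof.
  unfold radius. generalize (pos_INR n); intro h. assert (0 < / (INR n + 2)) by (apply Rinv_0_lt_compat; lra).
  assert (/ (INR n + 2) <= / 2) by (apply Rinv_le_contravar; lra). lra.
Qed.

Lemma radius_limit eps : 0 < eps -> exists N, forall n, (N <= n)%nat -> 1 - radius n <= eps.
Proof.
  intros h. destruct (archimed_cor1 eps h) as [N [h1 h2]]. exists N. intros n hn. unfold radius.
  apply le_INR in hn. apply lt_INR in h2. simpl in h2.
  assert (/ (INR n + 2) <= / INR N) by (apply Rinv_le_contravar; lra). lra.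
Qed.

Lemma szego_null eta delta eps : Cmod eta = 1 -> 0 < delta < 1 -> 0 < eps -> exists N, forall n, (N <= n)%nat ->
  forall w, Cmod w <= 1 - delta -> Cmod (szego (radius n) eta w) ^ 2 <= eps.
Proof.
  intros he hd heps. destruct (radius_limit (eps * delta ^ 2 / 2)) as [N hN].
  { generalize (pow_lt delta 2 (proj1 hd)). nra. }
  exists N. intros n hn w hw. specialize (hN n hn). generalize (radius_bounds n); intro hb.
  eapply Rle_trans. apply szego_small with (d := delta); auto; lra.
  apply Rle_div_l. apply pow_lt; lra. nra.
Qed.

Lemma prod_holo (k1 k2 : C -> C) : holD 1 k1 -> holD 1 k2 -> holo_D2 (fun z => k1 (fst z) * k2 (snd z))%C.
Proof. intros h1 h2. apply (holo_mult (fun z => k1 (fst z)) (fun z => k2 (snd z))). apply holo_of_holD1; auto. apply holo_of_holD2; auto. Qed.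

Lemma circ_int_prod_le (k1 k2 : C -> C) (p1 p2 : R -> R) r : holD 1 k1 -> holD 1 k2 -> 0 <= r < 1 ->
  (forall t, continuous p1 t) -> (forall t, continuous p2 t) ->
  (forall t, Cmod (k1 (RtoC r * expi t)%C) ^ 2 <= p1 t) -> (forall t, Cmod (k2 (RtoC r * expi t)%C) ^ 2 <= p2 t) ->
  RInt p1 0 (2 * PI) = 2 * PI -> RInt p2 0 (2 * PI) = 2 * PI ->
  circ_int (fun z => k1 (fst z) * k2 (snd z))%C r <= 1.
Proof.
  intros h1 h2 hr c1 c2 b1 b2 e1 e2. rewrite circ_int_dbl. apply Rle_div_l. apply fourPI2_pos.
  apply Rle_trans with (dbl (fun x y => p1 x * p2 y)).
  - apply dbl_le. apply dens_cont2; auto. apply prod_holo; auto.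
    + intro p. apply continuous_Rmult. apply (continuous_comp_gen fst p1). apply continuous_fst. apply c1.
      apply (continuous_comp_gen snd p2). apply continuous_snd. apply c2.
    + intros x y. unfold dens, tor. simpl fst; simpl snd. rewrite Cmod_mult, Rpow_mult_distr.
      apply Rmult_le_compat; auto using pow2_ge_0.
  - rewrite dbl_prod by auto. rewrite e1, e2. right; ring.
Qed.

Lemma dens_periodic f r x y : dens f r (x + 2 * PI) y = dens f r x y /\ dens f r x (y + 2 * PI) = dens f r x y.
Proof. unfold dens, tor. rewrite !expi_period. auto. Qed.

Lemma symbol_lipschitz_tor F F1 F2 F11 F12 F21 F22 : symbol F F1 F2 F11 F12 F21 F22 -> exists L, 0 <= L /\
  forall r x y a b, 0 <= r <= 1 -> Cmod (F (tor r x y) - F (tor 1 a b)) <= L * (2 * (1 - r) + 2 * Rabs (x - a) + 2 * Rabs (y - b)).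
Proof.
  intros sy. destruct (symbol_lipschitz _ _ _ _ _ _ _ sy) as [L [hL h]]. exists L. split; auto.
  intros r x y a b hr. eapply Rle_trans. apply h. apply tor1_incl. apply tor_incl; auto. unfold tor; simpl fst; simpl snd.
  apply Rmult_le_compat_l; auto. generalize (circle_near r x a hr) (circle_near r y b hr). lra.
Qed.

(** * Lower bounds for compositions near contact sets *)

Section Contact.
Variable phi : C * C -> C * C.
Hypotheses (hol1 : holo_D2 (fun z => fst (phi z))) (hol2 : holo_D2 (fun z => snd (phi z)))
  (hmaps : forall z, inD2 z -> inD2 (phi z)) (hsm : Ck_closed_bidisc 3 phi) (hcomp : compact_Cphi phi).

(** Kernels in a single variable are products with the constant 1, so one product estimate covers
    all the test functions. *)
Lemma test_upper eta1 eta2 n r : Cmod eta1 = 1 -> Cmod eta2 = 1 -> 0 < r < 1 ->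
  circ_int (fun z => szego (radius n) eta1 (fst z) * szego (radius n) eta2 (snd z))%C r <= 1 /\
  circ_int (fun z => szego (radius n) eta1 (fst z) * RtoC 1)%C r <= 1 /\
  circ_int (fun z => RtoC 1 * szego (radius n) eta2 (snd z))%C r <= 1.
Proof.
  intros h1 h2 hr. generalize (radius_bounds n); intro hb.
  assert (hs : forall eta, Cmod eta = 1 -> holD 1 (szego (radius n) eta) /\ (forall t, continuous (poi 1 (RtoC (radius n * r) * eta)) t) /\
    (forall t, Cmod (szego (radius n) eta (RtoC r * expi t)%C) ^ 2 <= poi 1 (RtoC (radius n * r) * eta) t) /\ RInt (poi 1 (RtoC (radius n * r) * eta)) 0 (2 * PI) = 2 * PI).
  { intros eta he. assert (hz : Cmod (RtoC (radius n * r) * eta) < 1).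
    { rewrite Cmod_mult, he, Cmod_RtoC_pos by (apply Rmult_le_pos; lra). nra. }
    split; [|split; [|split]]. apply szego_holD; auto; lra. intro; apply poi_continuous; auto; lra. intro; apply szego_circle; auto; lra. apply poi_mean; auto; lra. }
  assert (ho : holD 1 (fun _ => RtoC 1)) by apply holD_const.
  assert (h1c : forall t : R, continuous (fun _ : R => 1) t) by (intro; apply continuous_const).
  assert (h1b : forall t : R, Cmod (RtoC 1) ^ 2 <= 1) by (intro; rewrite Cmod_1; lra).
  assert (h1i : RInt (fun _ => 1) 0 (2 * PI) = 2 * PI) by (refine (eq_trans (RInt_const_R 0 (2 * PI) 1) _); match goal with |- @eq _ ?a ?b => change (@eq R a b) end; ring).
  destruct (hs eta1 h1) as [s1 [s2 [s3 s4]]]. destruct (hs eta2 h2) as [u1 [u2 [u3 u4]]].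
  split; [|split].
  - apply (circ_int_prod_le (szego (radius n) eta1) (szego (radius n) eta2) (poi 1 (RtoC (radius n * r) * eta1)) (poi 1 (RtoC (radius n * r) * eta2))); auto; lra.
  - apply (circ_int_prod_le (szego (radius n) eta1) (fun _ => RtoC 1) (poi 1 (RtoC (radius n * r) * eta1)) (fun _ => 1)); auto; lra.
  - apply (circ_int_prod_le (fun _ => RtoC 1) (szego (radius n) eta2) (fun _ => 1) (poi 1 (RtoC (radius n * r) * eta2))); auto; lra.
Qed.

Lemma test_contradiction (fn : nat -> C * C -> C) (c : R) : (forall n, holo_D2 (fn n)) ->
  (forall n r, 0 < r < 1 -> circ_int (fn n) r <= 1) ->
  (forall delta eps, 0 < delta < 1 -> 0 < eps -> exists N, forall n, (N <= n)%nat -> forall z, inK delta z -> Cmod (fn n z) ^ 2 <= eps) ->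
  0 < c -> (exists N, forall n, (N <= n)%nat -> c <= dbl (dens (fun z => fn n (phi z)) (radius n))) -> False.
Proof.
  intros hh hb hn hc [N hl].
  assert (h0 : 0 < c / (4 * PI ^ 2)) by (apply Rdiv_lt_0_compat; auto; apply fourPI2_pos).
  destruct (compact_null_sequence phi hol1 hol2 hmaps hcomp fn 1 hh hb hn (c / (4 * PI ^ 2) / 2) N ltac:(lra)) as [n [h1 h2]].
  generalize (radius_bounds n); intro hr. specialize (h2 (radius n) ltac:(lra)). specialize (hl n h1). rewrite circ_int_dbl in h2.
  assert (c / (4 * PI ^ 2) <= dbl (dens (fun z => fn n (phi z)) (radius n)) / (4 * PI ^ 2)).
  { apply Rmult_le_compat_r; auto. left; apply Rinv_0_lt_compat, fourPI2_pos. }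
  lra.
Qed.

Lemma single_test_null (j : bool) eta : Cmod eta = 1 -> forall delta eps, 0 < delta < 1 -> 0 < eps -> exists N, forall n, (N <= n)%nat ->
  forall z, inK delta z -> Cmod (szego (radius n) eta (selC j z)) ^ 2 <= eps.
Proof.
  intros he delta eps hd heps. destruct (szego_null eta delta eps he hd heps) as [N hN]. exists N. intros n hn z [z1 z2].
  apply hN; auto. destruct j; auto.
Qed.

Lemma single_test_contradiction (j : bool) eta c : Cmod eta = 1 -> 0 < c ->
  (forall n, c <= dbl (dens (fun z => szego (radius n) eta (phi_j phi j z)) (radius n))) -> False.
Proof.
  intros he hc hl.
  apply (test_contradiction (fun n z => szego (radius n) eta (selC j z)) c); auto.
  - intro n. generalize (radius_bounds n); intro. destruct j; unfold selC; [apply holo_of_holD2|apply holo_of_holD1]; apply szego_holD; auto; lra.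
  - intros n r hr. destruct (test_upper eta eta n r he he hr) as [_ [k1 k2]]. destruct j; unfold selC.
    + eapply Rle_trans. 2: exact k2. right. f_equal. apply functional_extensionality; intro. ring.
    + eapply Rle_trans. 2: exact k1. right. f_equal. apply functional_extensionality; intro. ring.
  - apply single_test_null; auto.
  - exists 0%nat. intros n _. exact (hl n).
Qed.

Lemma phi_test_holo n j eta : Cmod eta = 1 -> holo_D2 (fun z => szego (radius n) eta (phi_j phi j z)).
Proof.
  intros he. generalize (radius_bounds n); intro.
  assert (hk : holD 1 (szego (radius n) eta)) by (apply szego_holD; auto; lra).
  destruct j.
  - apply (holo_comp (fun z => szego (radius n) eta (snd z)) phi); auto. apply holo_of_holD2; auto.
  - apply (holo_comp (fun z => szego (radius n) eta (fst z)) phi); auto. apply holo_of_holD1; auto.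
Qed.

Lemma phi_j_disc z j : inD2 z -> Cmod (phi_j phi j z) < 1.
Proof. intros hz. destruct (hmaps z hz). destruct j; auto. Qed.

(** On the square of side h = 1 - [radius n] at the contact point, the Lipschitz bound puts both
    coordinates of phi within 6 L h of their boundary values. The product of the two squared kernels
    is of order 1/h^2 there, so its integral does not tend to 0. *)
Lemma no_double_contact xi : inT2 xi -> ~ inT2 (phi xi).
Proof.
  intros [x1 x2] [p1 p2]. destruct xi as [z1 z2]. simpl in x1, x2.
  destruct (inT_expi z1 x1) as [a1 [_ ->]]. destruct (inT_expi z2 x2) as [a2 [_ ->]].
  assert (exi : (expi a1, expi a2) = tor 1 a1 a2) by (unfold tor; f_equal; ring). rewrite exi in *. clear exi x1 x2.
  destruct (symbol_of_smooth phi false hol1 hol2 hmaps hsm) as [A1 [A2 [A3 [A4 [A5 [A6 sA]]]]]].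
  destruct (symbol_of_smooth phi true hol1 hol2 hmaps hsm) as [B1 [B2 [B3 [B4 [B5 [B6 sB]]]]]].
  destruct (symbol_lipschitz_tor _ _ _ _ _ _ _ sA) as [L1 [hL1 l1]]. destruct (symbol_lipschitz_tor _ _ _ _ _ _ _ sB) as [L2 [hL2 l2]].
  set (eta1 := phi_j phi false (tor 1 a1 a2)) in *. set (eta2 := phi_j phi true (tor 1 a1 a2)) in *.
  change (Cmod eta1 = 1) in p1. change (Cmod eta2 = 1) in p2.
  assert (q1 : 0 < (1 + 6 * L1) ^ 2) by (apply pow_lt; lra). assert (q2 : 0 < (1 + 6 * L2) ^ 2) by (apply pow_lt; lra).
  apply (test_contradiction (fun n z => szego (radius n) eta1 (fst z) * szego (radius n) eta2 (snd z))%C (/ (1 + 6 * L1) ^ 2 * / (1 + 6 * L2) ^ 2)).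
  - intro n. generalize (radius_bounds n); intro. apply prod_holo; apply szego_holD; auto; lra.
  - intros n r hr. exact (proj1 (test_upper eta1 eta2 n r p1 p2 hr)).
  - intros delta eps hd heps. destruct (szego_null eta1 delta eps p1 hd heps) as [N1 k1]. destruct (szego_null eta2 delta 1 p2 hd Rlt_0_1) as [N2 k2].
    exists (N1 + N2)%nat. intros n hn z [h1 h2]. specialize (k1 n ltac:(lia) _ h1). specialize (k2 n ltac:(lia) _ h2).
    rewrite Cmod_mult, Rpow_mult_distr. replace eps with (eps * 1) by ring. apply Rmult_le_compat; auto using pow2_ge_0.
  - apply Rmult_lt_0_compat; apply Rinv_0_lt_compat; auto.
  - exists 0%nat. intros n _. generalize (radius_bounds n); intro hb. set (h := 1 - radius n).
    (* The constant is the lower bound of the integrand times the area h^2 of the square. *)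
    replace (/ (1 + 6 * L1) ^ 2 * / (1 + 6 * L2) ^ 2) with (/ ((1 + 6 * L1) ^ 2 * h) * / ((1 + 6 * L2) ^ 2 * h) * h * h) by (field; unfold h; repeat split; lra).
    generalize PI2_3_2; intro hpi.
    apply dbl_lower with (beta := a2).
    + apply (dens_cont2 (fun z => szego (radius n) eta1 (fst (phi z)) * szego (radius n) eta2 (snd (phi z)))%C). 2: lra.
      apply (holo_mult (fun z => szego (radius n) eta1 (fst (phi z))) (fun z => szego (radius n) eta2 (snd (phi z)))).
      apply (phi_test_holo n false); auto. apply (phi_test_holo n true); auto.
    + intros; apply pow2_ge_0.
    + intros; apply dens_periodic.
    + intros; apply dens_periodic.
    + unfold h; lra.
    + unfold h; lra.
    + intros y hy. exists a1. intros x hx. unfold dens. rewrite Cmod_mult, Rpow_mult_distr.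
      assert (hin : inD2 (tor (radius n) x y)) by (apply tor_inD2; lra).
      assert (hx' : Rabs (x - a1) <= h) by (apply Rabs_le; lra). assert (hy' : Rabs (y - a2) <= h) by (apply Rabs_le; lra).
      assert (0 <= h) by (unfold h; lra).
      apply Rmult_le_compat; try (left; apply Rinv_0_lt_compat, Rmult_lt_0_compat; auto; unfold h; lra).
      * apply szego_lower; auto; try lra. apply (phi_j_disc _ false hin). eapply Rle_trans. apply (l1 (radius n) x y a1 a2); lra. fold h. nra.
      * apply szego_lower; auto; try lra. apply (phi_j_disc _ true hin). eapply Rle_trans. apply (l2 (radius n) x y a1 a2); lra. fold h. nra.
Qed.

(** For each y, phi_j is within 4 L h of eta on the torus of radius 1 - h for x in an interval of
    length h starting at tau. The squared kernel is at least a constant over h on a set of area eps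
    h. The curve is given pointwise, so no regularity of tau is asked for. *)
Lemma no_level_curve1 (j : bool) eta beta eps : Cmod eta = 1 -> 0 < eps <= 2 * PI ->
  (forall y, beta <= y <= beta + eps -> exists tau, phi_j phi j (tor 1 tau y) = eta) -> False.
Proof.
  intros he heps hlev.
  destruct (symbol_of_smooth phi j hol1 hol2 hmaps hsm) as [A1 [A2 [A3 [A4 [A5 [A6 sA]]]]]].
  destruct (symbol_lipschitz_tor _ _ _ _ _ _ _ sA) as [L [hL l]].
  assert (q : 0 < (1 + 4 * L) ^ 2) by (apply pow_lt; lra).
  apply (single_test_contradiction j eta (/ (1 + 4 * L) ^ 2 * eps)); auto.
  { apply Rmult_lt_0_compat; try lra. apply Rinv_0_lt_compat; auto. }
  intro n. generalize (radius_bounds n); intro hb. set (h := 1 - radius n). generalize PI2_3_2; intro hpi.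
  replace (/ (1 + 4 * L) ^ 2 * eps) with (/ ((1 + 4 * L) ^ 2 * h) * h * eps) by (field; unfold h; repeat split; lra).
  apply dbl_lower with (beta := beta).
  - apply dens_cont2. apply phi_test_holo; auto. lra.
  - intros; apply pow2_ge_0.
  - intros; apply dens_periodic.
  - intros; apply dens_periodic.
  - unfold h; lra.
  - lra.
  - intros y hy. destruct (hlev y hy) as [tau ht]. exists tau. intros x hx. unfold dens.
    apply szego_lower; auto; try lra. apply phi_j_disc, tor_inD2; lra.
    rewrite <- ht. eapply Rle_trans. apply (l (radius n) x y tau y); lra. fold h.
    assert (Rabs (x - tau) <= h) by (apply Rabs_le; lra). rewrite (Rminus_diag_eq y y) by auto. rewrite Rabs_R0. nra.
Qed.

Lemma no_level_curve2 (j : bool) eta beta eps : Cmod eta = 1 -> 0 < eps <= 2 * PI ->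
  (forall x, beta <= x <= beta + eps -> exists tau, phi_j phi j (tor 1 x tau) = eta) -> False.
Proof.
  intros he heps hlev.
  destruct (symbol_of_smooth phi j hol1 hol2 hmaps hsm) as [A1 [A2 [A3 [A4 [A5 [A6 sA]]]]]].
  destruct (symbol_lipschitz_tor _ _ _ _ _ _ _ sA) as [L [hL l]].
  assert (q : 0 < (1 + 4 * L) ^ 2) by (apply pow_lt; lra).
  apply (single_test_contradiction j eta (/ (1 + 4 * L) ^ 2 * eps)); auto.
  { apply Rmult_lt_0_compat; try lra. apply Rinv_0_lt_compat; auto. }
  intro n. generalize (radius_bounds n); intro hb. set (h := 1 - radius n). generalize PI2_3_2; intro hpi.
  replace (/ (1 + 4 * L) ^ 2 * eps) with (/ ((1 + 4 * L) ^ 2 * h) * h * eps) by (field; unfold h; repeat split; lra).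
  assert (hc : cont2 (dens (fun z => szego (radius n) eta (phi_j phi j z)) (radius n))) by (apply dens_cont2; [apply phi_test_holo; auto|lra]).
  rewrite dbl_swap by exact hc.
  apply (dbl_lower (fun y x => dens (fun z => szego (radius n) eta (phi_j phi j z)) (radius n) x y)) with (beta := beta).
  - apply cont2_swap; auto.
  - intros; apply pow2_ge_0.
  - intros; apply dens_periodic.
  - intros; apply dens_periodic.
  - unfold h; lra.
  - lra.
  - intros y hy. destruct (hlev y hy) as [tau ht]. exists tau. intros x hx. unfold dens.
    apply szego_lower; auto; try lra. apply phi_j_disc, tor_inD2; lra.
    rewrite <- ht. eapply Rle_trans. apply (l (radius n) y x y tau); lra. fold h.
    assert (Rabs (x - tau) <= h) by (apply Rabs_le; lra). rewrite (Rminus_diag_eq y y) by auto. rewrite Rabs_R0. nra.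
Qed.
End Contact.

(** * Hopf's lemma *)

Section Hopf.
Variables F F1 F2 F11 F12 F21 F22 : C * C -> C.
Hypothesis sy : symbol F F1 F2 F11 F12 F21 F22.

Lemma torus_slice_continuous G a t : ucont G -> continuous (fun t => G (tor 1 a t)) t.
Proof.
  intros hG. apply continuous_C_iff. intros e he. destruct (ucont_near_tor G a t e hG he) as [d [hd k]].
  apply locally_R_iff. exists d. split; auto. intros y hy. apply k; try lra. replace (a - a) with 0 by ring. rewrite Rabs_R0; lra.
Qed.

(* Harnack's inequality on the slice, through radii s < 1 where the slice is holomorphic *)
Lemma slice_harnack c a b rho : Cmod c = 1 -> 0 <= rho < 1 ->
  (1 - rho) / 2 * (RInt (fun t => 1 - Re (c * F (tor 1 a t))) 0 (2 * PI) / (2 * PI)) <= 1 - Re (c * F ((RtoC 1 * expi a)%C, (RtoC rho * expi b)%C)).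
Proof.
  intros hc hr. pose proof PI_RGT_0 as hpi. pose proof PI2_ge0 as hpi2.
  apply le_of_forall_eps with 2. lra. intros e he.
  destruct (ucont_dil F (sy_u _ _ _ _ _ _ _ sy) e he) as [s0 [hs0 k]].
  set (s := (s0 + 1) / 2). assert (hs : 0 < s < 1 /\ s0 <= s) by (unfold s; lra).
  set (w := (RtoC (s * rho) * expi b)%C). assert (hw : Cmod w < s) by (unfold w; rewrite Cmod_mult, Cmod_expi, Cmod_RtoC_pos by nra; nra).
  assert (hwe : Cmod w = s * rho) by (unfold w; rewrite Cmod_mult, Cmod_expi, Cmod_RtoC_pos by nra; ring).
  assert (hin : inD (RtoC s * expi a)) by (unfold inD; rewrite Cmod_mult, Cmod_expi, Cmod_RtoC_pos; lra).
  set (f := fun v => F ((RtoC s * expi a)%C, v)).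
  assert (hf : holD 1 f) by (apply holo_holD2; auto; apply sy).
  pose proof (poisson_formula f 1 s w hf ltac:(lra) hw) as pf.
  assert (cf : forall t : R, continuous (fun t : R => f (RtoC s * expi t)%C) t) by (intro t; apply continuous_circle with 1; [lra|intros; apply holD_continuous with 1; auto]).
  assert (cp : forall t : R, continuous (poi s w) t) by (intro; apply poi_continuous; lra).
  assert (cu : forall t : R, continuous (fun t : R => 1 - Re (c * f (RtoC s * expi t)%C)) t) by (intro t; specialize (cf t); cont).
  assert (cg : forall t : R, continuous (fun t : R => 1 - Re (c * F (tor 1 a t))) t) by (intro t; pose proof (torus_slice_continuous F a t (sy_u _ _ _ _ _ _ _ sy)); cont).
  assert (key : 1 - Re (c * f w) = RInt (fun t => poi s w t * (1 - Re (c * f (RtoC s * expi t)%C))) 0 (2 * PI) / (2 * PI)).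
  { rewrite <- pf. rewrite Re_cm_scal by (intro t; specialize (cf t); specialize (cp t); cont).
    rewrite (RInt_ext_all (fun t => poi s w t * (1 - Re (c * f (RtoC s * expi t)%C))) (fun t => poi s w t - Re (c * (RtoC (poi s w t) * f (RtoC s * expi t)))%C)).
    2: { intro t. replace (c * (RtoC (poi s w t) * f (RtoC s * expi t)%C))%C with (RtoC (poi s w t) * (c * f (RtoC s * expi t)%C))%C by ring. rewrite Re_scal. ring. }
    rewrite (RInt_minus_cont (poi s w) (fun t => Re (c * (RtoC (poi s w t) * f (RtoC s * expi t)))%C)), poi_mean; auto; try lra.
    field; lra. intro t; specialize (cf t); specialize (cp t); cont. }
  assert (hpl : forall t, (1 - rho) / 2 <= poi s w t).
  { intro t. unfold poi. rewrite hwe. assert (hd := circle_sub_ne s w t ltac:(lra) hw). apply Cmod_gt_0 in hd.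
    assert (hd2 : Cmod (RtoC s * expi t - w) <= s * (1 + rho)).
    { eapply Rle_trans. apply Cmod_sub_le. rewrite Cmod_mult, Cmod_expi, Cmod_RtoC_pos, hwe by lra. lra. }
    assert (Cmod (RtoC s * expi t - w) ^ 2 <= (s * (1 + rho)) ^ 2) by (apply pow_incr; lra).
    apply Rmult_le_reg_r with (Cmod (RtoC s * expi t - w) ^ 2). apply pow_lt; auto.
    unfold Rdiv at 2. rewrite Rmult_assoc, Rinv_l, Rmult_1_r by (apply pow_nonzero; lra).
    apply Rle_trans with ((1 - rho) / 2 * (s * (1 + rho)) ^ 2). apply Rmult_le_compat_l; lra.
    assert (0 <= s ^ 2 * ((1 - rho) * (1 + rho) * (1 - rho))) by (apply Rmult_le_pos; [apply pow2_ge_0|apply Rmult_le_pos; nra]). nra. }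
  assert (hu0 : forall t, 0 <= 1 - Re (c * f (RtoC s * expi t)%C)).
  { intro t. generalize (Re_le_mod (c * f (RtoC s * expi t)%C)). rewrite Cmod_mult, hc.
    generalize (sy_maps _ _ _ _ _ _ _ sy _ (tor_inD2 s a t ltac:(lra))). unfold f, tor. lra. }
  assert (hclose : forall z, inclD2 z -> Rabs (Re (c * F (dil s z)) - Re (c * F z)) <= e).
  { intros z hz. rewrite <- Re_minus. replace (c * F (dil s z) - c * F z)%C with (c * (F (dil s z) - F z))%C by ring.
    eapply Rle_trans. apply re_le_Cmod. rewrite Cmod_mult, hc, Rmult_1_l. left. apply k; auto. lra. }
  assert (hb : (1 - rho) / 2 * (RInt (fun t => 1 - Re (c * f (RtoC s * expi t)%C)) 0 (2 * PI) / (2 * PI)) <= 1 - Re (c * f w)).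
  { rewrite key. apply Rle_trans with (RInt (fun t => (1 - rho) / 2 * (1 - Re (c * f (RtoC s * expi t)%C))) 0 (2 * PI) / (2 * PI)).
    { right. pose proof (RInt_scal_cont _ 0 (2 * PI) cu ((1 - rho) / 2)) as es. cbv beta in es. rewrite es. exact (eq_sym (Rmult_assoc ((1 - rho) / 2) _ (/ (2 * PI)))). }
    apply Rmult_le_compat_r. left; apply Rinv_0_lt_compat; lra. apply RInt_le_cont; auto.
    intro t; specialize (cf t); cont. intro t; specialize (cf t); specialize (cp t); cont. intros t _. apply Rmult_le_compat_r; auto. }
  assert (hi : RInt (fun t => 1 - Re (c * F (tor 1 a t))) 0 (2 * PI) / (2 * PI) <= RInt (fun t => 1 - Re (c * f (RtoC s * expi t)%C)) 0 (2 * PI) / (2 * PI) + e).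
  { apply Rle_div_l. lra.
    apply Rle_trans with (RInt (fun t => (1 - Re (c * f (RtoC s * expi t)%C)) + e) 0 (2 * PI)).
    - apply RInt_le_cont; auto. intro t; specialize (cf t); cont. intros t _.
      specialize (hclose (tor 1 a t) (tor1_incl a t)). rewrite <- tor_dil in hclose. apply Rabs_le_between in hclose. unfold f. change (F ((RtoC s * expi a)%C, (RtoC s * expi t)%C)) with (F (tor s a t)). lra.
    - rewrite (RInt_plus_cont _ (fun _ => e) 0 (2 * PI) cu) by (intro; apply continuous_const). rewrite (RInt_const_R 0 (2 * PI) e). right. field. lra. }
  assert (hq : Rabs (Re (c * f w) - Re (c * F ((RtoC 1 * expi a)%C, (RtoC rho * expi b)%C))) <= e).
  { unfold f, w. replace ((RtoC s * expi a)%C, (RtoC (s * rho) * expi b)%C) with (dil s ((RtoC 1 * expi a)%C, (RtoC rho * expi b)%C)).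
    apply hclose. split; simpl; rewrite Cmod_mult, Cmod_expi, Cmod_RtoC_pos; lra.
    unfold dil; simpl. rewrite RtoC_mult. f_equal; ring. }
  apply Rabs_le_between in hq.
  apply (Rmult_le_compat_l ((1 - rho) / 2)) in hi; [|lra].
  assert ((1 - rho) / 2 * e <= e) by nra. nra.
Qed.

(* For u = 1 - Re (conj (F xi) F), a vanishing derivative gives u(rho) = O((1 - rho)^2), while u(rho) is at least (1 - rho)/2 times the mean of u: the mean is 0. *)
Lemma tangent_constant a1 a2 : Cmod (F (tor 1 a1 a2)) = 1 -> F2 (tor 1 a1 a2) = RtoC 0 -> forall t, F (tor 1 a1 t) = F (tor 1 a1 a2).
Proof.
  intros h1 h2. set (c := Cconj (F (tor 1 a1 a2))). assert (hc : Cmod c = 1) by (unfold c; rewrite Cmod_conj; auto).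
  assert (hcF : (c * F (tor 1 a1 a2))%C = RtoC 1) by (apply conj_unit_mult; auto).
  destruct (symbol_taylor2 _ _ _ _ _ _ _ sy) as [B [hB k]].
  set (J := RInt (fun t => 1 - Re (c * F (tor 1 a1 t))) 0 (2 * PI) / (2 * PI)).
  pose proof PI_RGT_0 as hpi.
  assert (hub : forall rho, 0 <= rho < 1 -> J <= 2 * B * (1 - rho)).
  { intros rho hr. pose proof (slice_harnack c a1 a2 rho hc hr) as hh. fold J in hh.
    specialize (k (RtoC 1 * expi a1)%C (RtoC 1 * expi a2)%C (RtoC rho * expi a2)%C).
    rewrite !Cmod_mult, !Cmod_expi, Cmod_1, Cmod_RtoC_pos in k by lra. specialize (k ltac:(lra) ltac:(lra) ltac:(lra)).
    change ((RtoC 1 * expi a1)%C, (RtoC 1 * expi a2)%C) with (tor 1 a1 a2) in k. rewrite h2 in k.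
    replace (RtoC rho * expi a2 - RtoC 1 * expi a2)%C with (- (RtoC (1 - rho) * expi a2))%C in k by (rewrite RtoC_minus; ring).
    rewrite Cmod_opp, Cmod_mult, Cmod_expi, Cmod_RtoC_pos in k by lra.
    set (v := F ((RtoC 1 * expi a1)%C, (RtoC rho * expi a2)%C)) in *.
    assert (q : 1 - Re (c * v) <= B * (1 - rho) ^ 2).
    { replace (1 - Re (c * v)) with (Re (c * F (tor 1 a1 a2) - c * v)) by (rewrite Re_minus, hcF; reflexivity).
      eapply Rle_trans. apply Re_le_mod. rewrite Rmult_1_r in k.
      replace (c * F (tor 1 a1 a2) - c * v)%C with (- (c * (v - F (tor 1 a1 a2) - 0 * - (RtoC (1 - rho) * expi a2))))%C by ring.
      rewrite Cmod_opp, Cmod_mult, hc, Rmult_1_l. exact k. }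
    apply Rmult_le_reg_l with ((1 - rho) / 2). lra. nra. }
  assert (hJ : J <= 0).
  { apply le_of_forall_eps with (2 * B). lra. intros e he. destruct (Rle_dec e 1).
    - specialize (hub (1 - e) ltac:(lra)). nra.
    - specialize (hub 0 ltac:(lra)). nra. }
  set (u := fun t => 1 - Re (c * F (tor 1 a1 t))).
  assert (hu0 : forall t, 0 <= u t).
  { intro t. unfold u. generalize (Re_le_mod (c * F (tor 1 a1 t))). rewrite Cmod_mult, hc.
    generalize (symbol_closed_bound _ _ _ _ _ _ _ sy _ (tor1_incl a1 t)). lra. }
  assert (cu : forall t, continuous u t) by (intro t; unfold u; pose proof (torus_slice_continuous F a1 t (sy_u _ _ _ _ _ _ _ sy)); cont).
  assert (hu : forall t, u t = 0).
  { intro t. destruct (Rle_lt_or_eq_dec 0 (u t) (hu0 t)) as [hp|]; auto. exfalso.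
    destruct (proj1 (locally_R_iff _ _) (proj1 (continuous_R_iff u t) (cu t) (u t / 2) ltac:(lra))) as [d [hd kd]].
    set (d' := Rmin (d / 2) PI). assert (hd' : 0 < d' /\ d' <= d / 2 /\ d' <= PI).
    { unfold d'. split. apply Rmin_pos; lra. split. apply Rmin_l. apply Rmin_r. }
    assert (X : u t / 2 * d' <= RInt u 0 (2 * PI)).
    { apply periodic_lower with (tau := t); auto. intro x. unfold u, tor. rewrite expi_period. reflexivity. lra.
      intros x hx. specialize (kd x ltac:(rewrite Rabs_pos_eq; lra)). apply Rabs_def2 in kd. lra. }
    assert (0 < u t / 2 * d') by nra. unfold J in hJ. fold u in hJ. apply Rle_div_l in hJ; lra. }
  intro t. specialize (hu t). unfold u in hu.
  assert (hle : Cmod (c * F (tor 1 a1 t)) <= 1) by (rewrite Cmod_mult, hc; generalize (symbol_closed_bound _ _ _ _ _ _ _ sy _ (tor1_incl a1 t)); lra).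
  assert (he : (c * F (tor 1 a1 t))%C = RtoC 1).
  { set (v := (c * F (tor 1 a1 t))%C) in *. assert (hre : Re v = 1) by lra.
    assert (hs : Cmod v ^ 2 = Re v ^ 2 + Im v ^ 2) by (unfold Cmod; rewrite <- Rsqr_pow2, Rsqr_sqrt; [reflexivity|]; generalize (pow2_ge_0 (fst v)) (pow2_ge_0 (snd v)); lra).
    assert (Cmod v ^ 2 <= 1) by (generalize (Cmod_ge_0 v); nra). apply C_ext. exact hre. change (Im v = 0). rewrite hre in hs. apply Rsqr_0_uniq. unfold Rsqr. nra. }
  transitivity (F (tor 1 a1 a2) * (c * F (tor 1 a1 t)))%C.
  - replace (F (tor 1 a1 a2) * (c * F (tor 1 a1 t)))%C with ((c * F (tor 1 a1 a2)) * F (tor 1 a1 t))%C by ring. rewrite hcF. ring.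
  - rewrite he. ring.
Qed.

(** The sign of t is taken equal to that of L; for small |t| the linear term would dominate. *)
Lemma linear_le_quadratic (L K t0 : R) : 0 < t0 -> (forall t, Rabs t <= t0 -> t * L <= K * t ^ 2) -> L = 0.
Proof.
  intros ht h. destruct (Req_dec L 0) as [|hL]; auto. exfalso.
  set (s := Rmin t0 (Rabs L / (2 * (Rabs K + 1)))). generalize (Rabs_pos K) (Rabs_pos_lt L hL); intros hK hL'.
  assert (hs : 0 < s /\ s <= t0 /\ s <= Rabs L / (2 * (Rabs K + 1))).
  { unfold s. split. apply Rmin_pos; auto. apply Rdiv_lt_0_compat; lra. split. apply Rmin_l. apply Rmin_r. }
  assert (hsk : s * (2 * (Rabs K + 1)) <= Rabs L) by (apply Rle_div_r; lra).
  assert (X : s * Rabs L <= K * s ^ 2).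
  { destruct (Rle_dec 0 L).
    - rewrite (Rabs_pos_eq L) by auto. apply h. rewrite Rabs_pos_eq; lra.
    - rewrite (Rabs_left L) by lra. replace (s * - L) with ((- s) * L) by ring. replace (s ^ 2) with ((- s) ^ 2) by ring. apply h. rewrite Rabs_Ropp, Rabs_pos_eq; lra. }
  generalize (Rle_abs K). nra.
Qed.

(** Re (c F) is at most 1 on the torus and equals 1 at the contact point, so no first-order term
    survives in any angular direction. *)
Lemma contact_first_order a1 a2 b1 b2 : Cmod (F (tor 1 a1 a2)) = 1 -> Re (Cconj (F (tor 1 a1 a2)) * dir1 F1 F2 b1 b2 (tor 1 a1 a2)) = 0.
Proof.
  intros h1. set (c := Cconj (F (tor 1 a1 a2))). assert (hc : Cmod c = 1) by (unfold c; rewrite Cmod_conj; auto).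
  assert (hcF : (c * F (tor 1 a1 a2))%C = RtoC 1) by (apply conj_unit_mult; auto).
  destruct (boundary_taylor _ _ _ _ _ _ _ sy c a1 a2 b1 b2 hc 1 Rlt_0_1) as [t0 [ht k]].
  apply linear_le_quadratic with (K := 1 - Re (c * dir2 F1 F2 F11 F12 F21 F22 b1 b2 (tor 1 a1 a2)) / 2) (t0 := t0); auto.
  intros t h. specialize (k t h). rewrite hcF in k.
  assert (Re (c * F (tor 1 (a1 + t * b1) (a2 + t * b2))) <= 1).
  { eapply Rle_trans. apply Re_le_mod. rewrite Cmod_mult, hc, Rmult_1_l. apply (symbol_closed_bound _ _ _ _ _ _ _ sy). apply tor1_incl. }
  apply Rabs_le_between in k. simpl (Re (RtoC 1)) in k. lra.
Qed.

(** Re (c F) does not exceed 1 along the radius in the second variable, hence its outward radial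
    derivative at the contact point is nonnegative. *)
Lemma contact_tang2 a1 a2 : Cmod (F (tor 1 a1 a2)) = 1 -> 0 <= Re (Cconj (F (tor 1 a1 a2)) * tang2 F2 (tor 1 a1 a2)).
Proof.
  intros h1. set (c := Cconj (F (tor 1 a1 a2))). assert (hc : Cmod c = 1) by (unfold c; rewrite Cmod_conj; auto).
  assert (hcF : (c * F (tor 1 a1 a2))%C = RtoC 1) by (apply conj_unit_mult; auto).
  destruct (symbol_taylor2 _ _ _ _ _ _ _ sy) as [B [hB k]].
  apply le_of_forall_eps with B; auto. intros e0 he0. set (e := Rmin e0 1).
  assert (he : 0 < e /\ e <= e0 /\ e <= 1) by (unfold e; split; [apply Rmin_pos; lra|split; [apply Rmin_l|apply Rmin_r]]).
  specialize (k (RtoC 1 * expi a1)%C (RtoC 1 * expi a2)%C (RtoC (1 - e) * expi a2)%C).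
  rewrite !Cmod_mult, !Cmod_expi, Cmod_1, Cmod_RtoC_pos in k by lra. specialize (k ltac:(lra) ltac:(lra) ltac:(lra)).
  change ((RtoC 1 * expi a1)%C, (RtoC 1 * expi a2)%C) with (tor 1 a1 a2) in k.
  replace (RtoC (1 - e) * expi a2 - RtoC 1 * expi a2)%C with (- (RtoC e * expi a2))%C in k by (rewrite RtoC_minus; ring).
  rewrite Cmod_opp, Cmod_mult, Cmod_expi, Cmod_RtoC_pos in k by lra.
  set (v := F ((RtoC 1 * expi a1)%C, (RtoC (1 - e) * expi a2)%C)) in *.
  assert (hv : Re (c * v) <= 1).
  { eapply Rle_trans. apply Re_le_mod. rewrite Cmod_mult, hc, Rmult_1_l. apply (symbol_closed_bound _ _ _ _ _ _ _ sy).
    split; simpl; rewrite Cmod_mult, Cmod_expi, Cmod_RtoC_pos; lra. }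
  assert (q : 1 - e * Re (c * tang2 F2 (tor 1 a1 a2)) - Re (c * v) <= B * e ^ 2).
  { replace (1 - e * Re (c * tang2 F2 (tor 1 a1 a2)) - Re (c * v)) with (Re (- (c * (v - F (tor 1 a1 a2) - F2 (tor 1 a1 a2) * - (RtoC e * expi a2))))%C).
    - eapply Rle_trans. apply Re_le_mod. rewrite Cmod_opp, Cmod_mult, hc, Rmult_1_l. rewrite Rmult_1_r in k. exact k.
    - replace (- (c * (v - F (tor 1 a1 a2) - F2 (tor 1 a1 a2) * - (RtoC e * expi a2))))%C with (c * F (tor 1 a1 a2) - RtoC e * (c * tang2 F2 (tor 1 a1 a2)) - c * v)%C.
      rewrite hcF, !Re_minus, Re_scal. reflexivity. unfold tang2, tor; simpl snd. ring. }
  assert (- (B * e ^ 2) <= e * Re (c * tang2 F2 (tor 1 a1 a2))) by lra.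
  assert (- (B * e) <= Re (c * tang2 F2 (tor 1 a1 a2))) by (apply Rmult_le_reg_l with e; nra). nra.
Qed.
End Hopf.

(** * Local diffeomorphisms of the plane *)

Lemma is_derive_pair (f g : R -> R) x df dg : is_derive f x df -> is_derive g x dg ->
  is_derive (V := prod_NormedModule R_AbsRing R_NormedModule R_NormedModule) (fun t => (f t, g t)) x (df, dg).
Proof.
  intros hf hg.
  apply (filterdiff_comp'_2 (T := R_NormedModule) (U := R_NormedModule) (V := R_NormedModule) (W := prod_NormedModule R_AbsRing R_NormedModule R_NormedModule)
    f g (fun a b => (a, b)) x (fun y => scal y df) (fun y => scal y dg) (fun a b => (a, b))); auto.
  apply (filterdiff_linear (U := prod_NormedModule R_AbsRing R_NormedModule R_NormedModule) (V := prod_NormedModule R_AbsRing R_NormedModule R_NormedModule)).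
  apply (is_linear_prod (T := prod_NormedModule R_AbsRing R_NormedModule R_NormedModule) (U := R_NormedModule) (V := R_NormedModule) (fun t => fst t) (fun t => snd t)).
  apply is_linear_fst. apply is_linear_snd.
Qed.

Section LocalDiffeo.
Variables m m1 m2 : R -> R -> R.
Hypotheses (hc : cont2 m) (hc1 : cont2 m1) (hc2 : cont2 m2)
  (hd1 : forall x y, is_derive (fun x => m x y) x (m1 x y)) (hd2 : forall x y, is_derive (fun y => m x y) y (m2 x y))
  (h0 : m 0 0 = 0) (hpos : 0 < m1 0 0).

Lemma cont2_near h x y eps : cont2 h -> 0 < eps -> exists d, 0 < d /\ forall x' y', Rabs (x' - x) < d -> Rabs (y' - y) < d -> Rabs (h x' y' - h x y) < eps.
Proof.
  intros hh he. destruct (proj1 (locally_RR_iff _ _) (proj1 (continuous_R_iff _ _) (hh (x, y)) eps he)) as [d [hd k]].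
  exists d. split; auto. intros x' y' h1 h2. exact (k (x', y') h1 h2).
Qed.

Lemma mvt1 x x' y : exists c, Rmin x x' <= c <= Rmax x x' /\ m x' y - m x y = m1 c y * (x' - x).
Proof.
  apply (MVT_gen (fun x => m x y) x x' (fun x => m1 x y)). intros; apply hd1.
  intros c _. apply continuity_pt_filterlim. apply (ex_derive_continuous (fun x => m x y)). eexists; apply hd1.
Qed.

Lemma mvt2 x y y' : exists c, Rmin y y' <= c <= Rmax y y' /\ m x y' - m x y = m2 x c * (y' - y).
Proof.
  apply (MVT_gen (fun y => m x y) y y' (fun y => m2 x y)). intros; apply hd2.
  intros c _. apply continuity_pt_filterlim. apply (ex_derive_continuous (fun y => m x y)). eexists; apply hd2.
Qed.

Lemma between_dist a b c : Rmin a b <= c <= Rmax a b -> Rabs (c - a) <= Rabs (b - a).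
Proof. unfold Rmin, Rmax. destruct (Rle_dec a b); intros; unfold Rabs; destruct (Rcase_abs _); destruct (Rcase_abs _); lra. Qed.

Lemma between_bound a b c e : Rmin a b <= c <= Rmax a b -> Rabs a <= e -> Rabs b <= e -> Rabs c <= e.
Proof. intros h ha hb. apply Rabs_le_between in ha. apply Rabs_le_between in hb. apply Rabs_le_between. revert h. unfold Rmin, Rmax. destruct (Rle_dec a b); intros; lra. Qed.

Lemma box : exists e kap K, 0 < e /\ 0 < kap /\ 0 <= K /\ forall x y, Rabs x <= e -> Rabs y <= e -> kap <= m1 x y /\ Rabs (m2 x y) <= K.
Proof.
  destruct (cont2_near m1 0 0 (m1 0 0 / 2) hc1 ltac:(lra)) as [d1 [p1 k1]].
  destruct (cont2_near m2 0 0 1 hc2 Rlt_0_1) as [d2 [p2 k2]].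
  set (e := Rmin d1 d2 / 2). assert (he : 0 < e /\ e < d1 /\ e < d2).
  { unfold e. generalize (Rmin_l d1 d2) (Rmin_r d1 d2) (Rmin_pos d1 d2 p1 p2). lra. }
  exists e, (m1 0 0 / 2), (Rabs (m2 0 0) + 1). split; [|split; [|split]]; try lra. generalize (Rabs_pos (m2 0 0)); lra.
  intros x y hx hy. specialize (k1 x y). specialize (k2 x y). rewrite !Rminus_0_r in k1, k2.
  specialize (k1 ltac:(lra) ltac:(lra)). specialize (k2 ltac:(lra) ltac:(lra)).
  apply Rabs_def2 in k1. split. lra.
  replace (m2 x y) with (m2 0 0 + (m2 x y - m2 0 0)) by ring. eapply Rle_trans. apply Rabs_triang. lra.
Qed.

(** * Inversion of (x, y) |-> (m x y, y) on a box *)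

Section Inverse.
Variables e kap K : R.
Hypotheses (he : 0 < e) (hk : 0 < kap) (hK : 0 <= K)
  (hbox : forall x y, Rabs x <= e -> Rabs y <= e -> kap <= m1 x y /\ Rabs (m2 x y) <= K).

Lemma strict_mono x x' y : Rabs x <= e -> Rabs x' <= e -> Rabs y <= e -> x < x' -> m x y < m x' y.
Proof.
  intros hx hx' hy hlt. destruct (mvt1 x x' y) as [c [hcc k]].
  destruct (hbox c y (between_bound _ _ _ _ hcc hx hx') hy) as [b _]. assert (0 < m1 c y * (x' - x)) by (apply Rmult_lt_0_compat; lra). lra.
Qed.

Definition dom (p : R * R) : Prop := Rabs (fst p) < e /\ Rabs (snd p) < e.
(** The second coordinate is preserved and m is increasing in x on the box, so the image of the open
    square is exactly the region between the graphs of m (- e) and m e. This makes the image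
    explicit and its openness elementary. *)
Definition img (q : R * R) : Prop := Rabs (snd q) < e /\ m (- e) (snd q) < fst q < m e (snd q).
Definition fmap (p : R * R) : R * R := (m (fst p) (snd p), snd p).

(** Intermediate value theorem in x for fixed y. The condition stands under the existential
    quantifier so that the chosen root is a function on the whole plane. *)
Lemma solve q : exists x, img q -> Rabs x < e /\ m x (snd q) = fst q.
Proof.
  destruct (classic (img q)) as [[h1 [h2 h3]]|]; [|exists 0; tauto].
  destruct (IVT_gen (fun x => m x (snd q)) (- e) e (fst q)) as [x [hx hv]].
  - intro x. apply continuity_pt_filterlim. apply (cont2_slice1 m); auto.
  - rewrite Rmin_left, Rmax_right by lra. lra.
  - exists x. intros _. rewrite Rmin_left, Rmax_right in hx by lra. split; auto. apply Rabs_def1.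
    + destruct (Req_dec x e) as [->|]; lra.
    + destruct (Req_dec x (- e)) as [->|]; lra.
Qed.

Definition tau (q : R * R) : R := proj1_sig (constructive_indefinite_description _ (solve q)).
Lemma tau_spec q : img q -> Rabs (tau q) < e /\ m (tau q) (snd q) = fst q.
Proof. unfold tau. destruct (constructive_indefinite_description _ (solve q)) as [x hx]. exact hx. Qed.

Definition finv (q : R * R) : R * R := (tau q, snd q).

Lemma dom_img p : dom p -> img (fmap p) /\ finv (fmap p) = p.
Proof.
  destruct p as [x y]. intros [h1 h2]. simpl in h1, h2. assert (he' := Rabs_pos_eq e ltac:(lra)).
  assert (h1' := h1). apply Rabs_def2 in h1'.
  assert (hi : img (fmap (x, y))).
  { split; simpl; auto. split; apply strict_mono; rewrite ?Rabs_Ropp; lra. }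
  split; auto. unfold finv, fmap; simpl. f_equal. destruct (tau_spec _ hi) as [q1 q2]. unfold fmap in *; simpl in *.
  set (t := tau (m x y, y)) in *. destruct (Rtotal_order t x) as [h|[h|h]]; auto; exfalso.
  - assert (X := strict_mono t x y ltac:(lra) ltac:(lra) ltac:(lra) h). lra.
  - assert (X := strict_mono x t y ltac:(lra) ltac:(lra) ltac:(lra) h). lra.
Qed.

Lemma img_dom q : img q -> dom (finv q) /\ fmap (finv q) = q.
Proof.
  intros hq. destruct (tau_spec q hq) as [q1 q2]. destruct q as [u y]. split. split; simpl; auto. apply hq.
  unfold fmap, finv; simpl. simpl in q2. rewrite q2. reflexivity.
Qed.

Lemma open_dom : Defs.open_set dom.
Proof.
  intros [x y] [h1 h2]. simpl in *. apply locally_RR_iff. exists (Rmin (e - Rabs x) (e - Rabs y)). split. apply Rmin_pos; lra.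
  intros [x' y'] k1 k2. simpl in *. generalize (Rmin_l (e - Rabs x) (e - Rabs y)) (Rmin_r (e - Rabs x) (e - Rabs y)). intros.
  split; simpl.
  - replace x' with (x + (x' - x)) by ring. eapply Rle_lt_trans. apply Rabs_triang. lra.
  - replace y' with (y + (y' - y)) by ring. eapply Rle_lt_trans. apply Rabs_triang. lra.
Qed.

Lemma open_img : Defs.open_set img.
Proof.
  intros [u y] [h1 [h2 h3]]. simpl in *.
  destruct (cont2_near m (- e) y ((u - m (- e) y) / 2) hc ltac:(lra)) as [d1 [p1 k1]].
  destruct (cont2_near m e y ((m e y - u) / 2) hc ltac:(lra)) as [d2 [p2 k2]].
  set (d := Rmin (Rmin d1 d2) (Rmin (e - Rabs y) (Rmin ((u - m (- e) y) / 2) ((m e y - u) / 2)))).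
  assert (hd : 0 < d) by (unfold d; repeat apply Rmin_pos; lra).
  assert (hd' : d <= d1 /\ d <= d2 /\ d <= e - Rabs y /\ d <= (u - m (- e) y) / 2 /\ d <= (m e y - u) / 2).
  { unfold d. repeat split.
    - eapply Rle_trans. apply Rmin_l. apply Rmin_l.
    - eapply Rle_trans. apply Rmin_l. apply Rmin_r.
    - eapply Rle_trans. apply Rmin_r. apply Rmin_l.
    - eapply Rle_trans. apply Rmin_r. eapply Rle_trans. apply Rmin_r. apply Rmin_l.
    - eapply Rle_trans. apply Rmin_r. eapply Rle_trans. apply Rmin_r. apply Rmin_r. }
  apply locally_RR_iff. exists d. split; auto. intros [u' y'] q1 q2. simpl in *.
  specialize (k1 (- e) y'). specialize (k2 e y'). rewrite Rminus_diag_eq, Rabs_R0 in k1, k2 by auto.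
  specialize (k1 p1 ltac:(lra)). specialize (k2 p2 ltac:(lra)). apply Rabs_def2 in k1. apply Rabs_def2 in k2. apply Rabs_def2 in q1.
  split; simpl. replace y' with (y + (y' - y)) by ring. eapply Rle_lt_trans. apply Rabs_triang. lra. lra.
Qed.

(** The mean value theorem along x at the height of q', and along y at the abscissa of q. This exact
    formula yields both the Lipschitz bound and, by continuity of m1 and m2, the derivative of the
    root. *)
Lemma tau_increment q q' : img q -> img q' -> exists c d, Rmin (tau q) (tau q') <= c <= Rmax (tau q) (tau q') /\ Rmin (snd q) (snd q') <= d <= Rmax (snd q) (snd q') /\
  kap <= m1 c (snd q') /\ Rabs (m2 (tau q) d) <= K /\
  (tau q' - tau q) * m1 c (snd q') = (fst q' - fst q) - m2 (tau q) d * (snd q' - snd q).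
Proof.
  intros hq hq'. destruct (tau_spec q hq) as [a1 a2]. destruct (tau_spec q' hq') as [b1 b2]. destruct hq as [hy _]. destruct hq' as [hy' _].
  destruct (mvt1 (tau q) (tau q') (snd q')) as [c [c1 c2]]. destruct (mvt2 (tau q) (snd q) (snd q')) as [d [d1 d2]].
  exists c, d. split; auto. split; auto.
  destruct (hbox c (snd q')) as [r1 _]. apply (between_bound _ _ _ _ c1); lra. lra.
  destruct (hbox (tau q) d) as [_ r2]. lra. apply (between_bound _ _ _ _ d1); lra.
  split; auto. split; auto. lra.
Qed.

Lemma tau_lipschitz q q' : img q -> img q' -> Rabs (tau q' - tau q) <= (Rabs (fst q' - fst q) + K * Rabs (snd q' - snd q)) / kap.
Proof.
  intros hq hq'. destruct (tau_increment q q' hq hq') as [c [d [_ [_ [h1 [h2 h3]]]]]].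
  apply Rle_div_r; auto. apply Rle_trans with (Rabs (tau q' - tau q) * Rabs (m1 c (snd q'))).
  - apply Rmult_le_compat_l. apply Rabs_pos. rewrite Rabs_pos_eq; lra.
  - rewrite <- Rabs_mult, h3. eapply Rle_trans. apply Rabs_triang. rewrite Rabs_Ropp, Rabs_mult.
    apply Rplus_le_compat_l. apply Rmult_le_compat_r; auto. apply Rabs_pos.
Qed.

Lemma tau_near q eps : img q -> 0 < eps -> exists d, 0 < d /\ forall q', Rabs (fst q' - fst q) < d -> Rabs (snd q' - snd q) < d -> img q' /\ Rabs (tau q' - tau q) < eps.
Proof.
  intros hq heps. destruct (proj1 (locally_RR_iff _ _) (open_img q hq)) as [d1 [p1 k1]].
  set (d := Rmin d1 (eps * kap / (1 + K))). assert (hp : 0 < eps * kap / (1 + K)) by (apply Rdiv_lt_0_compat; [apply Rmult_lt_0_compat; auto|lra]).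
  exists d. split. apply Rmin_pos; auto. intros q' h1 h2.
  assert (hl1 : d <= d1) by apply Rmin_l. assert (hl2 : d * (1 + K) <= eps * kap). { apply Rle_div_r. lra. apply Rmin_r. }
  assert (hq' : img q') by (apply k1; lra). split; auto.
  eapply Rle_lt_trans. apply tau_lipschitz; auto. apply Rlt_div_l; auto.
  assert (K * Rabs (snd q' - snd q) <= K * d) by (apply Rmult_le_compat_l; lra). lra.
Qed.

Lemma continuous_tau q : img q -> continuous tau q.
Proof.
  intros hq. apply continuous_R_iff. intros eps heps. destruct (tau_near q eps hq heps) as [d [hd k]].
  apply locally_RR_iff. exists d. split; auto. intros q' h1 h2. apply k; auto.
Qed.

(** The increment formula divided by t has coefficients taken at intermediate points; these tend to
    q, and the quotient is continuous in the pair (m1, m2) since m1 >= kap > 0. Any direction is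
    allowed, which gives both partial derivatives at once. *)
Lemma tau_derive q e1 e2 : img q ->
  is_derive (fun t => tau (fst q + t * e1, snd q + t * e2)) 0 ((e1 - m2 (tau q) (snd q) * e2) / m1 (tau q) (snd q)).
Proof.
  intros hq. set (p0 := m1 (tau q) (snd q)). set (s0 := m2 (tau q) (snd q)).
  destruct (tau_spec q hq) as [hx _]. assert (hy := proj1 hq).
  assert (hp0 : kap <= p0) by (apply hbox; lra).
  apply is_derive_R_iff. intros eps heps.
  assert (cq : continuous (fun z : R * R => (e1 - snd z * e2) / fst z) (p0, s0)) by (cont; simpl; lra).
  destruct (proj1 (locally_RR_iff _ _) (proj1 (continuous_R_iff _ _) cq eps heps)) as [d1 [q1 k1]]. simpl in k1.
  destruct (cont2_near m1 (tau q) (snd q) d1 hc1 q1) as [d2 [q2 k2]].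
  destruct (cont2_near m2 (tau q) (snd q) d1 hc2 q1) as [d3 [q3 k3]].
  destruct (tau_near q d2 hq q2) as [d4 [q4 k4]].
  set (B := Rabs e1 + Rabs e2 + 1). assert (hB : 1 <= B /\ Rabs e1 < B /\ Rabs e2 < B) by (unfold B; generalize (Rabs_pos e1) (Rabs_pos e2); lra).
  set (d := Rmin d2 (Rmin d3 d4)). assert (hd : 0 < d /\ d <= d2 /\ d <= d3 /\ d <= d4).
  { unfold d. split. repeat apply Rmin_pos; auto. split. apply Rmin_l. split. eapply Rle_trans. apply Rmin_r. apply Rmin_l. eapply Rle_trans; apply Rmin_r. }
  exists (d / B). split. apply Rdiv_lt_0_compat; lra.
  intros t ht. rewrite Rminus_0_r in *. set (q' := (fst q + t * e1, snd q + t * e2)).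
  assert (ht' : Rabs t * B < d) by (apply Rlt_div_r; lra). generalize (Rabs_pos t); intro htp.
  assert (r1 : Rabs (fst q' - fst q) < d). { simpl. replace (fst q + t * e1 - fst q) with (t * e1) by ring. rewrite Rabs_mult. nra. }
  assert (r2 : Rabs (snd q' - snd q) < d). { simpl. replace (snd q + t * e2 - snd q) with (t * e2) by ring. rewrite Rabs_mult. nra. }
  destruct (k4 q' ltac:(lra) ltac:(lra)) as [hq' hnear].
  destruct (tau_increment q q' hq hq') as [c [v [c1 [v1 [h1 [_ h3]]]]]].
  apply between_dist in c1. apply between_dist in v1.
  specialize (k2 c (snd q') ltac:(lra) ltac:(lra)). specialize (k3 (tau q) v). rewrite Rminus_diag_eq, Rabs_R0 in k3 by auto. specialize (k3 q3 ltac:(lra)).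
  assert (k5 : Rabs ((e1 - m2 (tau q) v * e2) / m1 c (snd q') - (e1 - s0 * e2) / p0) < eps) by exact (k1 (m1 c (snd q'), m2 (tau q) v) k2 k3).
  replace (fst q + 0 * e1, snd q + 0 * e2) with q by (destruct q; simpl; f_equal; ring). fold q'.
  set (p := m1 c (snd q')) in *. set (s := m2 (tau q) v) in *.
  assert (e0 : tau q' - tau q = (e1 - s * e2) / p * t).
  { apply Rmult_eq_reg_r with p; [|lra]. rewrite h3. unfold q'; simpl. field. lra. }
  rewrite e0. replace ((e1 - s * e2) / p * t - (e1 - s0 * e2) / p0 * t) with (((e1 - s * e2) / p - (e1 - s0 * e2) / p0) * t) by ring.
  rewrite Rabs_mult. apply Rmult_le_compat_r; auto. left. exact k5.
Qed.

Lemma box_positive q : img q -> m1 (tau q) (snd q) <> 0.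
Proof. intros hq. destruct (tau_spec q hq). destruct (hbox (tau q) (snd q) ltac:(lra) ltac:(generalize (proj1 hq); lra)). lra. Qed.

Lemma continuous_at_tau h q : cont2 h -> img q -> continuous (fun q : R * R => h (tau q) (snd q)) q.
Proof.
  intros hh hq. apply (continuous_comp_gen (fun q : R * R => (tau q, snd q)) (fun p : R * R => h (fst p) (snd p))).
  apply continuous_pair. apply continuous_tau; auto. apply continuous_snd. apply hh.
Qed.

(** Beyond bijectivity, class C^1 of the inverse rests on [tau_derive], whose right-hand side is
    continuous because the root is. *)
Lemma local_inverse : diffeo_nbhd0 fmap finv dom img.
Proof.
  assert (d00 : dom (0, 0)) by (split; simpl; rewrite Rabs_R0; auto).
  assert (hm : forall p : R * R, continuous fmap p) by (intro p; unfold fmap; apply continuous_pair; [apply hc|apply continuous_snd]).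
  assert (hf : forall q, img q -> continuous finv q) by (intros q hq; unfold finv; apply continuous_pair; [apply continuous_tau; auto|apply continuous_snd]).
  assert (g1 : forall p : R * R, continuous (fun p : R * R => (m1 (fst p) (snd p), 0)) p) by (intro p; apply continuous_pair; [apply hc1|apply continuous_const]).
  assert (g2 : forall p : R * R, continuous (fun p : R * R => (m2 (fst p) (snd p), 1)) p) by (intro p; apply continuous_pair; [apply hc2|apply continuous_const]).
  assert (gq : forall (e1 e2 : R) q, img q -> continuous (fun q : R * R => ((e1 - m2 (tau q) (snd q) * e2) / m1 (tau q) (snd q), e2)) q).
  { intros e1 e2 q hq. apply continuous_pair; [|apply continuous_const].
    pose proof (continuous_at_tau m1 q hc1 hq). pose proof (continuous_at_tau m2 q hc2 hq). pose proof (box_positive q hq). cont. }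
  split; [exact open_dom|]. split; [exact open_img|]. split; [exact d00|]. split.
  { replace (0, 0) with (fmap (0, 0)) by (unfold fmap; simpl; rewrite h0; auto). apply dom_img; auto. }
  split; [intros; apply dom_img; auto|]. split; [intros; apply img_dom; auto|]. split.
  - split. intros p _; apply hm. intros v [<-|[<-|[]]].
    + exists (fun p => (m1 (fst p) (snd p), 0)). split.
      * intros [x y] _. apply (is_derive_pair (fun t => m (x + t * 1) (y + t * 0)) (fun t => y + t * 0)).
        -- apply (is_derive_ext (fun t => m (x + t) y)). intro t. change (t : R) with t. rewrite (Rmult_1_r t), (Rmult_0_r t), (Rplus_0_r _). reflexivity.
           simpl. replace (m1 x y) with (1 * m1 (x + 0) y) by (rewrite Rplus_0_r; ring).
           apply (is_derive_comp (fun x => m x y) (fun t => x + t)). apply hd1. auto_derive; auto.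
        -- auto_derive; auto; ring.
      * split; [intros p _; exact (g1 p)|exact I].
    + exists (fun p => (m2 (fst p) (snd p), 1)). split.
      * intros [x y] _. apply (is_derive_pair (fun t => m (x + t * 0) (y + t * 1)) (fun t => y + t * 1)).
        -- apply (is_derive_ext (fun t => m x (y + t))). intro t. change (t : R) with t. rewrite (Rmult_1_r t), (Rmult_0_r t), (Rplus_0_r _). reflexivity.
           simpl. replace (m2 x y) with (1 * m2 x (y + 0)) by (rewrite Rplus_0_r; ring).
           apply (is_derive_comp (fun y => m x y) (fun t => y + t)). apply hd2. auto_derive; auto.
        -- auto_derive; auto; ring.
      * split; [intros p _; exact (g2 p)|exact I].
  - split. auto. intros v [<-|[<-|[]]].
    + exists (fun q => ((1 - m2 (tau q) (snd q) * 0) / m1 (tau q) (snd q), 0)). split.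
      * intros [u y] hq. apply (is_derive_pair (fun t => tau (u + t * 1, y + t * 0)) (fun t => y + t * 0)).
        apply (tau_derive (u, y) 1 0 hq). auto_derive; auto; ring.
      * split; [intros q hq; exact (gq 1 0 q hq)|exact I].
    + exists (fun q => ((0 - m2 (tau q) (snd q) * 1) / m1 (tau q) (snd q), 1)). split.
      * intros [u y] hq. apply (is_derive_pair (fun t => tau (u + t * 0, y + t * 1)) (fun t => y + t * 1)).
        apply (tau_derive (u, y) 0 1 hq). auto_derive; auto; ring.
      * split; [intros q hq; exact (gq 0 1 q hq)|exact I].
Qed.
End Inverse.

Lemma exists_local_inverse : exists Uinv A B, diffeo_nbhd0 fmap Uinv A B.
Proof. destruct box as [e [kap [K [h1 [h2 [h3 h4]]]]]]. exists (finv e h1), (dom e), (img e). apply (local_inverse e kap K); auto. Qed.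
End LocalDiffeo.

(** * Necessity *)

Lemma Re_Ci_mult w : Re (Ci * w) = - Im w.
Proof. destruct w; unfold Ci; simpl; ring. Qed.
Lemma Im_Ci_mult w : Im (Ci * w) = Re w.
Proof. destruct w; unfold Ci; simpl; ring. Qed.

(** * Conditions (i) and (ii) at a contact point *)

Section TrulyTwoDimensional.
Variables F F1 F2 F11 F12 F21 F22 : C * C -> C.
Hypothesis sy : symbol F F1 F2 F11 F12 F21 F22.

(** The quadratic remainder of [boundary_taylor] gives the derivative. The function g is only
    related to F by translation, so that the statement serves for both partial derivatives at every
    point. *)
Lemma boundary_is_derive c x1 x2 b1 b2 (g : R -> R) x : Cmod c = 1 ->
  (forall t, g (x + t) = Re (c * F (tor 1 (x1 + t * b1) (x2 + t * b2)))) -> is_derive g x (Re (c * dir1 F1 F2 b1 b2 (tor 1 x1 x2))).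
Proof.
  intros hc hg. apply is_derive_R_iff. intros eps heps.
  destruct (boundary_taylor _ _ _ _ _ _ _ sy c x1 x2 b1 b2 hc 1 Rlt_0_1) as [t0 [ht k]].
  set (kap := Re (c * dir2 F1 F2 F11 F12 F21 F22 b1 b2 (tor 1 x1 x2))) in *.
  set (M := 1 + Rabs kap / 2). assert (hM : 0 < M) by (unfold M; generalize (Rabs_pos kap); lra).
  exists (Rmin t0 (eps / M)). split. apply Rmin_pos; auto. apply Rdiv_lt_0_compat; auto.
  intros y hy. set (t := y - x) in *. replace y with (x + t) by (unfold t; ring). replace (g x) with (g (x + 0)) by (f_equal; ring).
  rewrite !hg, !Rmult_0_l, !Rplus_0_r.
  assert (h1 := Rmin_l t0 (eps / M)). assert (h2 := Rmin_r t0 (eps / M)). specialize (k t ltac:(lra)).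
  set (A := Re (c * F (tor 1 (x1 + t * b1) (x2 + t * b2)))) in *. set (B := Re (c * F (tor 1 x1 x2))) in *. set (L := Re (c * dir1 F1 F2 b1 b2 (tor 1 x1 x2))) in *.
  replace (A - B - L * t) with ((A - B - t * L - kap * t ^ 2 / 2) + kap * t ^ 2 / 2) by field.
  eapply Rle_trans. apply Rabs_triang.
  assert (q : Rabs (kap * t ^ 2 / 2) = Rabs kap / 2 * t ^ 2).
  { unfold Rdiv. rewrite !Rabs_mult. rewrite (Rabs_pos_eq (t ^ 2)) by apply pow2_ge_0. rewrite (Rabs_pos_eq (/ 2)) by lra. ring. }
  rewrite q. apply Rle_trans with (M * t ^ 2). unfold M; lra.
  rewrite <- (pow2_abs t). assert (Rabs t * M <= eps) by (apply Rle_div_r; lra). generalize (Rabs_pos t). nra.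
Qed.

Lemma cont2_torus G c a1 a2 : ucont G -> cont2 (fun x y => Re (c * G (tor 1 (a1 + x) (a2 + y)))).
Proof.
  intros hG p. assert (continuous (fun p : R * R => G (tor 1 (a1 + fst p) (a2 + snd p))) p).
  { apply continuous_C_iff. intros e he. destruct (ucont_near_tor G (a1 + fst p) (a2 + snd p) e hG he) as [d [hd k]].
    apply locally_RR_iff. exists d. split; auto. intros y h1 h2. apply k; try lra.
    replace (a1 + fst y - (a1 + fst p)) with (fst y - fst p) by ring; lra.
    replace (a2 + snd y - (a2 + snd p)) with (snd y - snd p) by ring; lra. }
  cont.
Qed.

(** The product is real by first-order contact, its real part is nonnegative by the radial argument
    for the swapped symbol, and it is not 0 because F1 is not. *)
Lemma contact_tang1_pos a1 a2 : Cmod (F (tor 1 a1 a2)) = 1 -> F1 (tor 1 a1 a2) <> RtoC 0 ->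
  0 < Re (Cconj (F (tor 1 a1 a2)) * tang1 F1 (tor 1 a1 a2)).
Proof.
  intros h1 hne. pose proof (contact_tang2 _ _ _ _ _ _ _ (symbol_swap _ _ _ _ _ _ _ sy) a2 a1 h1) as h.
  change (0 <= Re (Cconj (F (tor 1 a1 a2)) * tang1 F1 (tor 1 a1 a2))) in h.
  pose proof (contact_first_order _ _ _ _ _ _ _ sy a1 a2 1 0 h1) as hf.
  set (c := Cconj (F (tor 1 a1 a2))) in *. set (w := (c * tang1 F1 (tor 1 a1 a2))%C) in *.
  destruct (Rle_lt_or_eq_dec _ _ h) as [|he]; auto. exfalso.
  replace (c * dir1 F1 F2 1 0 (tor 1 a1 a2))%C with (Ci * w)%C in hf by (unfold w, dir1; ring).
  assert (hw : w = RtoC 0).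
  { rewrite Re_Ci_mult in hf. apply C_ext. symmetry; exact he. change (Im w = 0). lra. }
  apply hne. apply Cmod_eq_0. apply (f_equal Cmod) in hw. unfold w, tang1, tor in hw. simpl fst in hw.
  rewrite !Cmod_mult, Cmod_expi, Cmod_1, Cmod_0 in hw. unfold c in hw. rewrite Cmod_conj, h1 in hw. unfold tor. lra.
Qed.

Lemma rotate_limit G k (xi : C * C) : ucont G -> Cmod (fst xi) = 1 -> Cmod (snd xi) = 1 ->
  filterlim (fun z : C * C => (k * G ((fst xi * fst z)%C, (snd xi * snd z)%C))%C) (within inD2 (locally e2)) (locally (k * G xi)%C).
Proof.
  intros hG h1 h2 P hP. apply locally_C_iff in hP. destruct hP as [r [hr hP]].
  destruct (hG (r / (Cmod k + 1))) as [d [hd kd]]. apply Rdiv_lt_0_compat; auto. generalize (Cmod_ge_0 k); lra.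
  unfold within, filtermap. apply locally_CC_iff. exists d. split; auto. intros z k1 k2 [z1 z2]. unfold inD in z1, z2. change (Cmod (fst z - RtoC 1) < d) in k1. change (Cmod (snd z - RtoC 1) < d) in k2.
  apply hP. replace (k * G ((fst xi * fst z)%C, (snd xi * snd z)%C) - k * G xi)%C with (k * (G ((fst xi * fst z)%C, (snd xi * snd z)%C) - G xi))%C by ring.
  rewrite Cmod_mult. assert (hk := Cmod_ge_0 k).
  assert (X : Cmod (G ((fst xi * fst z)%C, (snd xi * snd z)%C) - G xi) < r / (Cmod k + 1)).
  { apply kd; try (split; simpl; rewrite ?Cmod_mult; nra); simpl fst; simpl snd.
    - replace (fst xi * fst z - fst xi)%C with (fst xi * (fst z - RtoC 1))%C by ring. rewrite Cmod_mult, h1, Rmult_1_l. exact k1.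
    - replace (snd xi * snd z - snd xi)%C with (snd xi * (snd z - RtoC 1))%C by ring. rewrite Cmod_mult, h2, Rmult_1_l. exact k2. }
  apply Rlt_div_r in X; [|lra]. generalize (Cmod_ge_0 (G ((fst xi * fst z)%C, (snd xi * snd z)%C) - G xi)). nra.
Qed.

Lemma rotate_inD2 (xi z : C * C) : Cmod (fst xi) = 1 -> Cmod (snd xi) = 1 -> inD2 z -> inD2 ((fst xi * fst z)%C, (snd xi * snd z)%C).
Proof. intros h1 h2 [z1 z2]. split; unfold inD in *; simpl; rewrite Cmod_mult; nra. Qed.

Lemma cder_rotate (a w : C) : cder (fun w => a * w)%C w a.
Proof.
  assert (X := cder_mult (fun _ => a) (fun w => w) w _ _ (cder_const a w) (cder_id w)). cbv beta in X.
  replace (0 * w + a * 1)%C with a in X by ring. exact X.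
Qed.

Lemma cder_scal (a : C) f w d : cder f w d -> cder (fun w => a * f w)%C w (a * d)%C.
Proof.
  intros h. assert (X := cder_mult (fun _ => a) f w _ _ (cder_const a w) h). cbv beta in X.
  replace (0 * f w + a * d)%C with (a * d)%C in X by ring. exact X.
Qed.

Lemma phitilde_dz1 xi : Cmod (fst xi) = 1 -> Cmod (snd xi) = 1 -> F xi <> RtoC 0 -> F1 xi <> RtoC 0 -> dz1_nonzero_at_e (phitilde F xi).
Proof.
  intros h1 h2 hF hF1. exists (fun z => ((Cconj (F xi) * fst xi) * F1 ((fst xi * fst z)%C, (snd xi * snd z)%C))%C), ((Cconj (F xi) * fst xi) * F1 xi)%C.
  split; [|split].
  - repeat apply Cmult_neq_0; auto. intro e. apply hF. apply Cmod_eq_0. rewrite <- Cmod_conj, e. apply Cmod_0. intro e; rewrite e, Cmod_0 in h1; lra.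
  - intros z hz. apply is_derive_C_iff. unfold phitilde; simpl.
    replace ((Cconj (F xi) * fst xi) * F1 ((fst xi * fst z)%C, (snd xi * snd z)%C))%C with (Cconj (F xi) * (F1 ((fst xi * fst z)%C, (snd xi * snd z)%C) * fst xi))%C by ring.
    apply (cder_scal _ (fun w => F ((fst xi * w)%C, (snd xi * snd z)%C))).
    apply (cder_comp (fun v => F (v, (snd xi * snd z)%C)) (fun w => fst xi * w)%C). apply cder_rotate.
    apply (sy_d1 _ _ _ _ _ _ _ sy _ (rotate_inD2 xi z h1 h2 hz)).
  - apply rotate_limit; auto. apply (sy_u1 _ _ _ _ _ _ _ sy).
Qed.

Lemma phitilde_dz2 xi : Cmod (fst xi) = 1 -> Cmod (snd xi) = 1 -> F xi <> RtoC 0 -> F2 xi <> RtoC 0 -> dz2_nonzero_at_e (phitilde F xi).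
Proof.
  intros h1 h2 hF hF2. exists (fun z => ((Cconj (F xi) * snd xi) * F2 ((fst xi * fst z)%C, (snd xi * snd z)%C))%C), ((Cconj (F xi) * snd xi) * F2 xi)%C.
  split; [|split].
  - repeat apply Cmult_neq_0; auto. intro e. apply hF. apply Cmod_eq_0. rewrite <- Cmod_conj, e. apply Cmod_0. intro e; rewrite e, Cmod_0 in h2; lra.
  - intros z hz. apply is_derive_C_iff. unfold phitilde; simpl.
    replace ((Cconj (F xi) * snd xi) * F2 ((fst xi * fst z)%C, (snd xi * snd z)%C))%C with (Cconj (F xi) * (F2 ((fst xi * fst z)%C, (snd xi * snd z)%C) * snd xi))%C by ring.
    apply (cder_scal _ (fun w => F ((fst xi * fst z)%C, (snd xi * w)%C))).
    apply (cder_comp (fun v => F ((fst xi * fst z)%C, v)) (fun w => snd xi * w)%C). apply cder_rotate.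
    apply (sy_d2 _ _ _ _ _ _ _ sy _ (rotate_inD2 xi z h1 h2 hz)).
  - apply rotate_limit; auto. apply (sy_u2 _ _ _ _ _ _ _ sy).
Qed.

(** The derivative of Im psi in the first angle at 0 is Re (c [tang1]) > 0, which makes U a local
    diffeomorphism of the form [fmap m]. The level curve to be excluded is the preimage under U of a
    vertical segment issuing from the origin. *)
Lemma truly_2d_of_no_level_curve a1 a2 : Cmod (F (tor 1 a1 a2)) = 1 -> F1 (tor 1 a1 a2) <> RtoC 0 -> F2 (tor 1 a1 a2) <> RtoC 0 ->
  (forall eps, 0 < eps <= 2 * PI -> (forall y, a2 <= y <= a2 + eps -> exists tau, F (tor 1 tau y) = F (tor 1 a1 a2)) -> False) ->
  truly_2d F (tor 1 a1 a2).
Proof.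
  intros h1 hF1 hF2 hlev.
  assert (e1 : Cmod (fst (tor 1 a1 a2)) = 1) by (simpl; rewrite Cmult_1_l; apply Cmod_expi).
  assert (e2' : Cmod (snd (tor 1 a1 a2)) = 1) by (simpl; rewrite Cmult_1_l; apply Cmod_expi).
  assert (hF : F (tor 1 a1 a2) <> RtoC 0) by (intro e; rewrite e, Cmod_0 in h1; lra).
  split. apply phitilde_dz1; auto. split. apply phitilde_dz2; auto.
  intro U. set (c := Cconj (F (tor 1 a1 a2))). assert (hc : Cmod c = 1) by (unfold c; rewrite Cmod_conj; auto).
  assert (hcF : (c * F (tor 1 a1 a2))%C = RtoC 1) by (apply conj_unit_mult; auto).
  (* Multiplication by - i turns imaginary parts into real parts, for which the boundary expansion
     is stated. *)
  set (c' := (- (Ci * c))%C). assert (hc' : Cmod c' = 1) by (unfold c'; rewrite Cmod_opp, Cmod_mult, Cmod_Ci, hc; ring).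
  assert (hrot : forall w, Re (c' * w) = Im (c * w)).
  { intro w. unfold c'. replace (- (Ci * c) * w)%C with (- (Ci * (c * w)))%C by ring. rewrite Re_opp, Re_Ci_mult. ring. }
  set (m := fun x y => Re (c' * F (tor 1 (a1 + x) (a2 + y)))).
  assert (hU : U = fmap m).
  { apply functional_extensionality. intros [x y]. unfold U, fmap, m; simpl fst; simpl snd. rewrite psi_of_tor, hrot. reflexivity. }
  destruct (exists_local_inverse m (fun x y => Re (c' * dir1 F1 F2 1 0 (tor 1 (a1 + x) (a2 + y)))) (fun x y => Re (c' * dir1 F1 F2 0 1 (tor 1 (a1 + x) (a2 + y))))) as [Uinv [A [B hdif]]].
  { apply cont2_torus. apply (sy_u _ _ _ _ _ _ _ sy). } { apply cont2_torus. eapply ucont_dir1; exact sy. } { apply cont2_torus. eapply ucont_dir1; exact sy. }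
  { intros x y. apply boundary_is_derive; auto. intro t. unfold m. do 4 f_equal; ring. }
  { intros x y. apply boundary_is_derive; auto. intro t. unfold m. do 4 f_equal; ring. }
  { unfold m. rewrite !Rplus_0_r, hrot, hcF. reflexivity. }
  { rewrite !Rplus_0_r, hrot. replace (c * dir1 F1 F2 1 0 (tor 1 a1 a2))%C with (Ci * (c * tang1 F1 (tor 1 a1 a2)))%C by (unfold dir1; ring).
    rewrite Im_Ci_mult. apply (contact_tang1_pos a1 a2 h1 hF1). }
  rewrite <- hU in hdif. exists Uinv, A, B. split. exact hdif. intro H.
  destruct hdif as [_ [oB [A0 [B0 [hA [hB _]]]]]].
  intros [h [N [hN hh]]].
  assert (hN0 := locally_singleton _ _ hN).
  assert (A00 : Uinv (0, 0) = (0, 0)).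
  { assert (hU0 : U (0, 0) = (0, 0)). { unfold U. simpl snd. rewrite psi_of_tor, !Rplus_0_r, conj_unit_mult by exact h1. reflexivity. }
    rewrite <- hU0 at 1. apply (hA (0, 0)). auto. }
  assert (h00 : h 0 = 0).
  { specialize (hh (0, 0) hN0). simpl in hh. rewrite <- hh. unfold H. rewrite A00, psi_of_tor, !Rplus_0_r, conj_unit_mult by exact h1. simpl. ring. }
  destruct (proj1 (locally_RR_iff _ _) hN) as [d1 [q1 k1]]. destruct (proj1 (locally_RR_iff _ _) (oB _ B0)) as [d2 [q2 k2]].
  generalize PI2_pos; intro hpi.
  (* Length of an interval of second angles over which (0, y - a2) stays both in N and in the image
     B, and which does not exceed a full turn. *)
  set (e := Rmin (2 * PI) (Rmin d1 d2 / 2)).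
  assert (he : 0 < e /\ e <= 2 * PI /\ e < d1 /\ e < d2).
  { unfold e. generalize (Rmin_pos d1 d2 q1 q2) (Rmin_l d1 d2) (Rmin_r d1 d2) (Rmin_l (2 * PI) (Rmin d1 d2 / 2)) (Rmin_r (2 * PI) (Rmin d1 d2 / 2)).
    intros. repeat split; try lra. apply Rmin_pos; lra. }
  apply (hlev e ltac:(lra)). intros y hy.
  assert (hy0 : Rabs (y - a2 - 0) < d1 /\ Rabs (y - a2 - 0) < d2) by (rewrite Rabs_pos_eq by lra; lra).
  assert (hz : Rabs (0 - 0) = 0) by (rewrite Rminus_0_r; apply Rabs_R0).
  specialize (k1 (0, y - a2)). specialize (k2 (0, y - a2)). simpl in k1, k2. specialize (k1 ltac:(lra) ltac:(lra)). specialize (k2 ltac:(lra) ltac:(lra)).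
  destruct (hB _ k2) as [_ hUU]. specialize (hh _ k1). simpl fst in hh. rewrite h00 in hh. unfold H in hh.
  (* U keeps the second coordinate, so the preimage is (t, y - a2). There Im psi = 0, and Re psi - 1
     = h 0 = 0. *)
  destruct (Uinv (0, y - a2)) as [t s]. pose proof (f_equal snd hUU) as es. change (s = y - a2) in es. subst s.
  pose proof (f_equal fst hUU) as ei. change (Im (psi_of F (tor 1 a1 a2) (t, y - a2)) = 0) in ei.
  rewrite psi_of_tor in hh, ei. fold c in hh, ei. replace (a2 + (y - a2)) with y in hh, ei by ring.
  exists (a1 + t).
  assert (hv : (c * F (tor 1 (a1 + t) y))%C = RtoC 1) by (apply C_ext; [change (Re (c * F (tor 1 (a1 + t) y)) = 1); lra|exact ei]).
  transitivity (F (tor 1 a1 a2) * (c * F (tor 1 (a1 + t) y)))%C.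
  - replace (F (tor 1 a1 a2) * (c * F (tor 1 (a1 + t) y)))%C with ((c * F (tor 1 a1 a2)) * F (tor 1 (a1 + t) y))%C by ring. rewrite hcF. ring.
  - rewrite hv. ring.
Qed.
End TrulyTwoDimensional.

Theorem mainTheorem15 (phi : C * C -> C * C)
  (Hholo1 : holo_D2 (fun z => fst (phi z)))
  (Hholo2 : holo_D2 (fun z => snd (phi z)))
  (Hmaps : forall z, inD2 z -> inD2 (phi z))
  (Hsmooth : Ck_closed_bidisc 3 phi) :
  (compact_Cphi phi ->
     (forall xi, inT2 xi -> ~ inT2 (phi xi)) /\
     (forall xi (j : bool), inT2 xi -> inT (phi_j phi j xi) -> truly_2d (phi_j phi j) xi))
  /\
  ((forall xi, inT2 xi -> ~ inT2 (phi xi)) ->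
   (forall xi (j : bool), inT2 xi -> inT (phi_j phi j xi) -> truly_2d_order2 (phi_j phi j) xi) ->
   compact_Cphi phi).
Proof.
  split; [|apply sufficiency; auto].
  intros hcomp. split. intros xi. apply no_double_contact; auto.
  intros [z1 z2] j [x1 x2] hj. simpl in x1, x2.
  destruct (inT_expi z1 x1) as [a1 [_ ->]]. destruct (inT_expi z2 x2) as [a2 [_ ->]].
  assert (exi : (expi a1, expi a2) = tor 1 a1 a2) by (unfold tor; f_equal; ring). rewrite exi in *. clear exi x1 x2.
  destruct (symbol_of_smooth phi j Hholo1 Hholo2 Hmaps Hsmooth) as [F1 [F2 [F3 [F4 [F5 [F6 sy]]]]]].
  generalize PI2_pos; intro hpi. unfold inT in hj.
  eapply truly_2d_of_no_level_curve; eauto.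
  (* If the first derivative vanishes, the swapped symbol is constant on a circle: phi_j keeps its
     value for all first angles x, with the second angle equal to a2. *)
  - intro h. apply (no_level_curve2 phi Hholo1 Hholo2 Hmaps Hsmooth hcomp j (phi_j phi j (tor 1 a1 a2)) 0 (2 * PI) hj ltac:(lra)).
    intros x _. exists a2. exact (tangent_constant _ _ _ _ _ _ _ (symbol_swap _ _ _ _ _ _ _ sy) a2 a1 hj h x).
  (* Likewise with the first angle fixed at a1, and all second angles. *)
  - intro h. apply (no_level_curve1 phi Hholo1 Hholo2 Hmaps Hsmooth hcomp j (phi_j phi j (tor 1 a1 a2)) 0 (2 * PI) hj ltac:(lra)).
    intros x _. exists a1. exact (tangent_constant _ _ _ _ _ _ _ sy a1 a2 hj h x).
  - intros eps he hl. exact (no_level_curve1 phi Hholo1 Hholo2 Hmaps Hsmooth hcomp j (phi_j phi j (tor 1 a1 a2)) a2 eps hj he hl).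
Qed.
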